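(* Let $d\ge2$, let $\mu\ge1$ be an integer, $k\in\mathbb{R}$, and suppose that a function $a(x,\xi)$ on $\mathbb{R}^{d-1}\times\mathbb{R}^{d-1}$ satisfies $$|\partial_\xi^\alpha\partial_x^\beta a(x,\xi)|\le C_{\alpha,\beta}\langle\xi\rangle^{k-|\alpha|}$$ for all multi-indices $\alpha$ and $\beta$ such that $|\beta|\le\mu$. Let $k'>k$. Then $$\|\mathrm{Op}_h(a)\|_{H_h^{k'}\to L^2}\lesssim\sum_{|\alpha|+|\beta|\le s_d,\ |\beta|\le\mu}h^{\frac{|\alpha|+|\beta|}{2}}C_{\alpha,\beta}+h^{\mu/2}\log(1+h^{-1})\sum_{|\alpha|\le d,\ |\beta|\le\mu}C_{\alpha,\beta}.$$ Moreover, if $\mu\ge s_d$, the second sum in the right-hand side can be removed.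
   Context: Here $0<h\le1$ is a semiclassical parameter and $\langle\xi\rangle=(1+|\xi|^2)^{1/2}$. For a symbol $a(x,\xi)$ on $\mathbb{R}^{d-1}\times\mathbb{R}^{d-1}$, $$(\mathrm{Op}_h(a)f)(x)=(2\pi h)^{-d+1}\int_{\mathbb{R}^{d-1}}\int_{\mathbb{R}^{d-1}}e^{-\frac ih\langle x-y,\xi\rangle}a(x,\xi)f(y)\,d\xi\,dy .$$ $L^2=L^2(\mathbb{R}^{d-1})$, and $H_h^k=H_h^k(\mathbb{R}^{d-1})$ is the Sobolev space with the semiclassical norm $\|u\|_{H_h^k}=\|\mathrm{Op}_h(\langle\xi\rangle^k)u\|_{L^2}$. $A\lesssim B$ means $A\le CB$ with a constant $C>0$ independent of $h$, of the symbols and of the constants $C_{\alpha,\beta}$ (it may depend on $d$, $\mu$ and the orders $k,k'$). $s_d$ is an integer depending only on $d$ with the following property: for every $k\in\mathbb{R}$, if $a\in C^\infty(\mathbb{R}^{d-1}\times\mathbb{R}^{d-1})$ satisfies $|\partial_\xi^\alpha\partial_x^\beta a|\le C_{\alpha,\beta}\langle\xi\rangle^k$ for all $\alpha,\beta$, then $\|\mathrm{Op}_h(a)\|_{H_h^k\to L^2}\lesssim\sum_{|\alpha|+|\beta|\le s_d}h^{(|\alpha|+|\beta|)/2}C_{\alpha,\beta}$. *)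

(* Defs.v *)
From HB Require Import structures.
From mathcomp Require Import all_boot all_order all_algebra.
From mathcomp Require Import complex.
From mathcomp Require Import all_classical all_reals all_analysis.

Set Implicit Arguments.
Unset Strict Implicit.
Unset Printing Implicit Defensive.

Import Order.TTheory GRing.Theory Num.Theory.
Import numFieldNormedType.Exports.

Local Open Scope classical_set_scope.
Local Open Scope ring_scope.
Local Open Scope complex_scope.

(* The norm of the normedModType ['rV[R]_n] is the sup norm; the Euclidean
   structure is given by [dotv]. *)
Definition dotv {R : realType} {n : nat} (x y : 'rV[R]_n) : R :=
  \sum_(i < n) x 0 i * y 0 i.

Definition bracket {R : realType} {n : nat} (x : 'rV[R]_n) : R :=
  Num.sqrt (1 + dotv x x).

Section lebesgue_measure_tuple.
Context {R : realType}.

Definition tcons n (p : measurableTypeR R * n.-tuple (measurableTypeR R)) :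
  n.+1.-tuple (measurableTypeR R) := [tuple of p.1 :: p.2].

Lemma measurable_tcons n : measurable_fun setT (@tcons n).
Proof. exact: measurable_cons. Qed.

(* The product measure is [\x^] rather than [\x] because the former asks
   sigma-finiteness of its first factor only. *)
Fixpoint lebesgue_tuple n :
    {measure set (n.-tuple (measurableTypeR R)) -> \bar R} :=
  match n with
  | 0 => dirac [tuple]
  | m.+1 =>
    measure_function_pushforward__canonical__measure_function_Measure
      (product_measure2 (@lebesgue_measure R) (lebesgue_tuple m))
      (@measurable_tcons m)
  end.

End lebesgue_measure_tuple.

Section complex_valued.
Context {R : realType} {n : nat}.

Definition row_of_tuple (t : n.-tuple (measurableTypeR R)) : 'rV[R]_n :=
  \row_i tnth t i.

Definition cintegral (F : 'rV[R]_n -> R[i]) : R[i] :=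
  (\int[lebesgue_tuple n]_t complex.Re (F (row_of_tuple t)))
  +i* (\int[lebesgue_tuple n]_t complex.Im (F (row_of_tuple t))).

Definition L2norm (u : 'rV[R]_n -> R[i]) : \bar R :=
  Lnorm (lebesgue_tuple n) 2%:E (fun t => (Normc.normc (u (row_of_tuple t)))%:E).

Definition cexpi (t : R) : R[i] := cos t +i* sin t.

End complex_valued.

Section derivatives.
Context {R : realType} {E : normedModType R}.
Implicit Types (f : E -> R[i]) (v : E) (vs : seq E).

Definition cderivable f (x v : E) : Prop :=
  derivable (@complex.Re R \o f) x v /\ derivable (@complex.Im R \o f) x v.

Definition cderive v f : E -> R[i] :=
  fun x => ('D_v (@complex.Re R \o f) x) +i* ('D_v (@complex.Im R \o f) x).

Definition ccontinuous f : Prop :=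
  continuous (@complex.Re R \o f) /\ continuous (@complex.Im R \o f).

(* [iderive [:: v1; ...; vm] f] is D_v1 (D_v2 (... (D_vm f))). *)
Fixpoint iderive vs f : E -> R[i] :=
  if vs is v :: ws then cderive v (iderive ws f) else f.

Fixpoint iderivable vs f : Prop :=
  if vs is v :: ws then
    iderivable ws f /\ (forall x, cderivable (iderive ws f) x v)
  else True.

Definition smooth f : Prop :=
  forall vs, iderivable vs f /\ ccontinuous (iderive vs f).

End derivatives.

Definition multiindex (n : nat) := {ffun 'I_n -> nat}.

Definition mi_order {n} (alpha : multiindex n) : nat :=
  (\sum_(i < n) alpha i)%N.

Definition mi_dirs {R : realType} {n} (alpha : multiindex n) : seq 'rV[R]_n :=
  flatten [seq nseq (alpha i) (delta_mx 0 i) | i <- enum 'I_n].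

Section semiclassical.
Context {R : realType} {n : nat}.
Implicit Types (h k : R) (u : 'rV[R]_n -> R[i]).
Implicit Types (a : 'rV[R]_n * 'rV[R]_n -> R[i]) (alpha beta : multiindex n).

(* Directions of d_xi^alpha d_x^beta, for symbols [a (x, xi)]. *)
Definition symbol_dirs alpha beta : seq ('rV[R]_n * 'rV[R]_n) :=
  [seq (0, v) | v <- mi_dirs alpha] ++ [seq (v, 0) | v <- mi_dirs beta].

(* Limited regularity in x: only the derivatives that are estimated are required
   to exist, pointwise; their continuity is not assumed. *)
Definition symbol_estimates (mu : nat) (k : R)
    (C : multiindex n -> multiindex n -> R) a : Prop :=
  forall alpha beta, (mi_order beta <= mu)%N ->
    iderivable (symbol_dirs alpha beta) a /\
    forall x xi,
      Normc.normc (iderive (symbol_dirs alpha beta) a (x, xi))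
        <= C alpha beta * bracket xi `^ (k - (mi_order alpha)%:R).

Definition schwartz u : Prop :=
  smooth u /\
  forall (N : nat) beta, exists M : R, forall x,
    bracket x ^+ N * Normc.normc (iderive (mi_dirs beta) u x) <= M.

(* The oscillatory integral of a Schwartz function [u]: integrated in y first,
   it converges absolutely for every symbol of polynomial growth in xi. *)
Definition Op h a u : 'rV[R]_n -> R[i] := fun x =>
  ((2 * pi * h) ^- n)%:C *
  cintegral (fun xi => cintegral (fun y =>
    cexpi (- (dotv (x - y) xi / h)) * a (x, xi) * u y)).

Definition sobolev_norm h k u : \bar R :=
  L2norm (Op h (fun p => (bracket p.2 `^ k)%:C) u).

(* Norm H_h^k -> L^2 of the extension by density of an operator given on
   Schwartz functions, which are dense in H_h^k; +oo if it is unbounded. *)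
Definition opnorm h k (T : ('rV[R]_n -> R[i]) -> 'rV[R]_n -> R[i]) : \bar R :=
  ereal_sup [set L2norm (T u) |
    u in [set u | schwartz u /\ (sobolev_norm h k u <= 1)%E]].

End semiclassical.

(* [s] has the property required of s_d, in dimension d - 1. *)
Definition bounded_on_sobolev (R : realType) (d s : nat) : Prop :=
  forall k : R, exists2 K : R, 0 < K &
    forall (h : R) (a : 'rV[R]_d.-1 * 'rV[R]_d.-1 -> R[i])
      (C : multiindex d.-1 -> multiindex d.-1 -> R),
    0 < h <= 1 ->
    smooth a ->
    (forall alpha beta x xi,
      Normc.normc (iderive (symbol_dirs alpha beta) a (x, xi))
        <= C alpha beta * bracket xi `^ k) ->
    (opnorm h k (Op h a) <=
      (K * \sum_(p \in [set p : multiindex d.-1 * multiindex d.-1 |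
                         (mi_order p.1 + mi_order p.2 <= s)%N])
             h `^ ((mi_order p.1 + mi_order p.2)%:R / 2) * C p.1 p.2)%:E)%E.

(* Main.v *)
Require Import Defs.
From HB Require Import structures.
From mathcomp Require Import all_boot all_order all_algebra.
From mathcomp Require Import complex.
From mathcomp Require Import all_classical all_reals all_analysis.
From mathcomp Require Import measurable_realfun ring lra.

Set Implicit Arguments.
Unset Strict Implicit.
Unset Printing Implicit Defensive.

Import Order.TTheory GRing.Theory Num.Theory.
Import numFieldNormedType.Exports.

Local Open Scope classical_set_scope.
Local Open Scope ring_scope.
Local Open Scope complex_scope.

(* Split a = b + r, where b averages translates of a against a Gaussian of width
   delta in x and delta^mu in xi, the translates being combined so that the x-mean
   cancels Taylor expansions up to order mu.  Then b is smooth and obeys the symbol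
   estimates with C_{alpha,beta} multiplied by a power delta^-(|beta| - mu)_+, so the
   hypothesis on s_d applies to it, while r is O(delta^mu) as a symbol of order k, in
   x uniformly, with its mixed xi-derivatives d_xi^S, S a set of coordinates.
   These derivatives control Op_h(r): writing r(x,xi) <xi>^(-k') as the integral of its
   full mixed derivative over the orthant {eta >= xi}, Op_h(r)u becomes an average,
   with the weight <eta>^(-(d-1)-(k'-k)), of Fourier transforms of restrictions of
   <xi>^k' u^ to orthants, each of L^2 norm at most |u|_{H^k'_h} by Plancherel.
   Hence |Op_h(a)| is bounded, for every delta in (0,1], by the sum for b plus a
   multiple of delta^mu; take delta = h^(1/2), and let delta tend to 0 if mu >= s_d,
   when no derivative of order |beta| > mu occurs. *)

(** * Lebesgue measure on tuples *)

(** The derivatives of [a] are only assumed to exist, in one order of differentiation and without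
    continuity, so mixed derivatives cannot be interchanged. Finite differences can: derivatives are
    traded for differences, the differences permuted, and traded back by the mean value theorem. The
    remainder needs this, since there x-differences are taken of xi-derivatives while the hypothesis
    has the x-derivatives inside. In xi a first-order comparison is enough, because the width
    delta^mu costs nothing: in the symbol estimates no xi-derivative falls on the kernel. The
    comparison spends one derivative beyond the d - 1 of the orthant representation, whence |alpha|
    <= d in the second sum. The gap k' - k acts twice: it makes r <xi>^(-k') vanish at infinity and
    the weight in eta integrable. The remainder carries no logarithm; [ln (1 + h^-1)] enters through
    its lower bound [ln 2]. For delta = h^(1/2) the loss delta^-(|beta| - mu) turns h^((|alpha| +
    |beta|)/2) into the power that belongs to a truncated index of x-order min(mu, |beta|). *)

Section lebesgue_tuple_theory.
Context {R : realType}.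
Notation TR := (measurableTypeR R).

Definition box_tuple (n : nat) (r : R) : set (n.-tuple TR) :=
  [set t | forall i, `|tnth t i| <= r].

Arguments box_tuple n r : clear implicits.

Lemma box_tuple_cons n (r : R) :
  @tcons R n @^-1` box_tuple n.+1 r = [set x : TR | `|x| <= r] `*` box_tuple n r.
Proof.
apply/seteqP; split => [[x t] /= H|[x t] /= [Hx Ht] i].
  split; first by have := H ord0; rewrite tnth0.
  by move=> i; have := H (lift ord0 i); rewrite tnthS.
by case: (unliftP ord0 i) => [j|] ->; rewrite ?tnth0 ?tnthS.
Qed.

Lemma measurable_box_tuple n (r : R) : measurable (box_tuple n r).
Proof.
have -> : box_tuple n r = \big[setI/setT]_(i < n) [set t | `|tnth t i| <= r].
  apply/seteqP; split => [t H|t].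
    by rewrite -bigcap_seq => i _; exact: H.
  by rewrite -bigcap_seq => H i; apply: H; rewrite /= mem_index_enum.
apply: bigsetI_measurable => i _.
have m : measurable_fun setT (fun t : n.-tuple TR => `|tnth t i| : TR).
  by apply: measurableT_comp => //; exact: measurable_tnth.
have := m measurableT `]-oo, r]%classic (measurable_itv _).
by rewrite setTI; congr (measurable _); apply/seteqP; split.
Qed.

Lemma lebesgue_tupleS n (A : set (n.+1.-tuple TR)) :
  lebesgue_tuple n.+1 A =
  ((@lebesgue_measure R) \x^ (lebesgue_tuple n))%E (@tcons R n @^-1` A).
Proof. by []. Qed.

Lemma sigma_finite_lebesgue_tuple n :
  sigma_finite setT (lebesgue_tuple n : set (n.-tuple TR) -> \bar R).
Proof.
exists (fun k => box_tuple n k%:R).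
  apply/seteqP; split => // t _.
  pose M := \sum_(i < n) `|tnth t i|.
  exists (Num.truncn M).+1 => // i.
  apply: (@le_trans _ _ M).
    by rewrite /M (bigD1 i) //= lerDl sumr_ge0.
  exact/ltW/truncnS_gt.
move=> k; split; first exact: measurable_box_tuple.
elim: n => [|n IH].
  by rewrite /= /dirac indicE; case: (_ \in _) => /=; rewrite ltry.
rewrite lebesgue_tupleS box_tuple_cons product_measure2E; last 2 first.
- have -> : [set x : TR | `|x| <= k%:R] = `[- k%:R, k%:R]%classic.
    by apply/seteqP; split => t /=; rewrite in_itv /= ler_norml.
  exact: measurable_itv.
- exact: measurable_box_tuple.
rewrite lte_mul_pinfty //.
have -> : [set x : TR | `|x| <= k%:R] = `[- k%:R, k%:R]%classic.
    by apply/seteqP; split => t /=; rewrite in_itv /= ler_norml.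
  rewrite /= lebesgue_measure_itv /=; case: ifP => //.
Qed.

(* The same measure as [lebesgue_tuple], as a head constant to which a
   sigma-finite structure can be attached. *)
Definition Lam n : set (n.-tuple TR) -> \bar R := lebesgue_tuple n.
HB.instance Definition _ n :=
  Measure.copy (@Lam n) (Measure.sort (lebesgue_tuple n)).
HB.instance Definition _ n := @Measure_isSigmaFinite.Build _ _ _
  (@Lam n) (@sigma_finite_lebesgue_tuple n).

Lemma measurable_comp_tcons d (U : measurableType d) n (f : n.+1.-tuple TR -> U) :
  measurable_fun setT f -> measurable_fun setT (f \o @tcons R n).
Proof. by move=> mf; apply: (measurableT_comp mf); exact: measurable_tcons. Qed.

Local Open Scope ereal_scope.

(** The measure is built from [\x^], whereas Tonelli's theorem concerns [\x]. The two agree on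
    measurable rectangles, hence everywhere by uniqueness of the product measure. *)
Lemma LamS n (f : n.+1.-tuple TR -> \bar R) :
  measurable_fun setT f -> (forall x, 0 <= f x) ->
  \int[@Lam n.+1]_t f t =
    \int[(@lebesgue_measure R) \x (@Lam n)]_p f (tcons p).
Proof.
move=> mf f0.
have -> : \int[@Lam n.+1]_t f t =
  \int[(@lebesgue_measure R) \x^ (@Lam n)]_p f (tcons p).
  rewrite -[X in \int[X]_t _ = _]/(pushforward _ (@tcons R n)).
  by rewrite ge0_integral_pushforward //; exact: measurable_tcons.
apply/esym/eq_measure_integral => //= A mA _.
by apply: product_measure_unique => // B C mB mC/=; rewrite product_measure2E.
Qed.

Lemma LamS1 n (f : n.+1.-tuple TR -> \bar R) :
  measurable_fun setT f -> (forall x, 0 <= f x) ->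
  \int[@Lam n.+1]_t f t =
    \int[@lebesgue_measure R]_x \int[@Lam n]_t f (tcons (x, t)).
Proof.
move=> mf f0; rewrite LamS // (fubini_tonelli1 (f \o @tcons R n)) //=.
exact: measurable_comp_tcons.
Qed.

Lemma LamS2 n (f : n.+1.-tuple TR -> \bar R) :
  measurable_fun setT f -> (forall x, 0 <= f x) ->
  \int[@Lam n.+1]_t f t =
    \int[@Lam n]_t \int[@lebesgue_measure R]_x f (tcons (x, t)).
Proof.
move=> mf f0; rewrite LamS // (fubini_tonelli2 (f \o @tcons R n)) //=.
exact: measurable_comp_tcons.
Qed.

Lemma Lam0 (f : 0.-tuple TR -> \bar R) : \int[@Lam 0]_t f t = f [tuple].
Proof.
rewrite -[LHS]/(\int[dirac [tuple]]_t f t) integral_dirac ?diracE ?in_setT ?mul1e //.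
rewrite (_ : f = cst (f [tuple])); first exact: measurable_cst.
by apply/funext => t /=; rewrite [t]tuple0.
Qed.

Definition affine_tuple n (l : R) (c : 'I_n -> R) (t : n.-tuple TR) : n.-tuple TR :=
  [tuple (l * tnth t i + c i)%R | i < n].

Lemma measurable_affine1 (l c : R) :
  measurable_fun setT ((fun x => l * x + c)%R : TR -> TR).
Proof. exact: measurable_funD (measurable_funM _ _) _. Qed.

Lemma measurable_affine n l c : measurable_fun setT (@affine_tuple n l c).
Proof.
apply/measurable_fun_tnthP => i.
rewrite (_ : _ \o _ = fun t => l * tnth t i + c i)%R; last first.
  by apply/funext => t /=; rewrite tnth_mktuple.
apply: (measurableT_comp (measurable_affine1 l (c i))).
exact: measurable_tnth.
Qed.

(** The pushforward of Lebesgue measure under x -> l x + c, multiplied by |l|, gives []a, b]] its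
    length, so it is Lebesgue measure by uniqueness. For negative l the preimage of []a, b]] is
    closed on the left and open on the right, hence the two cases. *)
Lemma integral_affine1 (l c : R) (f : TR -> \bar R) : (l != 0)%R ->
  measurable_fun setT f -> (forall x, 0 <= f x) ->
  \int[@lebesgue_measure R]_x f x =
  `|l|%:E * \int[@lebesgue_measure R]_x f (l * x + c)%R.
Proof.
move=> l0 mf f0.
have l0' : (0 < `|l|)%R by rewrite normr_gt0.
have mc : measurable_fun setT (f \o (fun x => l * x + c)%R).
  exact: (measurableT_comp mf (measurable_affine1 l c)).
pose nl := NngNum (ltW l0').
have maf := measurable_affine1 l c.
pose M := mscale nl
  (measure_function_pushforward__canonical__measure_function_Measure
    (@lebesgue_measure R) maf).
have E : \int[@lebesgue_measure R]_x f x = \int[M]_x f x.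
  apply: eq_measure_integral => A mA _.
  apply: lebesgue_measure_unique => // _ [[a b]] _ <-.
  rewrite /M /= /mscale /= /pushforward.
  case: (ltgtP l 0%R) l0 => // [ln|lp] _.
  - have -> : ((fun x => l * x + c)%R @^-1` `]a, b]) =
       `[((b - c) / l)%R, ((a - c) / l)%R[%classic.
      apply/seteqP; split => x /=; rewrite !in_itv /=;
      rewrite ler_ndivrMr // ltr_ndivlMr // lerBrDr ltrBlDr [(x * l)%R]mulrC andbC //.
    rewrite !lebesgue_measure_itv /= !lte_fin ltr_nM2r ?invr_lt0 // ltrD2r.
    case: ifP => _; last by rewrite mule0.
    rewrite -EFinB -EFinM; congr EFin; rewrite ltr0_norm // -mulrBl.
    by rewrite mulrCA; field; rewrite lt_eqF.
  - have -> : ((fun x => l * x + c)%R @^-1` `]a, b]) =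
       `]((a - c) / l)%R, ((b - c) / l)%R]%classic.
      apply/seteqP; split => x /=; rewrite !in_itv /=;
      by rewrite ltr_pdivrMr // ler_pdivlMr // lerBrDr ltrBlDr [(x * l)%R]mulrC.
    rewrite !lebesgue_measure_itv /= !lte_fin ltr_pM2r ?invr_gt0 // ltrD2r.
    case: ifP => _; last by rewrite mule0.
    rewrite -EFinB -EFinM; congr EFin; rewrite gtr0_norm // -mulrBl.
    by field; rewrite gt_eqF.
rewrite E ge0_integral_mscale //=; congr (_ * _).
by rewrite ge0_integral_pushforward // preimage_setT.
Qed.

Lemma affine_tcons n l c x (t : n.-tuple TR) :
  affine_tuple l c (tcons (x, t)) =
  tcons (l * x + c ord0, affine_tuple l (c \o lift ord0) t)%R.
Proof.
apply: eq_from_tnth => i; rewrite tnth_mktuple.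
by case: (unliftP ord0 i) => [j|] ->; rewrite ?tnth0 ?tnthS // tnth_mktuple.
Qed.

Lemma integral_affine n (l : R) (c : 'I_n -> R) (f : n.-tuple TR -> \bar R) :
  (l != 0)%R ->
  measurable_fun setT f -> (forall x, 0 <= f x) ->
  \int[@Lam n]_t f t = (`|l| ^+ n)%:E * \int[@Lam n]_t f (affine_tuple l c t).
Proof.
move=> l0; elim: n c f => [|n IH] c f mf f0.
  by rewrite !Lam0 mul1e; congr f; apply: eq_from_tnth => -[].
have ma := measurableT_comp mf (measurable_affine l c).
rewrite !LamS1 //.
have mf2 : measurable_fun setT (f \o @tcons R n).
  exact: measurable_comp_tcons.
rewrite (@integral_affine1 l (c ord0)) //; last 2 first.
- exact: (measurable_fun_fubini_tonelli_F (m2 := @Lam n) (f \o @tcons R n) mf2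
    (fun p => f0 (tcons p))).
- by move=> x; exact: integral_ge0.
rewrite exprS EFinM -muleA; congr (_ * _).
rewrite -ge0_integralZl //; last 2 first.
- apply: (measurable_fun_fubini_tonelli_F (m2 := @Lam n)
    (f \o affine_tuple l c \o @tcons R n) _ (fun p => f0 _)).
  exact: measurable_comp_tcons.
- by move=> x _; exact: integral_ge0.
apply: eq_integral => x _; rewrite (IH (c \o lift ord0)); last 2 first.
- apply: (measurableT_comp mf2); exact: measurable_pair1.
- by [].
by congr (_ * _); apply: eq_integral => t _; rewrite affine_tcons.
Qed.

End lebesgue_tuple_theory.
Arguments Lam {R} n.

(** * Measurability and product integrals on tuples *)

Section tuple_measurability.
Context {R : realType}.
Notation TR := (measurableTypeR R).
Notation rw := (@row_of_tuple R _).

Lemma row_of_tupleE n (t : n.-tuple TR) i : rw t 0 i = tnth t i.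
Proof. by rewrite mxE. Qed.

Lemma measurable_row_coord n i :
  measurable_fun setT (fun t : n.-tuple TR => rw t 0 i).
Proof.
rewrite (_ : (fun _ => _) = (fun t : n.-tuple TR => tnth t i)).
  exact: measurable_tnth.
by apply/funext => t; rewrite mxE.
Qed.

Lemma measurable_dotv d (U : measurableType d) n (f g : U -> n.-tuple TR) :
  measurable_fun setT f -> measurable_fun setT g ->
  measurable_fun setT (fun u => dotv (rw (f u)) (rw (g u))).
Proof.
move=> mf mg; rewrite /dotv; apply: measurable_sum => i.
apply: measurable_funM.
  by apply: (measurableT_comp (measurable_row_coord i) mf).
by apply: (measurableT_comp (measurable_row_coord i) mg).
Qed.

Lemma measurable_bracket d (U : measurableType d) n (f : U -> n.-tuple TR) :
  measurable_fun setT f -> measurable_fun setT (fun u => bracket (rw (f u))).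
Proof.
move=> mf; rewrite /bracket.
apply: (@measurableT_comp _ _ _ _ _ _ (@Num.sqrt R)).
  by apply: continuous_measurable_fun; exact: sqrt_continuous.
by apply: measurable_funD => //; exact: measurable_dotv.
Qed.

(* A function continuous in the real variable is the pointwise limit of the
   functions obtained by rounding that variable down to multiples of 1/k. *)
Lemma measurable_caratheodory d (U : measurableType d) (f : U -> TR -> R) :
  (forall s, measurable_fun setT (f ^~ s)) -> (forall u, continuous (f u : R -> R)) ->
  measurable_fun setT (fun p : U * TR => f p.1 p.2).
Proof.
move=> mf cf.
pose rd (k : nat) (s : R) : R := (Num.floor (k.+1%:R * s))%:~R / k.+1%:R.
have rdE k s : 0 <= s - rd k s <= k.+1%:R^-1.
  have k0 : (0 : R) < k.+1%:R by rewrite ltr0n.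
  rewrite /rd; have := Num.Theory.floor_itv (k.+1%:R * s); rewrite intrD => /andP[H1 H2].
  rewrite subr_ge0 ler_pdivrMr // [s * _]mulrC H1 /= lerBlDl -[X in _ + X]mul1r -mulrDl.
  by rewrite ler_pdivlMr // [s * _]mulrC ltW.
have rdcvg s : (fun k => rd k s) @ \oo --> s.
  apply/cvgrPdist_le => /= e e0; near=> k.
  rewrite ger0_norm; last by have /andP[] := rdE k s.
  have /andP[_ /le_trans ->//] := rdE k s.
  apply: ltW; near: k; exact: (near_infty_natSinv_lt (PosNum e0)).
apply: (@measurable_fun_cvg _ _ _ _
  (fun k (p : U * TR) => f p.1 (rd k p.2))); last first.
  move=> [u s] _ /=; apply: (continuous_cvg _ (cf u s)); exact: rdcvg.
move=> k _ B mB; rewrite setTI.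
(* For fixed k the rounded variable takes one value per integer j, so the preimage is a countable
   union of measurable rectangles. *)
rewrite (_ : _ @^-1` B = \bigcup_(j in [set: int])
  ((f ^~ (j%:~R / k.+1%:R)) @^-1` B `*` [set s | Num.floor (k.+1%:R * s) = j])).
  apply: countable_bigcupT_measurable; first exact: countableP.
  move=> j; apply: measurableX.
    by rewrite -[X in measurable X]setTI; exact: mf.
  rewrite (_ : [set s | _] =
     (fun s => k.+1%:R * s) @^-1` `[j%:~R, (j + 1)%:~R[%classic).
    rewrite -[X in measurable X]setTI.
    apply: (@mulrl_measurable R setT k.+1%:R) => //; exact: measurable_itv.
  apply/seteqP; split => s /=; rewrite in_itv /=.
    by move=> <-; exact: Num.Theory.floor_itv.
  by move/Num.Theory.floor_def.
apply/seteqP; split => [[u s] /= H|[u s] /= [j _] /= [H Hj]].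
  by exists (Num.floor (k.+1%:R * s)).
by rewrite /rd Hj.
Unshelve. all: by end_near. Qed.

Lemma row_of_tuple_cons n x (t : n.-tuple TR) :
  rw (tcons (x, t)) = \row_i (if unlift ord0 i is Some j then tnth t j else x).
Proof.
apply/rowP => i; rewrite !mxE.
by case: unliftP => [j|] ->; rewrite ?tnthS ?tnth0.
Qed.

(** Coordinates are peeled off one at a time: all but the first go into the measurable parameter of
    the preceding Carathéodory argument. Continuity along each axis therefore suffices, which is all
    that the existence of partial derivatives gives for symbols. *)
Lemma measurable_sepcont d (U : measurableType d) n (f : U -> 'rV[R]_n -> R) :
  (forall X, measurable_fun setT (f ^~ X)) ->
  (forall u X i, continuous (fun s : R => f u (X + s *: delta_mx 0 i))) ->
  measurable_fun setT (fun p : U * n.-tuple TR => f p.1 (rw p.2)).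
Proof.
elim: n d U f => [|n IH] d U f mf cf.
  rewrite (_ : (fun _ => _) = (f ^~ 0) \o fst); last first.
    by apply/funext => -[u t] /=; congr (f u _); apply/rowP => -[].
  by apply: measurableT_comp (mf _) _.
pose cons0 (s : R) (X : 'rV[R]_n) : 'rV[R]_n.+1 :=
  \row_i (if unlift ord0 i is Some j then X 0 j else s).
have cons0E s t : cons0 s (rw t) = rw (tcons (s, t)).
  rewrite row_of_tuple_cons; apply/rowP => i; rewrite !mxE.
  by case: unliftP => // j _; rewrite mxE.
have M : measurable_fun setT
    (fun p : (U * n.-tuple TR) * TR => f p.1.1 (cons0 p.2 (rw p.1.2))).
  apply: (@measurable_caratheodory _ _ (fun q s => f q.1 (cons0 s (rw q.2)))).
    move=> s; apply: (IH _ _ (fun u X => f u (cons0 s X))) => [X|u X i].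
      exact: mf.
    rewrite (_ : (fun _ => _) =
      (fun r => f u (cons0 s X + r *: delta_mx 0 (lift ord0 i)))); first exact: cf.
    apply/funext => r; congr (f u _); apply/rowP => j; rewrite !mxE.
    case: unliftP => [j' ->|->]; rewrite ?mxE /=.
      by rewrite (inj_eq lift_inj).
    by rewrite mulr0 addr0.
  move=> [u t] /=.
  rewrite (_ : (fun _ => _) =
      (fun r => f u (cons0 0 (rw t) + r *: delta_mx 0 ord0))); first exact: cf.
  apply/funext => r; congr (f u _); apply/rowP => j; rewrite !mxE.
  case: unliftP => [j' ->|->]; rewrite ?mxE /=.
    by rewrite mulr0 addr0.
  by rewrite mulr1 add0r.
pose sp (p : U * n.+1.-tuple TR) : (U * n.-tuple TR) * TR :=
  ((p.1, [tuple tnth p.2 (lift ord0 i) | i < n]), tnth p.2 ord0).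
have msp : measurable_fun setT sp.
  apply: measurable_fun_pair; first apply: measurable_fun_pair => //.
    apply/measurable_fun_tnthP => i.
    rewrite (_ : _ \o _ = (fun t : n.+1.-tuple TR => tnth t (lift ord0 i)) \o snd).
      by apply: measurableT_comp => //; exact: measurable_tnth.
    by apply/funext => p /=; rewrite tnth_mktuple.
  rewrite (_ : (fun _ => _) = (fun t : n.+1.-tuple TR => tnth t ord0) \o snd) //.
  by apply: measurableT_comp => //; exact: measurable_tnth.
rewrite (_ : (fun _ => _) =
   (fun p : (U * n.-tuple TR) * TR => f p.1.1 (cons0 p.2 (rw p.1.2))) \o sp).
  exact: measurableT_comp M msp.
apply/funext => -[u t] /=; rewrite cons0E; congr (f u (rw _)).
apply: eq_from_tnth => i; case: (unliftP ord0 i) => [j|] ->.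
  by rewrite tnthS tnth_mktuple.
by rewrite tnth0.
Qed.

Lemma row_of_affine_tuple n (l : R) (c : 'I_n -> R) t :
  rw (affine_tuple l c t) = l *: rw t + \row_i c i.
Proof. by apply/rowP => i; rewrite !mxE tnth_mktuple. Qed.

Lemma measurable_row_affine d (U : measurableType d) n (F : 'rV[R]_n -> U) (l : R) (v : 'rV[R]_n) :
  measurable_fun setT (F \o rw) -> measurable_fun setT (fun t => F (l *: rw t + v)).
Proof.
move=> mF; rewrite (_ : (fun _ => _) = (F \o rw) \o affine_tuple l (v 0)).
  by apply: (measurableT_comp mF); exact: measurable_affine.
apply/funext => t /=; rewrite row_of_affine_tuple; congr (F (_ + _)).
by apply/rowP => i; rewrite mxE.
Qed.

Local Open Scope ereal_scope.

Lemma integral_row_affine n (F : 'rV[R]_n -> \bar R) (l : R) (v : 'rV[R]_n) :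
  (l != 0)%R -> measurable_fun setT (F \o rw) -> (forall x, 0 <= F x) ->
  \int[@Lam R n]_t F (rw t) =
  (`|l| ^+ n)%:E * \int[@Lam R n]_t F (l *: rw t + v)%R.
Proof.
move=> l0 mF F0; rewrite (@integral_affine R n l (v 0%R) (F \o rw)) //.
congr (_ * _); apply: eq_integral => t _ /=; rewrite row_of_affine_tuple; congr (F (_ + _)%R).
  by apply/rowP => i; rewrite mxE.
by move=> t; exact: F0.
Qed.

Lemma integral_prod_tuple n (f : 'I_n -> R -> R) :
  (forall i, measurable_fun setT (f i)) -> (forall i x, 0 <= f i x)%R ->
  \int[@Lam R n]_t (\prod_(i < n) f i (rw t 0 i))%:E =
  \prod_(i < n) \int[@lebesgue_measure R]_x (f i x)%:E.
Proof.
elim: n f => [|n IH] f mf f0; first by rewrite Lam0 !big_ord0.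
rewrite LamS2; last 2 first.
- apply/measurable_EFinP; apply: measurable_prod => i _.
  by apply: measurableT_comp (mf i) _; exact: measurable_row_coord.
- by move=> t; rewrite lee_fin prodr_ge0.
rewrite big_ord_recl -IH //.
have I0 : 0 <= \int[lebesgue_measure]_x (f ord0 x)%:E.
  by apply: integral_ge0 => x _; rewrite lee_fin.
rewrite -ge0_integralZl //; last 2 first.
- apply/measurable_EFinP; apply: measurable_prod => i _.
  by apply: measurableT_comp (mf _) _; exact: measurable_row_coord.
- by move=> t _; rewrite lee_fin prodr_ge0.
apply: eq_integral => t _.
under eq_integral => x _.
  rewrite big_ord_recl row_of_tupleE tnth0.
  under eq_bigr do rewrite row_of_tupleE tnthS -row_of_tupleE.
  rewrite EFinM muleC.
  over.
rewrite /= ge0_integralZl //; last 3 first.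
- by apply/measurable_EFinP; exact: mf.
- by move=> x _; rewrite lee_fin.
- by rewrite lee_fin prodr_ge0.
by rewrite muleC.
Qed.

End tuple_measurability.

(** * Complex-valued integrals *)

Section complex_modulus.
Context {R : realType}.
Implicit Types z w : R[i].
Notation normc := (@Normc.normc R).

Lemma ReM z w : complex.Re (z * w) =
  complex.Re z * complex.Re w - complex.Im z * complex.Im w.
Proof. by case: z w => [a b] [c d]. Qed.

Lemma ImM z w : complex.Im (z * w) =
  complex.Re z * complex.Im w + complex.Im z * complex.Re w.
Proof. by case: z w => [a b] [c d]. Qed.

Lemma ReD z w : complex.Re (z + w) = complex.Re z + complex.Re w.
Proof. by case: z w => [a b] [c d]. Qed.

Lemma ImD z w : complex.Im (z + w) = complex.Im z + complex.Im w.
Proof. by case: z w => [a b] [c d]. Qed.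

Lemma ReIm_eq z w : complex.Re z = complex.Re w -> complex.Im z = complex.Im w -> z = w.
Proof. by case: z w => [a b] [c d] /= -> ->. Qed.

Lemma normc_ge0 z : 0 <= normc z.
Proof. by case: z => a b; rewrite /Normc.normc sqrtr_ge0. Qed.

Lemma normcE2 z : normc z ^+ 2 = complex.Re z ^+ 2 + complex.Im z ^+ 2.
Proof. by case: z => a b; rewrite /Normc.normc sqr_sqrtr // addr_ge0 ?sqr_ge0. Qed.

Lemma Re_le_normc z : `|complex.Re z| <= normc z.
Proof.
rewrite -(@ler_pXn2r _ 2) ?nnegrE ?normc_ge0 // real_normK ?num_real //.
by rewrite normcE2 lerDl sqr_ge0.
Qed.

Lemma Im_le_normc z : `|complex.Im z| <= normc z.
Proof.
rewrite -(@ler_pXn2r _ 2) ?nnegrE ?normc_ge0 // real_normK ?num_real //.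
by rewrite normcE2 lerDr sqr_ge0.
Qed.

Lemma normc_le_ReIm z : normc z <= `|complex.Re z| + `|complex.Im z|.
Proof.
rewrite -(@ler_pXn2r _ 2) ?nnegrE ?normc_ge0 ?addr_ge0 //.
rewrite normcE2 sqrrD !real_normK ?num_real // addrAC lerDl.
by rewrite mulrn_wge0 // mulr_ge0.
Qed.

Lemma normc_real (x : R) : normc x%:C = `|x|.
Proof. by rewrite /Normc.normc /= expr0n /= addr0 sqrtr_sqr. Qed.

Lemma normc_conj z : normc z^*%C = normc z.
Proof. by case: z => a b; rewrite /Normc.normc /= sqrrN. Qed.

Lemma mulcJ z : z * z^*%C = (normc z ^+ 2)%:C.
Proof. by rewrite normcE2; case: z => a b; simpc; congr (_ +i* _); ring. Qed.

Lemma conjcM z w : (z * w)^*%C = z^*%C * w^*%C.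
Proof. by case: z w => [a b] [c d]; simpc; congr (_ +i* _); ring. Qed.

Lemma realcM (x y : R) : (x * y)%:C = x%:C * y%:C :> R[i].
Proof. by simpc. Qed.

Lemma normc_cexpi (t : R) : normc (cexpi t) = 1.
Proof. by rewrite /Normc.normc /cexpi cos2Dsin2 sqrtr1. Qed.

Lemma cexpiD (s t : R) : cexpi (s + t) = cexpi s * cexpi t.
Proof. by rewrite /cexpi cosD sinD; simpc; rewrite [X in _ +i* X]addrC. Qed.

Lemma cexpiJ (t : R) : (cexpi t)^*%C = cexpi (- t).
Proof. by rewrite /cexpi cosN sinN. Qed.

Lemma normcD_le z w : normc (z + w) <= normc z + normc w.
Proof. exact: le_normcD. Qed.

End complex_modulus.

Section complex_integral.
Context {R : realType} d (T : measurableType d).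
Implicit Types (F G : T -> R[i]) (c : R[i]).
Notation normc := (@Normc.normc R).

Definition cmeas F :=
  measurable_fun setT (fun t => complex.Re (F t)) /\
  measurable_fun setT (fun t => complex.Im (F t)).

Definition cintegrable (mu : set T -> \bar R) F :=
  mu.-integrable setT (fun t => (complex.Re (F t))%:E) /\
  mu.-integrable setT (fun t => (complex.Im (F t))%:E).

(** An arbitrary measure space is allowed because Fubini's theorem is applied across different ones;
    for [Lam n] and [F \o row_of_tuple] this is convertible with [cintegral F]. *)
Definition cint (mu : {measure set T -> \bar R}) F : R[i] :=
  (\int[mu]_t complex.Re (F t)) +i* (\int[mu]_t complex.Im (F t)).

Lemma cmeasM F G : cmeas F -> cmeas G -> cmeas (fun t => F t * G t).
Proof.
move=> [F1 F2] [G1 G2]; split.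
  under eq_fun do rewrite ReM; by apply: measurable_funB; exact: measurable_funM.
under eq_fun do rewrite ImM; by apply: measurable_funD; exact: measurable_funM.
Qed.

Lemma cmeas_cst c : cmeas (fun=> c).
Proof. by split; exact: measurable_cst. Qed.

Lemma cmeas_real (f : T -> R) : measurable_fun setT f -> cmeas (fun t => (f t)%:C).
Proof. by move=> mf; split => //; exact: measurable_cst. Qed.

Lemma cmeas_cexpi (f : T -> R) : measurable_fun setT f -> cmeas (fun t => cexpi (f t)).
Proof.
move=> mf; split => /=; apply: measurableT_comp mf; apply: continuous_measurable_fun.
  exact: continuous_cos.
exact: continuous_sin.
Qed.

Lemma cmeasJ F : cmeas F -> cmeas (fun t => (F t)^*%C).
Proof.
move=> [F1 F2]; split.
  by rewrite (_ : (fun _ => _) = (fun t => complex.Re (F t))) //; apply/funext => t; case: (F t).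
rewrite (_ : (fun _ => _) = (fun t => - complex.Im (F t))); first exact: measurable_funN.
by apply/funext => t; case: (F t).
Qed.

Lemma measurable_normc F : cmeas F -> measurable_fun setT (fun t => normc (F t)).
Proof.
move=> [F1 F2]; rewrite (_ : (fun _ => _) =
  (fun t => Num.sqrt (complex.Re (F t) ^+ 2 + complex.Im (F t) ^+ 2))).
  apply: (@measurableT_comp _ _ _ _ _ _ (@Num.sqrt R)).
    by apply: continuous_measurable_fun; exact: sqrt_continuous.
  by apply: measurable_funD; exact: measurable_funX.
by apply/funext => t; rewrite -normcE2 sqrtr_sqr ger0_norm // normc_ge0.
Qed.

Variable mu : {measure set T -> \bar R}.

Lemma cintegrable_le F (g : T -> R) : cmeas F -> mu.-integrable setT (fun t => (g t)%:E) ->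
  (forall t, normc (F t) <= g t) -> cintegrable mu F.
Proof.
move=> [F1 F2] ig le; split.
  apply: (le_integrable measurableT _ _ ig); first exact/measurable_EFinP.
  move=> t _ /=; rewrite lee_fin.
  exact: le_trans (Re_le_normc _) (le_trans (le t) (ler_norm _)).
apply: (le_integrable measurableT _ _ ig); first exact/measurable_EFinP.
move=> t _ /=; rewrite lee_fin.
exact: le_trans (Im_le_normc _) (le_trans (le t) (ler_norm _)).
Qed.

Lemma cintegrable_cmeas F : cintegrable mu F -> cmeas F.
Proof.
move=> [/measurable_int F1 /measurable_int F2]; split; exact/measurable_EFinP.
Qed.

Lemma integrable_normc F : cintegrable mu F -> mu.-integrable setT (fun t => (normc (F t))%:E).
Proof.
move=> iF; have [F1 F2] := iF.
apply: (@le_integrable _ _ _ mu setT measurableT _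
  (fun t => `|(complex.Re (F t))%:E| + `|(complex.Im (F t))%:E|)%E).
- by apply/measurable_EFinP/measurable_normc/cintegrable_cmeas.
- move=> t _ /=; rewrite lee_fin (ger0_norm (normc_ge0 _)).
  by rewrite (ger0_norm (addr_ge0 _ _)) // normc_le_ReIm.
- by apply: integrableD => //; exact: integrable_abse.
Qed.

Lemma eq_cint F G : F =1 G -> cint mu F = cint mu G.
Proof. by move=> /funext ->. Qed.

Lemma cintZl c F : cintegrable mu F -> cint mu (fun t => c * F t) = c * cint mu F.
Proof.
move=> [F1 F2]; apply: ReIm_eq; rewrite ?ReM ?ImM /cint /=.
  under eq_Rintegral do rewrite ReM.
  rewrite RintegralB ?RintegralZl //.
  - exact: (integrableZl measurableT _ F1).
  - exact: (integrableZl measurableT _ F2).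
under eq_Rintegral do rewrite ImM.
rewrite RintegralD ?RintegralZl //.
- exact: (integrableZl measurableT _ F2).
- exact: (integrableZl measurableT _ F1).
Qed.

Lemma cintD F G : cintegrable mu F -> cintegrable mu G ->
  cint mu (fun t => F t + G t) = cint mu F + cint mu G.
Proof.
move=> [F1 F2] [G1 G2]; apply: ReIm_eq; rewrite ?ReD ?ImD /cint /=.
  by under eq_Rintegral do rewrite ReD; rewrite RintegralD.
by under eq_Rintegral do rewrite ImD; rewrite RintegralD.
Qed.

Lemma cintegrableZl c F : cintegrable mu F -> cintegrable mu (fun t => c * F t).
Proof.
move=> iF; apply: (@cintegrable_le _ (fun t => normc c * normc (F t))).
- apply: cmeasM; [exact: cmeas_cst|exact: cintegrable_cmeas iF].
- exact: (integrableZl measurableT _ (integrable_normc iF)).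
- by move=> t; rewrite Normc.normcM.
Qed.

Lemma cintJ F : cintegrable mu F -> cint mu (fun t => (F t)^*%C) = (cint mu F)^*%C.
Proof.
move=> [_ F2]; have E t : complex.Im (F t)^*%C = -1 * complex.Im (F t).
  by rewrite mulN1r; case: (F t).
rewrite /cint /=; congr (_ +i* _).
  by apply: eq_Rintegral => t _; case: (F t).
under eq_Rintegral do rewrite E.
by rewrite RintegralZl // mulN1r.
Qed.

(* The integral is rotated onto the positive half-line. *)
Lemma normc_cint_le F : cintegrable mu F -> normc (cint mu F) <= \int[mu]_t normc (F t).
Proof.
move=> iF; set I := cint mu F.
have [I0|I0] := eqVneq (normc I) 0.
  by rewrite I0; apply: Rintegral_ge0 => t _; exact: normc_ge0.
pose c := (normc I)^-1%:C * I^*%C.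
have nc : normc c = 1.
  by rewrite Normc.normcM normc_real normc_conj ger0_norm ?invr_ge0 ?normc_ge0 // mulVf.
have cI : c * I = (normc I)%:C.
  rewrite /c -mulrA [_^*%C * _]mulrC mulcJ expr2.
  by rewrite -rmorphM /= mulKf.
have : cint mu (fun t => c * F t) = (normc I)%:C by rewrite cintZl.
move/(congr1 (@complex.Re R)); rewrite /cint /= => <-.
have [iR _] := cintegrableZl c iF.
apply: le_Rintegral => //; first exact: integrable_normc.
move=> t _; apply: le_trans (ler_norm _) (le_trans (Re_le_normc _) _).
by rewrite Normc.normcM nc mul1r.
Qed.

End complex_integral.

Section complex_fubini.
Context {R : realType} d1 d2 (T1 : measurableType d1) (T2 : measurableType d2).
Variables (m1 : {sigma_finite_measure set T1 -> \bar R})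
          (m2 : {sigma_finite_measure set T2 -> \bar R}).
Notation normc := (@Normc.normc R).

(* All the integrands below are dominated by a product of integrable functions. *)
Variables (F : T1 * T2 -> R[i]) (g1 : T1 -> R) (g2 : T2 -> R).
Hypotheses (mF : cmeas F)
  (ig1 : m1.-integrable setT (fun t => (g1 t)%:E))
  (ig2 : m2.-integrable setT (fun t => (g2 t)%:E))
  (leF : forall p, normc (F p) <= g1 p.1 * g2 p.2).

Lemma integrable_prod_dominated :
  (m1 \x m2)%E.-integrable setT (fun p => (g1 p.1 * g2 p.2)%:E).
Proof.
have mg1 : measurable_fun setT g1 by apply/measurable_EFinP; exact: measurable_int ig1.
have mg2 : measurable_fun setT g2 by apply/measurable_EFinP; exact: measurable_int ig2.
have mm : measurable_fun setT (fun p : T1 * T2 => (g1 p.1 * g2 p.2)%:E).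
  apply/measurable_EFinP; apply: measurable_funM.
    exact: (measurableT_comp mg1 measurable_fst).
  exact: (measurableT_comp mg2 measurable_snd).
apply/integrable12ltyP => //=.
have -> : (\int[m1]_x \int[m2]_y `|g1 x * g2 y|%:E =
   (\int[m1]_x `|g1 x|%:E) * (\int[m2]_y `|g2 y|%:E))%E.
  rewrite -ge0_integralZr //; last 2 first.
  - by apply/measurable_EFinP; exact: measurableT_comp.
  - by apply: integral_ge0 => y _; rewrite lee_fin.
  apply: eq_integral => x _.
  under eq_integral do rewrite normrM EFinM.
  rewrite ge0_integralZl //.
  by apply/measurable_EFinP; exact: measurableT_comp.
move/integrableP : ig1 => [_ H1]; move/integrableP : ig2 => [_ H2].
rewrite lte_mul_pinfty //.
  by apply: integral_ge0 => y _; rewrite lee_fin.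
rewrite ge0_fin_numE //.
by apply: integral_ge0 => y _; rewrite lee_fin.
Qed.

Lemma cintegrable_prod_dominated : cintegrable (m1 \x m2)%E F.
Proof. exact: cintegrable_le integrable_prod_dominated leF. Qed.

Lemma cmeas_slice1 x : cmeas (fun y => F (x, y)).
Proof.
have [F1 F2] := mF; split.
  exact: (measurableT_comp F1 (measurable_pair1 x)).
exact: (measurableT_comp F2 (measurable_pair1 x)).
Qed.

Lemma cmeas_slice2 y : cmeas (fun x => F (x, y)).
Proof.
have [F1 F2] := mF; split.
  exact: (measurableT_comp F1 (measurable_pair2 y)).
exact: (measurableT_comp F2 (measurable_pair2 y)).
Qed.

Lemma cintegrable_slice1 x : cintegrable m2 (fun y => F (x, y)).
Proof.
apply: (@cintegrable_le _ _ _ m2 _ (fun y => g1 x * g2 y)) (cmeas_slice1 x) _ _.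
  exact: (integrableZl measurableT _ ig2).
by move=> y; exact: leF.
Qed.

Lemma cintegrable_slice2 y : cintegrable m1 (fun x => F (x, y)).
Proof.
apply: (@cintegrable_le _ _ _ m1 _ (fun x => g1 x * g2 y)) (cmeas_slice2 y) _ _.
  exact: (integrableZr measurableT _ ig1).
by move=> x; exact: leF.
Qed.

Lemma cint_fubini :
  cint m1 (fun x => cint m2 (fun y => F (x, y))) =
  cint m2 (fun y => cint m1 (fun x => F (x, y))).
Proof.
have [F1 F2] := cintegrable_prod_dominated.
rewrite /cint /=; congr (_ +i* _); rewrite /Rintegral; congr fine.
  have := Fubini F1; congr (_ = _); apply: eq_integral => x _; rewrite fineK //.
    by have [H _] := cintegrable_slice1 x; exact: (integrable_fin_num _ H).
  by have [H _] := cintegrable_slice2 x; exact: (integrable_fin_num _ H).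
have := Fubini F2; congr (_ = _); apply: eq_integral => x _; rewrite fineK //.
  by have [_ H] := cintegrable_slice1 x; exact: (integrable_fin_num _ H).
by have [_ H] := cintegrable_slice2 x; exact: (integrable_fin_num _ H).
Qed.

End complex_fubini.

(** * Integrals on the real line *)

Section line_integrals.
Context {R : realType}.
Notation TR := (measurableTypeR R).
Notation leb := (@lebesgue_measure R).

Lemma cvg_integral_ray (f : R -> R) (a : R) :
  leb.-integrable `[a, +oo[ (EFin \o f) ->
  (\int[leb]_(x in `[a, (a + k%:R)%R]) f x) @[k --> \oo] -->
  \int[leb]_(x in `[a, +oo[) f x.
Proof.
move=> intf.
pose D := `[a, +oo[%classic : set R.
pose A k := `[a, a + k%:R]%classic : set R.
have mf : measurable_fun D (EFin \o f) by exact: measurable_int intf.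
have mfA k : measurable_fun D (EFin \o (f \_ (A k))).
  rewrite (_ : EFin \o f \_ (A k) = (EFin \o f) \_ (A k)); last first.
    by apply/funext => x; rewrite /= !patchE; case: ifP.
  apply/(measurable_restrict _ (measurable_itv _) (measurable_itv _)).
  apply: measurable_funS mf; first exact: measurable_itv.
  exact: subIsetl.
have c1 : {ae leb, forall x, D x ->
    (fun k => (EFin \o (f \_ (A k))) x) @ \oo --> (EFin \o f) x}.
  apply: aeW => x xD; apply: cvg_near_cst.
  have [N _ HN] : \forall N \near \oo, x - a <= N%:R by exact: nbhs_infty_ger.
  exists N => // m /= Nm; rewrite patchE mem_set //= /A /= in_itv /=.
  move: xD; rewrite /D /= in_itv /= andbT => ->; rewrite -lerBlDl /=.
  exact: HN.
have c2 : {ae leb, forall x k, D x ->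
    (`|(EFin \o (f \_ (A k))) x| <= (abse \o (EFin \o f)) x)%E}.
  apply: aeW => x k xD /=; rewrite lee_fin patchE; case: ifP => // _.
  by rewrite normr0.
have [_ _ H] := @dominated_convergence _ _ R leb D (measurable_itv _) _ _ _ mfA mf c1 (integrable_abse intf) c2.
have : (fun k : nat => fine (\int[leb]_(x in D) (EFin \o (f \_ (A k))) x)%E) @ \oo --> \int[leb]_(x in D) f x.
  apply: fine_cvg; rewrite fineK; last exact: (integrable_fin_num _ intf).
  exact: H.
apply: cvg_trans; apply: near_eq_cvg; apply: nearW => k.
rewrite -/(Rintegral _ _ _) -Rintegral_mkcondr; congr (Rintegral _ _ _).
apply/seteqP; split => x; rewrite /D /A /= !in_itv /= andbT.
  by move=> [_].
by move=> /andP[-> ->].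
Qed.

(** Here [f] may change sign: the fundamental theorem is applied on the segments [a, a + k], and
    integrability carries both sides to the limit. *)
Lemma FTC_ray (f F : R -> R) (a l : R) :
  (forall x : R, is_derive x (1 : R) F (f x)) -> continuous f ->
  leb.-integrable `[a, +oo[ (EFin \o f) ->
  F x @[x --> +oo%R] --> l ->
  \int[leb]_(x in `[a, +oo[) f x = l - F a.
Proof.
move=> dF cf intf Fl.
have cF : continuous F.
  move=> x; apply: differentiable_continuous; apply/derivable1_diffP.
  by have [] := dF x.
have lim1 := cvg_integral_ray intf.
have lim2 : (fun k : nat => F (a + k%:R) - F a) @ \oo --> l - F a.
  apply: cvgB; last exact: cvg_cst.
  apply: (cvg_comp _ _ _ Fl).
  apply/cvgryPge => A; near=> k.
  rewrite -lerBlDl; near: k; exact: nbhs_infty_ger.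
apply: (cvg_unique (@norm_hausdorff _ _) lim1) => /=.
apply: cvg_trans lim2; apply: near_eq_cvg; near=> k.
have k0 : a < a + k%:R.
  by rewrite ltrDl ltr0n; near: k; exact: nbhs_infty_gt.
rewrite /Rintegral (@continuous_FTC2 _ f F) //.
- by apply: continuous_subspaceT => x; exact: cf.
- split; first by move=> x _; have [] := dF x.
  + by apply: cvg_at_right_filter; exact: cF.
  + by apply: cvg_at_left_filter; exact: cF.
- by move=> x _; rewrite derive1E; have [_ ->] := dF x.
Unshelve. all: by end_near. Qed.

Lemma cvg_shift_pinfty (c : R) : (fun x : R => c + x) @ +oo%R --> +oo%R.
Proof.
apply/cvgryPge => A; near=> x.
rewrite -lerBlDl; near: x; apply: nbhs_pinfty_ge; exact: num_real.
Unshelve. all: by end_near. Qed.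

Lemma powR_cvg_pinfty0 (c : R) : 0 < c -> (fun x : R => x `^ (- c)) @ +oo%R --> (0 : R).
Proof.
move=> c0; apply/cvgrPdist_le => /= e e0; near=> x.
have x0 : 0 < x by near: x; apply: nbhs_pinfty_gt; exact: num_real.
rewrite sub0r normrN ger0_norm ?powR_ge0 // powRN.
rewrite -[leRHS]invrK lef_pV2 ?posrE ?powR_gt0 ?invr_gt0 //.
have -> : e^-1 = (e^-1 `^ c^-1) `^ c.
  by rewrite -powRrM mulVf ?powRr1 ?invr_ge0 ?ltW // gt_eqF.
apply: ge0_ler_powR; rewrite ?nnegrE ?ltW ?powR_gt0 ?invr_gt0 //.
Unshelve. all: by end_near. Qed.

(** Products of this weight over the coordinates dominate powers of the bracket, which reduces
    integrability on R^n to the line. *)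
Definition wline (c x : R) : R := (1 + `|x|) `^ (- (1 + c)).

Lemma wline_ge0 c x : 0 <= wline c x.
Proof. exact: powR_ge0. Qed.

Lemma continuous_wline c : continuous (wline c).
Proof.
move=> x; rewrite /wline.
have H : {for 1 + `|x|, continuous (fun y : R => y `^ (- (1 + c)))}.
  apply: differentiable_continuous; apply/derivable1_diffP.
  apply: derivable_powR; rewrite in_itv /= andbT.
  by rewrite ltr_pwDl.
apply: (@continuous_comp _ _ _ (fun x : R => 1 + `|x|) (fun y : R => y `^ (- (1 + c)))) => //.
apply: cvgD; first exact: cvg_cst.
exact: norm_continuous.
Qed.

Lemma integral_wline_lty c : 0 < c -> (\int[leb]_x (wline c x)%:E < +oo)%E.
Proof.
move=> c0; rewrite ge0_symfun_integralT; last 3 first.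
- exact: wline_ge0.
- exact: continuous_wline.
- by move=> x /=; rewrite /wline normrN.
rewrite -set_itvcy.
have dF (x : R) : 0 <= x ->
    is_derive x (1 : R) (fun y : R => - (c^-1 * (1 + y) `^ (- c))) (wline c x).
  move=> x0; have x1 : 0 < 1 + x by rewrite ltr_pwDl.
  have H1 : is_derive x (1 : R) (fun y : R => 1 + y) 1.
    rewrite (_ : (fun y : R => 1 + y) = cst 1 + id) // -[X in is_derive _ _ _ X]add0r.
    exact: is_deriveD.
  have H2 := @is_derive1_comp _ (fun y : R => y `^ (- c)) (fun y => 1 + y) x _ _
    (is_derive1_powR (- c) x1) H1.
  apply: (is_derive_eq (is_deriveN (is_deriveZ c^-1 H2))).
  rewrite /wline (ger0_norm x0) mulr1.
  rewrite /GRing.scale /= mulNr mulrN opprK mulrA mulVf ?mul1r ?gt_eqF //.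
  by congr (_ `^ _); rewrite opprD addrC.
have cF (x : R) : 0 <= x ->
    {for x, continuous (fun y : R => - (c^-1 * (1 + y) `^ (- c)))}.
  move=> x0; apply: differentiable_continuous; apply/derivable1_diffP.
  by have [] := dF _ x0.
rewrite (@ge0_continuous_FTC2y _ _ (fun y : R => - (c^-1 * (1 + y) `^ (- c))) _ 0) //.
- by rewrite -EFinB -EFinM ltry.
- by move=> x _; exact: wline_ge0.
- by apply: continuous_subspaceT; exact: continuous_wline.
- rewrite -oppr0; apply: cvgN; rewrite -(mulr0 c^-1); apply: cvgMr.
  exact: (cvg_comp _ _ (cvg_shift_pinfty 1) (powR_cvg_pinfty0 c0)).
- by move=> x x0; have [] := dF _ (ltW x0).
- by apply: cvg_at_right_filter; exact: cF.
- by move=> x; rewrite in_itv /= andbT => x0; rewrite derive1E; have [_ ->] := dF _ (ltW x0).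
Qed.

(** Adding 1 to the cosine makes the integrand nonnegative, so that it can be integrated by a
    primitive on the half-line. The cosine transform of exp(-|x|) follows by subtracting the
    constant part, which is half of the case s = 0. *)
Lemma integral_expNabs_cos (s : R) :
  (\int[leb]_x (expR (- `|x|) * (1 + cos (s * x)))%:E = (2 * (1 + (1 + s ^+ 2)^-1))%:E)%E.
Proof.
have s1 : 0 < 1 + s ^+ 2 by rewrite ltr_pwDl ?sqr_ge0.
have cc : continuous (fun x : R => expR (- x) * (1 + cos (s * x))).
  move=> x; apply: cvgM.
    apply: (@continuous_comp _ _ _ (fun x : R => - x) (@expR R)); first exact: opp_continuous.
    exact: continuous_expR.
  apply: cvgD; first exact: cvg_cst.
  apply: (@continuous_comp _ _ _ (fun x : R => s * x) (@cos R)); first exact: mulrl_continuous.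
  exact: continuous_cos.
rewrite (@ge0_symfun_integralT _ (fun x => expR (- `|x|) * (1 + cos (s * x)))); last 3 first.
- by move=> x; rewrite mulr_ge0 ?expR_ge0 // -lerBlDl sub0r cos_geN1.
- rewrite (_ : (fun _ => _) = (fun x : R => expR (- x) * (1 + cos (s * x))) \o (fun x : R => `|x|)); last first.
    apply/funext => x /=; congr (_ * (1 + _)).
    by case: (ger0P x) => // _; rewrite mulrN cosN.
  move=> x; apply: continuous_comp; first exact: norm_continuous.
  exact: cc.
- by move=> x /=; rewrite normrN mulrN cosN.
rewrite -set_itvcy.
under eq_integral => x.
  rewrite inE /= in_itv /= andbT => x0; rewrite (ger0_norm x0); over.
(* The second summand is the real part of exp((-1 + i s) x) / (-1 + i s). *)
pose F (x : R) : R := - expR (- x) + (1 + s ^+ 2)^-1 * (expR (- x) * (s * sin (s * x) - cos (s * x))).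
have dF (x : R) : is_derive x (1 : R) F (expR (- x) * (1 + cos (s * x))).
  have H0 : is_derive x (1 : R) (fun y : R => s * y) s.
    apply: (is_derive_eq (is_deriveZ s (is_derive_id x 1))).
    by rewrite /GRing.scale /= mulr1.
  have HE : is_derive x (1 : R) (fun y : R => expR (- y)) (- expR (- x)).
    apply: (is_derive_eq (is_derive1_comp (is_derive_expR (- x)) (is_deriveN (is_derive_id x 1)))).
    by rewrite mulrN mulr1.
  have HS := is_derive1_comp (is_derive_sin (s * x)) H0.
  have HC := is_derive1_comp (is_derive_cos (s * x)) H0.
  apply: (is_derive_eq (is_deriveD (is_deriveN HE)
    (is_deriveZ (1 + s ^+ 2)^-1 (is_deriveM HE (is_deriveB (is_deriveZ s HS) HC))))).
  rewrite -[(_ - _) x]/(s * sin (s * x) - cos (s * x)) /GRing.scale /=.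
  by field; rewrite gt_eqF.
have Finf : F x @[x --> +oo%R] --> (0 : R).
  have E0 : expR (- x) @[x --> +oo%R] --> (0 : R) by exact: cvgr_expR.
  rewrite -[X in _ --> X]addr0 -[in X in X + _]oppr0; apply: cvgD; first exact: cvgN.
  rewrite -(mulr0 (1 + s ^+ 2)^-1); apply: cvgMr.
  apply/cvgrPdist_le => /= e e0.
  have e1 : 0 < e / (`|s| + 1) by rewrite divr_gt0 // ltr_wpDl.
  move/cvgrPdist_le: E0 => /(_ _ e1); apply: filterS => x.
  rewrite !sub0r !normrN => H.
  rewrite normrM; apply: le_trans (ler_pM _ _ H (_ : _ <= `|s| + 1)) _ => //.
    apply: le_trans (ler_normB _ _) _; apply: lerD.
      rewrite normrM ler_piMr // ler_norml sin_geN1 sin_le1 //.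
    by rewrite ler_norml cos_geN1 cos_le1.
  by rewrite divfK // gt_eqF // ltr_wpDl.
rewrite (@ge0_continuous_FTC2y _ _ F _ 0) //.
- rewrite -EFinB -EFinM /F oppr0 expR0 mulr0 sin0 cos0 mulr0; congr EFin; field.
  by rewrite gt_eqF.
- exact: continuous_subspaceT.
- apply: cvg_at_right_filter; apply: differentiable_continuous; apply/derivable1_diffP.
  by have [] := dF 0.
- by move=> x _; rewrite derive1E; have [_ ->] := dF x.
Qed.

Lemma measurable_expNabs : measurable_fun setT (fun x : R => expR (- `|x|)).
Proof.
apply: measurableT_comp; first exact: measurable_expR.
apply: measurableT_comp; first exact: oppr_measurable.
exact: normr_measurable.
Qed.

Lemma integral_expNabs : (\int[leb]_x (expR (- `|x|))%:E = 2%:E)%E.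
Proof.
have M : measurable_fun setT (fun x : TR => (expR (- `|x|))%:E).
  by apply/measurable_EFinP; exact: measurable_expNabs.
have := integral_expNabs_cos 0.
under eq_integral do rewrite mul0r cos0 mulrC EFinM.
rewrite ge0_integralZl //.
rewrite expr0n /= addr0 invr1 => H.
have I0 : (0 <= \int[leb]_x (expR (- `|x|))%:E)%E.
  by apply: integral_ge0 => x _; rewrite lee_fin expR_ge0.
move: H I0; case: (\int[leb]_x _)%E => [r| |] //=.
  by rewrite -EFinM => -[H] _; congr EFin; lra.
by rewrite mulry gtr0_sg ?mul1e // ltr_pwDl.
Qed.

Lemma integrable_expNabs : leb.-integrable setT (fun x : R => (expR (- `|x|))%:E).
Proof.
apply/integrableP; split; first by apply/measurable_EFinP; exact: measurable_expNabs.
under eq_integral do rewrite gee0_abs ?lee_fin ?expR_ge0 //.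
by rewrite integral_expNabs ltry.
Qed.

(** Since l is positive, finiteness of the products forces x and y to be finite, and distributivity
    is then that of real numbers. *)
Lemma muleBr_ge0 (l : R) (x y : \bar R) : 0 < l ->
  (l%:E * x < +oo -> l%:E * y < +oo -> 0 <= x -> 0 <= y ->
  l%:E * x - l%:E * y = l%:E * (x - y))%E.
Proof.
move=> l0 Fx Fy x0 y0.
have fin (z : \bar R) : (0 <= z -> l%:E * z < +oo -> z \is a fin_num)%E.
  move=> z0 Fz; rewrite ge0_fin_numE // ltNge leye_eq; apply/negP => /eqP H.
  by move: Fz; rewrite H mulry gtr0_sg // mul1e.
rewrite -(fineK (fin _ x0 Fx)) -(fineK (fin _ y0 Fy)).
by rewrite muleBr.
Qed.

Lemma integral_affine1_int (l c : R) (f : TR -> \bar R) : l != 0 ->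
  leb.-integrable setT f ->
  (\int[leb]_x f x = `|l|%:E * \int[leb]_x f (l * x + c)%R)%E.
Proof.
move=> l0 ifn; have mf := measurable_int _ ifn.
pose g : TR -> \bar R := fun x => f (l * x + c).
rewrite -/(g _) integralE -[X in (_ = _ * X)%E]/(\int[leb]_x g x)%E [X in (_ = _ * X)%E]integralE.
have E1 : (\int[leb]_x f^\+ x = `|l|%:E * \int[leb]_x g^\+ x)%E.
  rewrite (integral_affine1 c l0 (measurable_funepos mf) (fun x => funepos_ge0 f x)).
  by congr (_ * _)%E; apply: eq_integral => x _; rewrite !funeposE.
have E2 : (\int[leb]_x f^\- x = `|l|%:E * \int[leb]_x g^\- x)%E.
  rewrite (integral_affine1 c l0 (measurable_funeneg mf) (fun x => funeneg_ge0 f x)).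
  by congr (_ * _)%E; apply: eq_integral => x _; rewrite !funenegE.
have F1 := integral_funepos_lt_pinfty measurableT ifn.
have F2 := integral_funeneg_lt_pinfty measurableT ifn.
have l0' : 0 < `|l| by rewrite normr_gt0.
rewrite E1 E2; rewrite E1 in F1; rewrite E2 in F2.
have I1 : (0 <= \int[leb]_x g^\+ x)%E by apply: integral_ge0.
have I2 : (0 <= \int[leb]_x g^\- x)%E by apply: integral_ge0.
exact: muleBr_ge0.
Qed.

Lemma cint_expNabs (s : R) :
  cint leb (fun x : TR => (expR (- `|x|))%:C * cexpi (s * x)) = (2 / (1 + s ^+ 2))%:C.
Proof.
have s1 : 0 < 1 + s ^+ 2 by rewrite ltr_pwDl ?sqr_ge0.
have mc : measurable_fun setT (fun x : R => cos (s * x)).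
  apply: measurableT_comp; last exact: mulrl_measurable.
  by apply: continuous_measurable_fun; exact: continuous_cos.
have ms : measurable_fun setT (fun x : R => sin (s * x)).
  apply: measurableT_comp; last exact: mulrl_measurable.
  by apply: continuous_measurable_fun; exact: continuous_sin.
have ic : leb.-integrable setT (fun x : R => (expR (- `|x|) * cos (s * x))%:E).
  apply: (le_integrable measurableT _ _ integrable_expNabs).
    by apply/measurable_EFinP/measurable_funM => //; exact: measurable_expNabs.
  move=> x _; rewrite lee_fin normrM ler_piMr // ler_norml cos_geN1 cos_le1 //.
have is_ : leb.-integrable setT (fun x : R => (expR (- `|x|) * sin (s * x))%:E).
  apply: (le_integrable measurableT _ _ integrable_expNabs).
    by apply/measurable_EFinP/measurable_funM => //; exact: measurable_expNabs.
  move=> x _; rewrite lee_fin normrM ler_piMr // ler_norml sin_geN1 sin_le1 //.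
rewrite /cint; apply: ReIm_eq => /=.
  under eq_Rintegral do rewrite mul0r subr0.
  have := integral_expNabs_cos s.
  under eq_integral do rewrite mulrDr mulr1 EFinD.
  rewrite integralD // ?integral_expNabs //; last exact: integrable_expNabs.
  rewrite -[X in (_ + X)%E]fineK; last exact: (integrable_fin_num _ ic).
  rewrite -EFinD => -[H]; rewrite /Rintegral.
  have -> : fine (\int[leb]_x (expR (- `|x|) * cos (s * x))%:E) = 2 * (1 + s ^+ 2)^-1.
    by move: H; rewrite mulrDr mulr1 => /addrI.
  by [].
under eq_Rintegral do rewrite mul0r addr0.
(* The sine part is odd: the substitution x -> -x shows that its integral equals its own
   opposite. *)
have := @integral_affine1_int (-1) 0 _ _ is_.
rewrite oppr_eq0 oner_eq0 => /(_ isT).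
rewrite normrN1 mul1e.
under [X in _ = X -> _]eq_integral do
  rewrite mulN1r addr0 normrN mulrN sinN mulrN EFinN.
rewrite integralN; last first.
  by apply: fin_num_adde_defl; rewrite fin_numN; exact: integrable_neg_fin_num.
rewrite /Rintegral.
have := integrable_fin_num measurableT is_.
case: (\int[leb]_x _)%E => [r| |] //= _ [H].
by lra.
Qed.

End line_integrals.

(** * Directional derivatives and finite differences *)

Section directional_derivatives.
Context {R : realType} {E : normedModType R}.
Implicit Types (f g : E -> R) (x y v w : E) (vs ws : seq E) (t : R).

Lemma is_derive_line f x v t : derivable f (x + t *: v) v ->
  is_derive t (1 : R) (fun s : R => f (x + s *: v)) ('D_v f (x + t *: v)).
Proof.
move=> df.
have E1 : (fun h : R => h^-1 *: (((fun s => f (x + s *: v)) \o shift t) (h *: (1 : R)) - f (x + t *: v)))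
  = (fun h : R => h^-1 *: ((f \o shift (x + t *: v)) (h *: v) - f (x + t *: v))).
  apply/funext => h /=; congr (_ *: (f _ - _)).
  by rewrite [h%:A]mulr1 scalerDl addrCA.
split; first by rewrite /derivable E1.
by rewrite /derive E1.
Qed.

Lemma mvt_dir f x v t (B : R) : (forall s, derivable f (x + s *: v) v) ->
  (forall s, `|s| <= `|t| -> `|'D_v f (x + s *: v)| <= B) ->
  `|f (x + t *: v) - f x| <= `|t| * B.
Proof.
move=> df bd; pose phi s := f (x + s *: v).
have dphi s : is_derive s (1 : R) phi ('D_v f (x + s *: v)) by apply: is_derive_line.
have cphi : continuous phi.
  move=> s; apply: differentiable_continuous; apply/derivable1_diffP.
  by have [] := dphi s.
have -> : f (x + t *: v) - f x = phi t - phi 0 by rewrite /phi scale0r addr0.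
have [t0|t0] := leP 0 t.
  have [c ct ->] := MVT_segment t0 (fun s _ => dphi s) (continuous_subspaceT cphi).
  rewrite subr0 normrM mulrC ler_wpM2l // bd //.
  by move: ct; rewrite in_itv /= => /andP[c0 ct]; rewrite !ger0_norm // (le_trans c0).
have [c ct H] := MVT_segment (ltW t0) (fun s _ => dphi s) (continuous_subspaceT cphi).
rewrite distrC H sub0r normrM normrN mulrC ler_wpM2l // bd //.
by move: ct; rewrite in_itv /= => /andP[ct c0]; rewrite !ler0_norm ?lerN2 // (le_trans ct).
Qed.

Fixpoint rderive vs f : E -> R :=
  if vs is v :: ws then 'D_v (rderive ws f) else f.

Fixpoint rderivable vs f : Prop :=
  if vs is v :: ws then
    rderivable ws f /\ (forall x, derivable (rderive ws f) x v)
  else True.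

Lemma rderive_cat vs ws f : rderive (vs ++ ws) f = rderive vs (rderive ws f).
Proof. by elim: vs => //= v vs ->. Qed.

Lemma rderivable_cat vs ws f :
  rderivable (vs ++ ws) f <-> rderivable ws f /\ rderivable vs (rderive ws f).
Proof.
elim: vs => [|v vs IH] /=; first by split => [|[]].
split=> [[/IH[H1 H2] H3]|[H1 [H2 H3]]].
  by split; [exact: H1 | split; [exact: H2 | rewrite -rderive_cat]].
by split; [exact/IH|rewrite rderive_cat].
Qed.

Lemma Re_iderive vs (a : E -> R[i]) :
  (fun x => complex.Re (iderive vs a x)) = rderive vs (@complex.Re R \o a).
Proof. by elim: vs => //= v vs <-. Qed.

Lemma Im_iderive vs (a : E -> R[i]) :
  (fun x => complex.Im (iderive vs a x)) = rderive vs (@complex.Im R \o a).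
Proof. by elim: vs => //= v vs <-. Qed.

Lemma iderivableE vs (a : E -> R[i]) :
  iderivable vs a <->
  rderivable vs (@complex.Re R \o a) /\ rderivable vs (@complex.Im R \o a).
Proof.
elim: vs => [//|v vs IH] /=; rewrite -Re_iderive -Im_iderive.
split=> [[/IH[H1 H2] H3]|[[H1 H3] [H2 H4]]].
  by split; split; [exact: H1 | by move=> x; have [] := H3 x | exact: H2 | by move=> x; have [] := H3 x].
by split; [apply/IH|move=> x; split; [exact: H3|exact: H4]].
Qed.

Lemma derivable_translate f u x v : derivable f (x + u) v ->
  derivable (fun y => f (y + u)) x v /\ 'D_v (fun y => f (y + u)) x = 'D_v f (x + u).
Proof.
move=> df.
have E1 : (fun h : R => h^-1 *: (((fun y => f (y + u)) \o shift x) (h *: v) - f (x + u)))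
  = (fun h : R => h^-1 *: ((f \o shift (x + u)) (h *: v) - f (x + u))).
  by apply/funext => h /=; rewrite addrA.
by split; [rewrite /derivable E1|rewrite /derive E1].
Qed.

(** Differences commute with each other and with directional derivatives without any continuity;
    they carry every change of order below. *)
Definition delta w f : E -> R := fun x => f (x + w) - f x.

Lemma deltaC v w f : delta v (delta w f) = delta w (delta v f).
Proof.
apply/funext => x; rewrite /delta.
by rewrite [x + v + w]addrAC; ring.
Qed.

Definition deltas ws f := foldr delta f ws.

Lemma deltas_delta ws w f : deltas ws (delta w f) = delta w (deltas ws f).
Proof. by elim: ws => //= v ws ->; rewrite deltaC. Qed.

Lemma deltas_cat vs ws f : deltas (vs ++ ws) f = deltas vs (deltas ws f).
Proof. by rewrite /deltas foldr_cat. Qed.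

Lemma perm_deltas vs ws f : perm_eq vs ws -> deltas vs f = deltas ws f.
Proof.
elim: vs ws => [|v vs IH] ws; first by move/perm_size => /= /esym/size0nil ->.
move=> H; have vw : v \in ws by rewrite -(perm_mem H) mem_head.
case/splitPr: vw H => p1 p2 H.
have H3 : perm_eq vs (p1 ++ p2).
  by rewrite -(perm_cons v) (perm_trans H) // (perm_catCA p1 [:: v] p2).
by rewrite /= (IH _ H3) !deltas_cat /= deltas_delta.
Qed.

Lemma derivable_delta f w v : (forall x, derivable f x v) ->
  forall x, derivable (delta w f) x v /\ 'D_v (delta w f) x = delta w ('D_v f) x.
Proof.
move=> df x; have [d1 e1] := derivable_translate (df (x + w)).
have H : is_derive x v (delta w f) ('D_v f (x + w) - 'D_v f x).
  apply: is_deriveB; first by split.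
  by split; [exact: df | by []].
by split; case: H.
Qed.

Lemma derivable_deltas f ws v : (forall x, derivable f x v) ->
  (forall x, derivable (deltas ws f) x v) /\ 'D_v (deltas ws f) = deltas ws ('D_v f).
Proof.
move=> df; elim: ws => [//|w ws [IH1 IH2]] /=; split.
  by move=> x; have [] := derivable_delta w IH1 x.
by apply/funext => x; have [_ ->] := derivable_delta w IH1 x; rewrite IH2.
Qed.

Lemma rderivable_deltas vs ws f : rderivable vs f ->
  rderivable vs (deltas ws f) /\ rderive vs (deltas ws f) = deltas ws (rderive vs f).
Proof.
elim: vs => [//|v vs IH] /= [/IH[H1 H2] H3]; have [H4 H5] := derivable_deltas ws H3.
by split; [split; [exact: H1 | rewrite H2] | rewrite H2].
Qed.

Definition steps (l : seq (R * E)) : seq E := [seq p.1 *: p.2 | p <- l].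

(** The points at which the iterated mean value theorem may evaluate a derivative: from x, each step
    of [l] is made with its coefficient replaced by one of no larger modulus. *)
Fixpoint reach (l : seq (R * E)) x : set E :=
  if l is p :: l' then
    [set y | exists2 s, `|s| <= `|p.1| & reach l' (x + s *: p.2) y]
  else [set x].

Lemma reach_rcons l t v x s : `|s| <= `|t| ->
  reach l (x + s *: v) `<=` reach (rcons l (t, v)) x.
Proof.
move=> st; elim: l x => [|p l IH] x /=; first by move=> y ->; exists s.
move=> y [r rp H]; exists r => //; apply: IH.
by rewrite addrAC.
Qed.

(* Iterated mean value theorem: the innermost derivative is removed first. *)
Lemma deltas_le l f x (B : R) : rderivable [seq p.2 | p <- l] f ->
  (forall y, reach l x y -> `|rderive [seq p.2 | p <- l] f y| <= B) ->
  `|deltas (steps l) f x| <= \prod_(p <- l) `|p.1| * B.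
Proof.
elim/last_ind: l f x => [|l [t v] IH] f x /=.
  by move=> _ /(_ x erefl); rewrite big_nil mul1r.
rewrite map_rcons -cats1 => /rderivable_cat[/= [_ dv] dl] bd.
rewrite /steps map_rcons -cats1 deltas_cat /= deltas_delta -/(steps l).
rewrite (_ : \prod_(p <- _) _ = `|t| * \prod_(p <- l) `|p.1|); last first.
  by rewrite big_rcons /= mulrC.
rewrite -mulrA.
have [D1 D2] := derivable_deltas (steps l) dv.
apply: mvt_dir => [s|s st]; first exact: D1.
rewrite (congr1 (fun F => F (x + s *: v)) D2); apply: IH => // y ry.
have := bd y; rewrite rderive_cat /=; apply.
exact: reach_rcons ry.
Qed.

Lemma derive_le f x v (B : R) : derivable f x v ->
  (\forall t \near (0 : R), `|f (x + t *: v) - f x| <= `|t| * B) ->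
  `|'D_v f x| <= B.
Proof.
move=> df H; rewrite leNgt; apply/negP => HB.
have /cvgrPdist_lt : h^-1 *: ((f \o shift x) (h *: v) - f x) @[h --> 0^'] --> 'D_v f x by [].
move=> /(_ (`|'D_v f x| - B)); rewrite subr_gt0 => /(_ HB) H1.
have [t [t0 [Ht H2]]] : exists t : R, t != 0 /\ (`|f (x + t *: v) - f x| <= `|t| * B /\
   `|'D_v f x - t^-1 *: ((f \o shift x) (t *: v) - f x)| < `|'D_v f x| - B).
  have H4 : \forall t \near (0 : R)^', t != 0 by exact: nbhs_dnbhs_neq.
  have H3 : \forall t \near (0 : R)^', `|f (x + t *: v) - f x| <= `|t| * B.
    exact: cvg_within H.
  by have [t [? [? ?]]] := filter_ex (filterI H4 (filterI H3 H1)); exists t.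
have H3 : `|t^-1 *: ((f \o shift x) (t *: v) - f x)| <= B.
  by rewrite /= [t *: v + x]addrC normrM normfV ler_pdivrMl ?normr_gt0.
have := ler_normB ('D_v f x) ('D_v f x - t^-1 *: ((f \o shift x) (t *: v) - f x)).
rewrite subKr => H4.
have := lerB_dist ('D_v f x) (t^-1 *: ((f \o shift x) (t *: v) - f x)).
move=> H5; have := le_lt_trans H5 H2; rewrite ltrD2l ltrN2 => H6.
by have := lt_le_trans H6 H3; rewrite ltxx.
Qed.

(** Converse of the iterated mean value theorem: a derivative is a limit of difference quotients,
    taken here one direction at a time starting from the outermost. Only small steps matter, hence
    the restriction to coefficients of modulus at most 1. *)
Lemma rderive_le_deltas ws g x (B : R) : rderivable ws g ->
  (forall ts : seq R, size ts = size ws -> all (fun t => `|t| <= 1) ts ->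
    `|deltas (steps (zip ts ws)) g x| <= \prod_(t <- ts) `|t| * B) ->
  `|rderive ws g x| <= B.
Proof.
elim: ws g B => [|w ws IH] g B /=.
  by move=> _ /(_ [::] erefl isT); rewrite big_nil mul1r.
move=> [dws dw] bd; apply: derive_le => //.
near=> t.
have [H1 H2] := rderivable_deltas [:: t *: w] dws.
have -> : rderive ws g (x + t *: w) - rderive ws g x = rderive ws (delta (t *: w) g) x.
  by move: H2; rewrite /= => ->.
apply: IH => // ts sts ats.
have := bd (t :: ts); rewrite /= sts => /(_ erefl).
rewrite ats andbT big_cons -mulrA => H.
rewrite deltas_delta; apply: le_trans (H _) _; last by rewrite mulrCA.
  near: t; apply/nbhs_ballP; exists 1 => //= t; rewrite /ball /= sub0r normrN; exact: ltW.
Unshelve. all: by end_near. Qed.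

Lemma perm_lift (T : eqType) (l : seq (R * T)) (cs : seq T) :
  perm_eq [seq p.2 | p <- l] cs ->
  exists2 l', perm_eq l l' & [seq p.2 | p <- l'] = cs.
Proof.
elim: cs l => [|c cs IH] l H.
  exists [::] => //; move/perm_size: H; rewrite size_map /= => /size0nil -> //.
have /mapP[p pl pc] : c \in [seq p.2 | p <- l] by rewrite (perm_mem H) mem_head.
have H1 := perm_to_rem pl.
have [|l' P1 P2] := IH (rem p l).
  rewrite -(perm_cons c); apply: perm_trans H; rewrite perm_sym pc.
  by have := perm_map snd H1; rewrite /=.
exists (p :: l'); last by rewrite /= P2 pc.
by apply: perm_trans H1 _; rewrite perm_cons.
Qed.

(** A substitute for Schwarz's theorem. The derivatives [ws] are replaced by differences with steps
    of size at most 1, all differences are permuted into the order of [cs], and the mean value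
    theorem turns them into the derivative along [cs], the only one that is bounded. *)
Lemma mixed_bound f ws (l : seq (R * E)) cs x (B : R) :
  rderivable ws f -> rderivable cs f ->
  perm_eq (ws ++ [seq p.2 | p <- l]) cs ->
  (forall l' y, [seq p.2 | p <- l'] = cs ->
     (forall p, p \in l' -> p \in l \/ `|p.1| <= 1 /\ p.2 \in ws) ->
     reach l' x y -> `|rderive cs f y| <= B) ->
  `|deltas (steps l) (rderive ws f) x| <= \prod_(p <- l) `|p.1| * B.
Proof.
move=> dws dcs pcs bd.
have [H1 H2] := rderivable_deltas (steps l) dws.
rewrite -H2; apply: rderive_le_deltas => // ts sts ats.
rewrite -deltas_cat -[steps (zip ts ws) ++ _]map_cat -/(steps _).
have P0 : perm_eq [seq p.2 | p <- zip ts ws ++ l] cs.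
  by rewrite map_cat -/(unzip2 (zip ts ws)) unzip2_zip ?sts.
have [l' P1 P2] := perm_lift P0.
rewrite (perm_deltas (ws := steps l')) ?perm_map //.
have -> : \prod_(t <- ts) `|t| * (\prod_(p <- l) `|p.1| * B) = \prod_(p <- l') `|p.1| * B.
  rewrite mulrA -(perm_big _ P1) big_cat /=; congr (_ * _ * _).
  rewrite -[in LHS](unzip1_zip (s := ts) (t := ws)) ?sts // big_map //.
apply: deltas_le; rewrite P2 // => y ry; apply: bd ry => // p pl.
move: pl; rewrite -(perm_mem P1) mem_cat => /orP[pz|]; [right|by left].
split; last first.
  have := map_f snd pz; rewrite -/(unzip2 _) unzip2_zip ?sts //.
have := map_f fst pz; rewrite -/(unzip1 _) unzip1_zip ?sts // => /(allP ats).
by [].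
Qed.

End directional_derivatives.

(** * Integrals on R^n *)

Section japanese_bracket.
Context {R : realType} {n : nat}.
Implicit Types x y : 'rV[R]_n.

Lemma dotvC x y : dotv x y = dotv y x.
Proof. by apply: eq_bigr => i _; rewrite mulrC. Qed.

Lemma dotvDl x y z : dotv (x + y) z = dotv x z + dotv y z.
Proof. by rewrite -big_split; apply: eq_bigr => i _; rewrite mxE mulrDl. Qed.

Lemma dotvZl c x z : dotv (c *: x) z = c * dotv x z.
Proof. by rewrite mulr_sumr; apply: eq_bigr => i _; rewrite mxE mulrA. Qed.

Lemma dotvNl x z : dotv (- x) z = - dotv x z.
Proof. by rewrite -scaleN1r dotvZl mulN1r. Qed.

Lemma dotvBl x y z : dotv (x - y) z = dotv x z - dotv y z.
Proof. by rewrite dotvDl dotvNl. Qed.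

Lemma dotvv_ge0 x : 0 <= dotv x x.
Proof. by apply: sumr_ge0 => i _; rewrite -expr2 sqr_ge0. Qed.

Lemma sqr_le_dotv x i : x 0 i ^+ 2 <= dotv x x.
Proof.
rewrite /dotv (bigD1 i) //= -expr2 lerDl.
by apply: sumr_ge0 => j _; rewrite -expr2 sqr_ge0.
Qed.

Lemma sqr_bracket x : bracket x ^+ 2 = 1 + dotv x x.
Proof. by rewrite /bracket sqr_sqrtr // addr_ge0 ?dotvv_ge0. Qed.

Lemma bracket_ge1 x : 1 <= bracket x.
Proof.
by rewrite -(@ler_pXn2r _ 2) ?nnegrE ?sqrtr_ge0 // expr1n sqr_bracket lerDl dotvv_ge0.
Qed.

Lemma bracket_gt0 x : 0 < bracket x.
Proof. exact: lt_le_trans (bracket_ge1 x). Qed.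

Lemma bracketN x : bracket (- x) = bracket x.
Proof. by rewrite /bracket dotvNl dotvC dotvNl opprK. Qed.

Lemma bracket_coord x i : `|x 0 i| <= bracket x.
Proof.
rewrite -(@ler_pXn2r _ 2) ?nnegrE ?sqrtr_ge0 // sqr_bracket real_normK ?num_real //.
by rewrite (le_trans (sqr_le_dotv x i)) // lerDr.
Qed.

Lemma bracketD x y : bracket (x + y) <= 2 * (bracket x * bracket y).
Proof.
have b0 := bracket_gt0.
rewrite -(@ler_pXn2r _ 2) ?nnegrE ?mulr_ge0 ?(ltW (b0 _)) // !exprMn !sqr_bracket.
have H : dotv (x + y) (x + y) <= 2 * dotv x x + 2 * dotv y y.
  rewrite /dotv !mulr_sumr -big_split /=; apply: ler_sum => i _.
  rewrite mxE -!expr2 -subr_ge0.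
  by have := sqr_ge0 (x 0 i - y 0 i); rewrite sqrrB sqrrD; lra.
have X0 := dotvv_ge0 x; have Y0 := dotvv_ge0 y.
by have := mulr_ge0 X0 Y0; move: H; nra.
Qed.

Lemma bracket_le1 x : bracket x <= 1 + \sum_(i < n) `|x 0 i|.
Proof.
have S0 : 0 <= \sum_(i < n) `|x 0 i| by apply: sumr_ge0.
rewrite -(@ler_pXn2r _ 2) ?nnegrE ?sqrtr_ge0 ?addr_ge0 // sqr_bracket sqrrD expr1n mul1r.
have H : dotv x x <= (\sum_(i < n) `|x 0 i|) ^+ 2.
  rewrite expr2 mulr_suml; apply: ler_sum => i _.
  rewrite (le_trans (ler_norm _)) // normrM ler_wpM2l //.
  by rewrite (bigD1 i) //= lerDl sumr_ge0.
by move: H S0; lra.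
Qed.

Lemma powR_bracket_ge0 x (m : R) : 0 <= bracket x `^ m.
Proof. exact: powR_ge0. Qed.

Lemma ler_powR_bracket x (m m' : R) : m <= m' -> bracket x `^ m <= bracket x `^ m'.
Proof. by move=> mm; apply: ler_powR => //; exact: bracket_ge1. Qed.

(* Peetre's inequality. *)
Lemma powR_bracketD x y (m : R) :
  bracket (x + y) `^ m <= 2 `^ `|m| * (bracket y `^ `|m| * bracket x `^ m).
Proof.
have b0 := bracket_gt0.
have [m0|m0] := leP 0 m.
  rewrite (ger0_norm m0) -powRM ?(ltW (b0 _)) // -powRM ?mulr_ge0 ?(ltW (b0 _)) //.
  apply: ge0_ler_powR => //; rewrite ?nnegrE ?mulr_ge0 ?(ltW (b0 _)) //.
  by rewrite [bracket y * _]mulrC bracketD.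
rewrite (ltr0_norm m0); have m1 : 0 <= - m by rewrite oppr_ge0 ltW.
move: (- m) m1 (opprK m) => p p0 <-.
rewrite !(powRN _ p) mulrA ler_pdivlMr ?powR_gt0 // mulrC ler_pdivrMr ?powR_gt0 //.
rewrite -powRM ?(ltW (b0 _)) // -powRM ?mulr_ge0 ?(ltW (b0 _)) //.
apply: ge0_ler_powR => //; rewrite ?nnegrE ?mulr_ge0 ?(ltW (b0 _)) //.
have := bracketD (x + y) (- y); rewrite addrK bracketN => H.
by rewrite (le_trans H) // [bracket (x + y) * _]mulrC mulrA.
Qed.

Definition wprod (c : R) x : R := \prod_(i < n) wline c (x 0 i).

Lemma wprod_ge0 c x : 0 <= wprod c x.
Proof. by apply: prodr_ge0 => i _; exact: wline_ge0. Qed.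

(** The power is split into n equal factors, and each is compared with one coordinate by 1 + |x_i|
    <= 2 <x>. *)
Lemma bracket_le_wprod c x : 0 < c ->
  bracket x `^ (- (n%:R * (1 + c))) <= 2 `^ (n%:R * (1 + c)) * wprod c x.
Proof.
move=> c0; have c1 : 0 < 1 + c by rewrite addr_gt0.
have E (z : R) : 0 <= z -> z `^ (n%:R * (1 + c)) = \prod_(i < n) z `^ (1 + c).
  by move=> z0; rewrite prodr_const card_ord mulrC powRrM powR_mulrn ?powR_ge0.
have b0 := bracket_gt0 x.
rewrite powRN E ?(ltW b0) // (E 2) // -prodfV -big_split /=.
apply: ler_prod => i _; rewrite invr_ge0 powR_ge0 /=.
rewrite /wline powRN ler_pdivlMr ?powR_gt0 ?ltr_pwDl // mulrC ler_pdivrMr ?powR_gt0 //.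
rewrite -powRM ?(ltW b0) //; apply: ge0_ler_powR; rewrite ?nnegrE ?(ltW c1) ?addr_ge0 //.
  by rewrite mulr_ge0 // ltW.
rewrite mulr2n mulrDl mul1r lerD ?bracket_ge1 ?bracket_coord //.
Qed.

End japanese_bracket.

Section tuple_integrals.
Context {R : realType}.
Notation TR := (measurableTypeR R).
Notation rw := (@row_of_tuple R _).
Notation leb := (@lebesgue_measure R).
Notation normc := (@Normc.normc R).

Lemma measurable_row_continuous n (F : 'rV[R]_n -> R) :
  (forall X i, continuous (fun s : R => F (X + s *: delta_mx 0 i))) ->
  measurable_fun setT (F \o rw).
Proof.
move=> cF.
have H := @measurable_sepcont R _ TR n (fun _ X => F X) (fun X => measurable_cst _) (fun _ => cF).
rewrite (_ : F \o rw = (fun p : TR * n.-tuple TR => F (rw p.2)) \o (fun t => (0 : TR, t))) //.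
by apply: (measurableT_comp H); exact: measurable_fun_pair.
Qed.

Lemma integrable_wprod n c : 0 < c ->
  (@Lam R n).-integrable setT (fun t => (wprod c (rw t))%:E).
Proof.
move=> c0; have mw : measurable_fun setT (wline c).
  by apply: continuous_measurable_fun; exact: continuous_wline.
apply/integrableP; split.
  apply/measurable_EFinP; apply: measurable_prod => i _.
  by apply: (measurableT_comp mw); exact: measurable_row_coord.
under eq_integral do rewrite gee0_abs ?lee_fin ?wprod_ge0 //.
rewrite (integral_prod_tuple (fun _ => mw)); last by move=> _; exact: wline_ge0.
have H := integral_wline_lty c0.
have H0 : (0 <= \int[leb]_x (wline c x)%:E)%E.
  by apply: integral_ge0 => x _; rewrite lee_fin wline_ge0.
have -> : (\int[leb]_x (wline c x)%:E = (fine (\int[leb]_x (wline c x)%:E))%:E)%E.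
  by rewrite fineK // ge0_fin_numE.
by rewrite prodEFin ltry.
Qed.

Lemma integrable_bracket n (q : R) : (0 < n)%N -> n%:R < q ->
  (@Lam R n).-integrable setT (fun t => (bracket (rw t) `^ (- q))%:E).
Proof.
move=> n0 nq; have n0' : (0 : R) < n%:R by rewrite ltr0n.
pose c := q / n%:R - 1.
have c0 : 0 < c by rewrite subr_gt0 ltr_pdivlMr // mul1r.
have qE : q = n%:R * (1 + c) by rewrite /c addrCA subrr addr0 mulrC divfK // gt_eqF.
apply: (le_integrable measurableT _ _
  (integrableZl measurableT (2 `^ (n%:R * (1 + c))) (integrable_wprod n c0))).
  apply/measurable_EFinP; apply: (@measurableT_comp _ _ _ _ _ _ (@powR R ^~ (- q))); first exact: measurable_powR.
  exact: measurable_bracket.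
move=> t _; rewrite lee_fin !ger0_norm ?mulr_ge0 ?wprod_ge0 ?powR_ge0 //.
by rewrite qE bracket_le_wprod.
Qed.

Lemma Rint_affine n (F : 'rV[R]_n -> R) (l : R) (v : 'rV[R]_n) : l != 0 ->
  (@Lam R n).-integrable setT (fun t => (F (rw t))%:E) ->
  (@Lam R n).-integrable setT (fun t => (F (l *: rw t + v))%:E) /\
  \int[@Lam R n]_t F (rw t) = `|l| ^+ n * \int[@Lam R n]_t F (l *: rw t + v).
Proof.
move=> l0 iF; have mF := measurable_int _ iF.
have l0' : 0 < `|l| ^+ n by rewrite exprn_gt0 // normr_gt0.
have mG : measurable_fun setT (fun t : n.-tuple TR => (F (l *: rw t + v))%:E).
  exact: (measurable_row_affine (F := fun X => (F X)%:E)).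
have H (G : 'rV[R]_n -> \bar R) := @integral_row_affine R n G l v l0.
have iG : (@Lam R n).-integrable setT (fun t => (F (l *: rw t + v))%:E).
  apply/integrableP; split => //.
  move/integrableP : iF => [_]; rewrite (H (fun X => `|(F X)%:E|%E)) //; last first.
    exact: measurableT_comp.
  move=> Hlt; rewrite ltNge leye_eq; apply/negP => /eqP E.
  by move: Hlt; rewrite E mulry gtr0_sg // mul1e.
split => //; rewrite /Rintegral -[RHS]/(fine (`|l| ^+ n)%:E * _) -fineM //; last first.
  exact: (integrable_fin_num _ iG).
congr fine; rewrite integralE [X in (_ = _ * X)%E]integralE.
have E1 := H (fun X => (EFin \o F)^\+ X)%E.
have E2 := H (fun X => (EFin \o F)^\- X)%E.
have M1 : measurable_fun setT ((fun X => (EFin \o F)^\+ X)%E \o rw).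
  rewrite (_ : _ \o _ = (fun t => (F (rw t))%:E)^\+%E); first exact: measurable_funepos.
  by apply/funext => t; rewrite /= !funeposE.
have M2 : measurable_fun setT ((fun X => (EFin \o F)^\- X)%E \o rw).
  rewrite (_ : _ \o _ = (fun t => (F (rw t))%:E)^\-%E); first exact: measurable_funeneg.
  by apply/funext => t; rewrite /= !funenegE.
have {}E1 := E1 M1 (fun X => funepos_ge0 _ X).
have {}E2 := E2 M2 (fun X => funeneg_ge0 _ X).
have F1 := integral_funepos_lt_pinfty measurableT iF.
have F2 := integral_funeneg_lt_pinfty measurableT iF.
have {}E1 : (\int[@Lam R n]_t (fun t => (F (rw t))%:E)^\+ t = (`|l| ^+ n)%:E *
   \int[@Lam R n]_t (fun t => (F (l *: rw t + v))%:E)^\+ t)%E.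
  have -> : (\int[@Lam R n]_t (fun t => (F (rw t))%:E)^\+ t =
    \int[@Lam R n]_t (EFin \o F)^\+ (rw t))%E.
    by apply: eq_integral => t _; rewrite !funeposE.
  by rewrite E1; congr (_ * _)%E; apply: eq_integral => t _; rewrite !funeposE.
have {}E2 : (\int[@Lam R n]_t (fun t => (F (rw t))%:E)^\- t = (`|l| ^+ n)%:E *
   \int[@Lam R n]_t (fun t => (F (l *: rw t + v))%:E)^\- t)%E.
  have -> : (\int[@Lam R n]_t (fun t => (F (rw t))%:E)^\- t =
    \int[@Lam R n]_t (EFin \o F)^\- (rw t))%E.
    by apply: eq_integral => t _; rewrite !funenegE.
  by rewrite E2; congr (_ * _)%E; apply: eq_integral => t _; rewrite !funenegE.
rewrite E1 E2; apply: muleBr_ge0 => //; rewrite -?E1 -?E2 //; exact: integral_ge0.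
Qed.

Lemma integral_LamS n (f : n.+1.-tuple TR -> \bar R) :
  (leb \x @Lam R n)%E.-integrable setT (f \o @tcons R n) -> measurable_fun setT f ->
  (@Lam R n.+1).-integrable setT f /\
  (\int[@Lam R n.+1]_t f t = \int[leb \x @Lam R n]_p f (tcons p))%E.
Proof.
move=> iF mf; split.
  apply/integrableP; split => //; move/integrableP : iF => [_].
  by rewrite LamS //; exact: measurableT_comp.
rewrite integralE [RHS]integralE; congr (_ - _)%E.
  rewrite LamS //; last exact: measurable_funepos.
  by apply: eq_integral => p _; rewrite !funeposE.
rewrite LamS //; last exact: measurable_funeneg.
by apply: eq_integral => p _; rewrite !funenegE.
Qed.

Section dominated.
Variables (n : nat) (F : n.+1.-tuple TR -> R[i]) (g1 : TR -> R) (g2 : n.-tuple TR -> R).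
Hypotheses (mF : cmeas F)
  (ig1 : leb.-integrable setT (fun t => (g1 t)%:E))
  (ig2 : (@Lam R n).-integrable setT (fun t => (g2 t)%:E))
  (leF : forall p, normc (F (tcons p)) <= g1 p.1 * g2 p.2).

Let mFt : cmeas (fun p => F (tcons p)).
Proof. by case: mF => F1 F2; split; [exact: (measurable_comp_tcons F1)|exact: (measurable_comp_tcons F2)]. Qed.

Lemma cint_LamS1 :
  cintegrable (@Lam R n.+1) F /\
  cint (@Lam R n.+1) F = cint leb (fun x => cint (@Lam R n) (fun t => F (tcons (x, t)))).
Proof.
have [F1 F2] := mF.
have [I1 I2] := cintegrable_prod_dominated mFt ig1 ig2 leF.
have [J1 E1] := integral_LamS I1 (proj2 (measurable_EFinP _ _) F1).
have [J2 E2] := integral_LamS I2 (proj2 (measurable_EFinP _ _) F2).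
split => //; rewrite /cint /=; congr (_ +i* _); rewrite /Rintegral; congr fine.
  rewrite E1 -integral12_prod_meas1 //; apply: eq_integral => x _ /=; rewrite fineK //.
  by have [H _] := cintegrable_slice1 mFt ig2 leF x; exact: (integrable_fin_num _ H).
rewrite E2 -integral12_prod_meas1 //; apply: eq_integral => x _ /=; rewrite fineK //.
by have [_ H] := cintegrable_slice1 mFt ig2 leF x; exact: (integrable_fin_num _ H).
Qed.

Lemma cint_LamS2 :
  cint (@Lam R n.+1) F = cint (@Lam R n) (fun t => cint leb (fun x => F (tcons (x, t)))).
Proof.
rewrite (proj2 cint_LamS1).
exact: (cint_fubini mFt ig1 ig2 leF).
Qed.

End dominated.

Definition expNabs_tuple n (t : n.-tuple TR) : R := \prod_(i < n) expR (- `|rw t 0 i|).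

Lemma expNabs_tuple_ge0 n (t : n.-tuple TR) : 0 <= expNabs_tuple t.
Proof. by apply: prodr_ge0 => i _; exact: expR_ge0. Qed.

Lemma measurable_expNabs_tuple n : measurable_fun setT (@expNabs_tuple n).
Proof.
apply: measurable_prod => i _; apply: (measurableT_comp (@measurable_expNabs R)).
exact: measurable_row_coord.
Qed.

Lemma integrable_expNabs_tuple n :
  (@Lam R n).-integrable setT (fun t => (expNabs_tuple t)%:E).
Proof.
apply/integrableP; split; first by apply/measurable_EFinP; exact: measurable_expNabs_tuple.
under eq_integral do rewrite gee0_abs ?lee_fin ?expNabs_tuple_ge0 //.
rewrite (integral_prod_tuple (fun _ => @measurable_expNabs R)); last first.
  by move=> _ x; exact: expR_ge0.
by rewrite integral_expNabs prodEFin ltry.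
Qed.

Lemma cint_expNabs_tuple n (z : 'rV[R]_n) :
  cint (@Lam R n) (fun t => (expNabs_tuple t)%:C * cexpi (dotv z (rw t))) =
  (\prod_(i < n) (2 / (1 + z 0 i ^+ 2)))%:C.
Proof.
elim: n z => [|n IH] z.
  rewrite big_ord0 /cint; apply: ReIm_eq => /=.
    rewrite /Rintegral Lam0 /= /expNabs_tuple big_ord0 /dotv big_ord0 cos0 sin0.
    by rewrite mul1r mul0r subr0.
  rewrite /Rintegral Lam0 /= /expNabs_tuple big_ord0 /dotv big_ord0 cos0 sin0.
  by rewrite mulr0 mul0r addr0.
pose z' : 'rV[R]_n := \row_i z 0 (lift ord0 i).
have E0 x t : expNabs_tuple (tcons (x, t)) = expR (- `|x|) * @expNabs_tuple n t.
  rewrite /expNabs_tuple big_ord_recl row_of_tupleE tnth0; congr (_ * _).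
  by apply: eq_bigr => i _; rewrite !row_of_tupleE tnthS.
have E1 x (t : n.-tuple TR) : dotv z (rw (tcons (x, t))) = z 0 ord0 * x + dotv z' (rw t).
  rewrite /dotv big_ord_recl row_of_tupleE tnth0; congr (_ + _).
  by apply: eq_bigr => i _; rewrite !row_of_tupleE tnthS mxE.
have mF m (w : 'rV[R]_m) : cmeas (fun t : m.-tuple TR => (expNabs_tuple t)%:C * cexpi (dotv w (rw t))).
  apply: cmeasM; first exact: (cmeas_real (@measurable_expNabs_tuple m)).
  apply: cmeas_cexpi; apply: measurable_sum => i; apply: measurable_funM; first exact: measurable_cst.
  exact: measurable_row_coord.
have iF m (w : 'rV[R]_m) : cintegrable (@Lam R m) (fun t => (expNabs_tuple t)%:C * cexpi (dotv w (rw t))).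
  apply: (cintegrable_le (mF m w) (@integrable_expNabs_tuple m)) => t.
  by rewrite Normc.normcM normc_cexpi mulr1 normc_real ger0_norm ?expNabs_tuple_ge0.
have leF (p : TR * n.-tuple TR) :
    normc ((expNabs_tuple (tcons p))%:C * cexpi (dotv z (rw (tcons p)))) <=
    expR (- `|p.1|) * expNabs_tuple p.2.
  case: p => x t; rewrite Normc.normcM normc_cexpi mulr1 normc_real.
  by rewrite ger0_norm ?expNabs_tuple_ge0 // E0.
have [_ ->] := cint_LamS1 (mF _ z) (@integrable_expNabs R) (@integrable_expNabs_tuple n) leF.
pose c : R[i] := (\prod_(i < n) (2 / (1 + z' 0 i ^+ 2)))%:C.
transitivity (cint leb (fun x : TR => c * ((expR (- `|x|))%:C * cexpi (z 0 ord0 * x)))).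
  apply: eq_cint => x; rewrite /c -(IH z') mulrC -cintZl; last exact: iF.
  apply: eq_cint => t; rewrite E0 E1 cexpiD rmorphM /=.
  by rewrite mulrACA.
rewrite cintZl; last first.
  apply: (cintegrable_le _ (@integrable_expNabs R)).
    apply: cmeasM; first exact: (cmeas_real (@measurable_expNabs R)).
    by apply: cmeas_cexpi; exact: mulrl_measurable.
  by move=> x; rewrite Normc.normcM normc_cexpi mulr1 normc_real ger0_norm ?expR_ge0.
rewrite cint_expNabs big_ord_recl mulrC [RHS]rmorphM /=; congr (_ * _%:C).
by apply: eq_bigr => i _; rewrite mxE.
Qed.

End tuple_integrals.

Section complex_integral_limits.
Context {R : realType} d (T : measurableType d) (mu : {measure set T -> \bar R}).
Notation normc := (@Normc.normc R).

Lemma cmeas_comp d' (U : measurableType d') (F : T -> R[i]) (phi : U -> T) :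
  cmeas F -> measurable_fun setT phi -> cmeas (fun u => F (phi u)).
Proof.
move=> [F1 F2] mp.
by split; [exact: (measurableT_comp F1 mp)|exact: (measurableT_comp F2 mp)].
Qed.

Lemma cvg_Rintegral (f_ : nat -> T -> R) (f g : T -> R) :
  (forall k, measurable_fun setT (f_ k)) -> measurable_fun setT f ->
  (forall t, f_ ^~ t @ \oo --> f t) ->
  mu.-integrable setT (fun t => (g t)%:E) -> (forall k t, `|f_ k t| <= g t) ->
  \int[mu]_t f_ k t @[k --> \oo] --> \int[mu]_t f t.
Proof.
move=> mf_ mf cf ig le.
have c1 : {ae mu, forall x, setT x -> (fun k => (f_ k x)%:E) @ \oo --> (f x)%:E}.
  by apply: aeW => x _; apply: (cvg_EFin _ (cf x)); exact: nearW.
have c2 : {ae mu, forall x k, setT x -> (`|(f_ k x)%:E| <= (g x)%:E)%E}.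
  by apply: aeW => x k _; rewrite lee_fin.
have m1 k : measurable_fun setT (fun x => (f_ k x)%:E) by exact/measurable_EFinP.
have m2 : measurable_fun setT (fun x => (f x)%:E) by exact/measurable_EFinP.
have [H0 _ H] := @dominated_convergence _ _ R mu setT measurableT _ _ _ m1 m2 c1 ig c2.
apply: fine_cvg; rewrite fineK; last exact: (integrable_fin_num _ H0).
exact: H.
Qed.

Lemma measurable_Rintegral_param d' (U : measurableType d')
    (m2 : {sigma_finite_measure set T -> \bar R}) (G : U * T -> R) :
  measurable_fun setT G ->
  (forall u, m2.-integrable setT (fun t => (G (u, t))%:E)) ->
  measurable_fun setT (fun u => \int[m2]_t G (u, t)).
Proof.
move=> mG iG; have mE : measurable_fun setT (EFin \o G) by exact/measurable_EFinP.
have M1 := measurable_fun_fubini_tonelli_F (m2 := m2) _ (measurable_funepos mE) (fun p => funepos_ge0 _ p).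
have M2 := measurable_fun_fubini_tonelli_F (m2 := m2) _ (measurable_funeneg mE) (fun p => funeneg_ge0 _ p).
have -> : (fun u => \int[m2]_t G (u, t)) =
   (fun u => fine (fubini_F m2 (EFin \o G)^\+ u - fubini_F m2 (EFin \o G)^\- u)%E).
  apply/funext => u; rewrite /Rintegral integralE; congr (fine (_ - _)).
    by apply: eq_integral => t _; rewrite !funeposE.
  by apply: eq_integral => t _; rewrite !funenegE.
apply: (@measurableT_comp _ _ _ _ _ _ (@fine R)) => //.
exact: emeasurable_funB.
Qed.

Lemma cmeas_cint_param d' (U : measurableType d')
    (m2 : {sigma_finite_measure set T -> \bar R}) (G : U * T -> R[i]) :
  cmeas G -> (forall u, cintegrable m2 (fun t => G (u, t))) ->
  cmeas (fun u => cint m2 (fun t => G (u, t))).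
Proof.
move=> [G1 G2] iG; split.
  by apply: (measurable_Rintegral_param G1) => u; case: (iG u).
by apply: (measurable_Rintegral_param G2) => u; case: (iG u).
Qed.

End complex_integral_limits.

(** * Fourier integrals and Plancherel's inequality *)

Section fourier.
Context {R : realType} {n : nat}.
Notation TR := (measurableTypeR R).
Notation rw := (@row_of_tuple R n).
Notation L := (@Lam R n).
Notation normc := (@Normc.normc R).
Variable h : R.
Hypothesis h0 : 0 < h.
Implicit Types (f g : 'rV[R]_n -> R[i]).

Definition fker (x y : 'rV[R]_n) : R[i] := cexpi (- (dotv x y / h)).

Definition fourier f (x : 'rV[R]_n) : R[i] :=
  cint L (fun t => fker x (rw t) * f (rw t)).

Lemma normc_fker x y : normc (fker x y) = 1.
Proof. exact: normc_cexpi. Qed.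

Lemma cmeas_fker d (U : measurableType d) (f g : U -> n.-tuple TR) :
  measurable_fun setT f -> measurable_fun setT g ->
  cmeas (fun u => fker (rw (f u)) (rw (g u))).
Proof.
move=> mf mg; apply: cmeas_cexpi; apply: measurable_funN; apply: measurable_funM.
  exact: measurable_dotv.
exact: measurable_cst.
Qed.

Lemma cintegrable_fker f x : cintegrable L (f \o rw) ->
  cintegrable L (fun t => fker x (rw t) * f (rw t)).
Proof.
move=> iF; apply: (cintegrable_le _ (integrable_normc iF)) => [|t]; last first.
  by rewrite Normc.normcM normc_fker mul1r.
apply: cmeasM; last exact: cintegrable_cmeas iF.
apply: cmeas_cexpi; apply: measurable_funN; apply: measurable_funM; last exact: measurable_cst.
apply: measurable_sum => i; apply: measurable_funM; first exact: measurable_cst.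
exact: measurable_row_coord.
Qed.

Lemma normc_fourier_le f x : cintegrable L (f \o rw) ->
  normc (fourier f x) <= \int[L]_t normc (f (rw t)).
Proof.
move=> iF; apply: le_trans (normc_cint_le (cintegrable_fker x iF)) _.
by under eq_Rintegral do rewrite Normc.normcM normc_fker mul1r.
Qed.

Lemma cmeas_fourier f : cintegrable L (f \o rw) -> cmeas (fun t => fourier f (rw t)).
Proof.
move=> iF; apply: (cmeas_cint_param (m2 := L)
   (G := fun p => fker (rw p.1) (rw p.2) * f (rw p.2))).
  apply: cmeasM; first exact: cmeas_fker.
  exact: (cmeas_comp (cintegrable_cmeas iF) measurable_snd).
by move=> u /=; exact: (cintegrable_fker (rw u) iF).
Qed.

(** Damping factor for Plancherel's identity. Its Fourier transform is an explicit product of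
    Poisson kernels, nonnegative and integrable, so that no Fourier inversion is required. *)
Definition expNabs (x : 'rV[R]_n) : R := \prod_(i < n) expR (- `|x 0 i|).

Lemma expNabs_ge0 x : 0 <= expNabs x.
Proof. by apply: prodr_ge0 => i _; exact: expR_ge0. Qed.

Lemma expNabs_le1 x : expNabs x <= 1.
Proof.
suff /andP[] : 0 <= expNabs x <= 1 by [].
apply: (big_ind (fun y => 0 <= y <= 1)) => [|a b /andP[a0 a1] /andP[b0 b1]|i _].
- by rewrite ler01 lexx.
- by rewrite mulr_ge0 // mulr_ile1.
- by rewrite expR_ge0 /= -[leRHS]expR0 ler_expR oppr_le0.
Qed.

Lemma measurable_expNabs_scale (s : R) :
  measurable_fun setT (fun t : n.-tuple TR => expNabs (s *: rw t)).
Proof.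
have := measurable_row_affine (F := expNabs) s 0 (@measurable_expNabs_tuple R n).
by under eq_fun do rewrite addr0.
Qed.

Lemma integrable_expNabs_scale (s : R) : s != 0 ->
  L.-integrable setT (fun t => (expNabs (s *: rw t))%:E).
Proof.
move=> s0; have [+ _] := Rint_affine (F := expNabs) 0 s0 (@integrable_expNabs_tuple R n).
by under eq_fun do rewrite addr0.
Qed.

Definition poisson (z : 'rV[R]_n) : R := \prod_(i < n) (2 / (1 + z 0 i ^+ 2)).

Lemma poisson_ge0 z : 0 <= poisson z.
Proof. by apply: prodr_ge0 => i _; rewrite divr_ge0 ?addr_ge0 ?sqr_ge0. Qed.

Lemma poissonN z : poisson (- z) = poisson z.
Proof. by apply: eq_bigr => i _; rewrite mxE sqrrN. Qed.

Lemma measurable_poisson : measurable_fun setT (fun t => poisson (rw t)).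
Proof.
have mp : measurable_fun setT (fun x : R => 2 / (1 + x ^+ 2)).
  apply: continuous_measurable_fun => x; apply: cvgM; first exact: cvg_cst.
  apply: cvgV; first by rewrite gt_eqF // ltr_pwDl ?sqr_ge0.
  by apply: cvgD; [exact: cvg_cst|exact: exprn_continuous].
by apply: measurable_prod => i _; apply: (measurableT_comp mp); exact: measurable_row_coord.
Qed.

Lemma integrable_poisson : L.-integrable setT (fun t => (poisson (rw t))%:E).
Proof.
apply: (le_integrable measurableT _ _
   (integrableZl measurableT (4 ^+ n) (integrable_wprod n ltr01))).
  by apply/measurable_EFinP; exact: measurable_poisson.
move=> t _; rewrite lee_fin !ger0_norm ?poisson_ge0 ?mulr_ge0 ?exprn_ge0 ?wprod_ge0 //.
rewrite -[n in 4 ^+ n]card_ord -prodr_const -big_split /=.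
apply: ler_prod => i _; rewrite divr_ge0 ?addr_ge0 ?sqr_ge0 //=.
set s := rw t 0 i; rewrite /wline (_ : - (1 + 1) = - 2%:R :> R) //.
have s1 : 0 < 1 + `|s| by rewrite ltr_pwDl.
have s2 : 0 < 1 + s ^+ 2 by rewrite ltr_pwDl ?sqr_ge0.
rewrite powRN powR_mulrn ?(ltW s1) // ler_pdivrMr // mulrAC ler_pdivlMr ?exprn_gt0 //.
have := sqr_ge0 (1 - `|s|); rewrite -[s ^+ 2]real_normK ?num_real //.
by nra.
Qed.

Lemma cint_poisson (s : R) (z : 'rV[R]_n) : 0 < s ->
  cint L (fun t => (expNabs (s *: rw t))%:C * fker (rw t) z) =
  ((s ^+ n)^-1 * poisson ((s * h)^-1 *: z))%:C.
Proof.
move=> s0; pose w := - ((s * h)^-1 *: z).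
pose H (x : 'rV[R]_n) : R[i] := (expNabs x)%:C * cexpi (dotv w x).
have HE x : (expNabs (s *: x))%:C * fker x z = H (s *: x + 0).
  rewrite addr0 /H /fker; congr (_ * cexpi _).
  rewrite [RHS]dotvC dotvZl [dotv x w]dotvC dotvNl dotvZl [dotv z x]dotvC.
  by field; rewrite !gt_eqF.
have mH : cmeas (fun t => H (rw t)).
  apply: cmeasM; first exact: (cmeas_real (@measurable_expNabs_tuple R n)).
  apply: cmeas_cexpi; apply: measurable_sum => i; apply: measurable_funM; first exact: measurable_cst.
  exact: measurable_row_coord.
have [I1 I2] : cintegrable L (fun t => H (rw t)).
  apply: (cintegrable_le mH (@integrable_expNabs_tuple R n)) => t.
  by rewrite Normc.normcM normc_cexpi mulr1 normc_real ger0_norm ?expNabs_ge0.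
have sn : s != 0 by rewrite gt_eqF.
have [_ E1] := Rint_affine (F := fun x => complex.Re (H x)) 0 sn I1.
have [_ E2] := Rint_affine (F := fun x => complex.Im (H x)) 0 sn I2.
have E : cint L (fun t => H (rw t)) = (s ^+ n)%:C * cint L (fun t => H (s *: rw t + 0)).
  apply: ReIm_eq; rewrite ?ReM ?ImM /cint /= ?E1 ?E2 (ger0_norm (ltW s0)).
    by rewrite mul0r subr0.
  by rewrite mul0r addr0.
have -> : cint L (fun t => (expNabs (s *: rw t))%:C * fker (rw t) z) =
    cint L (fun t => H (s *: rw t + 0)) by apply: eq_cint => t; exact: HE.
have := @cint_expNabs_tuple R n w; rewrite -[X in X = _ -> _]/(cint L (fun t => H (rw t))) E.
have -> : \prod_(i < n) (2 / (1 + w 0 i ^+ 2)) = poisson ((s * h)^-1 *: z).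
  by rewrite -poissonN.
move=> E3; rewrite realcM -E3 mulrA -realcM mulVf ?mul1r //.
by rewrite expf_neq0.
Qed.

Definition sqnorm f : \bar R := (\int[L]_t (normc (f (rw t)) ^+ 2)%:E)%E.

Lemma measurable_sqnorm f : cmeas (f \o rw) ->
  measurable_fun setT (fun t => (normc (f (rw t)) ^+ 2)%:E).
Proof.
by move=> mf; apply/measurable_EFinP; apply: measurable_funX; exact: measurable_normc mf.
Qed.

(** The Fourier transform of the damping factor at scale s: an approximate identity as s tends to 0,
    except that its mass is [h ^+ n * kappa] instead of 1. *)
Definition Qker (s : R) (z : 'rV[R]_n) : R := (s ^+ n)^-1 * poisson ((s * h)^-1 *: z).

Lemma Qker_ge0 s z : 0 <= s -> 0 <= Qker s z.
Proof. by move=> s0; rewrite mulr_ge0 ?invr_ge0 ?exprn_ge0 ?poisson_ge0. Qed.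

Lemma cmeas_weighted d (U : measurableType d) (s : R) (phi : U -> n.-tuple TR) :
  measurable_fun setT phi -> cmeas (fun u => (expNabs (s *: rw (phi u)))%:C).
Proof.
by move=> mp; apply: cmeas_real; exact: (measurableT_comp (measurable_expNabs_scale s) mp).
Qed.

Lemma weighted_inner f s (z : 'rV[R]_n) : 0 < s -> cintegrable L (f \o rw) ->
  cint L (fun t => (expNabs (s *: rw t))%:C * fker (rw t) z * (fourier f (rw t))^*%C) =
  cint L (fun t => (f (rw t))^*%C * (Qker s (z - rw t))%:C).
Proof.
move=> s0 iF; have sn : s != 0 by rewrite gt_eqF.
have mf := cintegrable_cmeas iF.
pose G (p : n.-tuple TR * n.-tuple TR) : R[i] :=
  (f (rw p.2))^*%C * ((expNabs (s *: rw p.1))%:C * fker (rw p.1) (z - rw p.2)).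
have mG : cmeas G.
  apply: cmeasM; first exact: (cmeasJ (cmeas_comp mf measurable_snd)).
  apply: cmeasM; first exact: cmeas_weighted.
  apply: cmeas_cexpi; apply: measurable_funN; apply: measurable_funM; last exact: measurable_cst.
  apply: measurable_sum => i; apply: measurable_funM.
    exact: (measurableT_comp (measurable_row_coord i) measurable_fst).
  rewrite (_ : (fun _ => _) = (fun x : n.-tuple TR * n.-tuple TR => z 0 i - rw x.2 0 i)).
    apply: measurable_funB; first exact: measurable_cst.
    exact: (measurableT_comp (measurable_row_coord i) measurable_snd).
  by apply/funext => x; rewrite !mxE.
have leG p : normc (G p) <= expNabs (s *: rw p.1) * normc (f (rw p.2)).
  rewrite /G !Normc.normcM normc_fker mulr1 normc_conj normc_real.
  by rewrite ger0_norm ?expNabs_ge0 // mulrC.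
have ie := integrable_expNabs_scale sn.
transitivity (cint L (fun x => cint L (fun y => G (x, y)))).
  apply: eq_cint => x; rewrite -cintJ; last exact: cintegrable_fker.
  rewrite -cintZl; last first.
    apply: (cintegrable_le _ (integrable_normc iF)).
      apply: cmeasJ; exact: cintegrable_cmeas (cintegrable_fker (rw x) iF).
    by move=> t; rewrite normc_conj Normc.normcM normc_fker mul1r.
  apply: eq_cint => y; rewrite /G /= conjcM.
  have -> : fker (rw x) (z - rw y) = fker (rw x) z * (fker (rw x) (rw y))^*%C.
    rewrite /fker cexpiJ -cexpiD; congr cexpi.
    by rewrite opprK [in LHS]dotvC dotvBl mulrBl opprB addrC ![dotv (rw x) _]dotvC.
  ring.
rewrite (cint_fubini mG ie (integrable_normc iF) leG).
apply: eq_cint => y; rewrite /Qker -cint_poisson // -cintZl //.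
apply: (cintegrable_le _ ie).
  apply: cmeasM; first exact: cmeas_weighted.
  apply: cmeas_cexpi; apply: measurable_funN; apply: measurable_funM; last exact: measurable_cst.
  apply: measurable_sum => i; apply: measurable_funM; last exact: measurable_cst.
  exact: measurable_row_coord.
by move=> t; rewrite Normc.normcM normc_fker mulr1 normc_real ger0_norm ?expNabs_ge0.
Qed.

(** Both copies of [fourier f] are opened and the frequency is integrated first, which leaves the
    quadratic form of the kernel [Qker s]. The damping makes the integrand absolutely integrable, so
    that Fubini's theorem applies. *)
Lemma weighted_plancherel f s : 0 < s -> cintegrable L (f \o rw) ->
  cint L (fun t => (expNabs (s *: rw t) * normc (fourier f (rw t)) ^+ 2)%:C) =
  cint L (fun t => f (rw t) *
     cint L (fun u => (f (rw u))^*%C * (Qker s (rw t - rw u))%:C)).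
Proof.
move=> s0 iF; have sn : s != 0 by rewrite gt_eqF.
have mf := cintegrable_cmeas iF; have mFf := cmeas_fourier iF.
pose G (p : n.-tuple TR * n.-tuple TR) : R[i] :=
  f (rw p.2) * ((expNabs (s *: rw p.1))%:C * fker (rw p.1) (rw p.2) * (fourier f (rw p.1))^*%C).
pose M := \int[L]_t normc (f (rw t)).
have mG : cmeas G.
  apply: cmeasM; first exact: (cmeas_comp mf measurable_snd).
  apply: cmeasM; last exact: (cmeasJ (cmeas_comp mFf measurable_fst)).
  by apply: cmeasM; [exact: cmeas_weighted|exact: cmeas_fker].
have leG p : normc (G p) <= (M * expNabs (s *: rw p.1)) * normc (f (rw p.2)).
  rewrite /G !Normc.normcM normc_fker mulr1 normc_conj normc_real.
  rewrite ger0_norm ?expNabs_ge0 // mulrC ler_wpM2r ?normc_ge0 //.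
  by rewrite mulrC ler_wpM2r ?expNabs_ge0 // normc_fourier_le.
have ie := integrableZl measurableT M (integrable_expNabs_scale sn).
transitivity (cint L (fun x => cint L (fun y => G (x, y)))).
  apply: eq_cint => x; rewrite realcM -mulcJ.
  rewrite [LHS](_ : _ = (expNabs (s *: rw x))%:C * (fourier f (rw x))^*%C * fourier f (rw x)).
    rewrite -cintZl; last exact: cintegrable_fker.
    by apply: eq_cint => y; rewrite /G /=; ring.
  by ring.
rewrite (cint_fubini mG ie (integrable_normc iF) leG).
apply: eq_cint => y; rewrite -weighted_inner // -cintZl //.
apply: (cintegrable_le _ ie) => [|t].
  apply: cmeasM; last exact: cmeasJ.
  apply: cmeasM; first exact: cmeas_weighted.
  apply: cmeas_cexpi; apply: measurable_funN; apply: measurable_funM; last exact: measurable_cst.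
  apply: measurable_sum => i; apply: measurable_funM; last exact: measurable_cst.
  exact: measurable_row_coord.
rewrite !Normc.normcM normc_fker mulr1 normc_conj normc_real ger0_norm ?expNabs_ge0 //.
by rewrite mulrC ler_wpM2r ?expNabs_ge0 // normc_fourier_le.
Qed.

Lemma cmeas_translate (w : 'rV[R]_n) (l : R) f : cmeas (f \o rw) ->
  cmeas (fun t => f (l *: rw t + w)).
Proof.
move=> [F1 F2]; split.
  exact: (measurable_row_affine (F := fun x => complex.Re (f x))).
exact: (measurable_row_affine (F := fun x => complex.Im (f x))).
Qed.

Lemma measurable_Qker s (w : 'rV[R]_n) : measurable_fun setT (fun t => Qker s (w - rw t)).
Proof.
apply: measurable_funM; first exact: measurable_cst.
have := measurable_row_affine (F := poisson) (- (s * h)^-1) ((s * h)^-1 *: w) measurable_poisson.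
by congr measurable_fun; apply/funext => t; rewrite scalerBr scaleNr addrC.
Qed.

Definition kappa : R := \int[L]_t poisson (rw t).

Lemma kappa_ge0 : 0 <= kappa.
Proof. by apply: Rintegral_ge0 => t _; exact: poisson_ge0. Qed.

Lemma integral_Qker s (w : 'rV[R]_n) : 0 < s ->
  (\int[L]_t (Qker s (w - rw t))%:E = (h ^+ n * kappa)%:E)%E.
Proof.
move=> s0; have sh : 0 < s * h by rewrite mulr_gt0.
have l0 : - (s * h)^-1 != 0 by rewrite oppr_eq0 invr_eq0 gt_eqF.
have := integral_row_affine (F := fun x => (poisson x)%:E) ((s * h)^-1 *: w) l0.
move=> /(_ _ _)/[dup] _ E.
have {}E := E (proj2 (measurable_EFinP _ _) measurable_poisson)
  (fun x => (_ : 0%:E <= (poisson x)%:E)%E).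
have {}E : (\int[L]_t (poisson (rw t))%:E = (`|- (s * h)^-1| ^+ n)%:E *
   \int[L]_t (poisson ((s * h)^-1 *: (w - rw t)))%:E)%E.
  rewrite E; last by move=> x; rewrite lee_fin poisson_ge0.
  congr (_ * _)%E; apply: eq_integral => t _.
  by rewrite scalerBr scaleNr addrC.
under eq_integral do rewrite /Qker EFinM.
have mp : measurable_fun setT (fun t => (poisson ((s * h)^-1 *: (w - rw t)))%:E).
  apply/measurable_EFinP.
  have := measurable_row_affine (F := poisson) (- (s * h)^-1) ((s * h)^-1 *: w) measurable_poisson.
  by congr measurable_fun; apply/funext => t; rewrite scalerBr scaleNr addrC.
rewrite ge0_integralZl //; last 2 first.
- by move=> t _; rewrite lee_fin poisson_ge0.
- by rewrite lee_fin invr_ge0 exprn_ge0 // ltW.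
have -> : (h ^+ n * kappa)%:E = ((s ^+ n)^-1%:E * (((s * h) ^+ n)%:E *
    \int[L]_t (poisson (rw t))%:E))%E.
  rewrite /kappa /Rintegral -[X in (_ * (_ * X))%E]fineK; last first.
    exact: (integrable_fin_num _ integrable_poisson).
  rewrite -!EFinM; congr EFin; rewrite mulrA exprMn mulKf //.
  by rewrite expf_neq0 // gt_eqF.
rewrite E; congr (_ * _)%E; rewrite muleA -EFinM normrN normfV gtr0_norm //.
by rewrite -exprMn mulfV ?expr1n ?mul1e // gt_eqF.
Qed.

Lemma sqnorm_fin f (M : R) : cintegrable L (f \o rw) -> (forall x, normc (f x) <= M) ->
  L.-integrable setT (fun t => (normc (f (rw t)) ^+ 2)%:E).
Proof.
move=> iF leM; have M0 : 0 <= M by apply: le_trans (leM 0); exact: normc_ge0.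
apply: (le_integrable measurableT _ _ (integrableZl measurableT M (integrable_normc iF))).
  exact: measurable_sqnorm (cintegrable_cmeas iF).
move=> t _; rewrite lee_fin !ger0_norm ?mulr_ge0 ?normc_ge0 ?exprn_ge0 //.
by rewrite expr2 ler_wpM2r ?normc_ge0 //; exact: leM.
Qed.

(* Schur's test for the symmetric kernel [Qker s (x - y)]: 2ab <= a^2 + b^2. *)
Lemma weighted_plancherel_le f (M : R) s : 0 < s -> cintegrable L (f \o rw) ->
  (forall x, normc (f x) <= M) ->
  (\int[L]_t (expNabs (s *: rw t) * normc (fourier f (rw t)) ^+ 2)%:E <=
    (h ^+ n * kappa)%:E * sqnorm f)%E.
Proof.
move=> s0 iF leM; have mf := cintegrable_cmeas iF.
have K0 : 0 <= h ^+ n * kappa by rewrite mulr_ge0 ?kappa_ge0 // exprn_ge0 // ltW.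
have i2 := sqnorm_fin iF leM.
set a := fun t : n.-tuple TR => normc (f (rw t)).
have a0 t : 0 <= a t by exact: normc_ge0.
have ma : measurable_fun setT a by exact: measurable_normc mf.
pose P (p : n.-tuple TR * n.-tuple TR) : R := Qker s (rw p.1 - rw p.2).
have P0 p : 0 <= P p by rewrite Qker_ge0 // ltW.
have mP : measurable_fun setT P.
  apply: measurable_funM; first exact: measurable_cst.
  apply: measurable_prod => i _; apply: measurable_funM; first exact: measurable_cst.
  have mp : measurable_fun setT (fun x : R => (1 + x ^+ 2)^-1).
    apply: continuous_measurable_fun => x.
    apply: cvgV; first by rewrite gt_eqF // ltr_pwDl ?sqr_ge0.
    by apply: cvgD; [exact: cvg_cst|exact: exprn_continuous].
  apply: (measurableT_comp mp).
  rewrite (_ : (fun _ => _) = (fun x : n.-tuple TR * n.-tuple TR =>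
     (s * h)^-1 * (rw x.1 0 i - rw x.2 0 i))); last first.
    by apply/funext => x; rewrite !mxE.
  apply: measurable_funM; first exact: measurable_cst.
  apply: measurable_funB.
    exact: (measurableT_comp (measurable_row_coord i) measurable_fst).
  exact: (measurableT_comp (measurable_row_coord i) measurable_snd).
have iW : L.-integrable setT (fun t => (expNabs (s *: rw t) * normc (fourier f (rw t)) ^+ 2)%:E).
  have sn : s != 0 by rewrite gt_eqF.
  set N := \int[L]_t normc (f (rw t)).
  have N0 : 0 <= N by apply: Rintegral_ge0 => u _; exact: normc_ge0.
  apply: (le_integrable measurableT _ _
     (integrableZl measurableT (N ^+ 2) (integrable_expNabs_scale sn))).
    apply/measurable_EFinP; apply: measurable_funM; first exact: measurable_expNabs_scale.
    by apply: measurable_funX; exact: measurable_normc (cmeas_fourier iF).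
  move=> t _; rewrite lee_fin !ger0_norm ?mulr_ge0 ?expNabs_ge0 ?exprn_ge0 ?normc_ge0 //.
  rewrite mulrC ler_wpM2r ?expNabs_ge0 // ler_pXn2r ?nnegrE ?normc_ge0 ?normc_fourier_le //.
pose J t := cint L (fun u => (f (rw u))^*%C * (Qker s (rw t - rw u))%:C).
have mG : cmeas (fun p : n.-tuple TR * n.-tuple TR => (f (rw p.2))^*%C * (P p)%:C).
  apply: cmeasM; last exact: cmeas_real.
  exact: (cmeasJ (cmeas_comp mf measurable_snd)).
(* This bound blows up as s tends to 0 and serves integrability at fixed s only; the final estimate
   uses the mass of the kernel, which does not depend on s. *)
have QM z : Qker s z <= (s ^+ n)^-1 * 2 ^+ n.
  rewrite ler_wpM2l ?invr_ge0 ?exprn_ge0 ?(ltW s0) //.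
  rewrite -[n in 2 ^+ n]card_ord -prodr_const; apply: ler_prod => i _.
  rewrite divr_ge0 ?addr_ge0 ?sqr_ge0 //= ler_pdivrMr ?ltr_pwDl ?sqr_ge0 //.
  by rewrite ler_peMr // lerDl sqr_ge0.
have iG t : cintegrable L (fun u => (f (rw u))^*%C * (P (t, u))%:C).
  apply: (cintegrable_le _ (integrableZl measurableT ((s ^+ n)^-1 * 2 ^+ n) (integrable_normc iF))).
    by have [G1 G2] := mG; split; [exact: (measurableT_comp G1 (measurable_pair1 t))|
       exact: (measurableT_comp G2 (measurable_pair1 t))].
  move=> u; rewrite Normc.normcM normc_conj normc_real ger0_norm // mulrC.
  by rewrite ler_wpM2r ?normc_ge0 //; exact: QM.
have mJ : cmeas J by exact: (cmeas_cint_param mG iG).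
have leJ t : ((normc (J t))%:E <= \int[L]_u (a u * P (t, u))%:E)%E.
  apply: (@le_trans _ _ (\int[L]_u normc ((f (rw u))^*%C * (P (t, u))%:C))%:E).
    by rewrite lee_fin; exact: (normc_cint_le (iG t)).
  rewrite /Rintegral fineK; last exact: (integrable_fin_num _ (integrable_normc (iG t))).
  apply: ge0_le_integral => //.
  - by move=> u _; rewrite lee_fin normc_ge0.
  - by apply/measurable_EFinP/measurable_normc; case: (iG t) => ? ?; exact: cintegrable_cmeas (iG t).
  - apply/measurable_EFinP; apply: measurable_funM => //.
    exact: (measurableT_comp mP (measurable_pair1 t)).
  - by move=> u _; rewrite lee_fin Normc.normcM normc_conj normc_real ger0_norm.
have E := weighted_plancherel s0 iF.
have E' : (\int[L]_t (expNabs (s *: rw t) * normc (fourier f (rw t)) ^+ 2)%:E =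
    (complex.Re (cint L (fun t => f (rw t) * J t)))%:E)%E.
  rewrite -E /cint /= /Rintegral fineK //; exact: (integrable_fin_num _ iW).
have JM t : normc (J t) <= (s ^+ n)^-1 * 2 ^+ n * \int[L]_u a u.
  apply: le_trans (normc_cint_le (iG t)) _.
  rewrite -RintegralZl //; last exact: integrable_normc.
  apply: le_Rintegral => //; first exact: (integrable_normc (iG t)).
    exact: (integrableZl measurableT _ (integrable_normc iF)).
  move=> u _; rewrite Normc.normcM normc_conj normc_real ger0_norm // mulrC.
  by rewrite ler_wpM2r ?normc_ge0 //; exact: QM.
have iFJ : cintegrable L (fun t => f (rw t) * J t).
  apply: (cintegrable_le _ (integrableZl measurableT ((s ^+ n)^-1 * 2 ^+ n * \int[L]_u a u) (integrable_normc iF))).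
    exact: cmeasM.
  by move=> t; rewrite Normc.normcM mulrC ler_wpM2r ?normc_ge0.
have R0 p : (0 <= (a p.1 * a p.2 * P p)%:E)%E.
  by rewrite lee_fin; exact: mulr_ge0 (mulr_ge0 (a0 _) (a0 _)) (P0 _).
have R1 p : (0 <= (a p.1 ^+ 2 * P p)%:E)%E.
  by rewrite lee_fin; exact: mulr_ge0 (sqr_ge0 _) (P0 _).
have R2 p : (0 <= (a p.2 ^+ 2 * P p)%:E)%E.
  by rewrite lee_fin; exact: mulr_ge0 (sqr_ge0 _) (P0 _).
have mR : measurable_fun setT (fun p : n.-tuple TR * n.-tuple TR => (a p.1 * a p.2 * P p)%:E).
  apply/measurable_EFinP; apply: measurable_funM => //; apply: measurable_funM.
    exact: (measurableT_comp ma measurable_fst).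
  exact: (measurableT_comp ma measurable_snd).
have m1 : measurable_fun setT (fun p : n.-tuple TR * n.-tuple TR => (a p.1 ^+ 2 * P p)%:E).
  apply/measurable_EFinP; apply: measurable_funM => //; apply: measurable_funX.
  exact: (measurableT_comp ma measurable_fst).
have m2 : measurable_fun setT (fun p : n.-tuple TR * n.-tuple TR => (a p.2 ^+ 2 * P p)%:E).
  apply/measurable_EFinP; apply: measurable_funM => //; apply: measurable_funX.
  exact: (measurableT_comp ma measurable_snd).
apply: (@le_trans _ _ (\int[L]_t \int[L]_u (a t * a u * P (t, u))%:E)%E).
  rewrite E'; apply: (@le_trans _ _ (\int[L]_t normc (f (rw t) * J t))%:E).
    rewrite lee_fin; apply: le_trans (ler_norm _) (le_trans (Re_le_normc _) _).
    exact: (normc_cint_le iFJ).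
  rewrite /Rintegral fineK; last exact: (integrable_fin_num _ (integrable_normc iFJ)).
  apply: ge0_le_integral => //.
  - by move=> u _; rewrite lee_fin normc_ge0.
  - by apply/measurable_EFinP/measurable_normc; exact: cintegrable_cmeas iFJ.
  - exact: (measurable_fun_fubini_tonelli_F (m2 := L) (fun p => (a p.1 * a p.2 * P p)%:E) mR R0).
  - move=> t _; rewrite Normc.normcM EFinM.
    have -> : (\int[L]_u (a t * a u * P (t, u))%:E = (a t)%:E * \int[L]_u (a u * P (t, u))%:E)%E.
      rewrite -ge0_integralZl //; last 3 first.
      - apply/measurable_EFinP; apply: measurable_funM => //.
        exact: (measurableT_comp mP (measurable_pair1 t)).
      - by move=> u _; rewrite lee_fin; exact: mulr_ge0 (a0 _) (P0 _).
      - by rewrite lee_fin.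
      apply: eq_integral => u _.
      exact: (congr1 EFin (esym (mulrA (a t) (a u) (P (t, u))))).
    apply: lee_wpmul2l; [exact: (a0 t : (0 <= (a t)%:E)%E)|exact: (leJ t)].
have S1 : (\int[L]_t \int[L]_u (a t ^+ 2 * P (t, u))%:E = (h ^+ n * kappa)%:E * sqnorm f)%E.
  rewrite -ge0_integralZl //; last 2 first.
  - by apply/measurable_EFinP; exact: measurable_funX.
  - by move=> t _; rewrite lee_fin sqr_ge0.
  apply: eq_integral => t _; rewrite muleC -(integral_Qker (rw t) s0).
  have mQ : measurable_fun setT (fun u => (Qker s (rw t - rw u))%:E).
    by apply/measurable_EFinP; exact: measurable_Qker.
  have Q0 u : setT u -> (0 <= (Qker s (rw t - rw u))%:E)%E.
    by move=> _; rewrite lee_fin; exact: (P0 (t, u)).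
  have b0 : (0 <= a t ^+ 2)%R by exact: sqr_ge0.
  by rewrite -[RHS](ge0_integralZl_EFin _ measurableT Q0 mQ b0).
have S2 : (\int[L]_t \int[L]_u (a u ^+ 2 * P (t, u))%:E = (h ^+ n * kappa)%:E * sqnorm f)%E.
  transitivity (\int[L]_u \int[L]_t (a u ^+ 2 * P (t, u))%:E)%E.
    exact: (fubini_tonelli (m1 := L) (m2 := L) (fun p => (a p.2 ^+ 2 * P p)%:E) m2 R2).
  have Psym t u : P (t, u) = P (u, t) by rewrite /P /Qker /= -poissonN -scalerN opprB.
  rewrite -S1; apply: eq_integral => u _; apply: eq_integral => t _.
  by rewrite Psym.
apply: (@le_trans _ _ (\int[L]_t \int[L]_u ((2^-1)%:E * ((a t ^+ 2 * P (t, u))%:E + (a u ^+ 2 * P (t, u))%:E)))%E).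
  apply: ge0_le_integral => //.
  - by move=> t _; apply: integral_ge0 => u _; exact: (R0 (t, u)).
  - exact: (measurable_fun_fubini_tonelli_F (m2 := L) (fun p => (a p.1 * a p.2 * P p)%:E) mR R0).
  - apply: (measurable_fun_fubini_tonelli_F (m2 := L)
      (fun p => (2^-1)%:E * ((a p.1 ^+ 2 * P p)%:E + (a p.2 ^+ 2 * P p)%:E))%E).
      by apply: measurable_funeM; exact: emeasurable_funD.
    by move=> p; apply: mule_ge0; [rewrite lee_fin invr_ge0|exact: adde_ge0].
  - move=> t _; apply: ge0_le_integral => //.
    + by move=> u _; exact: (R0 (t, u)).
    + exact: (measurableT_comp mR (measurable_pair1 t)).
    + apply: measurable_funeM; apply: emeasurable_funD.
        exact: (measurableT_comp m1 (measurable_pair1 t)).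
      exact: (measurableT_comp m2 (measurable_pair1 t)).
    + move=> u _; rewrite -EFinD -EFinM lee_fin -mulrDl mulrA ler_wpM2r //.
      by have := sqr_ge0 (a t - a u); rewrite sqrrB; lra.
have T1 t : (\int[L]_u ((2^-1)%:E * ((a t ^+ 2 * P (t, u))%:E + (a u ^+ 2 * P (t, u))%:E)) =
   (2^-1)%:E * (\int[L]_u (a t ^+ 2 * P (t, u))%:E + \int[L]_u (a u ^+ 2 * P (t, u))%:E))%E.
  rewrite ge0_integralZl //; last 2 first.
  - apply: emeasurable_funD.
      exact: (measurableT_comp m1 (measurable_pair1 t)).
    exact: (measurableT_comp m2 (measurable_pair1 t)).
  - by move=> u _; exact: adde_ge0 (R1 (t, u)) (R2 (t, u)).
  congr (_ * _)%E; rewrite ge0_integralD //.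
  - by move=> u _; exact: (R1 (t, u)).
  - exact: (measurableT_comp m1 (measurable_pair1 t)).
  - by move=> u _; exact: (R2 (t, u)).
  - exact: (measurableT_comp m2 (measurable_pair1 t)).
under eq_integral do rewrite T1.
have N1 : measurable_fun setT (fun t => \int[L]_u (a t ^+ 2 * P (t, u))%:E)%E.
  exact: (measurable_fun_fubini_tonelli_F (m2 := L) _ m1 R1).
have N2 : measurable_fun setT (fun t => \int[L]_u (a u ^+ 2 * P (t, u))%:E)%E.
  exact: (measurable_fun_fubini_tonelli_F (m2 := L) _ m2 R2).
have G1 t : (0 <= \int[L]_u (a t ^+ 2 * P (t, u))%:E)%E.
  by apply: integral_ge0 => u _; exact: (R1 (t, u)).
have G2 t : (0 <= \int[L]_u (a u ^+ 2 * P (t, u))%:E)%E.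
  by apply: integral_ge0 => u _; exact: (R2 (t, u)).
rewrite ge0_integralZl //; last 2 first.
- exact: emeasurable_funD.
- by move=> t _; exact: adde_ge0.
rewrite ge0_integralD // S1 S2.
have X0 : ((h ^+ n * kappa)%:E * sqnorm f)%E \is a fin_num.
  by rewrite fin_numM // /sqnorm; exact: (integrable_fin_num _ i2).
rewrite -(fineK X0) -EFinD -EFinM lee_fin.
by lra.
Qed.

Definition sseq (k : nat) : R := k.+1%:R^-1.

Lemma sseq_gt0 k : 0 < sseq k.
Proof. by rewrite invr_gt0 ltr0n. Qed.

Lemma sseq_cvg0 : sseq k @[k --> \oo] --> (0 : R).
Proof. exact: cvg_harmonic. Qed.

Lemma expNabs_mono (s r : R) x : 0 <= r -> r <= s -> expNabs (s *: x) <= expNabs (r *: x).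
Proof.
move=> r0 rs; apply: ler_prod => i _; rewrite expR_ge0 /= ler_expR lerN2 !mxE !normrM.
by rewrite ler_wpM2r // !ger0_norm // (le_trans r0).
Qed.

Lemma expNabs_cvg1 x : expNabs (sseq k *: x) @[k --> \oo] --> (1 : R).
Proof.
have E k : expNabs (sseq k *: x) = expR (- (sseq k * \sum_(i < n) `|x 0 i|)).
  rewrite mulr_sumr -sumrN expR_sum; apply: eq_bigr => i _.
  by rewrite mxE normrM ger0_norm // ltW // sseq_gt0.
rewrite (_ : (fun _ => _) = (fun k => expR (- (sseq k * \sum_(i < n) `|x 0 i|)))); last exact/funext.
rewrite -[X in _ --> X]expR0; apply: (continuous_cvg _ (@continuous_expR R 0)).
rewrite -[X in _ --> X]oppr0; apply: cvgN.
rewrite -[X in _ --> X](mul0r (\sum_(i < n) `|x 0 i|)); apply: cvgMl; exact: sseq_cvg0.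
Qed.

(** The damping increases to 1 as s decreases to 0, so monotone convergence gives this half of
    Plancherel's identity. It covers discontinuous functions, in particular those cut off by an
    orthant. *)
Lemma sqnorm_fourier_le f (M : R) : cintegrable L (f \o rw) -> (forall x, normc (f x) <= M) ->
  (sqnorm (fourier f) <= (h ^+ n * kappa)%:E * sqnorm f)%E.
Proof.
move=> iF leM; have mFf := cmeas_fourier iF.
pose g k (t : n.-tuple TR) := ((expNabs (sseq k *: rw t) * normc (fourier f (rw t)) ^+ 2)%:E)%E.
have mg k : measurable_fun setT (g k).
  apply/measurable_EFinP; apply: measurable_funM; first exact: measurable_expNabs_scale.
  by apply: measurable_funX; exact: measurable_normc mFf.
have g0 k t : setT t -> (0 <= g k t)%E.
  by move=> _; rewrite lee_fin mulr_ge0 ?expNabs_ge0 // sqr_ge0.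
have gm t : setT t -> {homo g^~ t : k m / (k <= m)%N >-> (k <= m)%E}.
  move=> _ k m km; rewrite lee_fin ler_wpM2r ?sqr_ge0 // expNabs_mono ?(ltW (sseq_gt0 _)) //.
  by rewrite lef_pV2 ?posrE ?ltr0n // ler_nat.
have H := cvg_monotone_convergence (mu := L) measurableT mg g0 gm.
have E : (\int[L]_t limn (g^~ t) = sqnorm (fourier f))%E.
  apply: eq_integral => t _; apply/cvg_lim => //.
  apply: cvg_EFin; first exact: nearW.
  rewrite -[X in _ --> X]mul1r; apply: cvgMl; exact: expNabs_cvg1.
rewrite -E -(cvg_lim _ H) //; apply: lime_le; first by apply/cvg_ex; eexists; exact: H.
by apply: nearW => k; exact: (weighted_plancherel_le (sseq_gt0 k) iF leM).
Qed.

(** Rescaling moves s from the kernel into the argument of [g]; the limit s -> 0 can then be taken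
    under the fixed majorant [M * poisson]. *)
Lemma smoothed_kernel g (M s : R) (x : 'rV[R]_n) : 0 < s -> cintegrable L (g \o rw) ->
  (forall x, normc (g x) <= M) ->
  cint L (fun u => (g (rw u))^*%C * (Qker s (x - rw u))%:C) =
  (h ^+ n)%:C * cint L (fun u => (g (- (s * h) *: rw u + x))^*%C * (poisson (rw u))%:C).
Proof.
move=> s0 iG leM; have sh : 0 < s * h by rewrite mulr_gt0.
have l0 : - (s * h) != 0 by rewrite oppr_eq0 gt_eqF.
pose H (y : 'rV[R]_n) : R[i] := (g y)^*%C * (Qker s (x - y))%:C.
have [I1 I2] : cintegrable L (fun u => H (rw u)).
  have QM z : Qker s z <= (s ^+ n)^-1 * 2 ^+ n.
    rewrite ler_wpM2l ?invr_ge0 ?exprn_ge0 ?(ltW s0) //.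
    rewrite -[n in 2 ^+ n]card_ord -prodr_const; apply: ler_prod => i _.
    rewrite divr_ge0 ?addr_ge0 ?sqr_ge0 //= ler_pdivrMr ?ltr_pwDl ?sqr_ge0 //.
    by rewrite ler_peMr // lerDl sqr_ge0.
  apply: (cintegrable_le _ (integrableZl measurableT ((s ^+ n)^-1 * 2 ^+ n) (integrable_normc iG))).
    apply: cmeasM; first exact: (cmeasJ (cintegrable_cmeas iG)).
    by apply: cmeas_real; exact: measurable_Qker.
  move=> u; rewrite Normc.normcM normc_conj normc_real ger0_norm; last by rewrite Qker_ge0 // ltW.
  by rewrite mulrC ler_wpM2r ?normc_ge0 //; exact: QM.
have [J1 E1] := Rint_affine (F := fun y => complex.Re (H y)) x l0 I1.
have [J2 E2] := Rint_affine (F := fun y => complex.Im (H y)) x l0 I2.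
have HE u : H (- (s * h) *: rw u + x) =
    ((s ^+ n)^-1)%:C * ((g (- (s * h) *: rw u + x))^*%C * (poisson (rw u))%:C).
  rewrite /H /Qker realcM.
  have -> : (s * h)^-1 *: (x - (- (s * h) *: rw u + x)) = rw u.
    apply/rowP => i; rewrite !mxE; field.
    by rewrite !gt_eqF.
  by ring.
have iK : cintegrable L (fun u => (g (- (s * h) *: rw u + x))^*%C * (poisson (rw u))%:C).
  apply: (cintegrable_le _ (integrableZl measurableT M integrable_poisson)).
    apply: cmeasM; last by apply: cmeas_real; exact: measurable_poisson.
    by apply: cmeasJ; apply: cmeas_translate; exact: cintegrable_cmeas iG.
  move=> u; rewrite Normc.normcM normc_conj normc_real ger0_norm ?poisson_ge0 //.
  by rewrite ler_wpM2r ?poisson_ge0.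
have E : cint L (fun u => H (rw u)) = ((s * h) ^+ n)%:C * cint L (fun u => H (- (s * h) *: rw u + x)).
  apply: ReIm_eq; rewrite ?ReM ?ImM /cint /= ?E1 ?E2 normrN (gtr0_norm sh).
    by rewrite mul0r subr0.
  by rewrite mul0r addr0.
rewrite -[LHS]/(cint L (fun u => H (rw u))) E (eq_cint _ HE) cintZl //.
rewrite mulrA -realcM; congr (_%:C * _).
by rewrite exprMn mulrAC mulfV ?mul1r // expf_neq0 // gt_eqF.
Qed.

(** Continuity of [g] along rays lets the approximate identity recover [g] pointwise. The damped
    quadratic forms then converge to [h ^+ n * kappa] times the squared norm, while each of them
    stays below [sqnorm (fourier g)]. *)
Lemma sqnorm_le_fourier g (M : R) : cintegrable L (g \o rw) -> (forall x, normc (g x) <= M) ->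
  (forall x y, complex.Re (g (x + sseq k *: y)) @[k --> \oo] --> complex.Re (g x)) ->
  (forall x y, complex.Im (g (x + sseq k *: y)) @[k --> \oo] --> complex.Im (g x)) ->
  ((h ^+ n * kappa)%:E * sqnorm g <= sqnorm (fourier g))%E.
Proof.
move=> iG leM cR cI; have mg := cintegrable_cmeas iG; have mFg := cmeas_fourier iG.
have M0 : 0 <= M by apply: le_trans (leM 0); exact: normc_ge0.
have h1 : 0 <= h ^+ n by rewrite exprn_ge0 // ltW.
have i2 := sqnorm_fin iG leM.
pose a k := \int[L]_t (expNabs (sseq k *: rw t) * normc (fourier g (rw t)) ^+ 2).
pose K k (x : 'rV[R]_n) := cint L (fun u => (g (- (sseq k * h) *: rw u + x))^*%C * (poisson (rw u))%:C).
have mgk k x : cmeas (fun u => (g (- (sseq k * h) *: rw u + x))^*%C * (poisson (rw u))%:C).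
  apply: cmeasM; last by apply: cmeas_real; exact: measurable_poisson.
  by apply: cmeasJ; apply: cmeas_translate.
have leK k x u : normc ((g (- (sseq k * h) *: rw u + x))^*%C * (poisson (rw u))%:C) <= M * poisson (rw u).
  rewrite Normc.normcM normc_conj normc_real ger0_norm ?poisson_ge0 //.
  by rewrite ler_wpM2r ?poisson_ge0.
have iMP := integrableZl measurableT M integrable_poisson.
have iK k x : cintegrable L (fun u => (g (- (sseq k * h) *: rw u + x))^*%C * (poisson (rw u))%:C).
  exact: (cintegrable_le (mgk k x) iMP (leK k x)).
have aE k : a k = complex.Re (cint L (fun t => g (rw t) * ((h ^+ n)%:C * K k (rw t)))).
  have <- : complex.Re (cint L (fun t => (expNabs (sseq k *: rw t) *
     normc (fourier g (rw t)) ^+ 2)%:C)) = a k by [].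
  rewrite (weighted_plancherel (sseq_gt0 k) iG); congr complex.Re.
  by apply: eq_cint => t; rewrite (smoothed_kernel _ (sseq_gt0 k) iG leM).
have KM k x : normc (K k x) <= M * kappa.
  apply: le_trans (normc_cint_le (iK k x)) _; rewrite /kappa -RintegralZl //; last exact: integrable_poisson.
  by apply: le_Rintegral => //; exact: (integrable_normc (iK k x)).
have step k x u : - (sseq k * h) *: u + x = x + sseq k *: (- h *: u) :> 'rV[R]_n.
  by rewrite addrC scalerA mulrN.
have KR x : complex.Re (K k x) @[k --> \oo] --> complex.Re (g x) * kappa.
  have [P1 P2] : measurable_fun setT (fun u => complex.Re (g x) * poisson (rw u)) /\ True.
    by split => //; apply: measurable_funM; [exact: measurable_cst|exact: measurable_poisson].
  rewrite /kappa -RintegralZl //; last exact: integrable_poisson.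
  apply: (cvg_Rintegral _ P1 _ iMP) => [k|t|k t].
  - by case: (mgk k x).
  - under eq_fun do rewrite ReM /= mulr0 subr0 step.
    rewrite (_ : (fun _ => _) = (fun k => complex.Re (g (x + sseq k *: (- h *: rw t))) * poisson (rw t))).
      by apply: cvgMl; exact: cR.
    by apply/funext => k; case: (g _).
  - by apply: le_trans (Re_le_normc _) _; exact: leK.
have KI x : complex.Im (K k x) @[k --> \oo] --> - complex.Im (g x) * kappa.
  have [P1 P2] : measurable_fun setT (fun u => - complex.Im (g x) * poisson (rw u)) /\ True.
    by split => //; apply: measurable_funM; [exact: measurable_cst|exact: measurable_poisson].
  rewrite /kappa -RintegralZl //; last exact: integrable_poisson.
  apply: (cvg_Rintegral _ P1 _ iMP) => [k|t|k t].
  - by case: (mgk k x).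
  - under eq_fun do rewrite ImM /= mulr0 add0r step.
    rewrite (_ : (fun _ => _) = (fun k => - complex.Im (g (x + sseq k *: (- h *: rw t))) * poisson (rw t))).
      by apply: cvgMl; apply: cvgN; exact: cI.
    by apply/funext => k; case: (g _).
  - by apply: le_trans (Im_le_normc _) _; exact: leK.
have mK k : cmeas (fun t => K k (rw t)).
  apply: (cmeas_cint_param (m2 := L)
    (G := fun p => (g (- (sseq k * h) *: rw p.2 + rw p.1))^*%C * (poisson (rw p.2))%:C)).
    apply: cmeasM; last by apply: cmeas_real; exact: (measurableT_comp measurable_poisson measurable_snd).
    apply: cmeasJ.
    rewrite (_ : (fun _ => _) = (fun p : n.-tuple TR * n.-tuple TR =>
      (g \o rw) [tuple (- (sseq k * h) * tnth p.2 i + tnth p.1 i)%R | i < n])); last first.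
      apply/funext => p /=; congr g; apply/rowP => i; rewrite !mxE tnth_mktuple //.
    apply: (cmeas_comp mg); apply/measurable_fun_tnthP => i.
    rewrite (_ : _ \o _ = (fun p : n.-tuple TR * n.-tuple TR =>
      (- (sseq k * h) * tnth p.2 i + tnth p.1 i)%R)); last first.
      by apply/funext => p /=; rewrite tnth_mktuple.
    apply: measurable_funD; last exact: (measurableT_comp (measurable_tnth i) measurable_fst).
    apply: measurable_funM; first exact: measurable_cst.
    exact: (measurableT_comp (measurable_tnth i) measurable_snd).
  by move=> t; exact: (iK k (rw t)).
have acvg : a k @[k --> \oo] --> (h ^+ n * kappa) * \int[L]_t (normc (g (rw t)) ^+ 2).
  rewrite -RintegralZl //.
  rewrite (_ : a = fun k => \int[L]_t complex.Re (g (rw t) * ((h ^+ n)%:C * K k (rw t)))); last first.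
    by apply/funext => k; rewrite aE.
  have iB := integrableZl measurableT (h ^+ n * (M * kappa)) (integrable_normc iG).
  apply: (cvg_Rintegral _ _ _ iB) => [k||t|k t].
  - have [H _] : cmeas (fun t => g (rw t) * ((h ^+ n)%:C * K k (rw t))).
      apply: cmeasM => //; apply: cmeasM => //; exact: cmeas_cst.
    exact: H.
  - apply: measurable_funM; first exact: measurable_cst.
    by apply: measurable_funX; exact: measurable_normc.
  - have -> : h ^+ n * kappa * normc (g (rw t)) ^+ 2 =
      complex.Re (g (rw t)) * (h ^+ n * (complex.Re (g (rw t)) * kappa)) -
      complex.Im (g (rw t)) * (h ^+ n * (- complex.Im (g (rw t)) * kappa)).
      by rewrite normcE2; ring.
    rewrite (_ : (fun _ => _) = (fun k =>
      complex.Re (g (rw t)) * (h ^+ n * complex.Re (K k (rw t))) -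
      complex.Im (g (rw t)) * (h ^+ n * complex.Im (K k (rw t))))); last first.
      by apply/funext => k; rewrite !ReM !ImM; case: (K k _) => c d /=; rewrite !mul0r subr0 addr0.
    by apply: cvgB; apply: cvgMr; apply: cvgMr.
  - apply: le_trans (Re_le_normc _) _; rewrite !Normc.normcM normc_real (ger0_norm h1) mulrC.
    by rewrite ler_wpM2r ?normc_ge0 // ler_wpM2l.
have iW k : L.-integrable setT (fun t => (expNabs (sseq k *: rw t) * normc (fourier g (rw t)) ^+ 2)%:E).
  have sn : sseq k != 0 by rewrite gt_eqF // sseq_gt0.
  set N := \int[L]_t normc (g (rw t)).
  have N0 : 0 <= N by apply: Rintegral_ge0 => u _; exact: normc_ge0.
  apply: (le_integrable measurableT _ _
     (integrableZl measurableT (N ^+ 2) (integrable_expNabs_scale sn))).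
    apply/measurable_EFinP; apply: measurable_funM; first exact: measurable_expNabs_scale.
    by apply: measurable_funX; exact: measurable_normc mFg.
  move=> t _; rewrite lee_fin !ger0_norm ?mulr_ge0 ?expNabs_ge0 ?exprn_ge0 ?normc_ge0 //.
  by rewrite mulrC ler_wpM2r ?expNabs_ge0 // ler_pXn2r ?nnegrE ?normc_ge0 ?normc_fourier_le.
have ale k : ((a k)%:E <= sqnorm (fourier g))%E.
  rewrite /a /Rintegral fineK; last exact: (integrable_fin_num _ (iW k)).
  apply: ge0_le_integral => //.
  - by move=> t _; rewrite lee_fin mulr_ge0 ?expNabs_ge0 ?sqr_ge0.
  - by have := iW k; exact: measurable_int.
  - exact: measurable_sqnorm mFg.
  - by move=> t _; rewrite lee_fin ler_piMl ?sqr_ge0 // expNabs_le1.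
have -> : sqnorm g = (\int[L]_t (normc (g (rw t)) ^+ 2))%:E.
  by rewrite /Rintegral fineK //; exact: (integrable_fin_num _ i2).
rewrite -EFinM.
have H : (a k)%:E @[k --> \oo] --> ((h ^+ n * kappa) * \int[L]_t (normc (g (rw t)) ^+ 2))%:E.
  by apply: cvg_EFin => //; exact: nearW.
rewrite -(cvg_lim _ H) //; apply: lime_le; first by apply/cvg_ex; eexists; exact: H.
exact: nearW.
Qed.

(* The constant [h ^+ n * kappa] of Plancherel's identity cancels out, so that
   its value is not needed. *)
Lemma sqnorm_fourier_restrict g (M : R) (chi : 'rV[R]_n -> R) :
  cintegrable L (g \o rw) -> (forall x, normc (g x) <= M) ->
  (forall x y, complex.Re (g (x + sseq k *: y)) @[k --> \oo] --> complex.Re (g x)) ->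
  (forall x y, complex.Im (g (x + sseq k *: y)) @[k --> \oo] --> complex.Im (g x)) ->
  measurable_fun setT (chi \o rw) -> (forall x, 0 <= chi x <= 1) ->
  (sqnorm (fourier (fun x => ((chi x)%:C * g x)%R)) <= sqnorm (fourier g))%E.
Proof.
move=> iG leM cR cI mchi chi01; have mg := cintegrable_cmeas iG.
have le1 x : normc ((chi x)%:C * g x) <= normc (g x).
  have /andP[c0 c1] := chi01 x.
  by rewrite Normc.normcM normc_real ger0_norm // ler_piMl ?normc_ge0.
have mf : cmeas ((fun x => ((chi x)%:C * g x)%R) \o rw).
  by apply: cmeasM => //; exact: (cmeas_real mchi).
have iF : cintegrable L ((fun x => ((chi x)%:C * g x)%R) \o rw).
  by apply: (cintegrable_le mf (integrable_normc iG)) => t; exact: le1.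
apply: le_trans (sqnorm_fourier_le iF (fun x => le_trans (le1 x) (leM x))) _.
apply: le_trans (sqnorm_le_fourier iG leM cR cI).
apply: lee_wpmul2l.
  by rewrite lee_fin mulr_ge0 ?kappa_ge0 // exprn_ge0 // ltW.
apply: ge0_le_integral => //.
- by move=> t _; rewrite lee_fin sqr_ge0.
- exact: measurable_sqnorm mf.
- exact: measurable_sqnorm mg.
- by move=> t _; rewrite lee_fin ler_pXn2r ?nnegrE ?normc_ge0 //; exact: le1.
Qed.

End fourier.

(** * Rapidly decreasing functions *)

Section derive_integral.
Context {R : realType} {E : normedModType R}.

Lemma is_derive_of_line (f : E -> R) x v (df : R) :
  is_derive (0 : R) (1 : R) (fun s : R => f (x + s *: v)) df -> is_derive x v f df.
Proof.
have E1 : (fun h : R => h^-1 *: (((fun s => f (x + s *: v)) \o shift 0) (h *: (1 : R)) - f (x + 0 *: v)))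
  = (fun h : R => h^-1 *: ((f \o shift x) (h *: v) - f x)).
  apply/funext => h /=; rewrite scale0r addr0; congr (_ *: (f _ - _)).
    by rewrite [h%:A]mulr1 addrC.
  by rewrite addr0.
by move=> [H1 H2]; split; [move: H1|move: H2]; rewrite /derivable /derive E1.
Qed.

Lemma derive_Rintegral d (T : measurableType d) (mu : {measure set T -> \bar R})
    (F : E -> T -> R) x v (g : T -> R) :
  (forall t s, derivable (F ^~ t) (x + s *: v) v) ->
  (forall s, mu.-integrable setT (fun t => (F (x + s *: v) t)%:E)) ->
  (forall s t, `|s| <= 1 -> `|'D_v (F ^~ t) (x + s *: v)| <= g t) ->
  mu.-integrable setT (fun t => (g t)%:E) ->
  is_derive x v (fun y => \int[mu]_t F y t) (\int[mu]_t 'D_v (F ^~ t) x).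
Proof.
move=> dF iF leg ig; apply: is_derive_of_line.
pose f s t := F (x + s *: v) t.
have df s t : is_derive s (1 : R) (f ^~ t) ('D_v (F ^~ t) (x + s *: v)).
  exact: is_derive_line.
have pf s t : partial1of2 f s t = 'D_v (F ^~ t) (x + s *: v).
  by rewrite partial1of2E; exact: derive_val.
have := @cvg_differentiation_under_integral R _ T mu f setT measurableT 0 (-1) 1.
have -> : (\int[mu]_(y in setT) partial1of2 f 0 y) = \int[mu]_t 'D_v (F ^~ t) x.
  by apply: eq_Rintegral => t _; rewrite pf scale0r addr0.
have I0 : [set` `](-1 : R), 1[%R] 0 by rewrite /= in_itv /= ltrN10 ltr01.
move=> /(_ I0 (fun s _ => iF s) (fun s t _ _ => @ex_derive _ _ _ _ _ _ _ (df s t)) g).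
have g0 t : 0 <= g t by apply: le_trans (leg 0 t _); rewrite ?normr0.
move=> /(_ g0 ig) H.
have {}H : (h^-1 *: ((fun s => \int[mu]_t f s t) (h + 0) - (fun s => \int[mu]_t f s t) 0))
    @[h --> (0 : R)^'] --> \int[mu]_t 'D_v (F ^~ t) x.
  apply: H => s t; rewrite /= in_itv /= => /andP[s1 s2] _; rewrite pf; apply: leg.
  by rewrite ler_norml (ltW s1) (ltW s2).
have E1 : (fun h : R => h^-1 *: (((fun s => \int[mu]_t F (x + s *: v) t) \o shift 0) (h *: (1 : R))
      - \int[mu]_t F (x + 0 *: v) t)) =
    (fun h : R => h^-1 *: ((fun s => \int[mu]_t f s t) (h + 0) - (fun s => \int[mu]_t f s t) 0)).
  by apply/funext => h /=; rewrite [h%:A]mulr1.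
split; first by rewrite /derivable E1; apply/cvg_ex; eexists; exact: H.
by rewrite /derive E1; apply/cvg_lim.
Qed.

End derive_integral.

(** * Derivatives and translates of powers of the bracket *)

Section bracket_calculus.
Context {R : realType} {n : nat}.
Implicit Types x y v : 'rV[R]_n.

(** Powers of the bracket written without the square root: a directional derivative is then a linear
    form times a function of the same kind. *)
Definition sbra (q : R) x : R := (1 + dotv x x) `^ q.

Lemma sbraE (m : R) x : bracket x `^ m = sbra (m / 2) x.
Proof.
have H : 0 <= 1 + dotv x x by rewrite addr_ge0 ?dotvv_ge0.
by rewrite /sbra /bracket -powR12_sqrt // -powRrM mulrC.
Qed.

Lemma is_derive_dotv z y v : is_derive y v (fun x => dotv z x) (dotv z v).
Proof.
apply: is_derive_of_line.
rewrite (_ : (fun _ => _) = (fun s : R => dotv z y + s * dotv z v)); last first.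
  by apply/funext => s; rewrite dotvC dotvDl dotvZl ![dotv _ z]dotvC.
by apply: is_derive_eq; rewrite /GRing.scale /=; ring.
Qed.

Lemma is_derive_sbra q x v :
  is_derive x v (sbra q) (2 * q * dotv x v * sbra (q - 1) x).
Proof.
apply: is_derive_of_line.
pose p (s : R) := 1 + dotv x x + s * (2 * dotv x v) + s ^+ 2 * dotv v v.
have pE s : 1 + dotv (x + s *: v) (x + s *: v) = p s.
  rewrite dotvDl dotvZl [dotv x (_ + _)]dotvC [dotv v (_ + _)]dotvC !dotvDl !dotvZl.
  by rewrite [dotv v x]dotvC /p; ring.
have p0 : 0 < p 0 by rewrite -pE ltr_pwDl ?dotvv_ge0.
have dp : is_derive (0 : R) (1 : R) p (2 * dotv x v).
  rewrite /p; apply: is_derive_eq; rewrite /GRing.scale /=; ring.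
rewrite (_ : (fun _ => _) = (fun y : R => y `^ q) \o p); last first.
  by apply/funext => s; rewrite /sbra /= pE.
have := is_derive1_comp (is_derive1_powR q p0) dp.
rewrite -pE scale0r addr0 /sbra.
by move=> H; apply: is_derive_eq; ring.
Qed.

Lemma dotv_delta x (j : 'I_n) : dotv x (delta_mx 0 j) = x 0 j.
Proof.
rewrite /dotv (bigD1 j) //= big1 ?addr0; first by rewrite mxE !eqxx mulr1.
by move=> i /negPf ij; rewrite mxE ij andbF mulr0.
Qed.

Lemma bracket_scale (s : R) x : `|s| <= 1 -> bracket (s *: x) <= bracket x.
Proof.
move=> s1; rewrite /bracket ler_sqrt ?addr_ge0 ?dotvv_ge0 //.
rewrite lerD2l dotvZl dotvC dotvZl mulrA -expr2 -[leRHS]mul1r ler_wpM2r ?dotvv_ge0 //.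
by rewrite -real_normK ?num_real // expr_le1.
Qed.

Lemma bracket_translate_le (q s : R) x v : `|s| <= 1 ->
  bracket (x + s *: v) `^ q <= 2 `^ `|q| * bracket v `^ `|q| * bracket x `^ q.
Proof.
move=> s1; apply: le_trans (powR_bracketD x (s *: v) q) _.
rewrite -mulrA ler_wpM2l ?powR_ge0 // ler_wpM2r ?powR_ge0 //.
by apply: ge0_ler_powR; rewrite ?nnegrE ?sqrtr_ge0 // bracket_scale.
Qed.

End bracket_calculus.

Section integral_of_derivative.
Context {R : realType} {n : nat}.
Notation TR := (measurableTypeR R).
Notation rw := (@row_of_tuple R n).
Notation L := (@Lam R n).
Notation normc := (@Normc.normc R).

(** By translation invariance the integral of x -> H(x + y) does not depend on y; its derivative in
    y, taken under the integral sign at y = 0, is the integral of the derivative. *)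
Lemma Rintegral_derive0 (H : 'rV[R]_n -> R) v (M q : R) : (0 < n)%N -> n%:R < q ->
  measurable_fun setT (H \o rw) -> (forall x, derivable H x v) ->
  (forall x, `|H x| <= M * bracket x `^ (- q)) ->
  (forall x, `|'D_v H x| <= M * bracket x `^ (- q)) ->
  \int[L]_t 'D_v H (rw t) = 0.
Proof.
move=> n0 nq mH dH leH leD.
have M0 : 0 <= M.
  have := le_trans (normr_ge0 _) (leH 0).
  by rewrite pmulr_lge0 // powR_gt0 // bracket_gt0.
have iH : L.-integrable setT (fun t => (H (rw t))%:E).
  apply: (le_integrable measurableT _ _ (integrableZl measurableT M (integrable_bracket n0 nq))).
    exact/measurable_EFinP.
  move=> t _; rewrite lee_fin; apply: le_trans (leH _) _.
  by rewrite ler_norm.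
pose F y (t : n.-tuple TR) := H (rw t + y).
have FE y : (fun t => (F y t)%:E) = (fun t => (H (1 *: rw t + y))%:E).
  by apply/funext => t; rewrite scale1r.
have iF y : L.-integrable setT (fun t => (F y t)%:E).
  by rewrite FE; have [] := Rint_affine y (@oner_neq0 R) iH.
have cF y : \int[L]_t F y t = \int[L]_t H (rw t).
  have [_ ->] := Rint_affine y (@oner_neq0 R) iH.
  by rewrite normr1 expr1n mul1r; apply: eq_Rintegral => t _; rewrite scale1r.
have dF t y : derivable (F ^~ t) y v /\ 'D_v (F ^~ t) y = 'D_v H (rw t + y).
  have [D1 D2] := derivable_translate (dH (y + rw t)).
  rewrite (_ : F ^~ t = (fun z => H (z + rw t))); last by apply/funext => z; rewrite /F addrC.
  by rewrite D2 [y + _]addrC.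
pose K := M * (2 `^ `|- q| * bracket v `^ `|- q|).
have HD : is_derive (0 : 'rV[R]_n) v (fun y => \int[L]_t F y t) (\int[L]_t 'D_v (F ^~ t) 0).
  apply: (@derive_Rintegral _ _ _ _ _ _ _ _ (fun t => K * bracket (rw t) `^ (- q))).
  - by move=> t s; have [] := dF t (0 + s *: v).
  - by move=> s; exact: iF.
  - move=> s t s1; have [_ ->] := dF t (0 + s *: v); rewrite add0r.
    apply: le_trans (leD _) _; rewrite -mulrA ler_wpM2l //.
    exact: bracket_translate_le.
  - exact: (integrableZl measurableT K (integrable_bracket n0 nq)).
have := @derive_val _ _ _ _ _ _ _ HD.
rewrite (_ : (fun y => _) = cst (\int[L]_t H (rw t))); last by apply/funext => y; rewrite cF.
rewrite derive_cst => ->; apply: eq_Rintegral => t _.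
by have [_ ->] := dF t 0; rewrite addr0.
Qed.

End integral_of_derivative.

(** * Fourier transforms of Schwartz functions *)

Section schwartz_fourier.
Context {R : realType} {n : nat}.
Notation rw := (@row_of_tuple R n).
Notation L := (@Lam R n).
Notation normc := (@Normc.normc R).
Variables (h : R).
Hypotheses (h0 : 0 < h) (n0 : (0 < n)%N).

Lemma is_derive_cos_dotv z y v :
  is_derive y v (fun y : 'rV[R]_n => cos (- (dotv z y / h)))
    (- sin (- (dotv z y / h)) * (- (dotv z v / h))).
Proof.
apply: is_derive_of_line.
have E s : - (dotv z (y + s *: v) / h) = (- (dotv z y / h) + s * (- (dotv z v / h))).
  by rewrite dotvC dotvDl dotvZl ![dotv _ z]dotvC; ring.
pose p (s : R) := - (dotv z y / h) + s * (- (dotv z v / h)).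
have dp : is_derive (0 : R) (1 : R) p (- (dotv z v / h)).
  by apply: is_derive_eq; rewrite /GRing.scale /=; ring.
rewrite (_ : (fun _ => _) = cos \o p); last by apply/funext => s; rewrite /p /= E.
have -> : dotv z y / h = - p 0 by rewrite /p mul0r addr0 opprK.
rewrite opprK.
exact: is_derive1_comp.
Qed.

Lemma is_derive_sin_dotv z y v :
  is_derive y v (fun y : 'rV[R]_n => sin (- (dotv z y / h)))
    (cos (- (dotv z y / h)) * (- (dotv z v / h))).
Proof.
apply: is_derive_of_line.
have E s : - (dotv z (y + s *: v) / h) = (- (dotv z y / h) + s * (- (dotv z v / h))).
  by rewrite dotvC dotvDl dotvZl ![dotv _ z]dotvC; ring.
pose p (s : R) := - (dotv z y / h) + s * (- (dotv z v / h)).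
have dp : is_derive (0 : R) (1 : R) p (- (dotv z v / h)).
  by apply: is_derive_eq; rewrite /GRing.scale /=; ring.
rewrite (_ : (fun _ => _) = sin \o p); last by apply/funext => s; rewrite /p /= E.
have -> : dotv z y / h = - p 0 by rewrite /p mul0r addr0 opprK.
rewrite opprK.
exact: is_derive1_comp.
Qed.

Lemma cmeas_fker2 z : cmeas (fun t => fker h z (rw t)).
Proof.
apply: cmeas_cexpi; apply: measurable_funN; apply: measurable_funM; last exact: measurable_cst.
apply: measurable_sum => i; apply: measurable_funM; first exact: measurable_cst.
exact: measurable_row_coord.
Qed.

(** Integration by parts: [F'] is the derivative along [v] of the decaying function [fker h z * w],
    so its integral vanishes. *)
Lemma fourier_cderive (w : 'rV[R]_n -> R[i]) v (M q : R) z : n%:R < q ->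
  cmeas (w \o rw) -> cmeas (cderive v w \o rw) -> (forall x, cderivable w x v) ->
  (forall x, normc (w x) <= M * bracket x `^ (- q)) ->
  (forall x, normc (cderive v w x) <= M * bracket x `^ (- q)) ->
  fourier h (cderive v w) z = (0 +i* (dotv z v / h)) * fourier h w z.
Proof.
move=> nq mw mD dw lew leD; have iB := integrable_bracket n0 nq.
have M0 : 0 <= M.
  have := le_trans (normc_ge0 _) (lew 0).
  by rewrite pmulr_lge0 // powR_gt0 // bracket_gt0.
set c := dotv z v / h.
have iw : cintegrable L (w \o rw).
  by apply: (cintegrable_le mw (integrableZl measurableT M iB)) => t; exact: lew.
have iD : cintegrable L (cderive v w \o rw).
  by apply: (cintegrable_le mD (integrableZl measurableT M iB)) => t; exact: leD.
pose F y := fker h z y * w y.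
pose F' y := fker h z y * cderive v w y + (0 +i* (- c)) * F y.
have leF y : normc (F y) <= M * bracket y `^ (- q).
  by rewrite Normc.normcM normc_fker mul1r.
have leF' y : normc (F' y) <= (M + `|c| * M) * bracket y `^ (- q).
  apply: le_trans (normcD_le _ _) _; rewrite !Normc.normcM normc_fker !mul1r mulrDl lerD //.
  have -> : normc (0 +i* - c) = `|c|.
    by rewrite /Normc.normc expr0n add0r sqrrN sqrtr_sqr.
  by rewrite -mulrA ler_wpM2l.
have leMM : M <= M + `|c| * M by rewrite lerDl mulr_ge0.
have dR y : is_derive y v (fun y => complex.Re (F y)) (complex.Re (F' y)).
  have [d1 d2] := dw y.
  have E1 := is_derive_cos_dotv z y v; have E2 := is_derive_sin_dotv z y v.
  have := is_deriveB (is_deriveM E1 (derivableP d1)) (is_deriveM E2 (derivableP d2)).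
  rewrite (_ : (fun y => complex.Re (F y)) =
    (fun y => cos (- (dotv z y / h))) * (@complex.Re R \o w) -
    (fun y => sin (- (dotv z y / h))) * (@complex.Im R \o w)); last first.
    by apply/funext => x; rewrite /F ReM.
  by move=> H; apply: is_derive_eq; rewrite /F' /F ReD !ReM !ImM /GRing.scale /= -/c; ring.
have dI y : is_derive y v (fun y => complex.Im (F y)) (complex.Im (F' y)).
  have [d1 d2] := dw y.
  have E1 := is_derive_cos_dotv z y v; have E2 := is_derive_sin_dotv z y v.
  have := is_deriveD (is_deriveM E1 (derivableP d2)) (is_deriveM E2 (derivableP d1)).
  rewrite (_ : (fun y => complex.Im (F y)) =
    (fun y => cos (- (dotv z y / h))) * (@complex.Im R \o w) +
    (fun y => sin (- (dotv z y / h))) * (@complex.Re R \o w)); last first.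
    by apply/funext => x; rewrite /F ImM.
  by move=> H; apply: is_derive_eq; rewrite /F' /F ImD !ImM ?ReM /GRing.scale /= -/c; ring.
have [mF1 mF2] : cmeas (F \o rw) by apply: cmeasM => //; exact: cmeas_fker2.
have Z : cint L (F' \o rw) = 0.
  apply: ReIm_eq; rewrite /cint /=.
    have := @Rintegral_derive0 R n (fun y => complex.Re (F y)) v (M + `|c| * M) q n0 nq mF1.
    under eq_Rintegral do rewrite derive_val.
    apply => x.
    - exact: ex_derive.
    - apply: le_trans (Re_le_normc _) (le_trans (leF _) _).
      by rewrite ler_wpM2r // powR_bracket_ge0.
    - by rewrite derive_val; apply: le_trans (Re_le_normc _) (leF' _).
  have := @Rintegral_derive0 R n (fun y => complex.Im (F y)) v (M + `|c| * M) q n0 nq mF2.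
  under eq_Rintegral do rewrite derive_val.
  apply => x.
  - exact: ex_derive.
  - apply: le_trans (Im_le_normc _) (le_trans (leF _) _).
    by rewrite ler_wpM2r // powR_bracket_ge0.
  - by rewrite derive_val; apply: le_trans (Im_le_normc _) (leF' _).
have i1 := cintegrable_fker h z iD; have i2 := cintegrable_fker h z iw.
have : cint L (F' \o rw) =
    fourier h (cderive v w) z + (0 +i* (- c)) * fourier h w z.
  by rewrite /fourier -cintZl // -cintD //; exact: cintegrableZl.
rewrite Z => /esym/eqP; rewrite addr_eq0 => /eqP ->.
by rewrite -mulNr; congr (_ * _); apply: ReIm_eq; rewrite /= ?oppr0 ?opprK.
Qed.

Lemma mi_dirs_single (j : 'I_n) m :
  mi_dirs ([ffun i => if i == j then m else 0%N] : multiindex n) =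
  nseq m (delta_mx 0 j : 'rV[R]_n).
Proof.
rewrite /mi_dirs.
have : j \in enum 'I_n by rewrite mem_enum.
elim: (enum 'I_n) (enum_uniq 'I_n) => //= i s IH /andP[ins us].
rewrite inE ffunE; have [-> _|ji /=] := eqVneq j i.
  rewrite (_ : flatten _ = [::]) ?cats0 //.
  have : all (fun k => k != i) s by apply/allP => k ks; apply: contraNneq ins => <-.
  by elim: s {IH ins us} => //= k s IH /andP[/negPf ki /IH ->]; rewrite ffunE ki.
by move=> js; exact: IH.
Qed.

Lemma schwartz_decay (u : 'rV[R]_n -> R[i]) beta (N : nat) : schwartz u ->
  exists2 M, 0 <= M & forall x, normc (iderive (mi_dirs beta) u x) <= M * bracket x `^ (- N%:R).
Proof.
move=> [_ /(_ N beta)[M HM]].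
have b0 (x : 'rV[R]_n) : 0 < bracket x ^+ N by rewrite exprn_gt0 // bracket_gt0.
have M0 : 0 <= M.
  by apply: le_trans (HM 0); rewrite mulr_ge0 ?normc_ge0 // ltW.
exists M => // x; rewrite powRN powR_mulrn ?(ltW (bracket_gt0 _)) //.
by rewrite ler_pdivlMr // mulrC.
Qed.

Lemma cmeas_ccontinuous (w : 'rV[R]_n -> R[i]) : ccontinuous w -> cmeas (w \o rw).
Proof.
move=> [c1 c2].
have cl (X Y : 'rV[R]_n) : continuous (fun s : R => X + s *: Y).
  move=> s; apply: cvgD; first exact: cvg_cst.
  by apply: cvgZr_tmp; exact: cvg_id.
split.
  apply: (@measurable_row_continuous _ _ (@complex.Re R \o w)) => X i s.
  exact: (continuous_comp (@cl X (delta_mx 0 i) s) (c1 _)).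
apply: (@measurable_row_continuous _ _ (@complex.Im R \o w)) => X i s.
exact: (continuous_comp (@cl X (delta_mx 0 i) s) (c2 _)).
Qed.

Lemma schwartz_cintegrable u : schwartz u -> cintegrable L (u \o rw).
Proof.
move=> su; have [M M0 leM] := schwartz_decay [ffun=> 0%N] n.+1 su.
have E : mi_dirs ([ffun=> 0%N] : multiindex n) = ([::] : seq 'rV[R]_n).
  by rewrite /mi_dirs; elim: (enum 'I_n) => //= i s ->; rewrite ffunE.
have nq : n%:R < n.+1%:R :> R by rewrite ltr_nat.
apply: (cintegrable_le _ (integrableZl measurableT M (integrable_bracket n0 nq))).
  by apply: cmeas_ccontinuous; have [/(_ [::])[]] := su.
by move=> t; have := leM (rw t); rewrite E.
Qed.

(** Each derivative of [u] along coordinate j multiplies the transform by i z_j / h, and the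
    transform of the m-th derivative is bounded by its L^1 norm. *)
Lemma fourier_coord_decay (u : 'rV[R]_n -> R[i]) (j : 'I_n) m : schwartz u ->
  exists2 M : R, 0 <= M & forall z : 'rV[R]_n, `|z 0 j| ^+ m * normc (fourier h u z) <= M.
Proof.
move=> su; pose w m := iderive (nseq m (delta_mx 0 j : 'rV[R]_n)) u.
have dec k : exists2 M, 0 <= M & forall x, normc (w k x) <= M * bracket x `^ (- n.+1%:R).
  by have := schwartz_decay [ffun i => if i == j then k else 0%N] n.+1 su; rewrite mi_dirs_single.
have mw k : cmeas (w k \o rw).
  by apply: cmeas_ccontinuous; have [/(_ (nseq k (delta_mx 0 j)))[]] := su.
have dw k x : cderivable (w k) x (delta_mx 0 j).
  by have [/(_ (nseq k.+1 (delta_mx 0 j)))[[_ H] _] _] := su; exact: H.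
have nq : n%:R < n.+1%:R :> R by rewrite ltr_nat.
have zj (z : 'rV[R]_n) := dotv_delta z j.
have FE k z : fourier h (w k) z = (0 +i* (z 0 j / h)) ^+ k * fourier h u z.
  elim: k => [|k IH]; first by rewrite expr0 mul1r.
  rewrite exprS -mulrA -IH -zj.
  have [M1 M10 le1] := dec k; have [M2 M20 le2] := dec k.+1.
  have L1 x : normc (w k x) <= (M1 + M2) * bracket x `^ (- n.+1%:R).
    by apply: le_trans (le1 x) _; rewrite ler_wpM2r ?powR_bracket_ge0 // lerDl.
  have L2 x : normc (w k.+1 x) <= (M1 + M2) * bracket x `^ (- n.+1%:R).
    by apply: le_trans (le2 x) _; rewrite ler_wpM2r ?powR_bracket_ge0 // lerDr.
  exact: (fourier_cderive z nq (mw k) (mw k.+1) (dw k) L1 L2).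
have [M M0 leM] := dec m.
have im : cintegrable L (w m \o rw).
  exact: (cintegrable_le (mw m) (integrableZl measurableT M (integrable_bracket n0 nq)) (fun t => leM (rw t))).
pose K := \int[L]_t normc (w m (rw t)).
have K0 : 0 <= K by apply: Rintegral_ge0 => t _; exact: normc_ge0.
exists (h ^+ m * K) => [|z]; first by rewrite mulr_ge0 // exprn_ge0 // ltW.
have := normc_fourier_le h z im; rewrite FE Normc.normcM -/K.
have -> : normc ((0 +i* (z 0 j / h)) ^+ m) = `|z 0 j| ^+ m / h ^+ m.
  elim: (m) => [|k IH]; first by rewrite !expr0 divr1 /Normc.normc /= expr0n addr0 expr1n sqrtr1.
  rewrite exprS Normc.normcM IH /Normc.normc expr0n add0r sqrtr_sqr normrM normfV (gtr0_norm h0).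
  by rewrite !exprS invfM; ring.
by rewrite mulrAC ler_pdivrMr ?exprn_gt0 // mulrC [h ^+ m * K]mulrC mulrC.
Qed.

(** The kernel of [Op] pairs [u y] with exp(i <y, xi> / h), the opposite sign to [fker], hence the
    reflection. *)
Definition uhat u (xi : 'rV[R]_n) : R[i] := fourier h u (- xi).

Lemma uhat_decay (u : 'rV[R]_n -> R[i]) (m : nat) : schwartz u ->
  exists2 M : R, 0 <= M & forall xi, normc (uhat u xi) <= M * bracket xi `^ (- m%:R).
Proof.
move=> su.
have [M0 M00 leM0] : exists2 M, 0 <= M & forall z, normc (fourier h u z) <= M.
  have [M M_ge leM] := fourier_coord_decay (Ordinal n0) 0 su.
  by exists M => // z; have := leM z; rewrite expr0 mul1r.
have [B B0 leB] : exists2 B, 0 <= B &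
    forall (z : 'rV[R]_n) (i : 'I_n), `|z 0 i| ^+ m * normc (fourier h u z) <= B.
  have /choice[B HB] : forall j : 'I_n, exists B, 0 <= B /\
      forall z : 'rV[R]_n, `|z 0 j| ^+ m * normc (fourier h u z) <= B.
    by move=> j; have [B B0 H] := fourier_coord_decay j m su; exists B.
  exists (\sum_i B i) => [|z i]; first by apply: sumr_ge0 => i _; have [] := HB i.
  have [_ /(_ z) H] := HB i; apply: le_trans H _.
  by rewrite (bigD1 i) //= lerDl; apply: sumr_ge0 => k _; have [] := HB k.
pose c : R := (1 + n%:R) ^+ m.
exists (c * (M0 + B)) => [|xi]; first by rewrite mulr_ge0 ?exprn_ge0 ?addr_ge0.
have b0 : 0 < bracket xi by exact: bracket_gt0.
rewrite powRN powR_mulrn ?(ltW b0) // ler_pdivlMr ?exprn_gt0 //.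
(* The largest coordinate controls the whole bracket up to the factor 1 + n, whence the constant
   [c]; decay in each single coordinate is therefore enough. *)
have [i Hi] : exists i : 'I_n, forall k : 'I_n, `|xi 0 k| <= `|xi 0 i|.
  have [i _ H] := @Order.TotalTheory.arg_maxP _ _ _ (Ordinal n0) predT (fun k => `|xi 0 k|) isT.
  by exists i => k; exact: H.
have bi : bracket xi <= (1 + n%:R) * Num.max 1 `|xi 0 i|.
  apply: le_trans (bracket_le1 _) _; rewrite mulrDl mul1r lerD //.
    by rewrite le_max lexx.
  apply: le_trans (_ : \sum_(k < n) Num.max 1 `|xi 0 i| <= _).
    by apply: ler_sum => k _; rewrite le_max Hi orbT.
  by rewrite sumr_const card_ord mulr_natl.
have bm : bracket xi ^+ m <= c * (1 + `|xi 0 i| ^+ m).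
  apply: le_trans (_ : ((1 + n%:R) * Num.max 1 `|xi 0 i|) ^+ m <= _).
    by rewrite lerXn2r ?nnegrE ?(ltW b0) // mulr_ge0 ?addr_ge0 // le_max ler01.
  rewrite exprMn ler_wpM2l ?exprn_ge0 ?addr_ge0 //.
  by case: (leP 1 `|xi 0 i|) => _; rewrite ?expr1n ?lerDr ?lerDl ?exprn_ge0.
rewrite mulrC; apply: le_trans (ler_wpM2r (normc_ge0 _) bm) _.
rewrite -mulrA ler_wpM2l ?exprn_ge0 ?addr_ge0 // mulrDl mul1r lerD //.
  exact: leM0.
by have := leB (- xi) i; rewrite mxE normrN.
Qed.

Lemma cmeas_uhat u : schwartz u -> cmeas (uhat u \o rw).
Proof.
move=> su; have := cmeas_translate 0 (-1) (cmeas_fourier h (schwartz_cintegrable su)).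
rewrite /uhat; congr cmeas; apply/funext => t /=.
by rewrite addr0 scaleN1r.
Qed.

Lemma cvg_line (f : 'rV[R]_n -> R) x y : derivable f x y ->
  f (x + sseq k *: y) @[k --> \oo] --> f x.
Proof.
move=> df; have D : is_derive (0 : R) (1 : R) (fun s : R => f (x + s *: y)) ('D_y f x).
  by have := @is_derive_line _ _ f x y 0; rewrite scale0r addr0; exact.
have /differentiable_continuous C : differentiable (fun s : R => f (x + s *: y)) 0.
  by apply/derivable1_diffP; case: D.
have := continuous_cvg _ C (@sseq_cvg0 R); rewrite scale0r addr0; exact.
Qed.

Lemma cvg_uhat u x y : schwartz u ->
  complex.Re (uhat u (x + sseq k *: y)) @[k --> \oo] --> complex.Re (uhat u x) /\
  complex.Im (uhat u (x + sseq k *: y)) @[k --> \oo] --> complex.Im (uhat u x).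
Proof.
move=> su; have iu := schwartz_cintegrable su.
have mk z : cmeas (fun t => fker h (- z) (rw t) * u (rw t)).
  by apply: cmeasM; [exact: cmeas_fker2|exact: cintegrable_cmeas iu].
have lek z t : normc (fker h (- z) (rw t) * u (rw t)) <= normc (u (rw t)).
  by rewrite Normc.normcM normc_fker mul1r.
have EC t : cos (- (dotv (rw t) (- (x + sseq k *: y)) / h)) @[k --> \oo] --> cos (- (dotv (rw t) (- x) / h)).
  apply: (@cvg_line (fun z => cos (- (dotv (rw t) (- z) / h)))).
  under eq_fun do rewrite dotvC dotvNl mulNr -mulrN [dotv _ (rw t)]dotvC.
  have := is_derive_cos_dotv (- rw t) x y.
  under [X in is_derive _ _ X]eq_fun do rewrite dotvNl mulNr -mulrN.
  by move=> [].
have ES t : sin (- (dotv (rw t) (- (x + sseq k *: y)) / h)) @[k --> \oo] --> sin (- (dotv (rw t) (- x) / h)).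
  apply: (@cvg_line (fun z => sin (- (dotv (rw t) (- z) / h)))).
  under eq_fun do rewrite dotvC dotvNl mulNr -mulrN [dotv _ (rw t)]dotvC.
  have := is_derive_sin_dotv (- rw t) x y.
  under [X in is_derive _ _ X]eq_fun do rewrite dotvNl mulNr -mulrN.
  by move=> [].
split.
  apply: (cvg_Rintegral (f_ := fun k t => complex.Re (fker h (- (x + sseq k *: y)) (rw t) * u (rw t)))
     (f := fun t => complex.Re (fker h (- x) (rw t) * u (rw t))) _ _ _ (integrable_normc iu)).
  - by move=> k; case: (mk (x + sseq k *: y)).
  - by case: (mk x).
  - move=> t; rewrite ReM; under eq_fun do rewrite ReM.
    rewrite /fker /=; apply: cvgB; apply: cvgMl.
      by rewrite dotvC; under eq_fun do rewrite dotvC; exact: EC.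
    by rewrite dotvC; under eq_fun do rewrite dotvC; exact: ES.
  - by move=> k t; apply: le_trans (Re_le_normc _) _; exact: lek.
apply: (cvg_Rintegral (f_ := fun k t => complex.Im (fker h (- (x + sseq k *: y)) (rw t) * u (rw t)))
   (f := fun t => complex.Im (fker h (- x) (rw t) * u (rw t))) _ _ _ (integrable_normc iu)).
- by move=> k; case: (mk (x + sseq k *: y)).
- by case: (mk x).
- move=> t; rewrite ImM; under eq_fun do rewrite ImM.
  rewrite /fker /=; apply: cvgD; apply: cvgMl.
    by rewrite dotvC; under eq_fun do rewrite dotvC; exact: EC.
  by rewrite dotvC; under eq_fun do rewrite dotvC; exact: ES.
- by move=> k t; apply: le_trans (Im_le_normc _) _; exact: lek.
Qed.

(** The symbol does not depend on y, so the inner integral is [uhat]; a Fourier integral in xi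
    remains, with x frozen in the symbol. *)
Lemma Op_fourier a u x : schwartz u ->
  Op h a u x = ((2 * pi * h) ^- n)%:C * fourier h (fun xi => a (x, xi) * uhat u xi) x.
Proof.
move=> su; rewrite /Op; congr (_ * _).
rewrite -[LHS]/(cint L _); apply: eq_cint => t.
rewrite -[LHS]/(cint L _) /uhat /fourier mulrA -cintZl; last first.
  exact: (cintegrable_fker h (- rw t) (schwartz_cintegrable su)).
apply: eq_cint => s.
rewrite mulrA; congr (_ * _).
rewrite [RHS]mulrAC; congr (_ * _).
rewrite /fker -cexpiD; congr cexpi.
by rewrite dotvBl dotvNl [dotv (rw s) _]dotvC; ring.
Qed.

(** Up to the factor (2 pi h)^(-n), the H_h^k norm of [u] is the L^2 norm of the Fourier transform
    of this function. *)
Definition ghat k u (xi : 'rV[R]_n) : R[i] := (bracket xi `^ k)%:C * uhat u xi.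

Lemma ghat_props k u : schwartz u ->
  [/\ cintegrable L (ghat k u \o rw),
      exists M, forall xi, normc (ghat k u xi) <= M,
      forall x y, complex.Re (ghat k u (x + sseq j *: y)) @[j --> \oo] --> complex.Re (ghat k u x) &
      forall x y, complex.Im (ghat k u (x + sseq j *: y)) @[j --> \oo] --> complex.Im (ghat k u x)].
Proof.
move=> su; pose N := (Num.truncn `|k| + n).+2.
have nN : k - N%:R <= - n.+1%:R.
  have := truncnS_gt `|k|; have := ler_norm k; rewrite /N => h1 h2.
  have -> : (Num.truncn `|k| + n).+2 = ((Num.truncn `|k|).+1 + n.+1)%N by rewrite addnS addSn.
  by rewrite natrD; lra.
have [M M0 leM] := uhat_decay N su.
have leg xi : normc (ghat k u xi) <= M * bracket xi `^ (- n.+1%:R).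
  rewrite Normc.normcM normc_real ger0_norm ?powR_bracket_ge0 //.
  apply: le_trans (ler_wpM2l (powR_bracket_ge0 _ _) (leM xi)) _.
  rewrite mulrCA ler_wpM2l // -powRD; last by rewrite (gt_eqF (bracket_gt0 _)) implybT.
  exact: ler_powR_bracket.
have mg : cmeas (ghat k u \o rw).
  apply: cmeasM; last exact: cmeas_uhat.
  apply: cmeas_real; apply: (measurableT_comp (measurable_powR k)).
  exact: measurable_bracket.
have nq : n%:R < n.+1%:R :> R by rewrite ltr_nat.
have cb (x y : 'rV[R]_n) : bracket (x + sseq j *: y) `^ k @[j --> \oo] --> bracket x `^ k.
  rewrite (_ : (fun _ => _) = (fun j => sbra (k / 2) (x + sseq j *: y))); last first.
    by apply/funext => j; rewrite sbraE.
  by rewrite sbraE; apply: (@cvg_line (sbra (k / 2)) x y); case: (is_derive_sbra (k / 2) x y).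
split.
- by apply: (cintegrable_le mg (integrableZl measurableT M (integrable_bracket n0 nq))) => t; exact: leg.
- exists M => xi; apply: le_trans (leg xi) _; rewrite ler_piMr //.
  by rewrite powRN invf_le1 ?powR_gt0 ?bracket_gt0 // powR_mulrn ?exprn_ege1 ?bracket_ge1 // ltW ?bracket_gt0.
- move=> x y; have [c1 c2] := cvg_uhat x y su.
  rewrite (_ : (fun _ => _) = (fun j => bracket (x + sseq j *: y) `^ k * complex.Re (uhat u (x + sseq j *: y)))).
    by rewrite /ghat ReM /= mul0r subr0; exact: cvgM.
  by apply/funext => j; rewrite /ghat ReM /= mul0r subr0.
- move=> x y; have [c1 c2] := cvg_uhat x y su.
  rewrite (_ : (fun _ => _) = (fun j => bracket (x + sseq j *: y) `^ k * complex.Im (uhat u (x + sseq j *: y)))).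
    by rewrite /ghat ImM /= mul0r addr0; exact: cvgM.
  by apply/funext => j; rewrite /ghat ImM /= mul0r addr0.
Qed.

End schwartz_fourier.

(** * Operators with small symbols *)

Section coordinate_estimates.
Context {R : realType} {n : nat}.
Notation E := 'rV[R]_n.
Implicit Types (f g : E -> R) (l : seq E).

(* [est l m B f]: every derivative of [f] along distinct entries of [l], taken
   in the order of [l], is bounded by [B] times the weight of the expected
   order, and is continuous in the last direction used. *)
Fixpoint est l (m B : R) f : Prop :=
  match l with
  | [::] => forall x, `|f x| <= B * bracket x `^ m
  | v :: l' => [/\ forall x, derivable f x v, forall x, derivable ('D_v f) x v,
                 est l' m B f & est l' (m - 1) B ('D_v f)]
  end.

Lemma est_bound l m B f : est l m B f -> forall x, `|f x| <= B * bracket x `^ m.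
Proof. by elim: l => //= v l IH [_ _ /IH]. Qed.

Lemma est_ge0 l m B f : est l m B f -> 0 <= B.
Proof.
move=> /est_bound/(_ 0)/(le_trans (normr_ge0 _)).
by rewrite pmulr_lge0 // powR_gt0 // bracket_gt0.
Qed.

Lemma est_le l m B B' f : B <= B' -> est l m B f -> est l m B' f.
Proof.
move=> BB'; elim: l m f => [|v l IH] m f /=.
  by move=> H x; apply: le_trans (H x) _; rewrite ler_wpM2r ?powR_bracket_ge0.
by move=> [d1 d2 e1 e2]; split => //; exact: IH.
Qed.

Lemma est_add l m B B' f g : est l m B f -> est l m B' g -> est l m (B + B') (f + g).
Proof.
elim: l m f g => [|v l IH] m f g /=.
  move=> H1 H2 x; apply: le_trans (ler_normD _ _) _.
  by rewrite mulrDl lerD.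
move=> [d1 d2 e1 e2] [c1 c2 k1 k2].
have -> : 'D_v (f + g) = 'D_v f + 'D_v g.
  by apply/funext => x; rewrite deriveD.
split.
- by move=> x; exact: derivableD.
- by move=> x; exact: derivableD.
- exact: IH.
- exact: IH.
Qed.

(** Leibniz' rule: every differentiation doubles the number of terms, whence the power of 2. *)
Lemma est_mul l m m' B B' f g : est l m B f -> est l m' B' g ->
  est l (m + m') (2 ^+ size l * (B * B')) (f * g).
Proof.
elim: l m m' f g => [|v l IH] m m' f g /=.
  move=> H1 H2 x; rewrite expr0 mul1r powRD; last by rewrite (gt_eqF (bracket_gt0 _)) implybT.
  by rewrite mulrACA normrM ler_pM.
move=> [d1 d2 e1 e2] [c1 c2 k1 k2].
have BB : 0 <= B * B' by rewrite mulr_ge0 // ?(est_ge0 e1) ?(est_ge0 k1).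
have -> : 'D_v (f * g) = f * 'D_v g + 'D_v f * g.
  by apply/funext => x; rewrite deriveM //= /GRing.scale /=; congr (_ + _); exact: mulrC.
split.
- by move=> x; exact: derivableM.
- by move=> x; apply: derivableD; apply: derivableM.
- apply: est_le (IH _ _ _ _ e1 k1).
  by rewrite ler_wpM2r // ler_eXn2l // ltr1n.
- have -> : 2 ^+ (size l).+1 * (B * B') = 2 ^+ size l * (B * B') + 2 ^+ size l * (B * B').
    by rewrite exprS; ring.
  apply: est_add; first by rewrite -addrA; exact: IH.
  by rewrite addrAC; exact: IH.
Qed.

Lemma is_derive_monomial_sbra (T : seq 'I_n) (c q : R) (i : 'I_n) x : i \notin T ->
  is_derive x (delta_mx 0 i) (fun x : E => c * \prod_(j <- T) x 0 j * sbra q x)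
    (c * (2 * q) * \prod_(j <- i :: T) x 0 j * sbra (q - 1) x).
Proof.
move=> iT; apply: is_derive_of_line.
have pE s : \prod_(j <- T) (x + s *: delta_mx 0 i) 0 j = \prod_(j <- T) x 0 j.
  rewrite big_seq [RHS]big_seq; apply: eq_bigr => j jT.
  rewrite !mxE eqxx /=; case: eqVneq => [ji|_]; last by rewrite mulr0 addr0.
  by rewrite ji (negPf iT) in jT.
have D : is_derive (0 : R) (1 : R) (fun s : R => sbra q (x + s *: delta_mx 0 i))
    (2 * q * x 0 i * sbra (q - 1) x).
  have := @is_derive_line _ _ (sbra q) x (delta_mx 0 i) 0.
  rewrite scale0r addr0 => H; have D1 := is_derive_sbra q x (delta_mx 0 i).
  have := H (@ex_derive _ _ _ _ _ _ _ D1).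
  by rewrite (@derive_val _ _ _ _ _ _ _ D1) dotv_delta.
rewrite (_ : (fun _ => _) = (c * \prod_(j <- T) x 0 j) \*: (fun s : R => sbra q (x + s *: delta_mx 0 i))).
  by apply: is_derive_eq; rewrite big_cons /GRing.scale /=; ring.
by apply/funext => s; rewrite pE.
Qed.

(** Distinct directions keep the family closed: along a coordinate outside [T] the monomial is
    constant, so the derivative only adds that coordinate to [T] and lowers the power of the bracket
    by two, a net gain of one order. *)
Lemma est_monomial_sbra (s T : seq 'I_n) (c q : R) : uniq s -> {in s, forall i, i \notin T} ->
  exists B, est [seq delta_mx 0 i | i <- s] ((size T)%:R + 2 * q) B
    (fun x : E => c * \prod_(j <- T) x 0 j * sbra q x).
Proof.
have bound (U : seq 'I_n) (d p : R) (x : E) :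
    `|d * \prod_(j <- U) x 0 j * sbra p x| <= `|d| * bracket x `^ ((size U)%:R + 2 * p).
  have b0 := bracket_gt0 x.
  have -> : sbra p x = bracket x `^ (2 * p) by rewrite sbraE; congr sbra; field.
  rewrite !normrM -mulrA ler_wpM2l // powRD; last by rewrite (gt_eqF b0) implybT.
  rewrite [X in _ * X <= _]ger0_norm ?powR_ge0 // ler_wpM2r ?powR_ge0 // powR_mulrn ?(ltW b0) // normr_prod.
  elim: U => [|j U IH]; first by rewrite big_nil expr0.
  by rewrite big_cons exprS ler_pM ?bracket_coord // prodr_ge0.
elim: s T c q => [|i s IH] T c q /=.
  by move=> _ _; exists `|c| => x; exact: bound.
move=> /andP[ins us] dT.
have iT : i \notin T by apply: dT; rewrite mem_head.
have D x := is_derive_monomial_sbra c q x iT.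
have DE : 'D_(delta_mx 0 i) (fun x : E => c * \prod_(j <- T) x 0 j * sbra q x) =
    (fun x => c * (2 * q) * \prod_(j <- i :: T) x 0 j * sbra (q - 1) x).
  by apply/funext => x; exact: derive_val.
have [B1 e1] : exists B, est [seq delta_mx 0 i | i <- s] ((size T)%:R + 2 * q) B
    (fun x : E => c * \prod_(j <- T) x 0 j * sbra q x).
  by apply: IH => // j js; apply: dT; rewrite inE js orbT.
have [B2 e2] : exists B, est [seq delta_mx 0 i | i <- s] ((size (i :: T))%:R + 2 * (q - 1)) B
    (fun x : E => c * (2 * q) * \prod_(j <- i :: T) x 0 j * sbra (q - 1) x).
  apply: IH => // j js; rewrite inE negb_or dT ?inE ?js ?orbT // andbT.
  by apply: contraNneq ins => <-.
exists (B1 + B2); split.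
- by move=> x; exact: ex_derive.
(* [est] also asks for a second derivative along i. Now the monomial contains x_i, so this one
   factor is differentiated together with the power and the rest of the product stays constant. *)
- move=> x; rewrite DE.
  have H : is_derive x (delta_mx 0 i) (fun x : E => x 0 i * sbra (q - 1) x)
      (x 0 i * (2 * (q - 1) * x 0 i * sbra (q - 1 - 1) x) + sbra (q - 1) x).
    apply: is_derive_of_line; have D1 := is_derive_sbra (q - 1) x (delta_mx 0 i).
    have := @is_derive_line _ _ (sbra (q - 1)) x (delta_mx 0 i) 0.
    rewrite scale0r addr0 => /(_ (@ex_derive _ _ _ _ _ _ _ D1)).
    rewrite (@derive_val _ _ _ _ _ _ _ D1) dotv_delta => H1.
    rewrite (_ : (fun _ => _) = (fun s : R => x 0 i + s) * (fun s : R => sbra (q - 1) (x + s *: delta_mx 0 i))).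
      by apply: is_derive_eq; rewrite scale0r !addr0 /GRing.scale /=; ring.
    by apply/funext => a; rewrite !mxE !eqxx mulr1.
  have pE a : \prod_(j <- T) (x + a *: delta_mx 0 i) 0 j = \prod_(j <- T) x 0 j.
    rewrite big_seq [RHS]big_seq; apply: eq_bigr => j jT.
    rewrite !mxE eqxx /=; case: eqVneq => [ji|_]; last by rewrite mulr0 addr0.
    by rewrite ji (negPf iT) in jT.
  have := @is_derive_line _ _ (fun x : E => x 0 i * sbra (q - 1) x) x (delta_mx 0 i) 0.
  rewrite scale0r addr0 => /(_ (@ex_derive _ _ _ _ _ _ _ H)) H2.
  suff [] : is_derive x (delta_mx 0 i : E) (fun x : E => c * (2 * q) * \prod_(j <- i :: T) x 0 j * sbra (q - 1) x)
     (c * (2 * q) * \prod_(j <- T) x 0 j * 'D_(delta_mx 0 i) (fun x : E => x 0 i * sbra (q - 1) x) x) by [].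
  apply: is_derive_of_line.
  rewrite (_ : (fun _ => _) = (c * (2 * q) * \prod_(j <- T) x 0 j) \*: (fun s : R => (x + s *: delta_mx 0 i) 0 i * sbra (q - 1) (x + s *: delta_mx 0 i))).
    by apply: is_derive_eq.
  apply/funext => a; rewrite big_cons pE -[RHS]/(c * (2 * q) * \prod_(j <- T) x 0 j *
     ((x + a *: delta_mx 0 i) 0 i * sbra (q - 1) (x + a *: delta_mx 0 i))).
  by ring.
- by apply: est_le e1; rewrite lerDl; exact: est_ge0 e2.
- rewrite DE; apply: (@est_le _ _ B2); first by rewrite lerDr; exact: est_ge0 e1.
  by move: e2; congr est; rewrite /= -natr1; ring.
Qed.

Lemma est_bracket (k : R) (s : seq 'I_n) : uniq s ->
  exists B, est [seq delta_mx 0 i | i <- s] k B (fun x : E => bracket x `^ k).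
Proof.
move=> us; have [B] := @est_monomial_sbra s [::] 1 (k / 2) us (fun _ _ => isT).
rewrite add0r (_ : 2 * (k / 2) = k); last by field.
move=> H; exists B; move: H; congr est; apply/funext => x.
by rewrite big_nil !mul1r sbraE.
Qed.

Lemma est_catl l1 l2 m B f : est (l1 ++ l2) m B f ->
  est l2 (m - (size l1)%:R) B (foldl (fun g v => 'D_v g) f l1).
Proof.
elim: l1 m f => [|v l IH] m f /=; first by rewrite subr0.
by move=> [_ _ _ /IH]; rewrite -natr1 opprD addrA [m - 1 - _]addrAC.
Qed.

(** [rderive] applies the last entry of its list first and [est] the first one, hence the reversal.
    The four conclusions are what one integration along a ray in the direction [v] consumes. *)
Lemma est_suffix pre v suf m B f : est (rev (pre ++ v :: suf)) m B f ->
  [/\ forall x, derivable (rderive suf f) x v,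
      forall x, derivable (rderive (v :: suf) f) x v,
      forall x, `|rderive suf f x| <= B * bracket x `^ (m - (size suf)%:R) &
      forall x, `|rderive (v :: suf) f x| <= B * bracket x `^ (m - (size suf).+1%:R)].
Proof.
have DE : foldl (fun g v => 'D_v g) f (rev suf) = rderive suf f.
  by elim: suf => //= w suf IH; rewrite rev_cons foldl_rcons IH.
rewrite rev_cat rev_cons -cats1 -catA => /est_catl.
rewrite size_rev DE /= => -[d1 d2 e1 e2]; split => //.
  exact: est_bound e1.
by rewrite -natr1 opprD addrA; exact: est_bound e2.
Qed.

End coordinate_estimates.

Section derivative_measurability.
Context {R : realType}.
Notation rw := (@row_of_tuple R _).

Lemma cvg_quotient_sseq {E : normedModType R} (f : E -> R) x v : derivable f x v ->
  (sseq k)^-1 * (f (x + sseq k *: v) - f x) @[k --> \oo] --> 'D_v f x.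
Proof.
move=> df.
pose q (s : R) := s^-1 * (f (x + s *: v) - f x).
have : q s @[s --> (0 : R)^'] --> 'D_v f x.
  rewrite /q (_ : (fun _ => _) = (fun h : R => h^-1 *: ((f \o shift x) (h *: v) - f x))).
    exact: df.
  by apply/funext => s /=; congr (_ * (f _ - _)); rewrite addrC.
move/cvgr_dnbhsP; apply; split; last exact: sseq_cvg0.
by move=> k; rewrite gt_eqF // sseq_gt0.
Qed.

Lemma measurable_derive n (f : 'rV[R]_n -> R) v : measurable_fun setT (f \o rw) ->
  (forall x, derivable f x v) -> measurable_fun setT ('D_v f \o rw).
Proof.
move=> mf df; apply: (@measurable_fun_cvg _ _ _ _
   (fun k t => (sseq k)^-1 * (f (rw t + sseq k *: v) - f (rw t)))).
  move=> k; apply: measurable_funM; first exact: measurable_cst.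
  apply: measurable_funB => //.
  have := measurable_row_affine 1 (sseq k *: v) mf.
  by under eq_fun do rewrite scale1r.
by move=> t _; exact: cvg_quotient_sseq.
Qed.

End derivative_measurability.

(** * Recovering a decaying function from its full mixed derivative *)

Section ray_representation.
Context {R : realType} {n : nat}.
Notation TR := (measurableTypeR R).
Notation rw := (@row_of_tuple R _).
Notation leb := (@lebesgue_measure R).
Notation E := 'rV[R]_n.
Notation dir i := (delta_mx 0 i : E).
Notation dirs js := [seq delta_mx 0 i : E | i <- js].

Definition heav (a : R) : R := (0 <= a)%R%:R.

Lemma measurable_heav : measurable_fun setT heav.
Proof.
rewrite (_ : heav = \1_(`[0, +oo[)); first exact: measurable_indic.
by apply/funext => a; rewrite indicE /heav mem_setE in_itv /= andbT.
Qed.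

Lemma heav_bounds a : 0 <= heav a <= 1.
Proof. by rewrite /heav; case: (0 <= a); rewrite ?lexx ?ler01. Qed.

Fixpoint combs (js : seq 'I_n) (s : seq R) : E :=
  match js, s with
  | j :: js', a :: s' => a *: dir j + combs js' s'
  | _, _ => 0
  end.

Definition heavs (s : seq R) : R := \prod_(a <- s) heav a.

Fixpoint wlines (c : R) (js : seq 'I_n) (xi : E) (s : seq R) : R :=
  match js, s with
  | j :: js', a :: s' => wline c (xi 0 j + a) * wlines c js' xi s'
  | _, _ => 1
  end.

Lemma combs_notin js s i : i \notin js -> combs js s 0 i = 0.
Proof.
elim: js s => [|j js IH] [|a s] /=; rewrite ?mxE //= inE negb_or => /andP[ij /IH H].
by rewrite (negPf ij) mulr0 add0r H.
Qed.

Lemma combs_coord js s i : uniq js -> size s = size js ->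
  combs js s 0 i = if i \in js then nth 0 s (index i js) else 0.
Proof.
elim: js s => [|j js IH] [|a s] //=; first by rewrite mxE.
move=> /andP[jn uj] [sz]; rewrite !mxE inE eqxx /= [i == j]eq_sym.
have [<-|ij] /= := eqVneq j i; first by rewrite combs_notin // mulr1 addr0.
by rewrite mulr0 add0r IH.
Qed.

Lemma combs_enum (t : n.-tuple TR) : combs (enum 'I_n) t = rw t.
Proof.
apply/rowP => i; rewrite combs_coord ?enum_uniq ?size_tuple ?size_enum_ord //.
by rewrite mem_enum mxE index_enum_ord (tnth_nth 0).
by rewrite card_ord.
Qed.

Lemma heavs_ge0 s : 0 <= heavs s.
Proof. by apply: prodr_ge0 => a _; case/andP: (heav_bounds a). Qed.

Lemma heavs_le1 s : heavs s <= 1.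
Proof.
rewrite /heavs; elim: s => [|a s IH]; first by rewrite big_nil.
rewrite big_cons; have /andP[a0 a1] := heav_bounds a.
by rewrite mulr_ile1 // heavs_ge0.
Qed.

Lemma bracket_wlines c js (xi : E) s : 0 < c -> uniq js -> size s = size js ->
  bracket (xi + combs js s) `^ (- ((size js)%:R * (1 + c))) <=
  2 `^ ((size js)%:R * (1 + c)) * wlines c js xi s.
Proof.
move=> c0 uj sz; set y := xi + combs js s.
have b0 := bracket_gt0 y.
have c1 : 0 <= 1 + c by rewrite addr_ge0 // ltW.
have key (a : R) : `|a| <= bracket y ->
   bracket y `^ (- (1 + c)) <= 2 `^ (1 + c) * wline c a.
  move=> ay; have a1 : 0 < 1 + `|a| by rewrite ltr_pwDl.
  rewrite /wline !powRN ler_pdivlMr ?powR_gt0 // mulrC.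
  rewrite ler_pdivrMr ?powR_gt0 // -powRM ?(ltW b0) //.
  apply: ge0_ler_powR => //; rewrite ?nnegrE ?mulr_ge0 ?(ltW a1) ?(ltW b0) //.
  by have := bracket_ge1 y; lra.
have : {in js, forall j, `|xi 0 j + nth 0 s (index j js)| <= bracket y}.
  by move=> j jjs; have := bracket_coord y j; rewrite mxE combs_coord // jjs.
move: (bracket y) b0 key => b b0 key {y}.
elim: js s uj sz => [|j js IH] [|a s] //=; first by rewrite mul0r oppr0 !powRr0 mulr1.
move=> /andP[jn uj] [sz] H.
rewrite -natr1 mulrDl mul1r opprD powRD; last by rewrite (gt_eqF b0) implybT.
rewrite powRD; last by rewrite pnatr_eq0 implybT.
rewrite [leRHS](_ : _ = 2 `^ ((size js)%:R * (1 + c)) * wlines c js xi s *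
  (2 `^ (1 + c) * wline c (xi 0 j + a))); last by ring.
apply: ler_pM; rewrite ?powR_ge0 //.
  apply: IH => // i ijs; have := H i; rewrite inE ijs orbT => /(_ isT).
  by rewrite /=; case: eqVneq => // ji; rewrite ji ijs in jn.
by apply: key; have := H j; rewrite inE eqxx /= => /(_ isT).
Qed.

Lemma measurable_combs d (U : measurableType d) m (js : seq 'I_n) (G : E -> U) (xi : E) :
  measurable_fun setT (G \o rw) -> size js = m ->
  measurable_fun setT (fun t : m.-tuple TR => G (xi + combs js t)).
Proof.
move=> mG sz.
have mc i : measurable_fun setT (fun t : m.-tuple TR => combs js t 0 i : TR).
  elim: js m sz {mG} => [|j js IH] m /= sz.
    rewrite (_ : (fun _ => _) = cst (0 : TR)); first exact: measurable_cst.
    by apply/funext => t; rewrite mxE.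
  case: m sz => // m [sz].
  rewrite (_ : (fun _ => _) = (fun t : m.+1.-tuple TR =>
     (thead t * dir j 0 i + combs js [tuple of behead t] 0 i : TR))); last first.
    by apply/funext => t; rewrite {1}(tuple_eta t) /= !mxE.
  apply: measurable_funD.
    by apply: measurable_funM; [exact: measurable_tnth|exact: measurable_cst].
  exact: (measurableT_comp (IH _ sz) (@measurable_behead _ TR m)).
rewrite (_ : (fun _ => _) = (G \o rw) \o (fun t : m.-tuple TR => [tuple (xi 0 i + combs js t 0 i : TR) | i < n])).
  apply: (measurableT_comp mG); apply/measurable_fun_tnthP => i.
  rewrite (_ : _ \o _ = (fun t : m.-tuple TR => (xi 0 i + combs js t 0 i : TR))).
    by apply: measurable_funD; [exact: measurable_cst|exact: mc].
  by apply/funext => t /=; rewrite tnth_mktuple.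
apply/funext => t /=; congr G; apply/rowP => i.
by rewrite !mxE tnth_mktuple.
Qed.

Lemma integrable_wline (c b : R) : 0 < c ->
  leb.-integrable setT (fun a : TR => (wline c (b + a))%:E).
Proof.
move=> c0; have mw : measurable_fun setT (fun a : TR => (wline c a)%:E).
  by apply/measurable_EFinP; apply: continuous_measurable_fun; exact: continuous_wline.
have mwb : measurable_fun setT (fun a : TR => (wline c (b + a))%:E).
  apply/measurable_EFinP.
  apply: (@measurableT_comp _ _ _ _ _ _ (@wline R c)); first by apply: continuous_measurable_fun; exact: continuous_wline.
  by apply: measurable_funD; [exact: measurable_cst|exact: measurable_id].
apply/integrableP; split => //.
under eq_integral do rewrite gee0_abs ?lee_fin ?wline_ge0 //.
have := integral_wline_lty c0.
rewrite (integral_affine1 b (@oner_neq0 R) mw) ?normr1 ?mul1e; last first.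
  by move=> x; rewrite lee_fin wline_ge0.
by rewrite (_ : (fun x => (wline c (1 * x + b))%:E) = (fun x => (wline c (b + x))%:E)) //; apply/funext => x; rewrite mul1r addrC.
Qed.

Lemma wlinesE c js (xi : E) m (t : m.-tuple TR) (j0 : 'I_n) : size js = m ->
  wlines c js xi t = wprod c (1 *: rw t + \row_i xi 0 (nth j0 js i)).
Proof.
move=> sz; have H s : size s = m -> wlines c js xi s =
    \prod_(i < m) wline c (xi 0 (nth j0 js i) + nth 0 s i).
  elim: js m s {t} sz => [|j js IH] [|m] [|a s] //=; first by rewrite big_ord0.
  by move=> [sz] [szs]; rewrite big_ord_recl /= (IH m).
rewrite H ?size_tuple //; apply: eq_bigr => i _.
by rewrite !mxE mul1r (tnth_nth 0) addrC.
Qed.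

Lemma integrable_wlines c js (xi : E) m : 0 < c -> size js = m ->
  (@Lam R m).-integrable setT (fun t => (wlines c js xi t)%:E).
Proof.
case: js => [|j js] c0 sz.
  rewrite -sz; have := @integrable_wprod R 0 c c0; rewrite /wprod.
  by under eq_fun do rewrite big_ord0.
have := @Rint_affine _ _ _ 1 (\row_(i < m) xi 0 (nth j (j :: js) i)) (@oner_neq0 R) (integrable_wprod m c0).
by case=> H _; under eq_fun do rewrite (wlinesE _ _ _ j sz).
Qed.

Lemma Rint_LamS2 m (F : m.+1.-tuple TR -> R) (g1 : TR -> R) (g2 : m.-tuple TR -> R) :
  measurable_fun setT F ->
  leb.-integrable setT (fun t => (g1 t)%:E) ->
  (@Lam R m).-integrable setT (fun t => (g2 t)%:E) ->
  (forall p, `|F (tcons p)| <= g1 p.1 * g2 p.2) ->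
  \int[@Lam R m.+1]_t F t = \int[@Lam R m]_t \int[leb]_x F (tcons (x, t)).
Proof.
move=> mF i1 i2 le.
have le' p : Normc.normc (F (tcons p))%:C <= g1 p.1 * g2 p.2 by rewrite normc_real.
exact: (congr1 (@complex.Re R) (cint_LamS2 (cmeas_real mF) i1 i2 le')).
Qed.

Lemma cvg_bracket_ray (y : E) j (e : R) : 0 < e ->
  bracket (y + a *: dir j) `^ (- e) @[a --> +oo%R] --> (0 : R).
Proof.
move=> e0.
have H : ((fun a : R => a `^ (- e)) \o (fun a : R => - `|y 0 j| + a)) @ +oo%R --> (0 : R).
  apply: (@cvg_comp _ _ _ (fun a : R => - `|y 0 j| + a) (fun a : R => a `^ (- e)) _ _ _ (@cvg_shift_pinfty _ (- `|y 0 j|))).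
  exact: powR_cvg_pinfty0.
apply: (squeeze_cvgr _ (cvg_cst 0) H).
near=> a; rewrite powR_ge0 /=.
have a0 : 0 < - `|y 0 j| + a.
  by rewrite addrC subr_gt0; near: a; apply: nbhs_pinfty_gt; exact: num_real.
rewrite !powRN lef_pV2 ?posrE ?powR_gt0 ?bracket_gt0 //.
apply: ge0_ler_powR; rewrite ?nnegrE ?(ltW e0) ?(ltW a0) ?(ltW (bracket_gt0 _)) //.
apply: le_trans (bracket_coord _ j); rewrite !mxE !eqxx mulr1.
by apply: le_trans (ler_norm _); rewrite lerD2r; exact: lerNnormlW.
Unshelve. all: by end_near.
Qed.

(** [g] vanishes at infinity along the ray, so its value at y is minus the integral of its
    derivative; [heav] turns the half-line into an integral over the line, to which Fubini's theorem
    can be applied. *)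
Lemma ray_step (g : E -> R) j y (B K c e : R) : 0 < e -> 0 < c ->
  (forall x, derivable g x (dir j)) -> (forall x, derivable ('D_(dir j) g) x (dir j)) ->
  (forall x, `|g x| <= B * bracket x `^ (- e)) ->
  (forall a, `|'D_(dir j) g (y + a *: dir j)| <= K * wline c (y 0 j + a)) ->
  leb.-integrable setT (fun a => (heav a * 'D_(dir j) g (y + a *: dir j))%:E) /\
  g y = - \int[leb]_a (heav a * 'D_(dir j) g (y + a *: dir j)).
Proof.
move=> e0 c0 dg dDg leg leD.
pose f a := 'D_(dir j) g (y + a *: dir j).
have df (a : R) : is_derive a (1 : R) (fun a => g (y + a *: dir j)) (f a) by exact: is_derive_line.
(* The second derivative along j makes the integrand continuous, as the fundamental theorem of
   calculus requires. *)
have cf : continuous f.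
  move=> a; apply: differentiable_continuous; apply/derivable1_diffP.
  have := @is_derive_line _ _ ('D_(dir j) g) y (dir j) a (dDg _).
  by case.
have iw := integrableZl measurableT K (integrable_wline (y 0 j) c0).
have if_ : leb.-integrable setT (EFin \o f).
  apply: (le_integrable measurableT _ _ iw).
    by apply/measurable_EFinP; exact: continuous_measurable_fun.
  by move=> a _; rewrite lee_fin; apply: le_trans (leD a) (ler_norm _).
split.
  apply: (le_integrable measurableT _ _ if_).
    apply/measurable_EFinP; apply: measurable_funM; first exact: measurable_heav.
    exact: continuous_measurable_fun.
  move=> a _; rewrite lee_fin normrM; have /andP[h1 h2] := heav_bounds a.
  by rewrite (ger0_norm h1) ler_piMl.
have if0 : leb.-integrable `[0, +oo[ (EFin \o f) by exact: integrableS if_.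
have cF : g (y + a *: dir j) @[a --> +oo%R] --> (0 : R).
  have H0 : B * bracket (y + a *: dir j) `^ (- e) @[a --> +oo%R] --> (0 : R).
    by rewrite -[X in _ --> X](mulr0 B); apply: cvgMr; exact: cvg_bracket_ray.
  have H1 : - (B * bracket (y + a *: dir j) `^ (- e)) @[a --> +oo%R] --> (0 : R).
    by rewrite -[X in _ --> X]oppr0; exact: cvgN.
  apply: (squeeze_cvgr _ H1 H0); apply: nearW => a.
  by rewrite -ler_norml.
have := FTC_ray df cf if0 cF; rewrite scale0r addr0 sub0r => H.
rewrite -[LHS]opprK -H; congr (- _).
rewrite /Rintegral integral_mkcond; congr fine; apply: eq_integral => a _.
rewrite patchE mem_setE in_itv /= andbT /heav /f.
by case: (0 <= a); rewrite ?mul1r ?mul0r.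
Qed.

Lemma est_rderivable ws m B (f : E -> R) : est (rev ws) m B f -> rderivable ws f.
Proof.
move=> H; suff : forall pre suf, ws = pre ++ suf -> rderivable suf f by move/(_ [::] ws erefl).
move=> pre suf; elim: suf pre => [//|v suf IH] pre E1 /=; split.
  by apply: (IH (rcons pre v)); rewrite cat_rcons.
by rewrite E1 in H; have [] := est_suffix H.
Qed.

Lemma measurable_rderive ws (f : E -> R) : rderivable ws f ->
  measurable_fun setT (f \o rw) -> measurable_fun setT (rderive ws f \o rw).
Proof.
move=> + mf; elim: ws => //= v ws IH [/IH mD dD].
exact: measurable_derive.
Qed.

Lemma measurable_heavs m : measurable_fun setT (fun t : m.-tuple TR => heavs t).
Proof.
rewrite (_ : (fun _ => _) = (fun t : m.-tuple TR => \prod_(i < m) heav (tnth t i))).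
  apply: measurable_prod => i _; apply: (measurableT_comp measurable_heav).
  exact: measurable_tnth.
by apply/funext => t; rewrite /heavs big_tuple.
Qed.

(** One ray for each coordinate of [js], each contributing a sign; [pre] collects the coordinates
    peeled off by the induction. The total gain [e] is shared out as a gain [c] per coordinate,
    which dominates the integrand by a product of integrable weights on lines. *)
Lemma ray_rep f (e B c : R) : 0 < e -> 0 < c -> n%:R * c <= e ->
  measurable_fun setT (f \o rw) -> forall js pre m, size js = m -> uniq js ->
  est (rev (dirs (pre ++ js))) (- e) B f ->
  forall xi, f xi =
    \int[@Lam R m]_t ((-1) ^+ m * (heavs t * rderive (dirs js) f (xi + combs js t))).
Proof.
move=> e0 c0 nce mf; elim=> [|j js IH] pre m /= sz.
  move=> _ _ xi; rewrite -sz /Rintegral.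
  by rewrite Lam0 /= /heavs big_nil expr0 !mul1r addr0.
case: m sz => // m [sz] /andP[jn uj] H xi.
have Hs : est (rev (dirs pre ++ dir j :: dirs js)) (- e) B f by move: H; rewrite map_cat.
have [d1 d2 b1 b2] := est_suffix Hs.
have B0 := est_ge0 H.
have H' : est (rev (dirs (rcons pre j ++ js))) (- e) B f by rewrite cat_rcons.
rewrite (IH _ m sz uj H' xi).
set g := rderive (dirs js) f.
have uj' : uniq (j :: js) by rewrite /= jn.
have szn : ((size js).+1 <= n)%N.
  by rewrite -[n in (_ <= n)%N]card_ord -[X in (X <= _)%N](card_uniqP uj') max_card.
pose C := B * 2 `^ ((size js).+1%:R * (1 + c)).
have leDg s : size s = (size js).+1 ->
    `|'D_(dir j) g (xi + combs (j :: js) s)| <= C * wlines c (j :: js) xi s.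
  move=> szs; apply: le_trans (b2 _) _; rewrite /C -mulrA ler_wpM2l //.
  rewrite size_map; apply: le_trans (bracket_wlines xi c0 uj' szs); apply: ler_powR_bracket.
  rewrite /= mulrDr mulr1 opprD addrC lerD2l lerN2; apply: le_trans nce.
  by rewrite ler_wpM2r ?(ltW c0) // ler_nat.
pose F (t : m.+1.-tuple TR) := (-1) ^+ m.+1 * (heavs t * 'D_(dir j) g (xi + combs (j :: js) t)).
have FE a (t : m.-tuple TR) : F (tcons (a, t)) =
    ((-1) ^+ m.+1 * heavs t) * (heav a * 'D_(dir j) g (xi + combs js t + a *: dir j)).
  rewrite /F /heavs /= big_cons -addrA [combs js t + _]addrC; ring.
have mDg : measurable_fun setT ('D_(dir j) g \o rw).
  apply: (@measurable_rderive (dir j :: dirs js)) mf; rewrite /=; split => //.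
  by have := est_rderivable H; rewrite map_cat => /rderivable_cat[[]].
have mF : measurable_fun setT F.
  apply: measurable_funM; first exact: measurable_cst.
  apply: measurable_funM; first exact: measurable_heavs.
  by apply: (measurable_combs _ mDg); rewrite /= sz.
have leF p : `|F (tcons p)| <= wline c (xi 0 j + p.1) * (C * wlines c js xi p.2).
  rewrite /F !normrM normrX normrN1 expr1n mul1r ger0_norm ?heavs_ge0 //.
  apply: le_trans (_ : 1 * `|'D_(dir j) g (xi + combs (j :: js) (tcons p))| <= _).
    by rewrite ler_wpM2r // heavs_le1.
  rewrite mul1r; apply: le_trans (leDg _ _) _; first by rewrite /= size_tuple sz.
  by rewrite /= mulrCA.
rewrite [RHS](Rint_LamS2 mF (integrable_wline _ c0) (integrableZl measurableT C (integrable_wlines xi c0 sz)) leF).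
apply: eq_Rintegral => t _; under [in RHS]eq_Rintegral do rewrite FE.
have leq0 : 0 < e + (size js)%:R by rewrite ltr_wpDr.
have szt : size (t : seq R) = size js by rewrite size_tuple.
have [iS E2] : leb.-integrable setT
      (fun a => (heav a * 'D_(dir j) g (xi + combs js t + a *: dir j))%:E) /\
    g (xi + combs js t) =
   - \int[leb]_a (heav a * 'D_(dir j) g (xi + combs js t + a *: dir j)).
  apply: (@ray_step _ _ _ B (C * wlines c js xi t) c (e + (size js)%:R)) => //.
    by move=> x; have := b1 x; rewrite size_map -opprD.
  move=> a; have := leDg (a :: t); rewrite /= szt => /(_ erefl).
  rewrite -addrA [combs js t + _]addrC => /le_trans; apply.
  by rewrite !mxE combs_notin // addr0 -mulrA [wlines _ _ _ _ * _]mulrC.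
by rewrite E2 RintegralZl // exprS; ring.
Qed.

(** Indicator of the orthant above xi as a function of eta. In the operator bound it is read as a
    function of xi, where it cuts off the orthant below eta. *)
Definition chi (xi eta : E) : R := \prod_(i < n) heav (eta 0 i - xi 0 i).

Lemma chi_bounds xi eta : 0 <= chi xi eta <= 1.
Proof.
apply: (big_ind (fun y => 0 <= y <= 1)) => [|a b /andP[a0 a1] /andP[b0 b1]|i _].
- by rewrite ler01 lexx.
- by rewrite mulr_ge0 // mulr_ile1.
- exact: heav_bounds.
Qed.

Lemma measurable_chi d (U : measurableType d) (p q : U -> n.-tuple TR) :
  measurable_fun setT p -> measurable_fun setT q ->
  measurable_fun setT (fun u => chi (rw (p u)) (rw (q u))).
Proof.
move=> mp mq; apply: measurable_prod => i _.
apply: (@measurableT_comp _ _ _ _ _ _ heav); first exact: measurable_heav.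
apply: measurable_funB.
  exact: (measurableT_comp (measurable_row_coord i) mq).
exact: (measurableT_comp (measurable_row_coord i) mp).
Qed.

(** Translating the variable by xi removes xi from the derivative: it survives only in [chi]. This
    separation lets Fubini's theorem turn the operator into an average over eta. *)
Lemma ray_full f (e B : R) : (0 < n)%N -> 0 < e -> measurable_fun setT (f \o rw) ->
  est (rev (dirs (enum 'I_n))) (- e) B f ->
  [/\ measurable_fun setT (rderive (dirs (enum 'I_n)) f \o rw),
    forall x, `|rderive (dirs (enum 'I_n)) f x| <= B * bracket x `^ (- (n%:R + e)) &
    forall xi, f xi =
    \int[@Lam R n]_t ((-1) ^+ n * (chi xi (rw t) * rderive (dirs (enum 'I_n)) f (rw t)))].
Proof.
move=> n0 e0 mf H; set D := rderive _ f.
have mD : measurable_fun setT (D \o rw).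
  by apply: measurable_rderive mf; exact: est_rderivable H.
have bD x : `|D x| <= B * bracket x `^ (- (n%:R + e)).
  have [v [s Es]] : exists v s, dirs (enum 'I_n) = v :: s.
    case E1: (dirs (enum 'I_n)) => [|v s]; last by exists v, s.
    by have := congr1 size E1; rewrite size_map size_enum_ord => nE; rewrite nE in n0.
  have := H; rewrite Es => /(@est_suffix _ _ [::])[_ _ _ /(_ x)].
  rewrite -/(size (v :: s)) -Es size_map size_enum_ord -opprD [e + _]addrC.
  by rewrite /D.
split => // xi; have en : 0 < e / n%:R by rewrite divr_gt0 // ltr0n.
have nce : n%:R * (e / n%:R) <= e by rewrite mulrCA mulfV ?mulr1 // pnatr_eq0 -lt0n.
rewrite (ray_rep e0 en nce mf (size_enum_ord n) (enum_uniq _) (pre := [::]) H xi).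
pose F y := (-1) ^+ n * (chi xi y * D y).
have iF : (@Lam R n).-integrable setT (fun t => (F (rw t))%:E).
  have nq : n%:R < n%:R + e by rewrite ltrDl.
  apply: (le_integrable measurableT _ _ (integrableZl measurableT B (integrable_bracket n0 nq))).
    apply/measurable_EFinP; apply: measurable_funM; first exact: measurable_cst.
    apply: measurable_funM => //.
    apply: measurable_prod => i _; apply: (@measurableT_comp _ _ _ _ _ _ heav); first exact: measurable_heav.
    by apply: measurable_funB; [exact: measurable_row_coord|exact: measurable_cst].
  move=> t _; rewrite lee_fin; apply: le_trans (ler_norm _).
  rewrite !normrM normrX normrN1 expr1n mul1r.
  have /andP[c0 c1] := chi_bounds xi (rw t); rewrite (ger0_norm c0).
  by apply: le_trans (bD _); rewrite ler_piMl.
have [_ ->] := Rint_affine xi (@oner_neq0 R) iF; rewrite normr1 expr1n mul1r.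
apply: eq_Rintegral => t _; rewrite /F scale1r combs_enum addrC -/D; congr (_ * (_ * _)).
rewrite /heavs big_tuple; apply: eq_bigr => i _.
by rewrite !mxE addrK.
Qed.

End ray_representation.

Section weighted_cauchy_schwarz.
Context {R : realType} d (T : measurableType d) (mu : {measure set T -> \bar R}).

(** The integral of A (v - l)^2 is a nonnegative quadratic polynomial in l, evaluated at l = b / a.
    If a = 0 then b = 0, because |b| <= M a. *)
Lemma Rint_cauchy_schwarz (A v : T -> R) (M : R) :
  (forall t, 0 <= A t) -> mu.-integrable setT (fun t => (A t)%:E) ->
  measurable_fun setT v -> (forall t, `|v t| <= M) ->
  [/\ mu.-integrable setT (fun t => (A t * v t)%:E),
      mu.-integrable setT (fun t => (A t * v t ^+ 2)%:E) &
      (\int[mu]_t (A t * v t)) ^+ 2 <= \int[mu]_t A t * \int[mu]_t (A t * v t ^+ 2)].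
Proof.
move=> A0 iA mv leM.
have mA : measurable_fun setT A by apply/measurable_EFinP; exact: measurable_int iA.
have i1 : mu.-integrable setT (fun t => (A t * v t)%:E).
  apply: (le_integrable measurableT _ _ (integrableZl measurableT M iA)).
    by apply/measurable_EFinP; exact: measurable_funM.
  move=> t _; rewrite lee_fin !normrM [leLHS]mulrC ler_wpM2r //.
  by apply: le_trans (leM t) (ler_norm _).
have i2 : mu.-integrable setT (fun t => (A t * v t ^+ 2)%:E).
  apply: (le_integrable measurableT _ _ (integrableZl measurableT (M ^+ 2) iA)).
    by apply/measurable_EFinP; apply: measurable_funM => //; exact: measurable_funX.
  move=> t _; rewrite lee_fin !normrM [leLHS]mulrC ler_wpM2r //.
  by have H := le_trans (leM t) (ler_norm _); apply: ler_pM.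
split => //.
set a := \int[mu]_t A t; set b := \int[mu]_t (A t * v t); set c := \int[mu]_t _.
have a0 : 0 <= a by apply: Rintegral_ge0.
have key l : 0 <= c - 2 * l * b + l ^+ 2 * a.
  have E1 : \int[mu]_t (A t * (v t - l) ^+ 2) = c - 2 * l * b + l ^+ 2 * a.
    have j1 : mu.-integrable setT (EFin \o (fun t => 2 * l * (A t * v t))) := integrableZl measurableT (2 * l) i1.
    have j2 : mu.-integrable setT (EFin \o (fun t => l ^+ 2 * A t)) := integrableZl measurableT (l ^+ 2) iA.
    have j3 : mu.-integrable setT (EFin \o (fun t => A t * v t ^+ 2 - 2 * l * (A t * v t))) := integrableB measurableT i2 j1.
    rewrite /a /b /c -!RintegralZl // -RintegralB // -RintegralD //.
    by apply: eq_Rintegral => t _; ring.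
  by rewrite -E1; apply: Rintegral_ge0 => t _; rewrite mulr_ge0 // sqr_ge0.
have [a_0|] := eqVneq a 0.
  suff -> : b = 0 by rewrite expr0n a_0 mul0r.
  have bM : `|b| <= M * a.
    rewrite /a -RintegralZl //; apply: le_trans (le_normr_Rintegral _ _) _ => //.
    apply: le_Rintegral => //; first exact: integrable_norm i1.
      exact: (integrableZl measurableT M iA).
    by move=> t _; rewrite normrM mulrC (ger0_norm (A0 t)) ler_wpM2r.
  by apply/eqP; rewrite -normr_le0; move: bM; rewrite a_0 mulr0.
move=> an0; have ap : 0 < a by rewrite lt_def an0.
have := key (b / a); rewrite -(pmulr_rge0 _ ap).
have -> : a * (c - 2 * (b / a) * b + (b / a) ^+ 2 * a) = a * c - b ^+ 2 by field.
by rewrite subr_ge0.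
Qed.

End weighted_cauchy_schwarz.

(** * L^2 bound for an operator whose symbol has mixed xi-derivatives *)

Section operator_bound.
Context {R : realType} {n : nat}.
Notation TR := (measurableTypeR R).
Notation rw := (@row_of_tuple R n).
Notation L := (@Lam R n).
Notation normc := (@Normc.normc R).
Notation E := 'rV[R]_n.
Implicit Types (u : E -> R[i]).

Lemma L2normE (f : E -> R[i]) : L2norm f = (sqnorm f `^ (2^-1))%E.
Proof.
rewrite /L2norm unlock; congr (_ `^ _)%E; apply: eq_integral => t _.
by rewrite /= ger0_norm ?normc_ge0 // powR_mulrn ?normc_ge0.
Qed.

Lemma sqnorm_ge0 (f : E -> R[i]) : (0 <= sqnorm f)%E.
Proof. by apply: integral_ge0 => t _; rewrite lee_fin sqr_ge0. Qed.

Lemma L2norm_le_of_sqnorm (F G : E -> R[i]) (K : R) : 0 <= K ->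
  (sqnorm F <= (K ^+ 2)%:E * sqnorm G)%E -> (L2norm F <= K%:E * L2norm G)%E.
Proof.
move=> K0 H; rewrite !L2normE.
have K2 : (0 <= (K ^+ 2)%:E)%E by rewrite lee_fin exprn_ge0.
have -> : K%:E = ((K ^+ 2)%:E `^ (2^-1))%E.
  by rewrite poweR_EFin powR12_sqrt ?exprn_ge0 // sqrtr_sqr ger0_norm.
rewrite -poweRM ?sqnorm_ge0 //; apply: gt0_ler_poweR => //.
- by rewrite in_itv /= sqnorm_ge0 leey.
- by rewrite in_itv /= leey andbT mule_ge0 // sqnorm_ge0.
Qed.

Lemma sqnormZ (c : R) (f : E -> R[i]) : cmeas (f \o rw) ->
  sqnorm (fun x => c%:C * f x) = ((c ^+ 2)%:E * sqnorm f)%E.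
Proof.
move=> mf; rewrite /sqnorm -ge0_integralZl_EFin ?exprn_even_ge0 //; last 2 first.
- by move=> t _; rewrite lee_fin sqr_ge0.
- exact: measurable_sqnorm.
apply: eq_integral => t _.
by rewrite Normc.normcM normc_real exprMn real_normK ?num_real.
Qed.

Variable h : R.
Hypotheses (h0 : 0 < h) (n0 : (0 < n)%N).

Lemma cmeas_Op (a : E * E -> R[i]) u (B k : R) : schwartz u ->
  cmeas (fun p : n.-tuple TR * n.-tuple TR => a (rw p.1, rw p.2)) ->
  (forall x xi, normc (a (x, xi)) <= B * bracket xi `^ k) ->
  cmeas (fun t => Op h a u (rw t)).
Proof.
move=> su ma lea.
have mu : cmeas (uhat h u \o rw) by exact: cmeas_uhat.
have [ig _ _ _] := ghat_props h0 n0 k su.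
pose G (p : n.-tuple TR * n.-tuple TR) : R[i] :=
  fker h (rw p.1) (rw p.2) * (a (rw p.1, rw p.2) * uhat h u (rw p.2)).
have mG : cmeas G.
  apply: cmeasM; first exact: cmeas_fker.
  by apply: cmeasM => //; exact: (cmeas_comp mu measurable_snd).
have iG t : cintegrable L (fun s => G (t, s)).
  apply: (cintegrable_le _ (integrableZl measurableT B (integrable_normc ig))).
    by case: mG => m1 m2; split; [exact: (measurableT_comp m1 (measurable_pair1 t))
                                 |exact: (measurableT_comp m2 (measurable_pair1 t))].
  move=> s; rewrite !Normc.normcM normc_fker mul1r normc_real ger0_norm ?powR_bracket_ge0 //.
  by rewrite mulrA ler_wpM2r ?normc_ge0.
have H := cmeas_cint_param mG iG.
rewrite (_ : (fun _ => _) = (fun t => ((2 * pi * h) ^- n)%:C * cint L (fun s => G (t, s)))).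
  by apply: cmeasM H; exact: cmeas_cst.
by apply/funext => t; rewrite Op_fourier.
Qed.

(* The integral representation [ray_full] turns the operator into an average, with
   the integrable weight [<eta>^(-n-e)], of Fourier transforms of restrictions of
   [<xi>^k uhat] to orthants; each of them is bounded by Plancherel. *)
Lemma Op_est_le (r : E * E -> R[i]) (k e B : R) u : 0 < e -> schwartz u ->
  cmeas (fun p : n.-tuple TR * n.-tuple TR => r (rw p.1, rw p.2)) ->
  (forall x, est (rev [seq delta_mx 0 i | i <- enum 'I_n]) (- e) B
      (fun xi => complex.Re (r (x, xi)) * bracket xi `^ (- k))) ->
  (forall x, est (rev [seq delta_mx 0 i | i <- enum 'I_n]) (- e) B
      (fun xi => complex.Im (r (x, xi)) * bracket xi `^ (- k))) ->
  (L2norm (Op h r u) <=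
    (2 * B * \int[L]_t bracket (rw t) `^ (- (n%:R + e)))%:E * sobolev_norm h k u)%E.
Proof.
move=> e0 su mr estR estI.
pose ds : seq E := [seq delta_mx 0 i | i <- enum 'I_n].
have [g gE] : exists g, g = ghat h k u by exists (ghat h k u).
have [ig [Mg leMg] cgR cgI] := ghat_props h0 n0 k su.
rewrite -gE in ig leMg cgR cgI.
pose A (t : n.-tuple TR) := bracket (rw t) `^ (- (n%:R + e)).
have nq : n%:R < n%:R + e by rewrite ltrDl.
have iA : L.-integrable setT (fun t => (A t)%:E) by exact: (integrable_bracket n0 nq).
have A0 t : 0 <= A t by exact: powR_bracket_ge0.
have B0 : 0 <= B := est_ge0 (estR 0).
pose b1 x xi := complex.Re (r (x, xi)) * bracket xi `^ (- k).
pose b2 x xi := complex.Im (r (x, xi)) * bracket xi `^ (- k).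
have mw : measurable_fun setT (fun t : n.-tuple TR => bracket (rw t) `^ (- k)).
  by apply: (measurableT_comp (measurable_powR _)); exact: measurable_bracket.
have E1 (x : E) : rw [tuple (x 0 i : TR) | i < n] = x.
  by apply/rowP => i; rewrite mxE tnth_mktuple.
have mb1 x : measurable_fun setT (b1 x \o rw).
  apply: measurable_funM => //; case: mr => m1 _.
  have := measurableT_comp m1 (measurable_pair1 [tuple (x 0 i : TR) | i < n]).
  by apply: eq_measurable_fun => t _ /=; rewrite E1.
have mb2 x : measurable_fun setT (b2 x \o rw).
  apply: measurable_funM => //; case: mr => _ m1.
  have := measurableT_comp m1 (measurable_pair1 [tuple (x 0 i : TR) | i < n]).
  by apply: eq_measurable_fun => t _ /=; rewrite E1.
pose D x eta : R[i] := (rderive ds (b1 x) eta) +i* (rderive ds (b2 x) eta).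
pose sg : R[i] := ((-1) ^+ n)%:C.
have nsg : normc sg = 1 by rewrite normc_real normrX normrN1 expr1n.
have mD x : cmeas (D x \o rw).
  have [m1 _ _] := ray_full n0 e0 (mb1 x) (estR x).
  by have [m2 _ _] := ray_full n0 e0 (mb2 x) (estI x).
have leD x t : normc (D x (rw t)) <= 2 * B * A t.
  have [_ l1 _] := ray_full n0 e0 (mb1 x) (estR x).
  have [_ l2 _] := ray_full n0 e0 (mb2 x) (estI x).
  apply: le_trans (normc_le_ReIm _) _.
  by have := l1 (rw t); have := l2 (rw t); rewrite /D /A /=; lra.
(* The factor <xi>^(-k) goes into the represented function and <xi>^k into [g]; xi then occurs only
   in the orthant and in [g]. *)
have rE x xi : r (x, xi) * uhat h u xi =
    cint L (fun t => (chi xi (rw t))%:C * (sg * D x (rw t))) * g xi.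
  have -> : cint L (fun t => (chi xi (rw t))%:C * (sg * D x (rw t))) =
      (bracket xi `^ (- k))%:C * r (x, xi).
    have [_ _ H1] := ray_full n0 e0 (mb1 x) (estR x).
    have [_ _ H2] := ray_full n0 e0 (mb2 x) (estI x).
    apply: ReIm_eq.
      rewrite ReM /= mul0r subr0 mulrC -/(b1 x xi) (H1 xi).
      by apply: eq_Rintegral => t _; rewrite ?ReM ?ImM /=; ring.
    rewrite ImM /= mul0r addr0 mulrC -/(b2 x xi) (H2 xi).
    by apply: eq_Rintegral => t _; rewrite ?ReM ?ImM /=; ring.
  rewrite gE /ghat mulrACA -realcM mulrC -powRD; last first.
    by rewrite (gt_eqF (bracket_gt0 _)) implybT.
  by rewrite addNr powRr0 mul1r mulrC.
have mg := cintegrable_cmeas ig.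
(* For fixed t this does not involve the symbol, so Plancherel applies in x although the symbol
   depends on x; the latter enters through [D x] alone, which is bounded uniformly in x. *)
pose V (x : E) (t : n.-tuple TR) := fourier h (fun xi => (chi xi (rw t))%:C * g xi) x.
have iV t : cintegrable L ((fun xi => (chi xi (rw t))%:C * g xi) \o rw).
  apply: (cintegrable_le _ (integrable_normc ig)).
    by apply: cmeasM => //; apply: cmeas_real; apply: measurable_chi => //; exact: measurable_cst.
  move=> s; have /andP[c0 c1] := chi_bounds (rw s) (rw t).
  by rewrite Normc.normcM normc_real ger0_norm // ler_piMl ?normc_ge0.
have mV : cmeas (fun p : n.-tuple TR * n.-tuple TR => V (rw p.1) p.2).
  apply: (cmeas_cint_param (m2 := L) (G := fun q : (n.-tuple TR * n.-tuple TR) * n.-tuple TR =>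
     fker h (rw q.1.1) (rw q.2) * ((chi (rw q.2) (rw q.1.2))%:C * g (rw q.2)))).
    have f1 : measurable_fun setT (fun q : (n.-tuple TR * n.-tuple TR) * n.-tuple TR => q.1.1).
      exact: (measurableT_comp measurable_fst measurable_fst).
    have f2 : measurable_fun setT (fun q : (n.-tuple TR * n.-tuple TR) * n.-tuple TR => q.1.2).
      exact: (measurableT_comp measurable_snd measurable_fst).
    apply: cmeasM; first exact: cmeas_fker.
    apply: cmeasM; first by apply: cmeas_real; exact: measurable_chi.
    exact: (cmeas_comp mg measurable_snd).
  by move=> q; exact: (cintegrable_fker h (rw q.1) (iV q.2)).
have lechi s t : normc ((chi (rw s) (rw t))%:C * g (rw s)) <= normc (g (rw s)).
  have /andP[c0 c1] := chi_bounds (rw s) (rw t).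
  by rewrite Normc.normcM normc_real ger0_norm // ler_piMl ?normc_ge0.
pose Ng := \int[L]_t normc (g (rw t)).
have leV x t : normc (V x t) <= Ng.
  apply: le_trans (normc_fourier_le h x (iV t)) _; apply: le_Rintegral => //.
  - exact: integrable_normc (iV t).
  - exact: integrable_normc ig.
have mVx x : measurable_fun setT (fun t => normc (V (rw x) t)).
  exact: (measurableT_comp (measurable_normc mV) (measurable_pair1 x)).
pose c0 : R := (2 * pi * h) ^- n.
have OpE x : Op h r u x = c0%:C * cint L (fun t => sg * D x (rw t) * V x t).
  rewrite Op_fourier //; congr (_ * _).
  pose G (p : n.-tuple TR * n.-tuple TR) : R[i] :=
    fker h x (rw p.1) * g (rw p.1) * ((chi (rw p.1) (rw p.2))%:C * (sg * D x (rw p.2))).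
  have mG : cmeas G.
    apply: cmeasM.
      apply: cmeasM; last exact: (cmeas_comp mg measurable_fst).
      exact: (cmeas_comp (cmeas_fker2 h x) measurable_fst).
    apply: cmeasM; first by apply: cmeas_real; exact: measurable_chi.
    apply: cmeasM; first exact: cmeas_cst.
    exact: (cmeas_comp (mD x) measurable_snd).
  have leG p : normc (G p) <= normc (g (rw p.1)) * (2 * B * A p.2).
    rewrite /G !Normc.normcM normc_fker mul1r ler_wpM2l ?normc_ge0 // nsg mul1r.
    have /andP[c1 c2] := chi_bounds (rw p.1) (rw p.2).
    apply: le_trans (leD x p.2); rewrite normc_real ger0_norm //.
    by rewrite ler_piMl ?normc_ge0.
  have iA2 := integrableZl measurableT (2 * B) iA.
  transitivity (cint L (fun s => cint L (fun t => G (s, t)))).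
    apply: eq_cint => s; rewrite rE mulrCA mulrC -cintZl; last first.
      apply: (cintegrable_le _ iA2).
        apply: cmeasM; first by apply: cmeas_real; apply: measurable_chi => //; exact: measurable_cst.
        by apply: cmeasM; [exact: cmeas_cst|exact: mD].
      move=> t; rewrite !Normc.normcM nsg mul1r.
      have /andP[c1 c2] := chi_bounds (rw s) (rw t).
      apply: le_trans (leD x t); rewrite normc_real ger0_norm //.
      by rewrite ler_piMl ?normc_ge0.
    by apply: eq_cint => t; rewrite /G.
  rewrite (cint_fubini mG (integrable_normc ig) iA2 leG); apply: eq_cint => t.
  rewrite /V /fourier -cintZl; last exact: (cintegrable_fker h x (iV t)).
  by apply: eq_cint => s; rewrite /G /=; ring.
pose I := \int[L]_t A t.
have I0 : 0 <= I by apply: Rintegral_ge0.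
have c00 : 0 <= c0 by rewrite invr_ge0 exprn_ge0 // !mulr_ge0 ?pi_ge0 // ltW.
(* Cauchy-Schwarz with respect to the weight [A] costs one factor [I]; the integration in x and t
   below produces the second one, so the operator norm contains [I] to the first power. *)
have leOp x : normc (Op h r u (rw x)) ^+ 2 <=
    (c0 * (2 * B)) ^+ 2 * I * \int[L]_t (A t * normc (V (rw x) t) ^+ 2).
  have leV' t : `|normc (V (rw x) t)| <= Ng by rewrite ger0_norm ?normc_ge0.
  have [i1 i2 CS] := Rint_cauchy_schwarz A0 iA (mVx x) leV'.
  rewrite -mulrA; apply: le_trans (ler_wpM2l (sqr_ge0 (c0 * (2 * B))) CS).
  rewrite -exprMn lerXn2r ?nnegrE ?normc_ge0 //.
    by rewrite !mulr_ge0 //; apply: Rintegral_ge0 => t _; rewrite mulr_ge0 ?normc_ge0.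
  rewrite OpE Normc.normcM normc_real ger0_norm // -mulrA ler_wpM2l //.
  have leDV t : normc (sg * D (rw x) (rw t) * V (rw x) t) <= 2 * B * (A t * normc (V (rw x) t)).
    by rewrite !Normc.normcM nsg mul1r mulrA ler_wpM2r ?normc_ge0.
  have iF : cintegrable L (fun t => sg * D (rw x) (rw t) * V (rw x) t).
    apply: (cintegrable_le _ (integrableZl measurableT (2 * B) i1)).
      apply: cmeasM; first by apply: cmeasM; [exact: cmeas_cst|exact: mD].
      by case: mV => m1 m2; split; [exact: (measurableT_comp m1 (measurable_pair1 x))
                                 |exact: (measurableT_comp m2 (measurable_pair1 x))].
    exact: leDV.
  apply: le_trans (normc_cint_le iF) _.
  rewrite -RintegralZl //; apply: le_Rintegral => //.
  - exact: integrable_normc iF.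
  - exact: (integrableZl measurableT (2 * B) i1).
have leb x xi : normc (r (x, xi)) <= 2 * B * bracket xi `^ k.
  have := est_bound (estR x) xi; have := est_bound (estI x) xi.
  have w0 : 0 < bracket xi `^ k by rewrite powR_gt0 // bracket_gt0.
  have e1 : bracket xi `^ (- e) <= 1.
    by rewrite -[leRHS](powRr0 (bracket xi)); apply: ler_powR_bracket; rewrite oppr_le0 ltW.
  rewrite !normrM !powRN normfV !(gtr0_norm w0) !ler_pdivrMr // => l1 l2.
  apply: le_trans (normc_le_ReIm _) _.
  have : B * (bracket xi `^ e)^-1 * bracket xi `^ k <= B * bracket xi `^ k.
    by rewrite ler_wpM2r ?(ltW w0) // ler_piMr // -powRN.
  by lra.
have mOp := cmeas_Op su mr leb.
rewrite /sobolev_norm; apply: L2norm_le_of_sqnorm.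
  by rewrite !mulr_ge0.
(* The Sobolev norm carries the same prefactor [c0] as the operator, so no power of h remains. *)
have -> : Op h (fun p => (bracket p.2 `^ k)%:C) u = (fun x => c0%:C * fourier h g x).
  by apply/funext => x; rewrite Op_fourier // gE.
rewrite sqnormZ; last exact: cmeas_fourier.
pose W (p : n.-tuple TR * n.-tuple TR) : \bar R := (A p.2 * normc (V (rw p.1) p.2) ^+ 2)%:E.
have mW : measurable_fun setT W.
  apply/measurable_EFinP; apply: measurable_funM.
    apply: (measurableT_comp _ measurable_snd).
    by apply: (measurableT_comp (measurable_powR _)); exact: measurable_bracket.
  by apply: measurable_funX; exact: measurable_normc.
have W0 p : (0 <= W p)%E by rewrite lee_fin mulr_ge0 // sqr_ge0.
have mWx : measurable_fun setT (fun x => \int[L]_t W (x, t))%E.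
  exact: (measurable_fun_fubini_tonelli_F (m2 := L) _ mW W0).
have Wx0 x : (0 <= \int[L]_t W (x, t))%E by apply: integral_ge0.
pose Q := (c0 * (2 * B)) ^+ 2 * I.
have Q0 : 0 <= Q by rewrite mulr_ge0 ?sqr_ge0.
apply: (@le_trans _ _ (\int[L]_x (Q%:E * \int[L]_t W (x, t)))%E).
  apply: ge0_le_integral => //.
  - by move=> x _; rewrite lee_fin sqr_ge0.
  - exact: measurable_sqnorm.
  - exact: measurable_funeM.
  - move=> x _; apply: le_trans (_ : (_ <= (Q * \int[L]_t (A t * normc (V (rw x) t) ^+ 2))%:E)%E) _.
      by rewrite lee_fin; exact: leOp.
    have leV' t : `|normc (V (rw x) t)| <= Ng by rewrite ger0_norm ?normc_ge0.
    have [_ i2 _] := Rint_cauchy_schwarz A0 iA (mVx x) leV'.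
    by rewrite EFinM /Rintegral fineK //; exact: (integrable_fin_num _ i2).
rewrite ge0_integralZl_EFin //.
have -> : (\int[L]_x \int[L]_t W (x, t) = \int[L]_t \int[L]_x W (x, t))%E.
  exact: (fubini_tonelli (m1 := L) (m2 := L) W mW W0).
have leW t : (\int[L]_x W (x, t) <= (A t)%:E * sqnorm (fourier h g))%E.
  have mt : measurable_fun setT (fun s => chi (rw s) (rw t)).
    by apply: measurable_chi => //; exact: measurable_cst.
  have := sqnorm_fourier_restrict h0 (chi := fun xi => chi xi (rw t)) ig leMg cgR cgI mt
     (fun x => chi_bounds x (rw t)).
  have At : (0 <= (A t)%:E)%E by rewrite lee_fin.
  move=> H; apply: le_trans _ (lee_wpmul2l At H).
  rewrite -ge0_integralZl_EFin //; last 2 first.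
  - by move=> s _; rewrite lee_fin sqr_ge0.
  - by apply: measurable_sqnorm; exact: cmeas_fourier.
apply: (@le_trans _ _ (Q%:E * \int[L]_t ((A t)%:E * sqnorm (fourier h g)))%E).
  apply: lee_wpmul2l; first by rewrite lee_fin.
  have p2 : measurable_fun setT (fun t => \int[L]_x W (x, t))%E.
    exact: (measurable_fun_fubini_tonelli_G (m1 := L) _ mW W0).
  have p3 : measurable_fun setT (fun t => (A t)%:E * sqnorm (fourier h g))%E.
    by apply: emeasurable_funM; [exact: measurable_int iA|exact: measurable_cst].
  have p1 t : setT t -> (0 <= \int[L]_x W (x, t))%E by move=> _; exact: integral_ge0.
  have p4 t : setT t -> (0 <= (A t)%:E * sqnorm (fourier h g))%E.
    by move=> _; rewrite mule_ge0 ?sqnorm_ge0 // lee_fin.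
  have p5 t : setT t -> (\int[L]_x W (x, t) <= (A t)%:E * sqnorm (fourier h g))%E by [].
  have H := @ge0_le_integral _ _ R L setT measurableT _ _ p1 p2 p3 p5.
  exact: H.
have s0 := sqnorm_ge0 (fourier h g).
have -> : (\int[L]_t ((A t)%:E * sqnorm (fourier h g)) = I%:E * sqnorm (fourier h g))%E.
  rewrite ge0_integralZr //; last 2 first.
  - exact: measurable_int iA.
  - by move=> t _; rewrite lee_fin.
  by rewrite /I /Rintegral fineK //; exact: (integrable_fin_num _ iA).
rewrite !muleA -!EFinM; apply: lee_wpmul2r => //.
by rewrite lee_fin /Q -/I; lra.
Qed.

End operator_bound.

(** * Mollification of symbols *)

Section directional_linearity.
Context {R : realType} {E : normedModType R}.
Implicit Types (f : E -> R) (x v : E).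

Lemma derive_dirZ f x v (c : R) : derivable f x v ->
  is_derive x (c *: v) f (c * 'D_v f x).
Proof.
move=> df; apply: is_derive_of_line.
have D : is_derive (0 * c) (1 : R) (fun s : R => f (x + s *: v)) ('D_v f x).
  by rewrite mul0r; have := @is_derive_line _ _ f x v 0; rewrite scale0r addr0; exact.
have D2 : is_derive (0 : R) (1 : R) (fun s : R => s * c) c.
  by apply: is_derive_eq; rewrite /GRing.scale /=; ring.
rewrite (_ : (fun _ => _) = (fun s : R => f (x + s *: v)) \o (fun s : R => s * c)).
  by rewrite mulrC; exact: is_derive1_comp.
by apply/funext => s /=; rewrite scalerA.
Qed.

Lemma rderive_dirZ vs f (c : R) : rderivable vs f ->
  rderivable [seq c *: v | v <- vs] f /\
  rderive [seq c *: v | v <- vs] f = (fun x => c ^+ size vs * rderive vs f x).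
Proof.
elim: vs => [_|v vs IH] /=; first by split => //; apply/funext => x; rewrite mul1r.
move=> [/IH[r1 r2] d]; rewrite r2.
have D x : is_derive x (c *: v) (fun x => c ^+ size vs * rderive vs f x)
    (c ^+ (size vs).+1 * 'D_v (rderive vs f) x).
  have := derive_dirZ c (d x) => D1.
  rewrite (_ : (fun _ => _) = (c ^+ size vs) \*: rderive vs f) //.
  by apply: is_derive_eq; rewrite /GRing.scale /= exprS; ring.
by split; [split => // x; exact: ex_derive|apply/funext => x; exact: derive_val].
Qed.

Lemma rderive_lincomb (J : finType) (c : J -> R) (F : J -> E -> R) vs :
  (forall j, rderivable vs (F j)) ->
  rderivable vs (fun x => \sum_j c j * F j x) /\
  rderive vs (fun x => \sum_j c j * F j x) = (fun x => \sum_j c j * rderive vs (F j) x).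
Proof.
elim: vs => [|v vs IH] //= H.
have [r1 ->] := IH (fun j => (H j).1).
have D x : is_derive x v (fun x => \sum_j c j * rderive vs (F j) x)
    (\sum_j c j * 'D_v (rderive vs (F j)) x).
  rewrite (_ : (fun _ => _) = \sum_j (c j \*: rderive vs (F j))); last first.
    by apply/funext => y; rewrite fct_sumE.
  elim/big_ind2 : _ => [|f df g dg Df Dg|j _].
  - exact: is_derive_cst.
  - exact: is_deriveD.
  - by have [_ /(_ x)/derivableP D1] := H j; apply: is_derive_eq.
by split; [split => // x; exact: ex_derive|apply/funext => x; exact: derive_val].
Qed.

End directional_linearity.

(** * The Gaussian kernel *)

Section gaussian.
Context {R : realType} {N : nat}.
Notation V := 'rV[R]_N.
Notation rw := (@row_of_tuple R N).
Notation L := (@Lam R N).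

Definition gauss (W : V) : R := expR (- dotv W W).

(** Polynomials times the Gaussian. Generating them by linear forms, sums and scalars makes both the
    stability under derivatives and the decay direct inductions. *)
Inductive polygauss : (V -> R) -> Prop :=
| PG_gauss : polygauss gauss
| PG_mul w psi : polygauss psi -> polygauss (fun W => dotv w W * psi W)
| PG_add phi psi : polygauss phi -> polygauss psi -> polygauss (fun W => phi W + psi W)
| PG_scale c psi : polygauss psi -> polygauss (fun W => c * psi W).

Lemma is_derive_gauss x v : is_derive x v gauss (- 2 * (dotv v x * gauss x)).
Proof.
apply: is_derive_of_line.
pose p (s : R) := - (dotv x x + s * (2 * dotv x v) + s ^+ 2 * dotv v v).
have pE s : - dotv (x + s *: v) (x + s *: v) = p s.
  rewrite dotvDl dotvZl [dotv x (_ + _)]dotvC [dotv v (_ + _)]dotvC !dotvDl !dotvZl.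
  by rewrite [dotv v x]dotvC /p; ring.
have dp : is_derive (0 : R) (1 : R) p (- (2 * dotv x v)).
  rewrite /p; apply: is_derive_eq; rewrite /GRing.scale /=; ring.
rewrite (_ : (fun _ => _) = expR \o p); last by apply/funext => s; rewrite /gauss /= pE.
have := is_derive1_comp (is_derive_expR (p 0)) dp.
rewrite -pE scale0r addr0 -/(gauss x) => H; apply: is_derive_eq.
by rewrite dotvC; ring.
Qed.

Lemma polygauss_derive psi v : polygauss psi ->
  (forall x, derivable psi x v) /\ polygauss ('D_v psi).
Proof.
elim=> [|w f pf [df pD]|f g pf [df pDf] pg [dg pDg]|c f pf [df pD]].
- split=> [x|]; first by have [] := is_derive_gauss x v.
  rewrite (_ : 'D_v _ = (fun W => -2 * (dotv v W * gauss W))).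
    by apply: PG_scale; apply: PG_mul; exact: PG_gauss.
  by apply/funext => x; have H := is_derive_gauss x v; exact: derive_val.
- have D x : is_derive x v (fun W => dotv w W * f W) (dotv w x * 'D_v f x + dotv w v * f x).
    have D1 := is_derive_dotv w x v; have D2 := derivableP (df x).
    rewrite (_ : (fun _ => _) = (fun W => dotv w W) * f) //.
    by apply: is_derive_eq; rewrite /GRing.scale /= [f x * _]mulrC.
  split=> [x|]; first exact: ex_derive.
  rewrite (_ : 'D_v _ = (fun x => dotv w x * 'D_v f x + dotv w v * f x)).
    by apply: PG_add; [exact: PG_mul|exact: PG_scale].
  by apply/funext => x; exact: derive_val.
- have D x : is_derive x v (fun W => f W + g W) ('D_v f x + 'D_v g x).
    by apply: is_deriveD; exact: derivableP.
  split=> [x|]; first exact: ex_derive.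
  rewrite (_ : 'D_v _ = (fun x => 'D_v f x + 'D_v g x)); first exact: PG_add.
  by apply/funext => x; exact: derive_val.
- have D x : is_derive x v (fun W => c * f W) (c * 'D_v f x).
    have D2 := derivableP (df x).
    by rewrite (_ : (fun _ => _) = c \*: f) //; apply: is_derive_eq.
  split=> [x|]; first exact: ex_derive.
  rewrite (_ : 'D_v _ = (fun x => c * 'D_v f x)); first exact: PG_scale.
  by apply/funext => x; exact: derive_val.
Qed.

(** Stated for arbitrary lists of directions, so that any iterated derivative of a rapid function is
    rapid and a convolution can be differentiated repeatedly along the rescaled directions. *)
Definition rapid (psi : V -> R) : Prop := forall vs, rderivable vs psi /\
  forall q : nat, exists2 M, 0 <= M & forall W, `|rderive vs psi W| <= M * bracket W `^ (- q%:R).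

Lemma rapid_rderive vs psi : rapid psi -> rapid (rderive vs psi).
Proof.
move=> rp ws; have [r1 r2] := rp (ws ++ vs).
have /rderivable_cat[r3 r4] := r1; split => // q.
by have [M M0 H] := r2 q; exists M => // W; rewrite -rderive_cat.
Qed.

Lemma gauss_decay (q : nat) : exists2 M, 0 <= M &
  forall W, `|gauss W| <= M * bracket W `^ (- q%:R).
Proof.
(* The constant comes from exp t >= (1 + t / (q + 1))^(q + 1) with t = |W|^2, where (q + 1)(1 + t /
   (q + 1)) >= 1 + t. *)
exists (q.+1%:R ^+ q.+1) => [|W]; first by rewrite exprn_ge0.
have b0 := bracket_gt0 W; have b1 := bracket_ge1 W.
rewrite ger0_norm ?expR_ge0 // powRN powR_mulrn ?(ltW b0) //.
rewrite ler_pdivlMr ?exprn_gt0 // /gauss expRN mulrC ler_pdivrMr ?expR_gt0 //.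
set t := dotv W W; have t0 : 0 <= t by exact: dotvv_ge0.
have le1 : bracket W ^+ q <= (1 + t) ^+ q.+1.
  apply: le_trans (_ : (bracket W ^+ 2) ^+ q.+1 <= _); last by rewrite sqr_bracket.
  rewrite -exprM; apply: ler_weXn2l => //.
  by rewrite mul2n -addnn (leq_trans (leqnSn _)) // leq_addr.
apply: le_trans le1 _.
have -> : expR t = expR (t / q.+1%:R) ^+ q.+1.
  by rewrite -expRM_natl mulrCA mulfV ?mulr1 // pnatr_eq0.
rewrite -exprMn; rewrite lerXn2r ?nnegrE ?mulr_ge0 ?expR_ge0 ?addr_ge0 //.
apply: le_trans (ler_wpM2l (ler0n _ _) (expR_ge1Dx (t / q.+1%:R))).
rewrite mulrDr mulr1 mulrCA mulfV ?mulr1 ?pnatr_eq0 // lerD2r.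
by rewrite -[leLHS]/(1%:R) ler_nat.
Qed.

Lemma polygauss_decay psi : polygauss psi -> forall q : nat,
  exists2 M, 0 <= M & forall W, `|psi W| <= M * bracket W `^ (- q%:R).
Proof.
elim=> [q|w f _ IH q|f g _ IHf _ IHg q|c f _ IH q].
- exact: gauss_decay.
- have [M M0 H] := IH q.+1; pose K := \sum_(i < N) `|w 0 i|.
  have K0 : 0 <= K by apply: sumr_ge0.
  exists (K * M) => [|W]; first exact: mulr_ge0.
  have dw : `|dotv w W| <= K * bracket W.
    rewrite /dotv /K mulr_suml; apply: le_trans (ler_norm_sum _ _ _) _.
    by apply: ler_sum => i _; rewrite normrM ler_wpM2l // bracket_coord.
  rewrite normrM; apply: le_trans (ler_pM (normr_ge0 _) (normr_ge0 _) dw (H W)) _.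
  rewrite mulrACA ler_wpM2l ?mulr_ge0 //.
  rewrite -[X in X * _](powRr1 (ltW (bracket_gt0 W))) -powRD; last first.
    by rewrite (gt_eqF (bracket_gt0 _)) implybT.
  by apply: ler_powR_bracket; rewrite -natr1; lra.
- have [M M0 H] := IHf q; have [M' M0' H'] := IHg q.
  exists (M + M') => [|W]; first exact: addr_ge0.
  by apply: le_trans (ler_normD _ _) _; rewrite mulrDl lerD.
- have [M M0 H] := IH q; exists (`|c| * M) => [|W]; first exact: mulr_ge0.
  by rewrite normrM -mulrA ler_wpM2l.
Qed.

Lemma rapid_gauss : rapid gauss.
Proof.
have H vs : rderivable vs gauss /\ polygauss (rderive vs gauss).
  elim: vs => [|v vs [r p]] /=; first by split => //; exact: PG_gauss.
  by have [d p'] := polygauss_derive v p; split => //; split.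
by move=> vs; have [r p] := H vs; split => // q; exact: polygauss_decay.
Qed.

Lemma measurable_derivable (f : V -> R) : (forall x v, derivable f x v) ->
  measurable_fun setT (f \o rw).
Proof.
move=> df; apply: measurable_row_continuous => X i s.
apply: differentiable_continuous; apply/derivable1_diffP.
by have [] := @is_derive_line _ _ f X (delta_mx 0 i) s (df _ _).
Qed.

Lemma measurable_rapid psi : rapid psi -> measurable_fun setT (psi \o rw).
Proof.
by move=> rp; apply: measurable_derivable => x v; have [[_ H] _] := rp [:: v]; exact: H.
Qed.

Hypothesis N0 : (0 < N)%N.

Lemma integrable_rapid psi (q : R) : rapid psi ->
  L.-integrable setT (fun t => (bracket (rw t) `^ q * psi (rw t))%:E).
Proof.
move=> rp; have [_ H] := rp [::]; have [M M0 leM] := H (Num.truncn `|q| + N).+2.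
have nq : N%:R < N.+1%:R :> R by rewrite ltr_nat.
apply: (le_integrable measurableT _ _ (integrableZl measurableT M (integrable_bracket N0 nq))).
  apply/measurable_EFinP; apply: measurable_funM; last exact: measurable_rapid.
  by apply: (measurableT_comp (measurable_powR _)); exact: measurable_bracket.
move=> t _; rewrite lee_fin; apply: le_trans (ler_norm _).
rewrite normrM ger0_norm ?powR_bracket_ge0 //.
apply: le_trans (ler_wpM2l (powR_bracket_ge0 _ _) (leM _)) _.
rewrite mulrCA ler_wpM2l // -powRD; last by rewrite (gt_eqF (bracket_gt0 _)) implybT.
apply: ler_powR_bracket.
have := truncnS_gt `|q|; have := ler_norm q => h1 h2.
have -> : (Num.truncn `|q| + N).+2 = ((Num.truncn `|q|).+1 + N.+1)%N by rewrite addnS addSn.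
by rewrite natrD; lra.
Qed.

(** If the integral were 0, the positive Gaussian would vanish almost everywhere, so almost no point
    would exist and every integral would be 0. The integral of [expNabs_tuple], equal to 2^N,
    contradicts this. *)
Lemma integral_gauss_gt0 : 0 < \int[L]_t gauss (rw t).
Proof.
have g0 t : 0 <= gauss (rw t) by exact: expR_ge0.
have ig : L.-integrable setT (fun t => (gauss (rw t))%:E).
  have := integrable_rapid 0 rapid_gauss.
  by under eq_fun do rewrite powRr0 mul1r.
rewrite lt_def Rintegral_ge0 // andbT; apply/negP => /eqP I0.
have I1 : (\int[L]_t `|(gauss (rw t))%:E| = 0)%E.
  under eq_integral do rewrite gee0_abs ?lee_fin //.
  by rewrite -(fineK (integrable_fin_num measurableT ig)) -[fine _]/(\int[L]_t gauss (rw t)) I0.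
have mg : measurable_fun setT (fun t => (gauss (rw t))%:E) by exact: measurable_int ig.
have /ae_eq_integral_abs := mg => /(_ L measurableT)[/(_ I1) H _].
have me : measurable_fun setT (fun t => (@expNabs_tuple R N t)%:E).
  by apply/measurable_EFinP; exact: measurable_expNabs_tuple.
have /ae_eq_integral_abs := me => /(_ L measurableT)[_ H2].
have : (\int[L]_t `|(@expNabs_tuple R N t)%:E| = 0)%E.
  apply: H2; apply: filterS H => t Ht _; have := Ht I.
  by move=> [] /eqP; rewrite gt_eqF // expR_gt0.
under eq_integral do rewrite gee0_abs ?lee_fin ?expNabs_tuple_ge0 //.
rewrite (@integral_prod_tuple R N (fun _ x => expR (- `|x|))); last 2 first.
- by move=> _; exact: measurable_expNabs.
- by move=> _ x; exact: expR_ge0.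
under eq_bigr do rewrite integral_expNabs.
have -> : (\prod_(i < N) 2%:E = (2 ^+ N)%:E :> \bar R)%E.
  by elim: (N) => [|m IH]; rewrite ?big_ord0 // big_ord_recr /= IH -EFinM exprSr.
by move=> [] /eqP; rewrite expf_eq0 pnatr_eq0 andbF.
Qed.

End gaussian.

(** * Convolution in phase space *)

Section mollification.
Context {R : realType} {n : nat}.
Notation TR := (measurableTypeR R).
Notation rw := (@row_of_tuple R _).
Notation E := 'rV[R]_n.
Notation P := ('rV[R]_n * 'rV[R]_n)%type.
Notation L := (@Lam R (n + n)).
Hypothesis n0 : (0 < n)%N.
Variables (sg tau : R).
Hypotheses (sg0 : 0 < sg) (tau0 : 0 < tau) (tau1 : tau <= 1).

Let N0 : (0 < n + n)%N. Proof. by rewrite addn_gt0 n0. Qed.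

(** The kernel lives at unit scale on R^(2n); the different widths in x and in xi are put into this
    change of variables, of which [kappa2] is the inverse. *)
Definition iota2 (W : 'rV[R]_(n + n)) : P := (sg *: lsubmx W, tau *: rsubmx W).
Definition kappa2 (X : P) : 'rV[R]_(n + n) := row_mx (sg^-1 *: X.1) (tau^-1 *: X.2).

Lemma iota2D W W' : iota2 (W + W') = iota2 W + iota2 W'.
Proof. by rewrite /iota2 !linearD. Qed.

Lemma iota2N W : iota2 (- W) = - iota2 W.
Proof. by rewrite /iota2 !linearN. Qed.

Lemma kappa2D X Y : kappa2 (X + Y) = kappa2 X + kappa2 Y.
Proof. by rewrite /kappa2 add_row_mx !scalerDr. Qed.

Lemma kappa2Z s X : kappa2 (s *: X) = s *: kappa2 X.
Proof. by rewrite /kappa2 scale_row_mx !scalerA ![s * _]mulrC. Qed.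

Lemma kappa2K X : iota2 (kappa2 X) = X.
Proof.
rewrite /iota2 row_mxKl row_mxKr !scalerA !mulfV ?gt_eqF // !scale1r.
by case: X.
Qed.

Lemma bracket_rsubmx (W : 'rV[R]_(n + n)) : bracket (tau *: rsubmx W) <= bracket W.
Proof.
apply: le_trans (bracket_scale _ _) _; first by rewrite ger0_norm // ltW.
rewrite /bracket ler_sqrt ?addr_ge0 ?dotvv_ge0 // lerD2l /dotv big_split_ord /=.
apply: le_trans (_ : \sum_(i < n) W 0 (rshift n i) * W 0 (rshift n i) <= _).
  by under eq_bigr do rewrite !mxE.
by rewrite lerDr; apply: sumr_ge0 => i _; rewrite -expr2 sqr_ge0.
Qed.

Lemma bracket_iota2 (W : 'rV[R]_(n + n)) xi (m : R) :
  bracket (xi - (iota2 W).2) `^ m <= 2 `^ `|m| * (bracket W `^ `|m| * bracket xi `^ m).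
Proof.
apply: le_trans (powR_bracketD _ _ _) _; rewrite bracketN ler_wpM2l ?powR_ge0 //.
rewrite ler_wpM2r ?powR_ge0 //; apply: ge0_ler_powR; rewrite ?nnegrE ?sqrtr_ge0 //.
exact: bracket_rsubmx.
Qed.

Definition pmeas (f : P -> R) : Prop :=
  measurable_fun setT (fun p : n.-tuple TR * n.-tuple TR => f (rw p.1, rw p.2)).

(** The kernel is not normalised: derivatives of the Gaussian, whose integral may vanish, are used
    as kernels too. *)
Definition conv (f : P -> R) (psi : 'rV[R]_(n + n) -> R) (X : P) : R :=
  \int[L]_t (f (X - iota2 (rw t)) * psi (rw t)).

Lemma measurable_iota2 f (X : P) (s : R) : pmeas f ->
  measurable_fun setT (fun t : (n + n).-tuple TR => f (X + s *: iota2 (rw t))).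
Proof.
move=> mf.
pose p1 (t : (n + n).-tuple TR) : n.-tuple TR := [tuple (X.1 0 i + s * (sg * tnth t (lshift n i)))%R | i < n].
pose p2 (t : (n + n).-tuple TR) : n.-tuple TR := [tuple (X.2 0 i + s * (tau * tnth t (rshift n i)))%R | i < n].
have m1 : measurable_fun setT p1.
  apply/measurable_fun_tnthP => i.
  rewrite (_ : _ \o _ = (fun t : (n + n).-tuple TR => (X.1 0 i + s * (sg * tnth t (lshift n i)))%R)).
    apply: measurable_funD; first exact: measurable_cst.
    by do 2 (apply: measurable_funM; first exact: measurable_cst); exact: measurable_tnth.
  by apply/funext => t /=; rewrite tnth_mktuple.
have m2 : measurable_fun setT p2.
  apply/measurable_fun_tnthP => i.
  rewrite (_ : _ \o _ = (fun t : (n + n).-tuple TR => (X.2 0 i + s * (tau * tnth t (rshift n i)))%R)).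
    apply: measurable_funD; first exact: measurable_cst.
    by do 2 (apply: measurable_funM; first exact: measurable_cst); exact: measurable_tnth.
  by apply/funext => t /=; rewrite tnth_mktuple.
rewrite (_ : (fun _ => _) = (fun p => f (rw p.1, rw p.2)) \o (fun t => (p1 t, p2 t))).
  by apply: (measurableT_comp mf); exact: measurable_fun_pair.
apply/funext => t /=; congr f; rewrite [X in X + _]surjective_pairing; congr (_, _).
  by apply/rowP => i; rewrite !mxE tnth_mktuple.
by apply/rowP => i; rewrite !mxE tnth_mktuple.
Qed.

Section convolution.
Variables (f : P -> R) (B m : R).
Hypotheses (mf : pmeas f) (lef : forall x xi, `|f (x, xi)| <= B * bracket xi `^ m).

Let B0 : 0 <= B.
Proof.
have := le_trans (normr_ge0 _) (lef 0 0).
by rewrite pmulr_lge0 // powR_gt0 // bracket_gt0.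
Qed.

Lemma conv_integrand_le (X : P) W psi :
  `|f (X - iota2 W) * psi W| <=
  B * 2 `^ `|m| * bracket X.2 `^ m * (bracket W `^ `|m| * `|psi W|).
Proof.
rewrite normrM [leRHS]mulrA ler_wpM2r //.
rewrite [X - _]surjective_pairing; apply: le_trans (lef _ _) _.
rewrite -!mulrA ler_wpM2l //; apply: le_trans (bracket_iota2 _ _ _) _.
by rewrite [bracket W `^ _ * _]mulrC.
Qed.

Lemma integrable_conv psi X : rapid psi ->
  L.-integrable setT (fun t => (f (X - iota2 (rw t)) * psi (rw t))%:E).
Proof.
move=> rp; have ip := integrable_abse (integrable_rapid N0 `|m| rp).
apply: (le_integrable measurableT _ _ (integrableZl measurableT (B * 2 `^ `|m| * bracket X.2 `^ m) ip)).
  apply/measurable_EFinP; apply: measurable_funM; last exact: measurable_rapid.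
  have := measurable_iota2 X (-1) mf.
  by under eq_fun do rewrite scaleN1r.
move=> t _; rewrite lee_fin; apply: le_trans (conv_integrand_le _ _ _) _.
apply: le_trans (ler_norm _).
by rewrite /= normrM [`|bracket _ `^ _|]ger0_norm ?powR_bracket_ge0.
Qed.

Lemma conv_le psi X : rapid psi ->
  `|conv f psi X| <= B * 2 `^ `|m| * (\int[L]_t (bracket (rw t) `^ `|m| * `|psi (rw t)|)) * bracket X.2 `^ m.
Proof.
move=> rp; have ip := integrable_abse (integrable_rapid N0 `|m| rp).
have {}ip : L.-integrable setT (fun t => (bracket (rw t) `^ `|m| * `|psi (rw t)|)%:E).
  move: ip; congr integrable; apply/funext => t /=.
  by rewrite normrM [`|bracket _ `^ _|]ger0_norm ?powR_bracket_ge0.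
have ic := integrable_conv X rp.
apply: le_trans (le_normr_Rintegral measurableT ic) _.
rewrite mulrAC -RintegralZl //; apply: le_Rintegral => //.
- exact: (integrable_norm ic).
- exact: (integrableZl measurableT _ ip).
- by move=> t _; exact: conv_integrand_le.
Qed.

(** The reflection W -> [kappa2 X - W] moves X from the symbol to the kernel. The first form is
    differentiated through [f], the second through [psi]. *)
Lemma convE psi X : rapid psi ->
  L.-integrable setT (fun t => (f (iota2 (rw t)) * psi (kappa2 X - rw t))%:E) /\
  conv f psi X = \int[L]_t (f (iota2 (rw t)) * psi (kappa2 X - rw t)).
Proof.
move=> rp; have nz : (-1 : R) != 0 by rewrite oppr_eq0 oner_neq0.
pose F W := f (X - iota2 W) * psi W.
have FE W : F (-1 *: W + kappa2 X) = f (iota2 W) * psi (kappa2 X - W).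
  rewrite /F scaleN1r iota2D iota2N kappa2K opprD opprK addrCA subrr addr0.
  by rewrite [- W + _]addrC.
have [i1 e1] := Rint_affine (F := F) (kappa2 X) nz (integrable_conv X rp).
split; first by move: i1; under eq_fun do rewrite FE.
rewrite /conv -[LHS]/(\int[L]_t F (rw t)) e1 normrN1 expr1n mul1r.
by apply: eq_Rintegral => t _; rewrite FE.
Qed.

Lemma is_derive_conv_kernel psi X v : rapid psi ->
  is_derive X v (conv f psi) (conv f ('D_(kappa2 v) psi) X).
Proof.
move=> rp.
have dpsi W w : derivable psi W w by have [[_ H] _] := rp [:: w]; exact: H.
have rD : rapid ('D_(kappa2 v) psi) := rapid_rderive [:: kappa2 v] rp.
pose F (y : P) (t : (n + n).-tuple TR) := f (iota2 (rw t)) * psi (kappa2 y - rw t).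
have FE : conv f psi = (fun y => \int[L]_t F y t).
  by apply/funext => y; have [_ ->] := convE y rp.
have dF t y : is_derive y v (F ^~ t) (f (iota2 (rw t)) * 'D_(kappa2 v) psi (kappa2 y - rw t)).
  apply: is_derive_of_line.
  have := @is_derive_line _ _ psi (kappa2 y - rw t) (kappa2 v) 0.
  rewrite scale0r addr0 => /(_ (dpsi _ _)) D1.
  rewrite (_ : (fun _ => _) = f (iota2 (rw t)) \*: (fun s : R => psi (kappa2 y - rw t + s *: kappa2 v))).
    by apply: is_derive_eq.
  by apply/funext => s; rewrite /F kappa2D kappa2Z addrAC.
have [_ ->] := convE X rD; rewrite FE.
have -> : (\int[L]_t (f (iota2 (rw t)) * 'D_(kappa2 v) psi (kappa2 X - rw t))) =
    \int[L]_t 'D_v (F ^~ t) X.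
  by apply: eq_Rintegral => t _; rewrite derive_val.
(* After absorbing the growth <W>^|m| of the symbol, the decay <W>^(-q) of the kernel still leaves
   the integrable weight <W>^(-(2n + 1)). *)
have [_ H] := rD [::]; pose q := (Num.truncn `|m| + (n + n)).+2.
have [M M0 leM] := H q.
pose K := 2 `^ `|- q%:R| * (2 * (bracket (kappa2 X) * bracket (kappa2 v))) `^ `|- q%:R|.
apply: (derive_Rintegral (g := fun t => B * M * K * bracket (rw t) `^ (- (n + n).+1%:R))).
- by move=> t s; exact: ex_derive.
- by move=> s; have [] := convE (X + s *: v) rp.
- move=> s t s1; rewrite derive_val normrM.
  have f1 : `|f (iota2 (rw t))| <= B * bracket (rw t) `^ `|m|.
    rewrite [iota2 _]surjective_pairing; apply: le_trans (lef _ _) _; rewrite ler_wpM2l //.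
    apply: le_trans (ler_powR_bracket _ (ler_norm m)) _.
    by apply: ge0_ler_powR; rewrite ?nnegrE ?sqrtr_ge0 // bracket_rsubmx.
  have f2 : `|'D_(kappa2 v) psi (kappa2 (X + s *: v) - rw t)| <= M * K * bracket (rw t) `^ (- q%:R).
    apply: le_trans (leM _) _; rewrite -mulrA ler_wpM2l //.
    rewrite addrC; apply: le_trans (powR_bracketD _ _ _) _; rewrite bracketN /K -mulrA.
    rewrite ler_wpM2l ?powR_ge0 // ler_wpM2r ?powR_ge0 //.
    apply: ge0_ler_powR; rewrite ?nnegrE ?mulr_ge0 ?sqrtr_ge0 // kappa2D kappa2Z.
    apply: le_trans (bracketD _ _) _; rewrite ler_wpM2l // ler_wpM2l ?sqrtr_ge0 //.
    exact: bracket_scale.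
  apply: le_trans (ler_pM _ _ f1 f2) _; rewrite ?normr_ge0 //.
  have -> : B * bracket (rw t) `^ `|m| * (M * K * bracket (rw t) `^ (- q%:R)) =
     B * M * K * (bracket (rw t) `^ `|m| * bracket (rw t) `^ (- q%:R)) by ring.
  rewrite ler_wpM2l ?mulr_ge0 ?powR_ge0 // -powRD; last by rewrite (gt_eqF (bracket_gt0 _)) implybT.
  apply: ler_powR_bracket; rewrite /q.
  have -> : (Num.truncn `|m| + (n + n)).+2 = ((Num.truncn `|m|).+1 + (n + n).+1)%N by rewrite addnS addSn.
  by rewrite natrD; have := truncnS_gt `|m|; lra.
- have nq : (n + n)%:R < (n + n).+1%:R :> R by rewrite ltr_nat.
  exact: (integrableZl measurableT (B * M * K) (integrable_bracket N0 nq)).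
Qed.

Lemma is_derive_conv_symbol psi X v B' m' : rapid psi ->
  (forall Y, derivable f Y v) -> (forall x xi, `|'D_v f (x, xi)| <= B' * bracket xi `^ m') ->
  is_derive X v (conv f psi) (conv ('D_v f) psi X).
Proof.
move=> rp df leD.
have B'0 : 0 <= B'.
  have := le_trans (normr_ge0 _) (leD 0 0).
  by rewrite pmulr_lge0 // powR_gt0 // bracket_gt0.
have ip := integrable_abse (integrable_rapid N0 `|m'| rp).
have {}ip : L.-integrable setT (fun t => (bracket (rw t) `^ `|m'| * `|psi (rw t)|)%:E).
  move: ip; congr integrable; apply/funext => t /=.
  by rewrite normrM [`|bracket _ `^ _|]ger0_norm ?powR_bracket_ge0.
pose F (y : P) (t : (n + n).-tuple TR) := f (y - iota2 (rw t)) * psi (rw t).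
have dF t y : is_derive y v (F ^~ t) ('D_v f (y - iota2 (rw t)) * psi (rw t)).
  have [d1 d2] := derivable_translate (df (y - iota2 (rw t))).
  have D1 : is_derive y v (fun z => f (z - iota2 (rw t))) ('D_v f (y - iota2 (rw t))) by split.
  rewrite (_ : F ^~ t = psi (rw t) \*: (fun z => f (z - iota2 (rw t)))).
    by apply: is_derive_eq; rewrite /GRing.scale /= mulrC.
  by apply/funext => z; rewrite /F mulrC.
have -> : conv ('D_v f) psi X = \int[L]_t 'D_v (F ^~ t) X.
  by apply: eq_Rintegral => t _; rewrite derive_val.
pose K := B' * 2 `^ `|m'| * (2 `^ `|m'| * bracket v.2 `^ `|m'| * bracket X.2 `^ m').
apply: (derive_Rintegral (g := fun t => K * (bracket (rw t) `^ `|m'| * `|psi (rw t)|))).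
- by move=> t s; exact: ex_derive.
- by move=> s; exact: integrable_conv.
- move=> s t s1; rewrite derive_val normrM mulrA ler_wpM2r //.
  rewrite [X in 'D_v f X]surjective_pairing; apply: le_trans (leD _ _) _.
  rewrite /K -!mulrA ler_wpM2l //; apply: le_trans (bracket_iota2 _ _ _) _.
  rewrite ler_wpM2l ?powR_ge0 // mulrC !mulrA ler_wpM2r ?powR_ge0 //.
  exact: bracket_translate_le.
- exact: (integrableZl measurableT K ip).
Qed.

End convolution.

End mollification.

(** * Differences along sums of coordinate steps *)

Section coordinate_steps.
Context {R : realType} {E : normedModType R}.
Implicit Types (f g : E -> R) (l : seq (R * E)).

Definition total l : E := \sum_(p <- l) p.1 *: p.2.

Lemma reach_refl l x : reach l x x.
Proof.
by elim: l => //= p l IH; exists 0; rewrite ?normr0 // scale0r addr0.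
Qed.

Lemma telescope_le l f (M : R * E -> R) y :
  (forall p z, p \in l -> reach l y z -> `|f (z + p.1 *: p.2) - f z| <= M p) ->
  `|f (y + total l) - f y| <= \sum_(p <- l) M p.
Proof.
rewrite /total; elim: l y => [|p l IH] y Hf.
  by rewrite !big_nil addr0 subrr normr0.
rewrite !big_cons addrA; set S := \sum_(_ <- _) _ *: _; set a := y + _.
rewrite [X in `|X|](_ : _ = (f a - f y) + (f (a + S) - f a)); last by ring.
apply: le_trans (ler_normD _ _) _; apply: lerD.
  by apply: Hf; [exact: mem_head|exact: reach_refl].
apply: IH => q z ql rz; apply: Hf; first by rewrite inE ql orbT.
by exists p.1.
Qed.

Lemma reach_invariant l (Q : E -> Prop) :
  (forall p s y, p \in l -> Q y -> Q (y + s *: p.2)) ->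
  forall y z, reach l y z -> Q y -> Q z.
Proof.
elim: l => [_ y z -> //|p l IH] HQ y z /= [s _ rz] Qy.
apply: (IH _ _ z rz) => [q t x ql|]; first by apply: HQ; rewrite inE ql orbT.
by apply: HQ => //; exact: mem_head.
Qed.

(** The translation vector is arbitrary, whereas only coordinate derivatives are bounded. Each of
    the [mu] differences telescopes into [size L] differences along coordinates; [Q] records what
    stays true of the points met on the way. *)
Lemma deltas_nseq_le (L : seq (R * E)) f (Q : E -> Prop) (M : R) (mu : nat) :
  (forall p s y, p \in L -> Q y -> Q (y + s *: p.2)) ->
  (forall l y, size l = mu -> {subset l <= L} -> Q y -> `|deltas (steps l) f y| <= M) ->
  forall y, Q y -> `|deltas (nseq mu (total L)) f y| <= (size L)%:R ^+ mu * M.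
Proof.
move=> HQ H.
(* [l] holds the coordinate steps already chosen, while k differences along the full vector remain
   to be expanded. *)
suff claim k : forall l, (size l + k)%N = mu -> {subset l <= L} -> forall y, Q y ->
    `|deltas (nseq k (total L)) (deltas (steps l) f) y| <= (size L)%:R ^+ k * M.
  have sub0 : {subset ([::] : seq (R * E)) <= L} by [].
  by move=> y Qy; exact: (claim mu [::] (add0n _) sub0 y Qy).
elim: k => [|k IH] l sz sl y Qy.
  by rewrite expr0 mul1r; apply: H; rewrite ?addn0 // in sz *.
pose g := deltas (nseq k (total L)) (deltas (steps l) f).
have gp p z : p \in L -> reach L y z -> `|g (z + p.1 *: p.2) - g z| <= (size L)%:R ^+ k * M.
  move=> pL rz; have Qz := reach_invariant HQ rz Qy.
  have -> : g (z + p.1 *: p.2) - g z =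
      deltas (nseq k (total L)) (deltas (steps (p :: l)) f) z.
    by rewrite /= deltas_delta.
  apply: IH => //; first by rewrite /= addSnnS.
  by move=> q; rewrite inE => /orP[/eqP -> //|/sl].
have -> : (size L)%:R ^+ k.+1 * M = \sum_(p <- L) ((size L)%:R ^+ k * M).
  by rewrite big_const_seq count_predT iter_addr_0 -[RHS]mulr_natl exprS mulrA.
exact: (telescope_le gp).
Qed.

(* Coefficients of a mean that cancels Taylor expansions up to order [mu]. *)
Lemma difference_coefficients (mu : nat) : exists2 c : nat -> R,
  forall j, (mu <= j)%N -> c j = 0 &
  forall f w x, f x - \sum_(j < mu) c j * f (x + j.+1%:R *: w) =
    (-1) ^+ mu * deltas (nseq mu w) f x.
Proof.
elim: mu => [|mu [c c0 H]].
  by exists (fun=> 0) => // f w x; rewrite big_ord0 subr0 mul1r.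
(* Pascal's rule: c j is (-1)^j times the binomial coefficient of j + 1 in mu. *)
exists (fun j => c j + (if j is j'.+1 then - c j' else 1)) => [[|j] // muj|f w x].
  by rewrite !c0 ?oppr0 ?addr0 // ltnW.
rewrite /= /delta exprS mulN1r mulNr mulrBr opprB -!H.
under eq_bigr do rewrite mulrDl.
rewrite big_split /= big_ord_recr /= c0 // mul0r addr0 big_ord_recl /= mul1r scale1r.
have -> : \sum_(i < mu) - c (0 + i)%N * f (x + (bump 0 i).+1%:R *: w) =
    - \sum_(j < mu) c j * f (x + w + j.+1%:R *: w).
  rewrite -sumrN; apply: eq_bigr => i _; rewrite mulNr /bump /= add1n add0n.
  by rewrite -[i.+2%:R]natr1 scalerDl scale1r [_ + w]addrC addrA.
ring.
Qed.

End coordinate_steps.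

(** * Steps in phase space and their effect on the weight *)

Section phase_space.
Context {R : realType} {n : nat}.
Notation E := 'rV[R]_n.
Notation P := ('rV[R]_n * 'rV[R]_n)%type.

Definition xdirs (s : seq 'I_n) : seq P := [seq (delta_mx 0 i, 0) | i <- s].
Definition xidirs (s : seq 'I_n) : seq P := [seq (0, delta_mx 0 i) | i <- s].

(** An x-step of any length leaves <xi> unchanged; a xi-step must be short for <xi> to change by a
    controlled factor only. *)
Definition phase_step (b : R) (p : R * P) : Prop :=
  p.2.2 = 0 \/ (`|p.1| <= b /\ exists i, p.2.2 = delta_mx 0 i).

Lemma reach_bracket (b m : R) (l : seq (R * P)) (x z : P) : 1 <= b ->
  (forall p, p \in l -> phase_step b p) -> reach l x z ->
  bracket z.2 `^ m <= (4 * b) `^ (`|m| * (size l)%:R) * bracket x.2 `^ m.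
Proof.
move=> b1; elim: l x => [|p l IH] x Hl /=.
  by move=> ->; rewrite mulr0 powRr0 mul1r.
move=> [s sp rz]; have b0 : 0 < b by rewrite (lt_le_trans ltr01).
have /IH : forall q, q \in l -> phase_step b q by move=> q ql; apply: Hl; rewrite inE ql orbT.
move=> /(_ _ rz) /le_trans; apply.
have -> : (size l).+1%:R = (size l)%:R + 1 :> R by rewrite natr1.
rewrite mulrDr mulr1 powRD; last by rewrite (gt_eqF (mulr_gt0 _ b0)) ?implybT.
rewrite -mulrA ler_wpM2l ?powR_ge0 //.
have b4 : 1 <= (4 * b) `^ `|m|.
  by rewrite -[leLHS](powRr0 (4 * b)); apply: ler_powR => //; lra.
have -> : (x + s *: p.2).2 = x.2 + s *: p.2.2 by [].
have [-> | [tb [i ->]]] := Hl p (mem_head _ _).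
  by rewrite scaler0 addr0 ler_peMl ?powR_ge0.
apply: le_trans (powR_bracketD _ _ _) _; rewrite mulrA ler_wpM2r ?powR_ge0 //.
rewrite -powRM ?sqrtr_ge0 //; apply: ge0_ler_powR; rewrite ?nnegrE ?mulr_ge0 ?sqrtr_ge0 ?(ltW b0) //.
(* Peetre's factor 2 <step> is at most 2 (1 + b), hence at most 4 b because b >= 1. *)
suff : bracket (s *: delta_mx 0 i : E) <= 1 + b by lra.
apply: le_trans (bracket_le1 _) _; rewrite lerD2l (bigD1 i) //= big1 ?addr0.
  by rewrite !mxE !eqxx mulr1 (le_trans sp).
by move=> j /negPf ji; rewrite !mxE ji andbF mulr0 normr0.
Qed.

Definition phase_steps (Z : P) : seq (R * P) :=
  [seq (Z.1 0 i, (delta_mx 0 i, 0)) | i <- enum 'I_n] ++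
  [seq (Z.2 0 i, (0, delta_mx 0 i)) | i <- enum 'I_n].

Lemma row_total (z : E) : \sum_(i <- enum 'I_n) z 0 i *: delta_mx 0 i = z.
Proof. by rewrite big_enum [RHS]row_sum_delta. Qed.

Lemma total_x (z : E) :
  total [seq (z 0 i, (delta_mx 0 i, 0) : P) | i <- enum 'I_n] = (z, 0).
Proof.
rewrite /total big_map -[in RHS](row_total z); elim: (enum 'I_n) => [|i s IH].
  by rewrite !big_nil.
by rewrite !big_cons IH; congr pair; rewrite /= scaler0 addr0.
Qed.

Lemma total_xi (z : E) :
  total [seq (z 0 i, (0, delta_mx 0 i) : P) | i <- enum 'I_n] = (0, z).
Proof.
rewrite /total big_map -[in RHS](row_total z); elim: (enum 'I_n) => [|i s IH].
  by rewrite !big_nil.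
by rewrite !big_cons IH; congr pair; rewrite /= scaler0 addr0.
Qed.

Lemma total_phase Z : total (phase_steps Z) = Z.
Proof.
rewrite /total big_cat -!/(total _) total_x total_xi; case: Z => x y.
by congr pair; rewrite /= ?addr0 ?add0r.
Qed.

(** Partial derivatives bounded by a power of <xi> make [F] locally Lipschitz: an increment is split
    into 2n coordinate increments, each estimated by the mean value theorem. *)
Lemma continuous_of_partials (F : P -> R) (C m : R) :
  (forall v X, v \in xdirs (enum 'I_n) ++ xidirs (enum 'I_n) -> derivable F X v) ->
  (forall v X, v \in xdirs (enum 'I_n) ++ xidirs (enum 'I_n) ->
     `|'D_v F X| <= C * bracket X.2 `^ m) ->
  continuous F.
Proof.
move=> dF leF X.
have cnorm (z : E) i : `|z 0 i| <= `|z|.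
  by rewrite [leRHS]/Num.norm /= mx_normrE; apply/bigmax_geP; right => /=; exists (0, i).
have dirP Z p : p \in phase_steps Z -> [/\ p.2 \in xdirs (enum 'I_n) ++ xidirs (enum 'I_n),
    `|p.1| <= `|Z| & p.2.2 = 0 \/ exists i, p.2.2 = delta_mx 0 i].
  have ZE : `|Z| = Num.max `|Z.1| `|Z.2| by exact: prod_normE.
  rewrite mem_cat => /orP[/mapP[i ie ->]|/mapP[i ie ->]].
    split; [|by rewrite ZE le_max cnorm|by left].
    by rewrite mem_cat; apply/orP; left; apply/mapP; exists i.
  split; [|by rewrite ZE le_max cnorm orbT|by right; exists i].
  by rewrite mem_cat; apply/orP; right; apply/mapP; exists i.
have szE Z : size (phase_steps Z) = (n + n)%N by rewrite /phase_steps size_cat [size (map _ _)]size_map [X in (_ + X)%N]size_map size_enum_ord.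
case: (posnP n) => [n_0|n_gt0].
  have XE (Y : P) : Y = X.
    by rewrite [Y]surjective_pairing [X]surjective_pairing; congr pair;
      apply/rowP => i; have := ltn_ord i; rewrite {2}n_0.
  by apply: cvg_near_cst; apply: nearW => Y; rewrite (XE Y).
have C0 : 0 <= C.
  have i := Ordinal n_gt0.
  have v0 : (delta_mx 0 i, 0) \in xdirs (enum 'I_n) ++ xidirs (enum 'I_n).
    by rewrite mem_cat; apply/orP; left; apply/mapP; exists i; rewrite ?mem_enum.
  have := le_trans (normr_ge0 _) (leF _ 0 v0).
  by rewrite pmulr_lge0 // powR_gt0 // bracket_gt0.
(* Two comparisons of weights: one along the 2n steps of the path, one between the start of a step
   and the intermediate point of the mean value theorem. *)
pose K := C * ((4 * 1) `^ (`|m| * 1) * ((4 * 1) `^ (`|m| * (n + n)%:R) * bracket X.2 `^ m)).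
have K0 : 0 <= K by rewrite !mulr_ge0 ?powR_ge0.
have key Z : `|Z| <= 1 -> `|F (X + Z) - F X| <= (n + n)%:R * K * `|Z|.
  move=> Z1; rewrite -{1}(total_phase Z).
  have st p : p \in phase_steps Z -> phase_step 1 p.
    by move=> /dirP[_ p1 [p2|[i p2]]]; [left|right; split; [exact: le_trans Z1|exists i]].
  have -> : (n + n)%:R * K * `|Z| = \sum_(p <- phase_steps Z) (`|Z| * K).
    by rewrite big_const_seq count_predT iter_addr_0 -[RHS]mulr_natl szE mulrAC mulrA.
  apply: le_trans (telescope_le (M := fun p => `|p.1| * K) _) _; last first.
    rewrite big_seq [leRHS]big_seq; apply: ler_sum => p /dirP[_ p1 _].
    by rewrite ler_wpM2r.
  move=> p z pZ rz; have [pd _ _] := dirP _ _ pZ; apply: mvt_dir => s; first exact: dF.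
  move=> sp; apply: le_trans (leF _ _ pd) _; rewrite ler_wpM2l //.
  have r1 : reach [:: p] z (z + s *: p.2) by exists s.
  apply: le_trans (reach_bracket m (lexx 1) _ r1) _.
    by move=> q; rewrite inE => /eqP ->; exact: st.
  rewrite ler_wpM2l ?powR_ge0 //.
  by have := reach_bracket m (lexx 1) st rz; rewrite szE.
have nK : 0 <= (n + n)%:R * K by rewrite mulr_ge0.
apply/cvgrPdist_le => e e0; have eK : 0 < e / ((n + n)%:R * K + 1).
  by rewrite divr_gt0 // ltr_wpDl.
near=> Y.
have -> : F X - F Y = - (F (X + (Y - X)) - F X) by rewrite opprB [X + _]addrC subrK.
rewrite normrN; apply: le_trans (key _ _) _.
  by rewrite distrC; near: Y; apply: cvgr_dist_le => //; exact: cvg_id.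
apply: le_trans (_ : ((n + n)%:R * K + 1) * `|Y - X| <= _).
  by rewrite ler_wpM2r // lerDl.
rewrite mulrC -ler_pdivlMr ?ltr_wpDl //.

Unshelve. all: by end_near.
Qed.

End phase_space.

(** * Multi-indices as ordered lists of coordinates *)

Section index_lists.
Context {R : realType} {n : nat}.
Notation P := ('rV[R]_n * 'rV[R]_n)%type.
Implicit Types (s : seq 'I_n) (alpha beta : multiindex n).

Definition mi_list alpha : seq 'I_n := flatten [seq nseq (alpha i) i | i <- enum 'I_n].

Definition cnt s : multiindex n := [ffun i => count_mem i s].

Lemma mi_dirsE alpha : mi_dirs alpha = [seq delta_mx 0 i : 'rV[R]_n | i <- mi_list alpha].
Proof.
rewrite /mi_dirs /mi_list map_flatten; congr flatten.
by elim: (enum 'I_n) => //= i s ->; rewrite map_nseq.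
Qed.

Lemma symbol_dirsE alpha beta : symbol_dirs alpha beta =
  xidirs (mi_list alpha) ++ xdirs (mi_list beta) :> seq P.
Proof. by rewrite /symbol_dirs !mi_dirsE -!map_comp. Qed.

Lemma count_mi_list alpha i : count_mem i (mi_list alpha) = alpha i.
Proof.
rewrite /mi_list count_flatten -map_comp sumnE big_map.
rewrite (bigD1_seq i) ?mem_enum ?enum_uniq //= big1 ?addn0 => [|j ji].
  by rewrite count_nseq /= eqxx mul1n.
by rewrite count_nseq /= (negPf ji) mul0n.
Qed.

Lemma perm_mi_list s : perm_eq s (mi_list (cnt s)).
Proof. by apply/allP => i _; rewrite /= count_mi_list ffunE. Qed.

Lemma size_mi_list alpha : size (mi_list alpha) = mi_order alpha.
Proof.
rewrite /mi_list size_flatten /shape -map_comp sumnE big_map big_enum.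
by apply: eq_bigr => i _; rewrite /= size_nseq.
Qed.

Lemma mi_order_cnt s : mi_order (cnt s) = size s.
Proof. by rewrite -size_mi_list; apply/esym/perm_size/perm_mi_list. Qed.

(** The estimates are given for derivatives in the order of [symbol_dirs]. The ordered lists are
    exactly those that arise from multi-indices, so only along these can they be read off
    directly. *)
Definition ordered s := pairwise (fun i j : 'I_n => i <= j)%N s.

Lemma ordered_enum : ordered (enum 'I_n).
Proof.
have : pairwise leq [seq val i | i <- enum 'I_n].
  by rewrite val_enum_ord -sorted_pairwise ?iota_sorted //; exact: leq_trans.
by rewrite pairwise_map.
Qed.

Lemma ordered_mi_list alpha : ordered (mi_list alpha).
Proof.
rewrite /mi_list; move: ordered_enum; rewrite /ordered.
elim: (enum 'I_n) => //= i s IH /andP[is_ ps].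
rewrite pairwise_cat IH // andbT; apply/andP; split.
  apply/allrelP => j l; rewrite mem_nseq => /andP[_ /eqP ->] /flatten_mapP[l' l's].
  by rewrite mem_nseq => /andP[_ /eqP ->]; exact: (allP is_).
elim: (alpha i) => //= m ->; rewrite andbT; apply/allP => j.
by rewrite mem_nseq => /andP[_ /eqP ->].
Qed.

Lemma mi_list_cnt s : ordered s -> mi_list (cnt s) = s.
Proof.
move=> os; apply: (@sorted_eq _ (fun i j : 'I_n => i <= j)%N).
- by move=> i j l; exact: leq_trans.
- by move=> i j /anti_leq/val_inj.
- by apply: pairwise_sorted; exact: ordered_mi_list.
- exact: pairwise_sorted.
- by rewrite perm_sym; exact: perm_mi_list.
Qed.

End index_lists.

Section phase_measurability.
Context {R : realType} {n : nat}.
Notation TR := (measurableTypeR R).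
Notation rw := (@row_of_tuple R _).
Notation P := ('rV[R]_n * 'rV[R]_n)%type.
Implicit Types (f : P -> R).

Lemma pmeas_translate f (v : P) : pmeas f -> pmeas (fun X => f (X + v)).
Proof.
move=> mf.
have ma (c : 'rV[R]_n) : measurable_fun setT (affine_tuple 1 (fun i => c 0 i) : n.-tuple TR -> n.-tuple TR).
  exact: measurable_affine.
have E (c : 'rV[R]_n) t : rw (affine_tuple 1 (fun i => c 0 i) t) = rw t + c.
  by rewrite row_of_affine_tuple scale1r; congr (_ + _); apply/rowP => i; rewrite mxE.
rewrite /pmeas (_ : (fun _ => _) = (fun p => f (rw p.1, rw p.2)) \o
   (fun p : n.-tuple TR * n.-tuple TR =>
     (affine_tuple 1 (fun i => v.1 0 i) p.1, affine_tuple 1 (fun i => v.2 0 i) p.2))).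
  apply: (measurableT_comp mf); apply: measurable_fun_pair.
    exact: (measurableT_comp (ma v.1) measurable_fst).
  exact: (measurableT_comp (ma v.2) measurable_snd).
by apply/funext => p; rewrite /= !E.
Qed.

Lemma pmeas_derive f v : pmeas f -> (forall X, derivable f X v) -> pmeas ('D_v f).
Proof.
move=> mf df; apply: (@measurable_fun_cvg _ _ _ _
   (fun k p => (sseq k)^-1 * (f ((rw p.1, rw p.2) + sseq k *: v) - f (rw p.1, rw p.2)))).
  move=> k; apply: measurable_funM; first exact: measurable_cst.
  by apply: measurable_funB => //; exact: (pmeas_translate (sseq k *: v)).
by move=> p _; exact: cvg_quotient_sseq.
Qed.

Lemma pmeas_rderive f vs : pmeas f -> rderivable vs f -> pmeas (rderive vs f).
Proof.
by move=> mf; elim: vs => [//|v vs IH] /= [/IH md d]; exact: pmeas_derive.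
Qed.

Lemma pmeas_partials f :
  (forall v X, v \in xdirs (enum 'I_n) ++ xidirs (enum 'I_n) -> derivable f X v) -> pmeas f.
Proof.
move=> df.
have c1 (X : P) v : v \in xdirs (enum 'I_n) ++ xidirs (enum 'I_n) ->
    continuous (fun s : R => f (X + s *: v)).
  move=> vD s; apply: differentiable_continuous; apply/derivable1_diffP.
  by have [] := @is_derive_line _ _ f X v s (df _ _ vD).
apply: (@measurable_sepcont R _ _ n (fun u X => f (rw u, X))) => [X|u X i].
  apply: (@measurable_row_continuous _ _ (fun x => f (x, X))) => x i.
  have iD : ((delta_mx 0 i, 0) : P) \in xdirs (enum 'I_n) ++ xidirs (enum 'I_n).
    by rewrite mem_cat; apply/orP; left; apply/mapP; exists i; rewrite ?mem_enum.
  have := c1 (x, X) _ iD.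
  rewrite (_ : (fun s => f ((x, X) + _)) = (fun s : R => f (x + s *: delta_mx 0 i, X))) //.
  by apply/funext => s; congr f; congr pair; rewrite /= scaler0 addr0.
have iD : ((0, delta_mx 0 i) : P) \in xdirs (enum 'I_n) ++ xidirs (enum 'I_n).
  by rewrite mem_cat; apply/orP; right; apply/mapP; exists i; rewrite ?mem_enum.
have := c1 (rw u, X) _ iD.
rewrite (_ : (fun s => f ((rw u, X) + _)) = (fun s : R => f (rw u, X + s *: delta_mx 0 i))) //.
by apply/funext => s; congr f; congr pair; rewrite /= scaler0 addr0.
Qed.

Lemma rderive_slice (F : P -> R) x s : rderivable (xidirs s) F ->
  rderivable [seq delta_mx 0 i | i <- s] (fun xi => F (x, xi)) /\
  rderive [seq delta_mx 0 i | i <- s] (fun xi => F (x, xi)) =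
    (fun xi => rderive (xidirs s) F (x, xi)).
Proof.
elim: s => //= i s IH [/IH[r1 r2] d]; rewrite r2.
have D xi : is_derive xi (delta_mx 0 i : 'rV[R]_n) (fun xi => rderive (xidirs s) F (x, xi))
    ('D_(0, delta_mx 0 i) (rderive (xidirs s) F) (x, xi)).
  apply: is_derive_of_line.
  have := @is_derive_line _ _ (rderive (xidirs s) F) (x, xi) (0, delta_mx 0 i) 0.
  rewrite scale0r addr0 => /(_ (d _)).
  rewrite (_ : (fun t => rderive _ _ (_ + _)) =
    (fun t : R => rderive (xidirs s) F (x, xi + t *: delta_mx 0 i))) //.
  by apply/funext => t; congr rderive; congr pair; rewrite /= scaler0 addr0.
by split; [split => // xi; exact: ex_derive|apply/funext => xi; exact: derive_val].
Qed.

Lemma est_intro (l : seq 'rV[R]_n) (m B : R) (f : 'rV[R]_n -> R) :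
  (forall S v, subseq (rcons S v) l -> forall x,
     derivable (foldl (fun g v => 'D_v g) f S) x v /\
     derivable (foldl (fun g v => 'D_v g) f (rcons S v)) x v) ->
  (forall S, subseq S l -> forall x,
     `|foldl (fun g v => 'D_v g) f S x| <= B * bracket x `^ (m - (size S)%:R)) ->
  est l m B f.
Proof.
elim: l m f => [|v l IH] m f Hd Hb /=.
  by move=> x; have := Hb [::] isT x; rewrite subr0.
split.
- by move=> x; have [] := Hd [::] v _ x; rewrite //= eqxx sub0seq.
- by move=> x; have [] := Hd [::] v _ x; rewrite //= eqxx sub0seq.
- apply: IH => [S w Sl|S Sl]; first by apply: Hd; exact: subseq_trans Sl (subseq_cons _ _).
  by apply: Hb; exact: subseq_trans Sl (subseq_cons _ _).
- apply: IH => [S w Sl x|S Sl x].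
    by have := Hd (v :: S) w _ x; rewrite /= eqxx; exact.
  by have := Hb (v :: S) _ x; rewrite /= eqxx -natr1 opprD addrA addrAC; exact.
Qed.

(* The canonical order of derivatives is the one of [enum 'I_n]; [est] takes
   its directions in order of application. *)
Lemma est_intro_phase (F : P -> R) x (m B : R) :
  (forall s, ordered s -> rderivable (xidirs s) F) ->
  (forall s, ordered s -> uniq s -> forall xi,
     `|rderive (xidirs s) F (x, xi)| <= B * bracket xi `^ (m - (size s)%:R)) ->
  est (rev [seq delta_mx 0 i | i <- enum 'I_n]) m B (fun xi => F (x, xi)).
Proof.
move=> Hd Hb; pose e (i : 'I_n) : 'rV[R]_n := delta_mx 0 i.
have foldE (f : 'rV[R]_n -> R) s : foldl (fun g v => 'D_v g) f [seq e i | i <- s] = rderive [seq e i | i <- rev s] f.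
  elim/last_ind: s => // s i IH.
  by rewrite map_rcons foldl_rcons IH rev_rcons.
have subE S : subseq S (rev [seq e i | i <- enum 'I_n]) ->
    exists2 s, S = [seq e i | i <- s] & subseq (rev s) (enum 'I_n).
  rewrite -map_rev => /subseqP[msk szm ->].
  exists (mask msk (rev (enum 'I_n))); first by rewrite map_mask.
  by rewrite -[X in subseq _ X]revK subseq_rev mask_subseq.
have ord s : subseq s (enum 'I_n) -> ordered s.
  by move=> /subseq_pairwise; apply; exact: ordered_enum.
apply: est_intro => [S v /subE[s]|S /subE[s -> ss] xi].
  elim/last_ind: s => [|s i _]; first by case: S.
  rewrite map_rcons => /rcons_inj[-> ->]; rewrite rev_rcons => ss xi.
  have o1 := ord _ ss.
  (* A repeated entry keeps the list ordered, and the symbol has derivatives of every order in xi: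
     this yields the second derivative along i that [est] requires. *)
  have o2 : ordered (i :: i :: rev s).
    by move: o1; rewrite /ordered /= leqnn => /andP[-> ->].
  have [/= [[_ d1] d2] _] := rderive_slice x (Hd _ o2).
  by rewrite -map_rcons !foldE rev_rcons; split; [exact: d1|exact: d2].
have os := ord _ ss; rewrite foldE size_map.
have [_ ->] := rderive_slice x (Hd _ os).
by rewrite -(size_rev s); apply: Hb => //; exact: subseq_uniq ss (enum_uniq _).
Qed.

End phase_measurability.

(** * Finite differences of real-valued symbols *)

Section real_symbols.
Context {R : realType} {n : nat}.
Notation rw := (@row_of_tuple R _).
Notation P := ('rV[R]_n * 'rV[R]_n)%type.
Variables (mu : nat) (k : R).
Implicit Types (C : multiindex n -> multiindex n -> R) (f : P -> R).

Definition real_symbol C f : Prop := forall alpha beta, (mi_order beta <= mu)%N ->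
  rderivable (symbol_dirs alpha beta) f /\
  forall x xi, `|rderive (symbol_dirs alpha beta) f (x, xi)| <=
    C alpha beta * bracket xi `^ (k - (mi_order alpha)%:R).

Section one_symbol.
Variables (C : multiindex n -> multiindex n -> R) (f : P -> R).
Hypothesis symf : real_symbol C f.

Lemma real_symbol_ge0 alpha beta : (mi_order beta <= mu)%N -> 0 <= C alpha beta.
Proof.
move=> bmu; have [_ /(_ 0 0)/(le_trans (normr_ge0 _))] := symf alpha bmu.
by rewrite pmulr_lge0 // powR_gt0 // bracket_gt0.
Qed.

Lemma real_symbol_lists S T : ordered S -> ordered T -> (size T <= mu)%N ->
  rderivable (xidirs S ++ xdirs T) f /\
  forall x xi, `|rderive (xidirs S ++ xdirs T) f (x, xi)| <=
    C (cnt S) (cnt T) * bracket xi `^ (k - (size S)%:R).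
Proof.
move=> oS oT sT; have := symf (cnt S) (beta := cnt T).
by rewrite !mi_order_cnt symbol_dirsE !mi_list_cnt //; exact.
Qed.

(** Differences of a xi-derivative come in the wrong order for the hypothesis; [mixed_bound] sorts
    them into the canonical derivative of indices [cnt (S ++ T')] and [cnt T]. The power of 4 b
    compares the weight at the displaced point with that at X. *)
Lemma real_symbol_mixed S T' T (l : seq (R * P)) (b : R) X : ordered S ->
  (size T <= mu)%N -> [seq p.2 | p <- l] = xidirs T' ++ xdirs T -> 1 <= b ->
  (forall p, p \in l -> phase_step b p) ->
  `|deltas (steps l) (rderive (xidirs S) f) X| <=
  \prod_(p <- l) `|p.1| * (C (cnt (S ++ T')) (cnt T) *
    ((4 * b) `^ (`|k - (size (S ++ T'))%:R| * (size (S ++ T') + size T)%:R) *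
     bracket X.2 `^ (k - (size (S ++ T'))%:R))).
Proof.
move=> oS sT El b1 lb.
have sT' : (mi_order (cnt T) <= mu)%N by rewrite mi_order_cnt.
have [rd rb] := symf (cnt (S ++ T')) sT'.
have [rS _] : rderivable (xidirs S) f /\ True.
  have [+ _] := real_symbol_lists (T := [::]) oS isT (leq0n _).
  by rewrite /= cats0.
apply: (mixed_bound rS rd).
  rewrite El symbol_dirsE catA -map_cat.
  by apply: perm_cat; apply: perm_map; exact: perm_mi_list.
move=> l' y El' Hl' ry; rewrite [y]surjective_pairing; apply: le_trans (rb _ _) _.
rewrite mi_order_cnt ler_wpM2l ?real_symbol_ge0 //.
have szl' : size l' = (size (S ++ T') + size T)%N.
  have := congr1 size El'; rewrite symbol_dirsE size_map [in RHS]size_cat [size (xidirs _)]size_map.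
  by rewrite [size (xdirs _)]size_map !size_mi_list !mi_order_cnt.
rewrite -szl'; apply: reach_bracket ry => // p pl'.
case: (Hl' p pl') => [/lb //|[p1 /mapP[i _ Ei]]].
by right; rewrite Ei; split; [exact: le_trans b1|exists i].
Qed.

Hypotheses (n0 : (0 < n)%N) (mu0 : (0 < mu)%N).

Lemma pmeas_real_symbol : pmeas f.
Proof.
apply: pmeas_partials => v X; rewrite mem_cat => /orP[/mapP[i _ ->]|/mapP[i _ ->]].
  by have [/= [_ +] _] := real_symbol_lists (S := [::]) (T := [:: i]) isT isT mu0.
by have [/= [_ +] _] := real_symbol_lists (S := [:: i]) (T := [::]) isT isT (leq0n _).
Qed.

Variable Cm : R.
Hypothesis leCm : forall alpha beta,
  (mi_order alpha <= n.+1)%N -> (mi_order beta <= mu)%N -> C alpha beta <= Cm.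

Let Cm0 : 0 <= Cm.
Proof.
have z : mi_order ([ffun=> 0%N] : multiindex n) = 0%N.
  by rewrite /mi_order big1 // => i _; rewrite ffunE.
apply: le_trans (leCm (alpha := [ffun=> 0%N]) (beta := [ffun=> 0%N]) _ _); rewrite ?z //.
by apply: real_symbol_ge0; rewrite z.
Qed.

(* A crude exponent that absorbs all the losses in Peetre's inequality. *)
Definition loss : R := (`|k| + n.+1%:R) * (n.+1 + mu)%:R.

Lemma loss_ge0 : 0 <= loss.
Proof. by rewrite mulr_ge0 // addr_ge0. Qed.

Let pow_loss (b : R) (s t : nat) : 1 <= b -> (s <= n.+1)%N -> (t <= n.+1 + mu)%N ->
  (4 * b) `^ (`|k - s%:R| * t%:R) <= (4 * b) `^ loss.
Proof.
move=> b1 sn tn; apply: ler_powR; first by lra.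
apply: ler_pM => //; last by rewrite ler_nat.
apply: le_trans (ler_normB _ _) _; rewrite lerD2l normr_nat ler_nat //.
Qed.

(** The steps move x only and leave the weight alone; xi is displaced merely by the auxiliary unit
    steps that stand for the derivatives [S], whence the constant 4^loss, independent of z. *)
Lemma real_symbol_xdiff S (z : 'rV[R]_n) (r : R) X : ordered S -> (size S <= n)%N ->
  (forall i, `|z 0 i| <= r) ->
  `|deltas (nseq mu ((z, 0) : P)) (rderive (xidirs S) f) X| <=
  n%:R ^+ mu * (r ^+ mu * (Cm * (4 `^ loss * bracket X.2 `^ (k - (size S)%:R)))).
Proof.
move=> oS sS zr; pose L := [seq (z 0 i, (delta_mx 0 i, 0) : P) | i <- enum 'I_n].
have szL : size L = n by rewrite /L size_map size_enum_ord.
rewrite -(total_x z) -/L -[n in n%:R]szL.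
apply: (deltas_nseq_le (Q := fun y => y.2 = X.2)) => // [p s y /mapP[i _ ->] Qy|l y sl lL Qy].
  by rewrite /= scaler0 addr0.
have [T ET] : exists T, [seq p.2 | p <- l] = xdirs T.
  elim: l lL {sl} => [|p l IH] lL; first by exists [::].
  have /IH[T ET] : {subset l <= L} by move=> q ql; apply: lL; rewrite inE ql orbT.
  have /mapP[i _ Ep] := lL p (mem_head _ _).
  by exists (i :: T); rewrite /= ET Ep.
have sT : size T = mu by have := congr1 size ET; rewrite !size_map sl.
have lb p : p \in l -> phase_step 1 p.
  by move=> /lL/mapP[i _ ->]; left.
have El : [seq p.2 | p <- l] = xidirs [::] ++ xdirs T by rewrite ET.
have := real_symbol_mixed y oS (eq_leq sT) El (lexx 1) lb.
rewrite cats0 Qy mulr1 sT => /le_trans; apply.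
apply: ler_pM; rewrite ?mulr_ge0 ?powR_ge0 ?prodr_ge0 ?real_symbol_ge0 ?mi_order_cnt ?sT //.
  rewrite -sl; elim: l lL {sl ET El lb} => [|p l IH] lL; first by rewrite big_nil.
  rewrite big_cons exprS; apply: ler_pM; rewrite ?prodr_ge0 //.
    by have /mapP[i _ ->] := lL p (mem_head _ _); exact: zr.
  by apply: IH => q ql; apply: lL; rewrite inE ql orbT.
apply: ler_pM; rewrite ?mulr_ge0 ?powR_ge0 ?real_symbol_ge0 ?mi_order_cnt ?sT //.
  by apply: leCm; rewrite mi_order_cnt ?sT // (leq_trans sS).
rewrite ler_wpM2r ?powR_ge0 //.
have := @pow_loss 1 (size S) (size S + mu) (lexx _) (leqW sS).
by rewrite !mulr1; apply; rewrite leq_add2r leqW.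
Qed.

(** The increment spends one more xi-derivative, so orders up to n + 1 occur; the power of <xi>
    gained by it is given away. One factor (4 b)^loss comes from reordering, the other from the path
    between Y and its translate. *)
Lemma real_symbol_xidiff S (z : 'rV[R]_n) (r b : R) Y : ordered S -> (size S <= n)%N ->
  1 <= b -> (forall i, `|z 0 i| <= r) -> (forall i, `|z 0 i| <= b) ->
  `|rderive (xidirs S) f (Y + (0, z)) - rderive (xidirs S) f Y| <=
  n%:R * (r * (Cm * ((4 * b) `^ loss * ((4 * b) `^ loss * bracket Y.2 `^ (k - (size S)%:R))))).
Proof.
move=> oS sS b1 zr zb; pose L := [seq (z 0 i, (0, delta_mx 0 i) : P) | i <- enum 'I_n].
have szL : size L = n by rewrite /L size_map size_enum_ord.
rewrite -(total_xi z) -/L.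
have r0 : 0 <= r by apply: le_trans (zr (Ordinal n0)).
set M := r * _.
have -> : n%:R * M = \sum_(p <- L) M.
  by rewrite big_const_seq count_predT iter_addr_0 -[RHS]mulr_natl szL.
have Lb p : p \in L -> phase_step b p.
  by move=> /mapP[i _ ->]; right; split; [exact: zb|exists i].
apply: (telescope_le (M := fun=> M)) => p w pL rw.
have /mapP[i _ Ep] := pL.
have El : [seq p.2 | p <- [:: p]] = xidirs [:: i] ++ xdirs [::] by rewrite Ep.
have lb q : q \in [:: p] -> phase_step b q by rewrite inE => /eqP ->; exact: Lb.
have s0 : (size ([::] : seq 'I_n) <= mu)%N by [].
have := real_symbol_mixed w oS s0 El b1 lb.
rewrite /= /delta big_seq1 size_cat /= addn0 addn1 => /le_trans; apply.
rewrite /M; apply: ler_pM; rewrite ?mulr_ge0 ?powR_ge0 ?real_symbol_ge0 ?mi_order_cnt //.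
  by rewrite Ep; exact: zr.
apply: ler_pM; rewrite ?mulr_ge0 ?powR_ge0 ?real_symbol_ge0 ?mi_order_cnt //.
  by apply: leCm; rewrite mi_order_cnt ?size_cat ?addn1.
apply: ler_pM; rewrite ?powR_ge0 //.
  by apply: pow_loss => //; apply: leq_trans (leq_addr _ _).
apply: le_trans (reach_bracket _ b1 Lb rw) _; rewrite szL; apply: ler_pM; rewrite ?powR_ge0 //.
  by apply: pow_loss => //; rewrite (leq_trans (leqnSn n)) // leq_addr.
by apply: ler_powR_bracket; rewrite -natr1 opprD addrA gerBl.
Qed.

(** The x-translates alone combine to a difference of order [mu], of size delta^mu; the displacement
    in xi is undone at first order, at the cost tau. The remaining power of <W> is harmless, as it
    is later integrated against the Gaussian. *)
Lemma real_symbol_mean S (c : nat -> R) (delta tau : R) (W : 'rV[R]_(n + n)) X :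
  ordered S -> (size S <= n)%N -> 0 < delta -> 0 < tau <= 1 ->
  (forall (g : P -> R) w x, g x - \sum_(j < mu) c j * g (x + j.+1%:R *: w) =
    (-1) ^+ mu * deltas (nseq mu w) g x) ->
  `|rderive (xidirs S) f X -
    \sum_(j < mu) c j * rderive (xidirs S) f (X - iota2 (delta * j.+1%:R) tau W)| <=
  (delta ^+ mu + tau) * Cm * ((n%:R ^+ mu + n%:R * \sum_(j < mu) `|c j|) *
    (4 `^ loss * 4 `^ loss) *
    (bracket W `^ (mu%:R + loss + loss) * bracket X.2 `^ (k - (size S)%:R))).
Proof.
move=> oS sS d0 /andP[t0 t1] Hc; set g := rderive (xidirs S) f; set m := k - _.
set b := bracket W; have b1 : 1 <= b by exact: bracket_ge1.
have b0 : 0 < b by exact: bracket_gt0.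
pose z : 'rV[R]_n := - (delta *: lsubmx W); pose y : 'rV[R]_n := - (tau *: rsubmx W).
have zr i : `|z 0 i| <= delta * b.
  by rewrite !mxE normrN normrM (gtr0_norm d0) ler_pM2l // bracket_coord.
have yr i : `|y 0 i| <= tau * b.
  by rewrite !mxE normrN normrM (gtr0_norm t0) ler_pM2l // bracket_coord.
have yb i : `|y 0 i| <= b.
  by apply: le_trans (yr i) _; rewrite ler_piMl // ltW.
(* The width delta (j + 1) in x produces the equally spaced translates of a finite difference, and
   the fixed width tau gives all of them the same displacement in xi. *)
have XE j : X - iota2 (delta * j.+1%:R) tau W = (X + j.+1%:R *: ((z, 0) : P)) + (0, y).
  rewrite /iota2 [X in X - _]surjective_pairing; congr pair.
    by rewrite /= addr0 /z scalerN scalerA [_ * delta]mulrC.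
  by rewrite /= scaler0 addr0.
have XE2 j : (X + j.+1%:R *: ((z, 0) : P)).2 = X.2 by rewrite /= scaler0 addr0.
have bp : 0 <= b `^ (mu%:R + loss + loss) by exact: powR_ge0.
have e1 : b ^+ mu <= b `^ (mu%:R + loss + loss).
  rewrite -powR_mulrn ?(ltW b0) //; apply: ler_powR => //.
  by have := loss_ge0; lra.
have e2 : b * (b `^ loss * b `^ loss) <= b `^ (mu%:R + loss + loss).
  rewrite -{1}(powRr1 (ltW b0)) -!powRD; try by rewrite (gt_eqF b0) implybT.
  apply: ler_powR => //; rewrite addrA !lerD2r.
  by rewrite -[leLHS]/(1%:R) ler_nat.
have l0 : 0 <= 4 `^ loss by exact: powR_ge0.
have l1 : 1 <= 4 `^ loss.
  by rewrite -[leLHS](powRr0 4); apply: ler_powR; [lra|exact: loss_ge0].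
have p0 : 0 <= bracket X.2 `^ m by exact: powR_ge0.
set F := 4 `^ loss * 4 `^ loss * (b `^ (mu%:R + loss + loss) * bracket X.2 `^ m).
have A1 : `|g X - \sum_(j < mu) c j * g (X + j.+1%:R *: ((z, 0) : P))| <=
    delta ^+ mu * Cm * (n%:R ^+ mu * F).
  rewrite Hc normrM normrX normrN1 expr1n mul1r.
  apply: le_trans (real_symbol_xdiff X oS sS zr) _; rewrite exprMn.
  rewrite [leLHS](_ : _ = delta ^+ mu * Cm * (n%:R ^+ mu * (4 `^ loss * (b ^+ mu * bracket X.2 `^ m)))); last by rewrite /m; ring.
  rewrite ler_wpM2l ?mulr_ge0 ?exprn_ge0 ?(ltW d0) // ler_wpM2l ?exprn_ge0 //.
  apply: ler_pM => //; first by rewrite mulr_ge0 ?exprn_ge0 ?(ltW b0).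
    by rewrite ler_peMl.
  by rewrite ler_wpM2r.
have A2 j : `|g (X + j.+1%:R *: ((z, 0) : P)) - g (X - iota2 (delta * j.+1%:R) tau W)| <=
    tau * Cm * (n%:R * F).
  rewrite XE distrC; apply: le_trans (real_symbol_xidiff _ oS sS b1 yr yb) _.
  rewrite XE2 powRM ?(ltW b0) //.
  rewrite [leLHS](_ : _ = tau * Cm * (n%:R * (4 `^ loss * 4 `^ loss *
     ((b * (b `^ loss * b `^ loss)) * bracket X.2 `^ m)))); last by rewrite /m; ring.
  rewrite ler_wpM2l ?mulr_ge0 ?(ltW t0) // ler_wpM2l // ler_wpM2l ?mulr_ge0 //.
  by rewrite ler_wpM2r.
have F0 : 0 <= F by rewrite !mulr_ge0.
set U := g X - _ in A1 *.
rewrite [X in `|X|](_ : _ = U + \sum_(j < mu) c j * (g (X + j.+1%:R *: ((z, 0) : P)) -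
    g (X - iota2 (delta * j.+1%:R) tau W))); last first.
  have -> : \sum_(j < mu) c j * (g (X + j.+1%:R *: ((z, 0) : P)) -
      g (X - iota2 (delta * j.+1%:R) tau W)) =
    \sum_(j < mu) c j * g (X + j.+1%:R *: ((z, 0) : P)) -
    \sum_(j < mu) c j * g (X - iota2 (delta * j.+1%:R) tau W).
    by rewrite -sumrB; apply: eq_bigr => j _; rewrite mulrBr.
  by rewrite /U; ring.
apply: le_trans (ler_normD _ _) _.
apply: le_trans (_ : delta ^+ mu * Cm * (n%:R ^+ mu * F) +
    \sum_(j < mu) `|c j| * (tau * Cm * (n%:R * F)) <= _).
  apply: lerD => //; apply: le_trans (ler_norm_sum _ _ _) _.
  by apply: ler_sum => j _; rewrite normrM ler_wpM2l.
rewrite -mulr_suml; set V := \sum_(j < mu) _.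
have V0 : 0 <= V by apply: sumr_ge0.
have dm : 0 <= delta ^+ mu by rewrite exprn_ge0 // ltW.
rewrite -[(_ * (4 `^ loss * 4 `^ loss)) * _]mulrA -/F.
rewrite -subr_ge0.
have -> : (delta ^+ mu + tau) * Cm * ((n%:R ^+ mu + n%:R * V) * F) -
  (delta ^+ mu * Cm * (n%:R ^+ mu * F) + V * (tau * Cm * (n%:R * F))) =
  tau * Cm * (n%:R ^+ mu * F) + delta ^+ mu * Cm * (n%:R * V * F) by ring.
by rewrite addr_ge0 // !mulr_ge0 // ?exprn_ge0 // ltW.
Qed.

End one_symbol.

End real_symbols.

(** * Iterated derivatives of convolutions *)

Section iterated_convolution.
Context {R : realType} {n : nat}.
Notation P := ('rV[R]_n * 'rV[R]_n)%type.
Hypothesis n0 : (0 < n)%N.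
Variables (sg tau : R).
Hypotheses (sg0 : 0 < sg) (tau0 : 0 < tau) (tau1 : tau <= 1).

(** Each differentiation under the integral needs bounds for the derivative before and after it; the
    hypothesis on suffixes supplies them at every stage. *)
Lemma conv_rderive_symbol vs (f : P -> R) psi : rapid psi -> pmeas f ->
  rderivable vs f ->
  (forall pre suf, vs = pre ++ suf -> exists B m, forall x xi,
     `|rderive suf f (x, xi)| <= B * bracket xi `^ m) ->
  rderivable vs (conv sg tau f psi) /\
  rderive vs (conv sg tau f psi) = conv sg tau (rderive vs f) psi.
Proof.
move=> rp mf; elim: vs => [//|v vs IH] /= [rd d] H.
have [|r1 r2] := IH rd; first by move=> pre suf E; apply: (H (v :: pre)); rewrite E.
have [B [m leB]] := H [:: v] vs erefl; have [B' [m' leB']] := H [::] (v :: vs) erefl.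
have md := pmeas_rderive mf rd.
rewrite r2.
have D X : is_derive X v (conv sg tau (rderive vs f) psi) (conv sg tau ('D_v (rderive vs f)) psi X).
  exact: (is_derive_conv_symbol n0 sg tau0 tau1 md leB X rp d leB').
by split; [split; [exact: r1 | move=> X; exact: ex_derive] | apply/funext => X; exact: derive_val].
Qed.

Lemma conv_rderive_kernel vs (f : P -> R) (B m : R) psi : rapid psi -> pmeas f ->
  (forall x xi, `|f (x, xi)| <= B * bracket xi `^ m) ->
  rderivable vs (conv sg tau f psi) /\
  rderive vs (conv sg tau f psi) = conv sg tau f (rderive [seq kappa2 sg tau v | v <- vs] psi).
Proof.
move=> rp mf leB; elim: vs => //= v vs [r1 r2]; rewrite r2.
have D X : is_derive X v (conv sg tau f (rderive [seq kappa2 sg tau v | v <- vs] psi))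
    (conv sg tau f ('D_(kappa2 sg tau v) (rderive [seq kappa2 sg tau v | v <- vs] psi)) X).
  exact: (is_derive_conv_kernel n0 sg0 tau0 tau1 mf leB X v (rapid_rderive _ rp)).
by split; [split; [exact: r1 | move=> X; exact: ex_derive] | apply/funext => X; exact: derive_val].
Qed.

Lemma conv_smooth vs (f : P -> R) (B m : R) psi : rapid psi -> pmeas f ->
  (forall x xi, `|f (x, xi)| <= B * bracket xi `^ m) ->
  continuous (rderive vs (conv sg tau f psi)).
Proof.
move=> rp mf leB.
pose K v := B * 2 `^ `|m| * (\int[@Lam R (n + n)]_t (bracket (row_of_tuple t) `^ `|m| *
   `|rderive [seq kappa2 sg tau w | w <- v :: vs] psi (row_of_tuple t)|)).
have [r1 _] := conv_rderive_kernel vs rp mf leB.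
have leK v X : `|'D_v (rderive vs (conv sg tau f psi)) X| <= K v * bracket X.2 `^ m.
  have [_ E] := conv_rderive_kernel (v :: vs) rp mf leB.
  rewrite -[X in `|X|]/(rderive (v :: vs) (conv sg tau f psi) X) E.
  exact: (conv_le n0 sg tau0 tau1 mf leB X (rapid_rderive _ rp)).
pose ds := xdirs (enum 'I_n) ++ xidirs (enum 'I_n) : seq P.
apply: (@continuous_of_partials _ _ _ (\sum_(v <- ds) `|K v|) m) => v X vd.
  by have [[_ d] _] := conv_rderive_kernel (v :: vs) rp mf leB; exact: d.
apply: le_trans (leK v X) _; rewrite ler_wpM2r ?powR_ge0 //.
apply: le_trans (ler_norm _) _.
by rewrite (big_rem v) //= lerDl sumr_ge0.
Qed.

(** Every x-derivative that falls on the kernel costs one factor [sg^-1]; this is the only source of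
    negative powers of delta. *)
Lemma conv_xdirs s (f : P -> R) (psi : 'rV[R]_(n + n) -> R) : rapid psi ->
  rderive [seq kappa2 sg tau v | v <- xdirs s] psi =
  (fun W => sg^-1 ^+ size s * rderive [seq row_mx (delta_mx 0 i) 0 | i <- s] psi W).
Proof.
move=> rp; have [r _] := rp [seq row_mx (delta_mx 0 i) 0 | i <- s].
have [_] := rderive_dirZ sg^-1 r; rewrite size_map => <-; congr rderive.
rewrite /xdirs -!map_comp; apply: eq_map => i /=.
by rewrite /kappa2 /= scaler0 scale_row_mx scaler0.
Qed.

End iterated_convolution.

(** * The mollified symbol and the remainder *)

Section mollified_symbol.
Context {R : realType} {n : nat}.
Notation TR := (measurableTypeR R).
Notation rw := (@row_of_tuple R _).
Notation P := ('rV[R]_n * 'rV[R]_n)%type.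
Notation L := (@Lam R (n + n)).
Implicit Types (f : P -> R).
Hypothesis n0 : (0 < n)%N.
Variables (mu : nat) (k : R).
Hypothesis mu0 : (0 < mu)%N.

(** The at most [mu] innermost x-derivatives, which can fall on the symbol; the dropped entries are
    the outer ones, left to the kernel. A tail of an ordered list is ordered, so the estimates apply
    to it. *)
Definition trunc_index (beta : multiindex n) : multiindex n :=
  cnt (drop (mi_order beta - mu) (mi_list beta)).

Lemma mi_order_trunc beta : mi_order (trunc_index beta) = minn mu (mi_order beta).
Proof. by rewrite mi_order_cnt size_drop size_mi_list; rewrite /minn; case: ltnP => H; [rewrite subKn // ltnW|rewrite (eqP H) subn0]. Qed.

Lemma rderiveB vs f g : rderivable vs f -> rderivable vs g ->
  rderivable vs (fun X => f X - g X) /\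
  rderive vs (fun X => f X - g X) = (fun X => rderive vs f X - rderive vs g X).
Proof.
elim: vs => [//|v vs IH] /= [rf df] [rg dg]; have [r ->] := IH rf rg.
have D X : is_derive X v (fun X => rderive vs f X - rderive vs g X)
    ('D_v (rderive vs f) X - 'D_v (rderive vs g) X).
  by apply: is_deriveB; exact: derivableP.
by split; [split; [exact: r | move=> X; exact: ex_derive] | apply/funext => X; exact: derive_val].
Qed.

Lemma map_suffix (I : Type) (T : Type) (e : I -> T) s pre suf :
  [seq e i | i <- s] = pre ++ suf -> exists s1 s2, s = s1 ++ s2 /\ suf = [seq e i | i <- s2].
Proof.
move=> H; exists (take (size pre) s), (drop (size pre) s); rewrite cat_take_drop; split => //.
by rewrite map_drop H drop_size_cat.
Qed.

Lemma ordered_catr (s1 s2 : seq 'I_n) : ordered (s1 ++ s2) -> ordered s2.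
Proof. by rewrite /ordered pairwise_cat => /and3P[]. Qed.

Lemma Rintegral_lincomb (c : nat -> R) (a : R) (G : nat -> (n + n).-tuple TR -> R) g m :
  L.-integrable setT (fun t => (g t)%:E) ->
  (forall j, L.-integrable setT (fun t => (G j t)%:E)) ->
  L.-integrable setT (fun t => (a * g t - \sum_(j < m) c j * G j t)%:E) /\
  \int[L]_t (a * g t - \sum_(j < m) c j * G j t) =
    a * \int[L]_t g t - \sum_(j < m) c j * \int[L]_t G j t.
Proof.
move=> ig iG; have ia : L.-integrable setT (EFin \o (fun t => a * g t)) := integrableZl measurableT a ig.
elim: m => [|m [i1 e1]].
  rewrite big_ord0 subr0 -RintegralZl //.
  have E t : a * g t - \sum_(j < 0) c j * G j t = a * g t by rewrite big_ord0 subr0.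
  by split; [under eq_fun do rewrite E|apply: eq_Rintegral => t _; rewrite E].
have im : L.-integrable setT (EFin \o (fun t => c m * G m t)) := integrableZl measurableT (c m) (iG m).
have E t : a * g t - \sum_(j < m.+1) c j * G j t = (a * g t - \sum_(j < m) c j * G j t) - c m * G m t.
  by rewrite big_ord_recr /= opprD addrA.
split; first by under eq_fun do rewrite E; exact: (integrableB measurableT i1 im).
under eq_Rintegral do rewrite E.
have i1' : L.-integrable setT (EFin \o (fun t => a * g t - \sum_(j < m) c j * G j t)) := i1.
have iGm : L.-integrable setT (EFin \o G m) := iG m.
have -> : \sum_(j < m.+1) c j * \int[L]_t G j t =
    \sum_(j < m) c j * \int[L]_t G j t + c m * \int[L]_t G m t by rewrite big_ord_recr.
by rewrite RintegralB // e1 RintegralZl // opprD addrA.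
Qed.

Theorem mollify : exists (K : multiindex n -> multiindex n -> R) (K2 : R),
  [/\ forall alpha beta, 0 <= K alpha beta, 0 <= K2 &
  forall C f (delta : R), real_symbol mu k C f -> 0 < delta <= 1 ->
  exists fd : P -> R,
  [/\ pmeas f, pmeas fd,
    forall vs, rderivable vs fd /\ continuous (rderive vs fd),
    forall alpha beta x xi, `|rderive (symbol_dirs alpha beta) fd (x, xi)| <=
      K alpha beta * delta^-1 ^+ (mi_order beta - mu) * C alpha (trunc_index beta) *
      bracket xi `^ (k - (mi_order alpha)%:R) &
    forall Cm, (forall alpha beta, (mi_order alpha <= n.+1)%N -> (mi_order beta <= mu)%N ->
        C alpha beta <= Cm) ->
      forall x, est (rev [seq delta_mx 0 i | i <- enum 'I_n]) k (K2 * delta ^+ mu * Cm)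
        (fun xi => f (x, xi) - fd (x, xi))]].
Proof.
have N0 : (0 < n + n)%N by rewrite addn_gt0 n0.
have [c _ Hc] := @difference_coefficients R P mu.
pose G := @gauss R (n + n); have rG : rapid G := rapid_gauss.
pose c0 := \int[L]_t G (rw t); have c00 : 0 < c0 := integral_gauss_gt0 N0.
pose pre beta := take (mi_order beta - mu) (mi_list beta) : seq 'I_n.
pose psi0 (beta : multiindex n) := rderive [seq row_mx (delta_mx 0 i) 0 | i <- pre beta] G.
pose I0 m beta := \int[L]_t (bracket (rw t) `^ m * `|psi0 beta (rw t)|).
have I00 m beta : 0 <= I0 m beta.
  by apply: Rintegral_ge0 => t _; rewrite mulr_ge0 ?powR_ge0.
pose K (alpha beta : multiindex n) : R :=
  \sum_(j < mu) `|c j / c0| * (2 `^ `|k - (mi_order alpha)%:R| * I0 `|k - (mi_order alpha)%:R| beta).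
pose rho : R := mu%:R + @loss R n mu k + @loss R n mu k.
pose K1 : R := (n%:R ^+ mu + n%:R * \sum_(j < mu) `|c j|) * (4 `^ @loss R n mu k * 4 `^ @loss R n mu k).
pose J := \int[L]_t (bracket (rw t) `^ rho * G (rw t)).
have G0 W : 0 <= G W by exact: expR_ge0.
have J0 : 0 <= J by apply: Rintegral_ge0 => t _; rewrite mulr_ge0 ?powR_ge0.
have K10 : 0 <= K1 by rewrite !mulr_ge0 ?addr_ge0 ?exprn_ge0 ?mulr_ge0 ?sumr_ge0 ?powR_ge0.
(* The factor 2 comes from [delta ^+ mu + tau] with tau = delta^mu, and [c0^-1] from the
   normalisation of the Gaussian. *)
exists K, (c0^-1 * (2 * K1 * J)); split.
- by move=> alpha beta; apply: sumr_ge0 => j _; rewrite !mulr_ge0 ?powR_ge0.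
- by rewrite mulr_ge0 ?invr_ge0 ?(ltW c00) // mulr_ge0 // mulr_ge0.
move=> C f delta symf /andP[d0 d1].
(* Small enough for the first-order error in xi to match the error delta^mu in x. In the estimates
   the xi-derivatives fall on [f], so that no negative power of tau arises. *)
pose tau := delta ^+ mu.
have t0 : 0 < tau by rewrite exprn_gt0.
have t1 : tau <= 1 by rewrite exprn_ile1 // ltW.
have sg0 j : 0 < delta * j.+1%:R by rewrite mulr_gt0 // ltr0n.
have mf := pmeas_real_symbol symf mu0.
have [_ leB0] := real_symbol_lists symf (S := [::]) (T := [::]) isT isT (leq0n _).
(* Averaging over the (j + 1)-fold translate is the same as averaging with the x-width enlarged by
   the factor j + 1. *)
pose fj (j : 'I_mu) := conv (delta * j.+1%:R) tau f G.
pose fd X := \sum_(j < mu) (c j / c0) * fj j X.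
have rj vs j : rderivable vs (fj j).
  by have [] := conv_rderive_kernel n0 (sg0 j) t0 t1 vs rG mf leB0.
have fdE vs : rderivable vs fd /\
    rderive vs fd = (fun X => \sum_(j < mu) (c j / c0) * rderive vs (fj j) X).
  by apply: rderive_lincomb => j; exact: rj.
exists fd; split => //.
- apply: pmeas_partials => v X _.
  by have [[_ d] _] := fdE [:: v]; exact: d.
- move=> vs; have [r ->] := fdE vs; split => //.
  move=> X; rewrite (_ : (fun _ => _) = \sum_(j < mu) (fun X => c j / c0 * rderive vs (fj j) X)); last first.
    by apply/funext => Y; rewrite fct_sumE.
  elim/big_ind : _ => [|a b ca cb|j _]; first exact: cvg_cst.
    exact: (cvgD ca cb).
  apply: cvgM; first exact: cvg_cst.
  have H := conv_smooth n0 (sg0 j) t0 t1 (vs := vs) rG mf leB0.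
  exact: (H X).
- move=> alpha beta x xi; set p := (mi_order beta - mu)%N.
  set m := k - (mi_order alpha)%:R; have [_ ->] := fdE (symbol_dirs alpha beta).
  pose suf := drop p (mi_list beta).
  have oL := ordered_mi_list beta; rewrite -(cat_take_drop p (mi_list beta)) in oL.
  have osuf : ordered suf := ordered_catr oL.
  have ssuf : (size suf <= mu)%N.
    by rewrite size_drop size_mi_list /p leq_subLR addnC -maxnE leq_maxr.
  have spre : size (pre beta) = p.
    by rewrite size_takel // size_mi_list leq_subr.
  have oA := ordered_mi_list alpha.
  have [rA bA] := real_symbol_lists symf oA osuf ssuf.
  have cA : cnt (mi_list alpha) = alpha.
    by apply/ffunP => i; rewrite ffunE count_mi_list.
  rewrite cA size_mi_list in bA.
  have /rderivable_cat[rS rA'] := rA.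
  set g0 := rderive (xdirs suf) f in rA'.
  have mg0 : pmeas g0 by exact: pmeas_rderive.
  have bg0 : forall x xi, `|g0 (x, xi)| <= C (cnt [::]) (cnt suf) * bracket xi `^ (k - 0%:R).
    by have [_ H] := real_symbol_lists symf (S := [::]) isT osuf ssuf.
  have suffS pr sf : xdirs suf = pr ++ sf -> exists B m, forall x xi,
      `|rderive sf f (x, xi)| <= B * bracket xi `^ m.
    move=> /map_suffix[s1 [s2 [E1 ->]]].
    have o2 : ordered s2 by move: osuf; rewrite E1 => /ordered_catr.
    have z2 : (size s2 <= mu)%N.
      by apply: leq_trans ssuf; rewrite E1 size_cat leq_addl.
    have [_ H] := real_symbol_lists symf (S := [::]) isT o2 z2.
    by exists (C (cnt [::]) (cnt s2)), (k - 0%:R).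
  have suffA pr sf : xidirs (mi_list alpha) = pr ++ sf -> exists B m, forall x xi,
      `|rderive sf g0 (x, xi)| <= B * bracket xi `^ m.
    move=> /map_suffix[s1 [s2 [E1 ->]]].
    have o2 : ordered s2 by move: oA; rewrite E1 => /ordered_catr.
    have [_ H] := real_symbol_lists symf o2 osuf ssuf.
    exists (C (cnt s2) (cnt suf)), (k - (size s2)%:R) => y eta.
    by rewrite -rderive_cat; exact: H.
  (* Three stages, from the inside out: the x-derivatives [suf] fall on [f], the remaining |beta| -
     mu ones on the kernel, and the xi-derivatives on the symbol again. The derivative of [f] thus
     obtained is in the canonical order. *)
  have bj (j : 'I_mu) : `|rderive (symbol_dirs alpha beta) (fj j) (x, xi)| <=
      (2 `^ `|m| * I0 `|m| beta) * (delta^-1 ^+ p * C alpha (trunc_index beta) * bracket xi `^ m).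
    have [_ E1] := conv_rderive_symbol n0 (delta * j.+1%:R) t0 t1 rG mf rS suffS.
    have [_ E2] := conv_rderive_kernel n0 (sg0 j) t0 t1 (xdirs (pre beta)) rG mg0 bg0.
    set psi := rderive _ G in E2.
    have rpsi : rapid psi by exact: rapid_rderive.
    have [_ E3] := conv_rderive_symbol n0 (delta * j.+1%:R) t0 t1 rpsi mg0 rA' suffA.
    have -> : rderive (symbol_dirs alpha beta) (fj j) =
        conv (delta * j.+1%:R) tau (rderive (xidirs (mi_list alpha)) g0) psi.
      rewrite symbol_dirsE -{1}(cat_take_drop p (mi_list beta)) /xdirs map_cat -!/(xdirs _).
      by rewrite !rderive_cat E1 E2 E3.
    have mA : pmeas (rderive (xidirs (mi_list alpha)) g0) by exact: pmeas_rderive.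
    have bA' : forall x xi, `|rderive (xidirs (mi_list alpha)) g0 (x, xi)| <=
        C alpha (cnt suf) * bracket xi `^ m.
      by move=> y eta; rewrite -rderive_cat; exact: bA.
    apply: le_trans (conv_le n0 (delta * j.+1%:R) t0 t1 mA bA' (x, xi) rpsi) _.
    have psiE W : psi W = (delta * j.+1%:R)^-1 ^+ p * psi0 beta W.
      by rewrite /psi conv_xdirs // spre.
    have s1 : 0 <= (delta * j.+1%:R)^-1 ^+ p by rewrite exprn_ge0 // invr_ge0 ltW.
    have -> : \int[L]_t (bracket (rw t) `^ `|m| * `|psi (rw t)|) =
        (delta * j.+1%:R)^-1 ^+ p * I0 `|m| beta.
      rewrite /I0 -RintegralZl //.
        by apply: eq_Rintegral => t _; rewrite psiE normrM ger0_norm // mulrCA.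
      have := integrable_abse (integrable_rapid N0 `|m| (rapid_rderive [seq row_mx (delta_mx 0 i) 0 | i <- pre beta] rG)).
      congr integrable; apply/funext => t /=.
      by rewrite normrM [`|bracket _ `^ _|]ger0_norm ?powR_bracket_ge0.
    have Ct : 0 <= C alpha (cnt suf) by apply: (real_symbol_ge0 symf); rewrite mi_order_cnt.
    rewrite [leLHS](_ : _ = 2 `^ `|m| * I0 `|m| beta *
      ((delta * j.+1%:R)^-1 ^+ p * C alpha (cnt suf) * bracket xi `^ m)); last by rewrite /=; ring.
    rewrite ler_wpM2l ?mulr_ge0 ?powR_ge0 // ler_wpM2r ?powR_ge0 //.
    (* All the widths delta (j + 1) are at least delta, so their inverses are at most delta^-1. *)
    rewrite ler_wpM2r //; apply: lerXn2r; rewrite ?nnegrE ?invr_ge0 ?(ltW d0) ?(ltW (sg0 j)) //.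
    by rewrite lef_pV2 ?posrE // ler_peMr ?(ltW d0) // ler1n.
  apply: le_trans (ler_norm_sum _ _ _) _.
  rewrite /K -!mulrA mulr_suml; apply: ler_sum => j _.
  rewrite normrM -!mulrA ler_wpM2l //.
  by apply: le_trans (bj j) _; rewrite -!mulrA.
- move=> Cm leCm x.
  have suffA s (os : ordered s) pr sf : xidirs s = pr ++ sf -> exists B m, forall x xi,
      `|rderive sf f (x, xi)| <= B * bracket xi `^ m.
    move=> /map_suffix[s1 [s2 [E1 ->]]].
    have o2 : ordered s2 by move: os; rewrite E1 => /ordered_catr.
    have [_ H] := real_symbol_lists symf o2 (T := [::]) isT (leq0n _).
    by move: H; rewrite cats0 => H; exists (C (cnt s2) (cnt [::])), (k - (size s2)%:R).
  have rS s : ordered s -> rderivable (xidirs s) f.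
    by move=> os; have [] := real_symbol_lists symf os (T := [::]) isT (leq0n _); rewrite cats0.
  apply: (est_intro_phase (F := fun X => f X - fd X)) => [s os|s os us xi].
    by have [] := rderiveB (rS s os) (fdE (xidirs s)).1.
  have [_ ->] := rderiveB (rS s os) (fdE (xidirs s)).1.
  have [_ ->] := fdE (xidirs s).
  have sn : (size s <= n)%N.
    by rewrite -[n in (_ <= n)%N]card_ord -[X in (X <= _)%N](card_uniqP us) max_card.
  set g := rderive (xidirs s) f; set X : P := (x, xi).
  have mg : pmeas g by apply: pmeas_rderive => //; exact: rS.
  have bg : forall x xi, `|g (x, xi)| <= C (cnt s) (cnt [::]) * bracket xi `^ (k - (size s)%:R).
    by have [_] := real_symbol_lists symf os (T := [::]) isT (leq0n _); rewrite cats0.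
  have E1 (j : 'I_mu) : rderive (xidirs s) (fj j) X =
      \int[L]_t (g (X - iota2 (delta * j.+1%:R) tau (rw t)) * G (rw t)).
    have [_ E] := conv_rderive_symbol n0 (delta * j.+1%:R) t0 t1 rG mf (rS s os) (suffA s os).
    by rewrite /fj E.
  pose GG (j : nat) (t : (n + n).-tuple TR) := g (X - iota2 (delta * j.+1%:R) tau (rw t)) * G (rw t).
  have iGG j : L.-integrable setT (fun t => (GG j t)%:E).
    exact: (integrable_conv n0 (delta * j.+1%:R) t0 t1 mg bg X rG).
  have iG : L.-integrable setT (fun t => (G (rw t))%:E).
    by have := integrable_rapid N0 0 rG; under eq_fun do rewrite powRr0 mul1r.
  have [iH EH] := Rintegral_lincomb c (g X) mu iG iGG.
  (* As [c0] is the integral of the Gaussian, [g X] can be put under the integral too; the integrand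
     becomes the combination that [real_symbol_mean] estimates for each W. *)
  have -> : g X - \sum_(j < mu) c j / c0 * rderive (xidirs s) (fj j) X =
      c0^-1 * \int[L]_t (g X * G (rw t) - \sum_(j < mu) c j * GG j t).
    rewrite EH -/c0 mulrBr mulrCA mulVf ?gt_eqF // mulr1; congr (_ - _).
    by rewrite mulr_sumr; apply: eq_bigr => j _; rewrite E1 mulrA [_^-1 * _]mulrC.
  rewrite normrM gtr0_norm ?invr_gt0 //.
  set m := k - _; rewrite -!mulrA ler_wpM2l ?invr_ge0 ?(ltW c00) //.
  apply: le_trans (le_normr_Rintegral measurableT iH) _.
  have Cm0 : 0 <= Cm.
    apply: le_trans (leCm (cnt [::]) (cnt [::]) _ _); rewrite ?mi_order_cnt //.
    by apply: (real_symbol_ge0 symf); rewrite mi_order_cnt.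
  have iJ := integrable_rapid N0 rho rG.
  pose Q := (delta ^+ mu + tau) * Cm * K1 * bracket xi `^ m.
  apply: le_trans (_ : \int[L]_t (Q * (bracket (rw t) `^ rho * G (rw t))) <= _).
    apply: le_Rintegral => //.
    - exact: (integrable_norm iH).
    - exact: (integrableZl measurableT Q iJ).
    move=> t _.
    rewrite [X in `|X|](_ : _ = (g X - \sum_(j < mu) c j * g (X - iota2 (delta * j.+1%:R) tau (rw t))) * G (rw t)); last first.
      by rewrite mulrBl mulr_suml; congr (_ - _); apply: eq_bigr => j _; rewrite /GG mulrA.
    rewrite normrM (ger0_norm (G0 _)) mulrA ler_wpM2r //.
    have t01 : 0 < tau <= 1 by rewrite t0 t1.
    apply: le_trans (real_symbol_mean symf n0 mu0 leCm (rw t) X os sn d0 t01 Hc) _.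
    by rewrite /Q /K1 /rho -/m /=; lra.
  by rewrite RintegralZl // -/J le_eqVlt; apply/orP; left; apply/eqP; rewrite /Q /tau /K1; ring.
Qed.

End mollified_symbol.

(** * Conclusion *)

Section finite_index_sums.
Context {R : realType}.

Lemma fsum_le_card (T : choiceType) (D : set T) (F : T -> R) (S : R) : finite_set D ->
  (forall x, D x -> F x <= S) ->
  \sum_(x \in D) F x <= (size (finmap.enum_fset (fset_set D)))%:R * S.
Proof.
move=> finD FS; rewrite fsbig_finite //= mulr_natl.
rewrite (_ : S *+ _ = \sum_(x <- finmap.enum_fset (fset_set D)) S); last first.
  by rewrite big_const_seq count_predT iter_addr_0.
rewrite [leLHS]big_seq [leRHS]big_seq; apply: ler_sum => x.
by rewrite (in_fset_set finD) => /set_mem /FS.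
Qed.

Lemma fsum_ge_term (T : choiceType) (D : set T) (F : T -> R) y : finite_set D ->
  (forall x, D x -> 0 <= F x) -> D y -> F y <= \sum_(x \in D) F x.
Proof.
move=> finD F0 Dy; rewrite fsbig_finite //=.
rewrite (bigD1_seq y) /=; last by rewrite finmap.fset_uniq.
- rewrite lerDl big_seq_cond; apply: sumr_ge0 => x /andP[+ _].
  by rewrite (in_fset_set finD) => /set_mem /F0.
by rewrite (in_fset_set finD); apply/mem_set.
Qed.

Lemma fsum_ge0 (T : choiceType) (D : set T) (F : T -> R) : finite_set D ->
  (forall x, D x -> 0 <= F x) -> 0 <= \sum_(x \in D) F x.
Proof.
move=> finD F0; rewrite fsbig_finite //= big_seq; apply: sumr_ge0 => x.
by rewrite (in_fset_set finD) => /set_mem /F0.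
Qed.

Lemma finite_multiindex n (m : nat) :
  finite_set [set p : multiindex n * multiindex n |
    (mi_order p.1 <= m)%N /\ (mi_order p.2 <= m)%N].
Proof.
have fin1 : finite_set [set alpha : multiindex n | (mi_order alpha <= m)%N].
  pose g (e : {ffun 'I_n -> 'I_m.+1}) : multiindex n := [ffun i => e i : nat].
  apply: (@sub_finite_set _ _ (g @` setT)); last exact/finite_image/finite_finset.
  move=> alpha /= le; exists [ffun i => inord (alpha i)] => //.
  apply/ffunP => i; rewrite !ffunE inordK // ltnS (leq_trans _ le) //.
  by rewrite /mi_order (bigD1 i) //= leq_addr.
apply: (@sub_finite_set _ _ ([set alpha : multiindex n | (mi_order alpha <= m)%N] `*`
  [set alpha : multiindex n | (mi_order alpha <= m)%N])); last exact: finite_setX.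
by move=> p.
Qed.
End finite_index_sums.

Section operator_splitting.
Context {R : realType} {n : nat}.
Notation TR := (measurableTypeR R).
Notation rw := (@row_of_tuple R n).
Notation L := (@Lam R n).
Notation normc := (@Normc.normc R).
Notation P := ('rV[R]_n * 'rV[R]_n)%type.
Notation pcmeas a := (cmeas (fun p : n.-tuple TR * n.-tuple TR => a (rw p.1, rw p.2))).

Lemma L2norm_triangle (F G H : 'rV[R]_n -> R[i]) : cmeas (F \o rw) -> cmeas (G \o rw) ->
  cmeas (H \o rw) -> (forall x, F x = G x + H x) -> (L2norm F <= L2norm G + L2norm H)%E.
Proof.
move=> mF mG mH FGH.
have le1 : (1 <= 2%:E :> \bar R)%E by rewrite lee_fin ler1n.
have /(_ (measurable_normc mG) (measurable_normc mH) le1) := @eminkowski _ _ R (lebesgue_tuple n)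
  (fun t => normc ((G \o rw) t)) (fun t => normc ((H \o rw) t)) 2%:E.
apply: le_trans; rewrite -/(L2norm F).
pose N := fun x => (normc (G x) + normc (H x))%:C.
have mN : cmeas (N \o rw).
  by apply: cmeas_real; apply: measurable_funD; exact: measurable_normc.
rewrite [leRHS](_ : _ = L2norm N); last first.
  rewrite /L2norm; congr Lnorm; apply/funext => t.
  by rewrite /N (normc_real (normc (G (rw t)) + normc (H (rw t)))) ger0_norm // addr_ge0 ?normc_ge0.
rewrite -[leRHS]mul1e; apply: L2norm_le_of_sqnorm => //.
rewrite expr1n mul1e; apply: ge0_le_integral => //.
- by move=> t _; rewrite lee_fin sqr_ge0.
- exact: measurable_sqnorm.
- exact: measurable_sqnorm.
move=> t _; rewrite lee_fin lerXn2r ?nnegrE ?normc_ge0 //.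
rewrite normc_real ger0_norm ?FGH ?normcD_le //.
by rewrite addr_ge0 ?normc_ge0.
Qed.

Variable h : R.
Hypotheses (h0 : 0 < h) (n0 : (0 < n)%N).

Lemma cintegrable_symbol (a : P -> R[i]) (B k : R) u x : schwartz u -> pcmeas a ->
  (forall x xi, normc (a (x, xi)) <= B * bracket xi `^ k) ->
  cintegrable L (fun t => a (x, rw t) * uhat h u (rw t)).
Proof.
move=> su ma leB; have [ig _ _ _] := ghat_props h0 n0 k su.
have ign := integrable_normc ig.
apply: (@cintegrable_le _ _ _ _ _ (fun t => B * normc (ghat h k u (rw t)))).
- apply: cmeasM; last exact: cmeas_uhat.
  have mp : measurable_fun setT (fun t : n.-tuple TR => ([tuple x 0 i | i < n] : n.-tuple TR, t)).
    exact: measurable_fun_pair.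
  have := cmeas_comp ma mp.
  congr (cmeas _); apply/funext => t /=; congr (a (_, _)).
  by apply/rowP => i; rewrite mxE tnth_mktuple.
- have := integrableZl measurableT B ign.
  by congr (integrable _ _ _); apply/funext => t /=; rewrite EFinM.
move=> t; rewrite /ghat !Normc.normcM normc_real ger0_norm ?powR_ge0 // mulrA.
by apply: ler_wpM2r; [exact: normc_ge0|exact: leB].
Qed.

(** Additivity in the symbol holds because [uhat] decays faster than any power of <xi>, so both
    integrals in xi converge absolutely. *)
Lemma Op_split (a b r : P -> R[i]) (Ba Br ka kr : R) u x : schwartz u ->
  pcmeas b -> pcmeas r ->
  (forall x xi, normc (b (x, xi)) <= Ba * bracket xi `^ ka) ->
  (forall x xi, normc (r (x, xi)) <= Br * bracket xi `^ kr) ->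
  (forall X, a X = b X + r X) ->
  Op h a u x = Op h b u x + Op h r u x.
Proof.
move=> su mb mr leb ler abr; rewrite !Op_fourier // -mulrDr; congr (_ * _).
rewrite /fourier -cintD; first by apply: eq_cint => t; rewrite abr mulrDl mulrDr.
- exact: (cintegrable_fker (f := fun xi => b (x, xi) * uhat h u xi) h x
    (cintegrable_symbol x su mb leb)).
exact: (cintegrable_fker (f := fun xi => r (x, xi) * uhat h u xi) h x
    (cintegrable_symbol x su mr ler)).
Qed.

Lemma opnorm_perturb (k c : R) (T S : ('rV[R]_n -> R[i]) -> 'rV[R]_n -> R[i]) : 0 <= c ->
  (forall u, schwartz u -> L2norm (T u) <= L2norm (S u) + c%:E * sobolev_norm h k u)%E ->
  (opnorm h k T <= opnorm h k S + c%:E)%E.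
Proof.
move=> c0 leTS; apply: ge_ereal_sup => _ [u [su nu] <-].
apply: le_trans (leTS u su) _; apply: leeD.
  by apply: ereal_sup_ubound; exists u.
by rewrite -[leRHS]mule1; apply: lee_wpmul2l; rewrite ?lee_fin.
Qed.
End operator_splitting.

Section complex_symbols.
Context {R : realType} {n : nat}.
Notation P := ('rV[R]_n * 'rV[R]_n)%type.
Notation normc := (@Normc.normc R).

Lemma symbol_parts mu k C (a : P -> R[i]) : symbol_estimates mu k C a ->
  real_symbol mu k C (@complex.Re R \o a) /\ real_symbol mu k C (@complex.Im R \o a).
Proof.
move=> sa; split=> alpha beta lemu; have [/iderivableE[dR dI] le] := sa alpha beta lemu.
  split=> // x xi; rewrite -Re_iderive.
  by apply: le_trans (Re_le_normc _) (le _ _).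
split=> // x xi; rewrite -Im_iderive.
by apply: le_trans (Im_le_normc _) (le _ _).
Qed.

Lemma iderive_parts vs (f g : P -> R) X :
  iderive vs (fun X => f X +i* g X) X = rderive vs f X +i* rderive vs g X.
Proof.
apply: ReIm_eq => /=.
  exact: (congr1 (@^~ X) (Re_iderive vs (fun X => f X +i* g X))).
exact: (congr1 (@^~ X) (Im_iderive vs (fun X => f X +i* g X))).
Qed.

Lemma smooth_parts (f g : P -> R) :
  (forall vs, rderivable vs f /\ continuous (rderive vs f)) ->
  (forall vs, rderivable vs g /\ continuous (rderive vs g)) ->
  smooth (fun X => f X +i* g X).
Proof.
move=> sf sg vs; have [df cf] := sf vs; have [dg cg] := sg vs.
split; first by apply/iderivableE.
split.
  by rewrite (_ : _ \o _ = rderive vs f) //; apply/funext => X; rewrite /= iderive_parts.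
by rewrite (_ : _ \o _ = rderive vs g) //; apply/funext => X; rewrite /= iderive_parts.
Qed.

Lemma normc_parts_le (x y : R) (B : R) : `|x| <= B -> `|y| <= B -> normc (x +i* y) <= 2 * B.
Proof.
move=> xB yB; apply: le_trans (normc_le_ReIm _) _.
by rewrite mulr_natl mulr2n; apply: lerD.
Qed.
End complex_symbols.

Section symbol_splitting.
Context {R : realType} {n : nat}.
Notation TR := (measurableTypeR R).
Notation rw := (@row_of_tuple R n).
Notation L := (@Lam R n).
Notation normc := (@Normc.normc R).
Notation P := ('rV[R]_n * 'rV[R]_n)%type.
Notation MI := (multiindex n).
Hypothesis n0 : (0 < n)%N.

(** Trades a symbol of order k for a function decaying like <xi>^(-(k' - k)), the form in which the
    ray representation applies. *)
Lemma est_times_bracket (k k' : R) : exists2 D : R, 0 <= D &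
  forall (B : R) (f : 'rV[R]_n -> R),
    est (rev [seq delta_mx 0 i | i <- enum 'I_n]) k B f ->
    est (rev [seq delta_mx 0 i | i <- enum 'I_n]) (- (k' - k)) (D * B)
      (fun xi => f xi * bracket xi `^ (- k')).
Proof.
have [D0] := @est_bracket R n (- k') (rev (enum 'I_n)) (eq_ind_r is_true (enum_uniq _) (rev_uniq _)).
rewrite map_rev => eD; exists (2 ^+ n * D0).
  by rewrite mulr_ge0 ?exprn_ge0 ?(est_ge0 eD).
move=> B f ef; have := est_mul ef eD.
rewrite size_rev size_map size_enum_ord opprB (mulrC B) mulrA.
by congr est.
Qed.

(** [K] is chosen before h, delta and the symbol, so delta remains free: it can be tied to h, or
    sent to 0 for a fixed symbol. *)
Lemma Op_split_estimate (s mu : nat) (k k' : R) : bounded_on_sobolev R n.+1 s ->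
  (0 < mu)%N -> k < k' -> exists2 K : R, 0 < K &
  forall (h delta Cm : R) (a : P -> R[i]) (C : MI -> MI -> R),
    0 < h <= 1 -> 0 < delta <= 1 -> symbol_estimates mu k C a ->
    (forall alpha beta, (mi_order alpha <= n.+1)%N -> (mi_order beta <= mu)%N ->
      C alpha beta <= Cm) ->
    (opnorm h k' (Op h a) <= (K *
      (\sum_(p \in [set p : MI * MI | (mi_order p.1 + mi_order p.2 <= s)%N])
        h `^ ((mi_order p.1 + mi_order p.2)%:R / 2) *
        (delta^-1 ^+ (mi_order p.2 - mu) * C p.1 (trunc_index mu p.2)) +
       delta ^+ mu * Cm))%:E)%E.
Proof.
move=> hs mu0 kk'; have [Ks Ks0 bnd] := hs k'.
have [K [K2 [K0 K20 moll]]] := mollify n0 k mu0.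
have [D D0 eD] := est_times_bracket k k'.
set D1 := [set p : MI * MI | (mi_order p.1 + mi_order p.2 <= s)%N].
have finD1 : finite_set D1.
  apply: (sub_finite_set _ (finite_multiindex n s)) => p /= le.
  by split; apply: leq_trans le; rewrite ?leq_addr ?leq_addl.
pose M := \sum_(p \in D1) K p.1 p.2.
have leM p : D1 p -> K p.1 p.2 <= M.
  by move=> Dp; apply: (@fsum_ge_term _ _ D1 (fun p => K p.1 p.2)) => // q _; exact: K0.
have M0 : 0 <= M by apply: fsum_ge0 => // p _; exact: K0.
pose J := \int[L]_t bracket (rw t) `^ (- (n%:R + (k' - k))).
have J0 : 0 <= J by apply: Rintegral_ge0 => t _; rewrite powR_ge0.
exists (1 + Ks * (2 * M) + 2 * (D * K2) * J).
  by rewrite ltr_wpDr ?ltr_wpDr ?mulr_ge0 // ltW.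
move=> h delta Cm a C h01 d01 sa leC.
have [h0 h1] := andP h01; have [d0 d1] := andP d01.
have [sR sI] := symbol_parts sa.
have C0 alpha beta : (mi_order beta <= mu)%N -> 0 <= C alpha beta.
  exact: (real_symbol_ge0 sR).
have Ct alpha beta : 0 <= C alpha (trunc_index mu beta).
  by apply: C0; rewrite mi_order_trunc geq_minl.
have Cm0 : 0 <= Cm.
  have zo : mi_order ([ffun=> 0%N] : MI) = 0%N.
    by rewrite /mi_order big1 // => i _; rewrite ffunE.
  by apply: le_trans (C0 [ffun=> 0%N] [ffun=> 0%N] _) (leC _ _ _ _); rewrite zo.
have [f1 [mR mf1 sf1 bf1 ef1]] := moll C _ delta sR d01.
have [f2 [mI mf2 sf2 bf2 ef2]] := moll C _ delta sI d01.
pose b X := f1 X +i* f2 X; pose r X := a X - b X.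
(* Bounds for the smooth part at order k'. The hypothesis on [s] has the same weight for all alpha,
   so the gain <xi>^(-|alpha|) and the gap k' - k are given away; the 2 accounts for real and
   imaginary parts. *)
pose C' alpha beta := 2 * (K alpha beta * delta^-1 ^+ (mi_order beta - mu) *
  C alpha (trunc_index mu beta)).
have bb alpha beta x xi : normc (iderive (symbol_dirs alpha beta) b (x, xi)) <=
    C' alpha beta * bracket xi `^ k'.
  rewrite iderive_parts -mulrA; apply: normc_parts_le.
    apply: le_trans (bf1 _ _ _ _) _; apply: ler_wpM2l.
      by rewrite !mulr_ge0 ?exprn_ge0 ?invr_ge0 // ltW.
    by apply: ler_powR_bracket; rewrite lerBlDr (le_trans (ltW kk')) ?lerDl.
  apply: le_trans (bf2 _ _ _ _) _; apply: ler_wpM2l.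
    by rewrite !mulr_ge0 ?exprn_ge0 ?invr_ge0 // ltW.
  by apply: ler_powR_bracket; rewrite lerBlDr (le_trans (ltW kk')) ?lerDl.
have main := bnd h b C' h01 (smooth_parts sf1 sf2) bb.
have mb : cmeas (fun p : n.-tuple TR * n.-tuple TR => b (rw p.1, rw p.2)).
  by split.
have ma : cmeas (fun p : n.-tuple TR * n.-tuple TR => a (rw p.1, rw p.2)).
  by split.
have reE X : complex.Re (r X) = complex.Re (a X) - f1 X by rewrite /r /b; case: (a X).
have imE X : complex.Im (r X) = complex.Im (a X) - f2 X by rewrite /r /b; case: (a X).
have mr : cmeas (fun p : n.-tuple TR * n.-tuple TR => r (rw p.1, rw p.2)).
  split.
    rewrite (_ : (fun _ => _) = (fun p => complex.Re (a (rw p.1, rw p.2)) - f1 (rw p.1, rw p.2))).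
      exact: measurable_funB.
    by apply/funext => p; rewrite reE.
  rewrite (_ : (fun _ => _) = (fun p => complex.Im (a (rw p.1, rw p.2)) - f2 (rw p.1, rw p.2))).
    exact: measurable_funB.
  by apply/funext => p; rewrite imE.
have e1 x := eD _ _ (ef1 Cm leC x); have e2 x := eD _ _ (ef2 Cm leC x).
have br x xi : normc (r (x, xi)) <= 2 * (K2 * delta ^+ mu * Cm) * bracket xi `^ k.
  rewrite -mulrA; apply: le_trans (normc_le_ReIm _) _; rewrite mulr_natl mulr2n.
  rewrite reE imE; apply: lerD; first exact: (est_bound (ef1 Cm leC x)).
  exact: (est_bound (ef2 Cm leC x)).
have bz x xi : normc (b (x, xi)) <= C' [ffun=> 0%N] [ffun=> 0%N] * bracket xi `^ k'.
  have := bb [ffun=> 0%N] [ffun=> 0%N] x xi; congr (normc _ <= _).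
  have z : mi_dirs ([ffun=> 0%N] : MI) = [::] :> seq 'rV[R]_n.
    by rewrite /mi_dirs; elim: (enum 'I_n) => //= i l ->; rewrite ffunE.
  by rewrite /symbol_dirs z.
have ba x xi : normc (a (x, xi)) <=
    (C' [ffun=> 0%N] [ffun=> 0%N] + 2 * (K2 * delta ^+ mu * Cm)) * bracket xi `^ k'.
  rewrite (_ : a (x, xi) = b (x, xi) + r (x, xi)); last by rewrite /r addrC subrK.
  apply: le_trans (normcD_le _ _) _; rewrite mulrDl; apply: lerD => //.
  apply: le_trans (br _ _) _; apply: ler_wpM2l; last exact/ler_powR_bracket/ltW.
  by rewrite !mulr_ge0 ?exprn_ge0 // ltW.
pose Z := 2 * (D * (K2 * delta ^+ mu * Cm)) * J.
have Z0 : 0 <= Z by rewrite !mulr_ge0 ?exprn_ge0 // ltW.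
have step : (opnorm h k' (Op h a) <= opnorm h k' (Op h b) + Z%:E)%E.
  apply: opnorm_perturb => // u su.
  apply: le_trans (L2norm_triangle (cmeas_Op h0 n0 su ma ba) (cmeas_Op h0 n0 su mb bz)
    (cmeas_Op h0 n0 su mr br) _) _.
    move=> x; apply: (Op_split h0 n0 x su mb mr bz br) => X.
    by rewrite /r addrC subrK.
  apply: leeD2l; apply: (Op_est_le h0 n0 _ su mr).
  - by rewrite subr_gt0.
  - by move=> x; under [F in est _ _ _ F]eq_fun do rewrite reE; exact: e1.
  by move=> x; under [F in est _ _ _ F]eq_fun do rewrite imE; exact: e2.
apply: le_trans step _; apply: le_trans (leeD2r _ main) _.
rewrite -EFinD lee_fin.
set S := \sum_(p \in D1) _.
pose F (p : MI * MI) := h `^ ((mi_order p.1 + mi_order p.2)%:R / 2) *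
  (delta^-1 ^+ (mi_order p.2 - mu) * C p.1 (trunc_index mu p.2)).
rewrite -[X in _ * (X + _)]/(\sum_(p \in D1) F p); set S' := \sum_(p \in D1) F p.
have F0 p : 0 <= F p by rewrite !mulr_ge0 ?powR_ge0 ?exprn_ge0 ?invr_ge0 // ltW.
have S0 : 0 <= S' by apply: fsum_ge0 => // p _.
have leS : S <= 2 * M * S'.
  rewrite /S /S' !fsbig_finite //= mulr_sumr !big_seq; apply: ler_sum => p.
  rewrite (in_fset_set finD1) => /set_mem /leM Kp.
  rewrite [leLHS](_ : _ = 2 * K p.1 p.2 * F p); last by rewrite /C' /F; ring.
  by apply: ler_wpM2r => //; rewrite ler_pM2l.
have dC : 0 <= delta ^+ mu * Cm by rewrite mulr_ge0 ?exprn_ge0 // ltW.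
have ZE : Z = 2 * (D * K2) * J * (delta ^+ mu * Cm) by rewrite /Z; ring.
rewrite mulrDr ZE; apply: lerD.
  apply: le_trans (ler_wpM2l (ltW Ks0) leS) _; rewrite -subr_ge0.
  rewrite (_ : _ - _ = (1 + 2 * (D * K2) * J) * S'); last by ring.
  by rewrite !(mulr_ge0, addr_ge0).
apply: ler_wpM2r => //; have : 0 <= Ks * (2 * M) by rewrite !mulr_ge0 // ltW.
lra.
Qed.

(** Each term on the left equals the term of the last sum at the truncated index, hence is at most
    that whole sum of nonnegative terms; the constant counts the terms on the left. *)
Lemma truncated_sum_le (s mu : nat) (h delta : R) (C : MI -> MI -> R) : 0 < h ->
  (forall alpha beta, (mi_order beta <= mu)%N -> 0 <= C alpha beta) ->
  (forall p : MI * MI, (mi_order p.1 + mi_order p.2 <= s)%N ->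
    h `^ ((mi_order p.1 + mi_order p.2)%:R / 2) * delta^-1 ^+ (mi_order p.2 - mu) =
    h `^ ((mi_order p.1 + minn mu (mi_order p.2))%:R / 2)) ->
  \sum_(p \in [set p : MI * MI | (mi_order p.1 + mi_order p.2 <= s)%N])
    h `^ ((mi_order p.1 + mi_order p.2)%:R / 2) *
    (delta^-1 ^+ (mi_order p.2 - mu) * C p.1 (trunc_index mu p.2)) <=
  (size (finmap.enum_fset (fset_set
    [set p : MI * MI | (mi_order p.1 + mi_order p.2 <= s)%N])))%:R *
  \sum_(p \in [set p : MI * MI |
      (mi_order p.1 + mi_order p.2 <= s)%N /\ (mi_order p.2 <= mu)%N])
    h `^ ((mi_order p.1 + mi_order p.2)%:R / 2) * C p.1 p.2.
Proof.
move=> h0 C0 eqh.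
have fin1 : finite_set [set p : MI * MI | (mi_order p.1 + mi_order p.2 <= s)%N].
  apply: (sub_finite_set _ (finite_multiindex n s)) => p /= le.
  by split; apply: leq_trans le; rewrite ?leq_addr ?leq_addl.
apply: fsum_le_card => // p ps; rewrite mulrA eqh // -mi_order_trunc.
set D := [set p | _ /\ _].
have finD : finite_set D by apply: (sub_finite_set _ fin1) => q [].
apply: (@fsum_ge_term _ _ D (fun q => h `^ ((mi_order q.1 + mi_order q.2)%:R / 2) * C q.1 q.2)
  (p.1, trunc_index mu p.2)) => //.
  by move=> q [_ le]; rewrite mulr_ge0 ?powR_ge0 ?C0.
split; rewrite /= mi_order_trunc ?geq_minl //.
by apply: leq_trans ps; rewrite leq_add2l geq_minr.
Qed.
End symbol_splitting.

Theorem proposition2p4 (R : realType) (d s : nat) (mu : nat) (k k' : R)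
    (hd : (2 <= d)%N) (hs : bounded_on_sobolev R d s)
    (hmu : (1 <= mu)%N) (hk : k < k') :
  (exists2 K : R, 0 < K &
    forall (h : R) (a : 'rV[R]_d.-1 * 'rV[R]_d.-1 -> R[i])
      (C : multiindex d.-1 -> multiindex d.-1 -> R),
    0 < h <= 1 ->
    symbol_estimates mu k C a ->
    (opnorm h k' (Op h a) <=
      (K * (\sum_(p \in [set p : multiindex d.-1 * multiindex d.-1 |
                          (mi_order p.1 + mi_order p.2 <= s)%N /\
                          (mi_order p.2 <= mu)%N])
              h `^ ((mi_order p.1 + mi_order p.2)%:R / 2) * C p.1 p.2
            + h `^ (mu%:R / 2) * ln (1 + h^-1) *
              \sum_(p \in [set p : multiindex d.-1 * multiindex d.-1 |
                            (mi_order p.1 <= d)%N /\ (mi_order p.2 <= mu)%N])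
                C p.1 p.2))%:E)%E)
  /\
  ((s <= mu)%N ->
   exists2 K : R, 0 < K &
    forall (h : R) (a : 'rV[R]_d.-1 * 'rV[R]_d.-1 -> R[i])
      (C : multiindex d.-1 -> multiindex d.-1 -> R),
    0 < h <= 1 ->
    symbol_estimates mu k C a ->
    (opnorm h k' (Op h a) <=
      (K * \sum_(p \in [set p : multiindex d.-1 * multiindex d.-1 |
                         (mi_order p.1 + mi_order p.2 <= s)%N /\
                         (mi_order p.2 <= mu)%N])
             h `^ ((mi_order p.1 + mi_order p.2)%:R / 2) * C p.1 p.2)%:E)%E).
Proof.
case: d hd hs => // n; rewrite ltnS => n0 hs.
rewrite -[n.+1.-1]/n.
have [K K0 core] := Op_split_estimate n0 hs hmu hk.
pose N : R := (size (finmap.enum_fset (fset_set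
    [set p : multiindex n * multiindex n | (mi_order p.1 + mi_order p.2 <= s)%N])))%:R.
set D := [set p | _ /\ (_ p.2 <= mu)%N]; set D2 := [set p | (_ <= n.+1)%N /\ _].
have finD : finite_set D.
  apply: (sub_finite_set _ (finite_multiindex n s)) => p [le _].
  by split; apply: leq_trans le; rewrite ?leq_addr ?leq_addl.
have finD2 : finite_set D2.
  apply: (sub_finite_set _ (finite_multiindex n (maxn n.+1 mu))) => p [le1 le2].
  by split; rewrite leq_max ?le1 ?le2 ?orbT.
have N0 : 0 <= N by [].
have C0 (C : multiindex n -> multiindex n -> R) a (sa : symbol_estimates mu k C a) alpha beta :
    (mi_order beta <= mu)%N -> 0 <= C alpha beta.
  by have [sR _] := symbol_parts sa; exact: (real_symbol_ge0 sR).
have sum0 h C a (sa : symbol_estimates mu k C a) :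
    0 <= \sum_(p \in D) h `^ ((mi_order p.1 + mi_order p.2)%:R / 2) * C p.1 p.2.
  by apply: fsum_ge0 => // p [_ le]; rewrite mulr_ge0 ?powR_ge0 // (C0 _ _ sa).
have sum20 C a (sa : symbol_estimates mu k C a) : 0 <= \sum_(p \in D2) C p.1 p.2.
  by apply: fsum_ge0 => // p [_ le]; rewrite (C0 _ _ sa).
have leCm C a (sa : symbol_estimates mu k C a) alpha beta : (mi_order alpha <= n.+1)%N ->
    (mi_order beta <= mu)%N -> C alpha beta <= \sum_(p \in D2) C p.1 p.2.
  move=> le1 le2; apply: (@fsum_ge_term _ _ D2 (fun p => C p.1 p.2) (alpha, beta)) => //.
  by move=> p [_ le]; rewrite (C0 _ _ sa).
split.
  (* The remainder is bounded by h^(mu/2) times the second sum; since h <= 1, dividing by [ln 2]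
     makes room for the factor ln(1 + h^-1) >= ln 2. *)
  have ln20 : 0 < ln 2 :> R by rewrite ln_gt0 // ltr1n.
  exists (K * (N + (ln 2)^-1)); first by rewrite mulr_gt0 // ltr_wpDl // invr_gt0.
  move=> h a C h01 sa; have [h0 h1] := andP h01.
  have dE m : (h `^ 2^-1) ^+ m = h `^ (m%:R / 2).
    by rewrite -powR_mulrn ?powR_ge0 // -powRrM mulrC.
  have d01 : 0 < h `^ 2^-1 <= 1.
    rewrite powR_gt0 //=; have := @ger_powR _ h h01 0 2^-1.
    by rewrite powRr0; apply; rewrite invr_ge0.
  apply: le_trans (core h (h `^ 2^-1) _ a C h01 d01 sa (leCm C a sa)) _.
  rewrite lee_fin -mulrA ler_pM2l // mulrDl mulrDr.
  have le1 := @truncated_sum_le R n s mu h (h `^ 2^-1) C h0 (C0 C a sa).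
  have le2 : h `^ (mu%:R / 2) * \sum_(p \in D2) C p.1 p.2 <=
      (ln 2)^-1 * (h `^ (mu%:R / 2) * ln (1 + h^-1) * \sum_(p \in D2) C p.1 p.2).
    rewrite !mulrA; apply: ler_wpM2r; first exact: sum20 sa.
    rewrite mulrAC -[leLHS]mul1r; apply: ler_wpM2r; first exact: powR_ge0.
    rewrite mulrC ler_pdivlMr // mul1r ler_ln ?posrE ?addr_gt0 ?invr_gt0 //.
    by have : 1 <= h^-1 by [rewrite invf_ge1]; lra.
  rewrite dE; apply: lerD.
    apply: le_trans (le1 _) _; last by rewrite lerDl; apply: mulr_ge0 => //;
      rewrite !mulr_ge0 ?powR_ge0 ?ln_ge0 ?(sum20 _ _ sa) // lerDl invr_ge0 ltW.
    (* With delta = h^(1/2) the exponents of h add up to half of |alpha| + |beta| - (|beta| - mu)_+,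
       that is of |alpha| + min(mu, |beta|). *)
    move=> p _; rewrite exprVn dE -powRN -powRD; last by rewrite (gt_eqF h0) implybT.
    congr (_ `^ _); rewrite -mulNr -mulrDl; congr (_ / _).
    have {1}-> : mi_order p.2 = (minn mu (mi_order p.2) + (mi_order p.2 - mu))%N.
      by rewrite minnC minnE subnK ?leq_subr.
    by rewrite addnA natrD addrK.
  apply: le_trans le2 _; rewrite mulrDr lerDr; apply: mulr_ge0; last exact: sum0 sa.
  by rewrite invr_ge0 ltW.
move=> smu; exists (K * (N + 1)); first by rewrite mulr_gt0 // ltr_wpDl.
move=> h a C h01 sa; have [h0 h1] := andP h01.
apply/lee_addgt0Pr => e e0.
set Cm := \sum_(p \in D2) C p.1 p.2.
have Cm0 : 0 <= Cm by exact: sum20 sa.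
(* delta may depend on e and on the symbol: it is taken so small that the remainder K delta^mu Cm is
   at most e. The added 1 keeps the denominator positive when [Cm] is 0. *)
pose c := e / (K * (Cm + 1)); pose delta := Num.min 1 c.
have c0 : 0 < c by rewrite divr_gt0 // mulr_gt0 // ltr_wpDl.
have d0 : 0 < delta by rewrite lt_min ltr01.
have d1 : delta <= 1 by rewrite ge_min lexx.
have d01 : 0 < delta <= 1 by rewrite d0.
apply: le_trans (core h delta _ a C h01 d01 sa (leCm C a sa)) _.
rewrite -EFinD lee_fin -/Cm mulrDr; apply: lerD.
  rewrite -mulrA ler_pM2l // mulrDl mul1r.
  apply: le_trans (@truncated_sum_le R n s mu h delta C h0 (C0 C a sa) _) _.
    (* Here |beta| <= s <= mu, so no negative power of delta occurs and the first sum does not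
       depend on delta. *)
    move=> p ps; have le : (mi_order p.2 <= mu)%N.
      by apply: leq_trans smu; apply: leq_trans ps; rewrite leq_addl.
    by rewrite (minn_idPr le) (eqP le) expr0 mulr1.
  by rewrite lerDl; exact: sum0 sa.
have dle : delta ^+ mu <= c.
  apply: (@le_trans _ _ delta); last by rewrite ge_min lexx orbT.
  by apply: ler_iXnr => //; rewrite ltW.
rewrite -[leRHS](_ : K * (c * (Cm + 1)) = e).
  rewrite ler_pM2l //; apply: ler_pM => //; first by rewrite exprn_ge0 // ltW.
  by rewrite lerDl.
rewrite /c; field.
by rewrite !gt_eqF // ltr_wpDl.
Qed.
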